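(* Let $I$ be an arc. A PL map $\varphi:I\to\mathbb{R}^2$ is approximable by embeddings if and only if one of the following equivalent conditions holds: (D) (the deleted product property) there is a map $\{(x,y)\in I\times I: x\neq y\}\to S^1$ such that its restriction to the set $\{(x,y)\in I\times I:\varphi x\neq\varphi y\}$ is homotopic to the map given by the formula $\tilde\varphi(x,y)=\frac{\varphi x-\varphi y}{\|\varphi x-\varphi y\|}$; (V) the van Kampen obstruction (with $\mathbb{Z}_2$-coefficients) $v(\varphi)=0$.
   Context: Approximability: $\varphi:I\to\mathbb{R}^2$ is approximable by embeddings if for each $\varepsilon>0$ there is a map $f:I\to\mathbb{R}^2$ without self-intersections that is $\varepsilon$-close to $\varphi$. Maps are continuous. The van Kampen obstruction. Take a triangulation of $I$ for which $\varphi$ is a simplicial map to a graph $G\subset\mathbb{R}^2$ (vertices go to vertices, each edge is mapped linearly onto an edge or to a vertex). Denote by $x_1,\dots,x_k$ the vertices of $I$ in the order along $I$, and denote the edge $x_ix_{i+1}$ by $i$. Let $I^*=\bigcup_{i<j-1} i\times j$ (a 2-dimensional cell complex with cells $i\times j$). Paint red the edges $x_i\times j$ and $j\times x_i$ of $I^*$ such that $\varphi x_i\cap\varphi j=\emptyset$, and the cells $i\times j$ of $I^*$ such that $\varphi i\cap\varphi j=\emptyset$; denote by $I^{*\varphi}$ the red set. Take a general position map $f:I\to\mathbb{R}^2$ sufficiently close to $\varphi$, and to each cell $i\times j$ of $I^*$ assign the number $v_f(i\times j)=|fi\cap fj| \pmod 2$. Cut $I^*$ along the red edges, and let $C_1,\dots,C_n$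 be all those of the resulting components for which $\partial C_l\cap\partial I^*\subset I^{*\varphi}$. Put $v_f(C_l)=\sum_{i\times j\subset C_l}v_f(i\times j)\in\mathbb{Z}_2$. The van Kampen obstruction is the vector $v(\varphi)=(v_f(C_1),\dots,v_f(C_n))$; it does not depend on the choice of $f$. *)

(* Defs.v *)
From HB Require Import structures.
From mathcomp Require Import all_boot all_order all_algebra.
From mathcomp Require Import all_classical all_reals all_analysis.
From mathcomp Require Import finmap.

Set Implicit Arguments.
Unset Strict Implicit.
Unset Printing Implicit Defensive.

Import Order.TTheory GRing.Theory Num.Theory.
Import numFieldNormedType.Exports.

Local Open Scope classical_set_scope.
Local Open Scope ring_scope.

(** The arc is the unit interval [I = [0, 1]].  A map [I -> R^2] is a function
    [R -> R * R] of which only the values on [I] matter. *)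

Section Plane.
Context {R : realType}.

Definition unit_arc : set R := `[0, 1]%classic.

(* The library norm on [R * R] is the sup norm; it induces the same topology. *)
Definition enorm (p : R * R) : R := Num.sqrt (p.1 ^+ 2 + p.2 ^+ 2).

Definition circle : set (R * R) := [set p | enorm p = 1].

Definition det2 (p q : R * R) : R := p.1 * q.2 - p.2 * q.1.

Definition collinear (a b c : R * R) : Prop := det2 (b - a) (c - a) = 0.

Definition seg (p q : R * R) : set (R * R) :=
  [set (1 - t) *: p + t *: q | t in unit_arc].

Definition close_to (eps : R) (f phi : R -> R * R) : Prop :=
  forall t, unit_arc t -> enorm (f t - phi t) < eps.

Definition approximable_by_embeddings (phi : R -> R * R) : Prop :=
  forall eps : R, 0 < eps ->
    exists f : R -> R * R,
      [/\ {within unit_arc, continuous f}, set_inj unit_arc f & close_to eps f phi].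

Definition affine_on (f : R -> R * R) (a b : R) : Prop :=
  forall t, unit_arc t -> f ((1 - t) * a + t * b) = (1 - t) *: f a + t *: f b.

(* A triangulation of [I] is the increasing sequence of its vertices. *)
Definition triangulation (xs : seq R) : Prop :=
  [/\ sorted <%R xs, xs`_0 = 0 & last 0 xs = 1].

Definition nedges (xs : seq R) : nat := (size xs).-1.

Definition edge (xs : seq R) (i : nat) : set R := `[xs`_i, xs`_i.+1]%classic.

Definition linear_on_edges (f : R -> R * R) (xs : seq R) : Prop :=
  forall i, (i < nedges xs)%N -> affine_on f xs`_i xs`_i.+1.

Definition piecewise_linear (f : R -> R * R) : Prop :=
  exists2 xs, triangulation xs & linear_on_edges f xs.

(** ** The deleted product property *)

Definition deleted_product : set (R * R) :=
  [set z | [/\ unit_arc z.1, unit_arc z.2 & z.1 <> z.2]].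

Definition separated_pairs (phi : R -> R * R) : set (R * R) :=
  [set z | [/\ unit_arc z.1, unit_arc z.2 & phi z.1 <> phi z.2]].

Definition gauss_map (phi : R -> R * R) (z : R * R) : R * R :=
  (enorm (phi z.1 - phi z.2))^-1 *: (phi z.1 - phi z.2).

Definition map_to_circle (A : set (R * R)) (g : R * R -> R * R) : Prop :=
  {within A, continuous g} /\ (forall z, A z -> circle (g z)).

Definition circle_homotopic (A : set (R * R)) (g h : R * R -> R * R) : Prop :=
  exists H : (R * R) * R -> R * R,
    [/\ {within A `*` unit_arc, continuous H},
        forall z t, A z -> unit_arc t -> circle (H (z, t)),
        forall z, A z -> H (z, 0) = g z
      & forall z, A z -> H (z, 1) = h z].

Definition deleted_product_property (phi : R -> R * R) : Prop :=
  exists2 g, map_to_circle deleted_product g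
           & circle_homotopic (separated_pairs phi) g (gauss_map phi).

(** ** Simplicial maps to plane graphs *)

Record graph_data := GraphData {
  gvertices : seq (R * R);
  gedges : seq ((R * R) * (R * R)) }.

Definition plane_graph (G : graph_data) : Prop :=
  [/\ forall e, e \in gedges G ->
        [/\ e.1 \in gvertices G, e.2 \in gvertices G & e.1 != e.2],
      forall e v, e \in gedges G -> v \in gvertices G ->
        seg e.1 e.2 v -> v = e.1 \/ v = e.2
    & forall e e', e \in gedges G -> e' \in gedges G ->
        seg e.1 e.2 = seg e'.1 e'.2 \/
        seg e.1 e.2 `&` seg e'.1 e'.2 `<=` [set v | v \in gvertices G]].

Definition simplicial_to (phi : R -> R * R) (xs : seq R) (G : graph_data) : Prop :=
  [/\ forall x, x \in xs -> phi x \in gvertices G,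
      linear_on_edges phi xs
    & forall i, (i < nedges xs)%N ->
        [\/ phi xs`_i = phi xs`_i.+1,
            (phi xs`_i, phi xs`_i.+1) \in gedges G
          | (phi xs`_i.+1, phi xs`_i) \in gedges G]].

Definition simplicial_triangulation (phi : R -> R * R) (xs : seq R) : Prop :=
  triangulation xs /\ exists2 G, plane_graph G & simplicial_to phi xs G.

(* The vertices of [xs] are required to be among the vertices [ys] in general
   position, so that they do not lie on self-intersections of [f]; the last
   condition excludes triple points. *)
Definition general_position (xs : seq R) (f : R -> R * R) : Prop :=
  exists ys : seq R,
    [/\ triangulation ys,
        {subset xs <= ys},
        linear_on_edges f ys,
        forall a b c, a \in ys -> b \in ys -> c \in ys -> uniq [:: a; b; c] ->
          ~ collinear (f a) (f b) (f c)
      & forall s t u, unit_arc s -> unit_arc t -> unit_arc u -> f s = f t -> f t = f u ->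
          ~~ uniq [:: s; t; u]].

End Plane.

(** ** The cell complex I^*

    Indices start at 0: the vertices of [I] are [xs`_0, ..., xs`_n] and the edge
    [i < n] joins [xs`_i] to [xs`_i.+1].  The 2-cell [i x j] of I^* is
    represented by [(i, j)] with [i.+1 < j]. *)

Notation cell n := {c : 'I_n * 'I_n | (c.1.+1 < c.2)%N}.

(* [inl (a, j)] stands for [x_a x j], and [inr (i, b)] for [i x x_b]. *)
Notation side n := (('I_n.+1 * 'I_n) + ('I_n * 'I_n.+1))%type.

Definition endpoint (a i : nat) : bool := (a == i) || (a == i.+1).

Definition is_face n (e : side n) (c : cell n) : bool :=
  match e with
  | inl (a, j) => endpoint a (val c).1 && (j == (val c).2)
  | inr (i, b) => (i == (val c).1) && endpoint b (val c).2
  end.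

(* An edge of I^* lies on the boundary of I^* iff it is a face of exactly one
   2-cell. *)
Definition boundary_side n (e : side n) : bool :=
  #|[set c : cell n | is_face e c]%SET| == 1%N.

Section VanKampen.
Context {R : realType} (phi : R -> R * R) (xs : seq R).
Let n := nedges xs.

Definition red_side (e : side n) : bool :=
  match e with
  | inl (a, j) => `[< ~ (phi @` edge xs j) (phi xs`_a) >]
  | inr (i, b) => `[< ~ (phi @` edge xs i) (phi xs`_b) >]
  end.

Definition red_cell (c : cell n) : bool :=
  `[< (phi @` edge xs (val c).1) `&` (phi @` edge xs (val c).2) = set0 >].

(* [e] is contained in the union of the red edges and the red 2-cells. *)
Definition in_red_set (e : side n) : bool :=
  red_side e || [exists c : cell n, is_face e c && red_cell c].

Definition glued : rel (cell n) := [rel c d |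
  [exists e : side n, [&& is_face e c, is_face e d & ~~ red_side e]]].

(* After cutting along the red edges, two 2-cells are in the same component iff
   they are joined by a chain of 2-cells glued along edges that are not red. *)
Definition cut_components : {set {set cell n}} :=
  equivalence_partition (connect glued) [set: cell n]%SET.

(* Testing the edges of I^* is enough for the condition
   that [bd C] meets [bd I^*] inside the red set: around a
   boundary vertex of I^*, a sector of C is bounded by two edges each of which
   is red or lies on the boundary of I^*. *)
Definition obstruction_component (C : {set cell n}) : bool :=
  (C \in cut_components) &&
  [forall c in C, forall e : side n,
     is_face e c && boundary_side e ==> in_red_set e].

(* [fset_set A] lists the elements of a finite set [A]; in general position the
   intersections are finite. *)
Definition intersection_parity (f : R -> R * R) (c : cell n) : 'Z_2 :=
  (#|` fset_set ((f @` edge xs (val c).1) `&` (f @` edge xs (val c).2))|)%:R.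

Notation obstruction_index := {C : {set cell n} | obstruction_component C}.
Notation obstruction_vector := {ffun obstruction_index -> 'Z_2}.

Definition obstruction_of_map (f : R -> R * R) : obstruction_vector :=
  [ffun C : obstruction_index => \sum_(c in val C) intersection_parity f c].

(* [v] is the common value of [obstruction_of_map f] for all general position
   maps [f] sufficiently close to [phi]; such [f] exist arbitrarily close to
   [phi], hence [v] is unique. *)
Definition is_van_kampen_obstruction (v : obstruction_vector) : Prop :=
  exists2 eps : R, 0 < eps &
    forall f, general_position xs f -> close_to eps f phi ->
      obstruction_of_map f = v.

End VanKampen.

Arguments is_van_kampen_obstruction {R} phi xs v.

(* Main.v *)
Require Import Defs.
From mathcomp Require Import finmap.
From mathcomp Require Import all_boot all_order all_algebra.
From mathcomp Require Import all_classical all_reals all_analysis.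
From mathcomp Require Import zify ring lra.

(** Let [V a] be the image of the [a]-th vertex of a simplicial triangulation.  A
    half-lift is a choice of square roots of the directions [V a - V b], for [a < b],
    encoded by one bit each, that is continuous along every red side of [I^*].

    A map as in (D) has a square root over the contractible set of pairs [x < y];
    carried along the homotopy it gives a half-lift.  The number of crossings of a
    general position map over a cell is modulo 2 the sum over the four sides of the
    number of times the difference vector crosses a fixed ray; since the cell complex
    cut along the red sides is exact at the cells, (V) says that these four terms can
    be corrected off the red sides to a coboundary, i.e. to a half-lift.

    A half-lift compares any two passages of the path through a vertex or an edge of
    the graph.  This comparison need not be transitive, but by induction on the length
    of the path, passing to its derivative, whose edges are the passages of the path
    through vertices that do not turn back, it is replaced by orders in which the
    strands can be laid out side by side without crossings.

    Conversely, an embedding close to [phi] defines a map as in (D).  The homotopy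
    to [phi] first slides a pair away from the set [phi x = phi y] to where the
    difference of [phi] is bounded below. *)

Set Implicit Arguments.
Unset Strict Implicit.
Unset Printing Implicit Defensive.

(** * Strand systems and planar orders *)

(** Under (D) the direction lifts to the double cover of the circle over the pairs [x < y], and the
    sheet is one bit; this is why $\mathbb{Z}_2$-coefficients lose nothing. The implications proved
    are: approximability gives (D), (D) gives half-lifts, half-lifts give approximability, and (V)
    is equivalent to the existence of half-lifts. Strands that leave a vertex along different edges
    are compared by angle, hence transitively; only strands inside one edge may fail to be ordered.
    In the derivative such strands are separated by the way they continue, and noncrossing at the
    vertex forces transitivity there. What the derivative forgets are the zigzags inside an edge,
    and laying them back without crossings is the hard half of the induction. *)

Section StrandSystems.
Variable T : eqType.
Implicit Types (a b : nat -> T) (s : T -> T) (v d : T -> nat) (lt : rel T).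

Definition pt N a b (p : T) : Prop := exists2 i, (i < N)%N & p = a i \/ p = b i.

(** For points on a circle cut open and ordered linearly by [lt], this is the parity of the
    interleaving of the chords [p p'] and [q q']. As a sum of four bits it makes sense when [lt] is
    not an order, and it is additive along polygonal paths. *)
Definition cross lt (p p' q q' : T) : bool :=
  lt p q (+) lt p q' (+) lt p' q (+) lt p' q'.

(** Discs sit at the vertices and pipes along the edges of a graph. Strand [i] runs through a pipe
    from [a i] to [b i], and chord [i] joins [b i] to [a i.+1] inside a disc; [s] exchanges the ends
    of a strand, [v] is the disc of a point and [d] its dart, that is, the mouth of the pipe at the
    disc. Between different darts [lt] is an order of blocks on the boundary of the disc ([sys_blk],
    [sys_trs]); inside a dart it is only antisymmetric. The two mouths of a pipe see its strands in
    opposite orders ([sys_pipe]), and chords do not cross ([sys_chd]). *)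
Record strand_system N a b s v d lt : Prop := StrandSystem {
  sys_inja : forall i j, (i < N)%N -> (j < N)%N -> a i = a j -> i = j;
  sys_injb : forall i j, (i < N)%N -> (j < N)%N -> b i = b j -> i = j;
  sys_ab : forall i j, (i < N)%N -> (j < N)%N -> a i <> b j;
  sys_sa : forall i, (i < N)%N -> s (a i) = b i;
  sys_sb : forall i, (i < N)%N -> s (b i) = a i;
  sys_dv : forall p q, pt N a b p -> pt N a b q -> d p = d q -> v p = v q;
  sys_ds : forall p q, pt N a b p -> pt N a b q -> d p = d q -> d (s p) = d (s q);
  sys_dn : forall p, pt N a b p -> d p <> d (s p);
  sys_chv : forall i, (i.+1 < N)%N -> v (b i) = v (a i.+1);
  sys_anti : forall p q, pt N a b p -> pt N a b q -> p <> q -> lt p q = ~~ lt q p;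
  sys_blk : forall p p' q, pt N a b p -> pt N a b p' -> pt N a b q ->
    v p = v q -> d p <> d q -> d p = d p' -> lt p q = lt p' q;
  sys_trs : forall p q r, pt N a b p -> pt N a b q -> pt N a b r ->
    v p = v q -> v q = v r -> d p <> d q -> d q <> d r -> d p <> d r ->
    lt p q -> lt q r -> lt p r;
  sys_pipe : forall p q, pt N a b p -> pt N a b q -> p <> q -> d p = d q ->
    lt (s p) (s q) = ~~ lt p q;
  sys_chd : forall i j, (i.+1 < N)%N -> (j.+1 < N)%N -> i <> j -> v (b i) = v (b j) ->
    cross lt (b i) (a i.+1) (b j) (a j.+1) = false }.

(** Transitivity is now demanded inside the darts too, so the points of a disc are linearly ordered
    along its boundary; between darts nothing may change. *)
Record planar_order N a b s v d lt (lt' : rel T) : Prop := PlanarOrder {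
  po_anti : forall p q, pt N a b p -> pt N a b q -> p <> q -> lt' p q = ~~ lt' q p;
  po_agree : forall p q, pt N a b p -> pt N a b q -> v p = v q -> d p <> d q ->
    lt' p q = lt p q;
  po_trs : forall p q r, pt N a b p -> pt N a b q -> pt N a b r ->
    p <> q -> q <> r -> p <> r ->
    v p = v q -> v q = v r -> lt' p q -> lt' q r -> lt' p r;
  po_pipe : forall p q, pt N a b p -> pt N a b q -> p <> q -> d p = d q ->
    lt' (s p) (s q) = ~~ lt' p q;
  po_chd : forall i j, (i.+1 < N)%N -> (j.+1 < N)%N -> i <> j -> v (b i) = v (b j) ->
    cross lt' (b i) (a i.+1) (b j) (a j.+1) = false }.

(** * The derivative of a strand system *)

Section Derivative.
Variables (N : nat) (a b : nat -> T) (s : T -> T) (v d : T -> nat) (lt : rel T).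
Hypothesis S : strand_system N a b s v d lt.

Let P := pt N a b.

Lemma pta i : (i < N)%N -> P (a i). Proof. by move=> h; exists i => //; left. Qed.
Lemma ptb i : (i < N)%N -> P (b i). Proof. by move=> h; exists i => //; right. Qed.
Hint Resolve pta ptb : core.

Lemma pts p : P p -> P (s p).
Proof.
by case=> i h [] ->; [rewrite (sys_sa S h)|rewrite (sys_sb S h)]; auto.
Qed.

Lemma ss p : P p -> s (s p) = p.
Proof.
case=> i h [] ->; first by rewrite (sys_sa S h) (sys_sb S h).
by rewrite (sys_sb S h) (sys_sa S h).
Qed.

Lemma blkr p q q' : P p -> P q -> P q' -> v p = v q -> d p <> d q -> d q = d q' ->
  lt p q = lt p q'.
Proof.
move=> Pp Pq Pq' vE dN dE.
rewrite (sys_anti S Pp Pq) ?(sys_anti S Pp Pq'); try congruence.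
by congr (~~ _); apply: (sys_blk S) => //; congruence.
Qed.

(** The chord after strand [j] returns into the pipe from which it came. The guard makes the last
    strand, which no chord follows, a non-turn, so every sequence of turns stops. *)
Definition turn j := (j.+1 < N)%N && (d (b j) == d (a j.+1)).
Definition ends := [seq j <- iota 0 N.-1 | ~~ turn j].

Lemma mem_ends j : (j \in ends) = (j.+1 < N)%N && ~~ turn j.
Proof. by rewrite mem_filter mem_iota andbC; congr (_ && _); lia. Qed.

Lemma endsP j : j \in ends -> (j.+1 < N)%N /\ d (b j) <> d (a j.+1).
Proof. by rewrite mem_ends /turn => /andP[-> /eqP]. Qed.

Lemma ends_sorted : sorted ltn ends.
Proof. by apply: sorted_filter; [exact: ltn_trans|exact: iota_ltn_sorted]. Qed.

(** Strands of the derivative are the chords that do not turn back; its chords are the zigzags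
    between two consecutive ones. *)
Let M := size ends.
Let js := nth 0 ends.
Let a' k := b (js k).
Let b' k := a (js k).+1.

Lemma jsP k : (k < M)%N -> ((js k).+1 < N)%N /\ d (b (js k)) <> d (a (js k).+1).
Proof. by move=> h; apply: endsP; rewrite mem_nth. Qed.

Lemma js_mono k l : (k < M)%N -> (l < M)%N -> (js k < js l)%N = (k < l)%N.
Proof.
move=> hk hl; apply/idP/idP; last first.
  by move=> h; apply: (sorted_ltn_nth ltn_trans 0 ends_sorted); rewrite ?inE.
apply: contraLR; rewrite -!leqNgt leq_eqVlt => /orP[/eqP -> //|h].
by apply: ltnW; apply: (sorted_ltn_nth ltn_trans 0 ends_sorted); rewrite ?inE.
Qed.

Lemma js_inj k l : (k < M)%N -> (l < M)%N -> js k = js l -> k = l.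
Proof. by move=> hk hl e; have := js_mono hk hl; have := js_mono hl hk; lia. Qed.

Lemma js_turn k j : (k.+1 < M)%N -> (js k < j < js k.+1)%N -> turn j.
Proof.
move=> hk /andP[h1 h2]; have hk' : (k < M)%N by lia.
apply/negPn/negP => nt.
have jin : j \in ends.
  by rewrite mem_ends nt andbT; have [] := jsP hk; lia.
have hm : (index j ends < M)%N by rewrite index_mem.
have e : js (index j ends) = j by rewrite /js nth_index.
have := js_mono hk' hm; have := js_mono hm hk; rewrite e; lia.
Qed.

(** Recognizes a zigzag bounded on both sides by non-turning chords as a chord of the derivative, so
    that noncrossing there can be quoted for it. *)
Lemma run_js i f : (0 < i <= f)%N -> (f.+1 < N)%N -> ~~ turn i.-1 -> ~~ turn f ->
  (forall j, (i <= j < f)%N -> turn j) ->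
  exists k, [/\ (k.+1 < M)%N, (js k).+1 = i & js k.+1 = f].
Proof.
move=> hi hf ni nf ht.
have iin : i.-1 \in ends by rewrite mem_ends ni andbT; lia.
have fin : f \in ends by rewrite mem_ends nf andbT; lia.
set k := index i.-1 ends; set l := index f ends.
have hk : (k < M)%N by rewrite index_mem.
have hl : (l < M)%N by rewrite index_mem.
have ek : js k = i.-1 by rewrite /js nth_index.
have el : js l = f by rewrite /js nth_index.
have kl : (k < l)%N by rewrite -js_mono //; lia.
have hk1 : (k.+1 < M)%N by lia.
exists k; split=> //; first lia.
have : (js k < js k.+1)%N by rewrite js_mono.
have : (js k.+1 <= js l)%N.
  by move: (kl); rewrite leq_eqVlt => /orP[/eqP -> //|h]; apply: ltnW; rewrite js_mono.
have [_ nt] := jsP hk1.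
have h := ht (js k.+1).
have : ~~ turn (js k.+1) by rewrite /turn negb_and (introN eqP nt) orbT.
case: (ltngtP (js k.+1) f) => //; try lia.
Qed.

(** Inverts [a] on points; the value [N] of [index] on points not of the form [a i] is what tells
    the two kinds of points apart in [si] and [chp]. *)
Definition ia p := index p [seq a i | i <- iota 0 N].
Definition ib p := index p [seq b i | i <- iota 0 N].

Lemma ia_a i : (i < N)%N -> ia (a i) = i.
Proof.
move=> h; have := @index_uniq _ (a 0) i [seq a i | i <- iota 0 N].
rewrite size_map size_iota (nth_map 0) ?size_iota // nth_iota // add0n; apply=> //.
rewrite map_inj_in_uniq ?iota_uniq // => k l; rewrite !mem_iota => hk hl.
by apply: (sys_inja S); lia.
Qed.

Lemma ib_b i : (i < N)%N -> ib (b i) = i.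
Proof.
move=> h; have := @index_uniq _ (b 0) i [seq b i | i <- iota 0 N].
rewrite size_map size_iota (nth_map 0) ?size_iota // nth_iota // add0n; apply=> //.
rewrite map_inj_in_uniq ?iota_uniq // => k l; rewrite !mem_iota => hk hl.
by apply: (sys_injb S); lia.
Qed.

Lemma ia_b i : (i < N)%N -> ia (b i) = N.
Proof.
move=> h; rewrite /ia memNindex ?size_map ?size_iota //.
by apply/mapP => -[j]; rewrite mem_iota => hj /esym; apply: (sys_ab S); lia.
Qed.

Definition si p := if (ia p < N)%N then ia p else ib p.

Lemma si_a i : (i < N)%N -> si (a i) = i.
Proof. by move=> h; rewrite /si ia_a // h. Qed.
Lemma si_b i : (i < N)%N -> si (b i) = i.
Proof. by move=> h; rewrite /si ia_b // ltnn ib_b. Qed.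

Lemma si_s p : P p -> si (s p) = si p.
Proof. by case=> i h [] ->; rewrite ?(sys_sa S h) ?(sys_sb S h) si_a ?si_b. Qed.

Lemma si_inj p q : P p -> P q -> si p = si q -> d p = d q -> p = q.
Proof.
move=> [i hi ep] [j hj eq]; move: ep eq => [] -> [] ->; rewrite ?si_a ?si_b // => -> //.
  by rewrite -(sys_sa S hj) => /(sys_dn S (pta hj)).
by rewrite -(sys_sa S hj) => /esym /(sys_dn S (pta hj)).
Qed.

(** The other end of the chord at [p]. At the two endpoints of the path, where there is no chord,
    the value is junk. *)
Definition chp p := if (ia p < N)%N then b (ia p).-1 else a (ib p).+1.

Lemma chp_b i : (i < N)%N -> chp (b i) = a i.+1.
Proof. by move=> h; rewrite /chp ia_b // ltnn ib_b. Qed.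
Lemma chp_a i : (i.+1 < N)%N -> chp (a i.+1) = b i.
Proof. by move=> h; rewrite /chp ia_a // h. Qed.

Definition code (x y : nat) : nat := choice.pickle (x, y).
Lemma code_inj x y x' y' : code x y = code x' y' -> x = x' /\ y = y'.
Proof. by move/(pcan_inj choice.pickleK) => -[-> ->]. Qed.

(** The discs of the derivative are the pipes, coded as unordered pairs of darts; a dart [d'] of the
    derivative is a mouth of the pipe together with the dart reached through the chord. [lt'] puts
    one mouth of a pipe entirely before the other, in the arbitrary order of their labels. *)
Definition v' p := code (minn (d p) (d (s p))) (maxn (d p) (d (s p))).
Definition d' p := code (d p) (d (chp p)).
Definition lt' p q := if d p == d q then lt p q else (d p < d q)%N.

Let P' := pt M a' b'.

(** The points of the derived system, described without the enumeration [js]. *)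
Definition terminal p := exists2 i, (i.+1 < N)%N &
  d (b i) <> d (a i.+1) /\ (p = b i /\ chp p = a i.+1 \/ p = a i.+1 /\ chp p = b i).

Lemma ptP' p : P' p -> terminal p.
Proof.
case=> k hk e; have [h1 h2] := jsP hk; have h3 : (js k < N)%N by lia.
exists (js k) => //; split=> //.
by case: e => ->; [left|right]; rewrite /a' /b' ?chp_b ?chp_a.
Qed.

Lemma terminal_chp p : terminal p ->
  [/\ P p, P (chp p), chp (chp p) = p, v p = v (chp p) & d p <> d (chp p)].
Proof.
case=> i hi [n]; have hi' : (i < N)%N by lia.
case=> -[-> ->]; rewrite ?chp_a ?chp_b ?(sys_chv S) //; split; auto.
Qed.

Lemma v'P p q : P p -> P q -> v' p = v' q -> d p = d q \/ d p = d (s q).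
Proof. by move=> _ _ /code_inj; lia. Qed.

Lemma v'_d p q : P p -> P q -> d p = d q -> v' p = v' q.
Proof. by move=> Pp Pq e; rewrite /v' e (sys_ds S Pp Pq e). Qed.

Lemma v's p : P p -> v' (s p) = v' p.
Proof. by move=> Pp; rewrite /v' ss // minnC maxnC. Qed.

Lemma lt'_anti p q : P p -> P q -> p <> q -> lt' p q = ~~ lt' q p.
Proof.
move=> Pp Pq n; rewrite /lt' eq_sym; case: eqP => e; first exact: (sys_anti S).
lia.
Qed.

Lemma cross_swap p p' q q' (l : rel T) : cross l p p' q q' = cross l p' p q q'.
Proof. by rewrite /cross; case: (l p q) (l p q') (l p' q) (l p' q') => -[] [] []. Qed.
Lemma cross_swapr p p' q q' (l : rel T) : cross l p p' q q' = cross l p p' q' q.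
Proof. by rewrite /cross; case: (l p q) (l p q') (l p' q) (l p' q') => -[] [] []. Qed.

Lemma terminal_cross p q : terminal p -> terminal q -> p <> q -> p <> chp q ->
  v p = v q -> cross lt p (chp p) q (chp q) = false.
Proof.
case=> i hi [ni ei] [j hj [nj ej]] npq npq' vE.
have ij : i <> j by move=> ij; subst j; case: ei ej => -[e1 e2] [] [e3 e4]; congruence.
have vi := sys_chv S hi; have vj := sys_chv S hj.
have H : cross lt (b i) (a i.+1) (b j) (a j.+1) = false.
  apply: (sys_chd S) => //.
  by case: ei ej vE => -[-> _] [] [-> _]; congruence.
case: ei => -[-> ->]; case: ej => -[-> ->] //.
- by rewrite cross_swapr.
- by rewrite cross_swap.
- by rewrite cross_swap cross_swapr.
Qed.

(** The two chords are parallel. Their four comparisons sum to zero, and by the block property the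
    two mixed ones are complementary, so the near ends and the far ends are ordered oppositely. *)
Lemma terminal_lt' p q : terminal p -> terminal q -> p <> q -> d' p = d' q ->
  lt' (chp p) (chp q) = ~~ lt' p q.
Proof.
move=> tp tq npq /code_inj [e1 e2].
have [Pp Pcp cp vp np] := terminal_chp tp.
have [Pq Pcq cq vq nq] := terminal_chp tq.
rewrite /lt' e1 e2 !eqxx.
have vpq : v p = v q by apply: (sys_dv S).
have npq' : p <> chp q by congruence.
have := terminal_cross tp tq npq npq' vpq; rewrite /cross.
have -> : lt p (chp q) = lt q (chp q) by apply: (sys_blk S) => //; congruence.
have -> : lt (chp p) q = lt (chp q) q by apply: (sys_blk S) => //; congruence.
rewrite (sys_anti S Pq Pcq); last congruence.
by case: (lt p q) (lt (chp q) q) (lt (chp p) (chp q)) => -[] [].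
Qed.

(** If [p] and [q] share a dart, their chords lead to different darts. Noncrossing then expresses
    [lt p q] by three comparisons between different darts, and these depend on the darts alone. *)
Lemma terminal_blk p p1 q : terminal p -> terminal p1 -> terminal q ->
  v' p = v' q -> d' p <> d' q -> d' p = d' p1 -> lt' p q = lt' p1 q.
Proof.
move=> tp tp1 tq vE nd /code_inj [e1 e2].
have [Pp Pcp cp vp np] := terminal_chp tp.
have [Pq Pcq cq vq nq] := terminal_chp tq.
have [Pp1 Pcp1 cp1 vp1 np1] := terminal_chp tp1.
rewrite /lt' -e1; case: eqP => // e3.
have ne : d (chp p) <> d (chp q) by move=> e; apply: nd; rewrite /d' e3 e.
have vpq : v p = v q by apply: (sys_dv S).
have vpp : v p = v p1 by apply: (sys_dv S).
have c1 : cross lt p (chp p) q (chp q) = false by apply: terminal_cross => //; congruence.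
have c2 : cross lt p1 (chp p1) q (chp q) = false by apply: terminal_cross => //; congruence.
move: c1 c2; rewrite /cross.
have -> : lt p (chp q) = lt p1 (chp q) by apply: (sys_blk S) => //; congruence.
have -> : lt (chp p) q = lt (chp p1) q by apply: (sys_blk S) => //; congruence.
have -> : lt (chp p) (chp q) = lt (chp p1) (chp q).
  by apply: (sys_blk S) => //; congruence.
by case: (lt p q) (lt p1 q) (lt p1 (chp q)) (lt (chp p1) q) (lt (chp p1) (chp q))
  => -[] [] [] [].
Qed.

(** By noncrossing, points of one dart are compared as their far ends are in the cyclic order of
    darts cut open at the common dart, and cutting a cyclic order gives a linear one. Transitivity
    among the three far darts and the common dart, [t1] to [t8], leaves a finite check. *)
Lemma terminal_trs_same p q r : terminal p -> terminal q -> terminal r ->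
  d p = d q -> d q = d r -> d' p <> d' q -> d' q <> d' r -> d' p <> d' r ->
  lt p q -> lt q r -> lt p r.
Proof.
move=> tp tq tr e1 e2 n1 n2 n3.
have [Pp Pcp cp vp np] := terminal_chp tp.
have [Pq Pcq cq vq nq] := terminal_chp tq.
have [Pr Pcr cr vr nr] := terminal_chp tr.
have m1 : d (chp p) <> d (chp q) by move=> e; apply: n1; rewrite /d' e1 e.
have m2 : d (chp q) <> d (chp r) by move=> e; apply: n2; rewrite /d' e2 e.
have m3 : d (chp p) <> d (chp r) by move=> e; apply: n3; rewrite /d' e1 e2 e.
have v1 : v p = v q by apply: (sys_dv S).
have v2 : v q = v r by apply: (sys_dv S).
have c1 : cross lt p (chp p) q (chp q) = false by apply: terminal_cross => //; congruence.
have c2 : cross lt q (chp q) r (chp r) = false by apply: terminal_cross => //; congruence.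
have c3 : cross lt p (chp p) r (chp r) = false by apply: terminal_cross => //; congruence.
move: c1 c2 c3; rewrite /cross.
have -> : lt p (chp q) = lt q (chp q) by apply: (sys_blk S) => //; congruence.
have -> : lt p (chp r) = lt q (chp r) by apply: (sys_blk S) => //; congruence.
have -> : lt (chp p) q = lt (chp p) r by apply: blkr => //; congruence.
have -> : lt (chp q) r = lt (chp q) q by apply: blkr => //; congruence.
rewrite (sys_anti S Pcq Pq); last congruence.
have htr x y z := @sys_trs _ _ _ _ _ _ _ S x y z.
have han x y := @sys_anti _ _ _ _ _ _ _ S x y.
have E1 : lt (chp q) (chp p) = ~~ lt (chp p) (chp q) by apply: han => //; congruence.
have E2 : lt (chp r) (chp q) = ~~ lt (chp q) (chp r) by apply: han => //; congruence.
have E3 : lt (chp r) (chp p) = ~~ lt (chp p) (chp r) by apply: han => //; congruence.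
have E4 : lt (chp q) r = ~~ lt q (chp q).
  have -> : lt (chp q) r = lt (chp q) q by apply: blkr => //; congruence.
  by apply: han => //; congruence.
have E5 : lt (chp r) r = ~~ lt q (chp r).
  have -> : lt (chp r) r = lt (chp r) q by apply: blkr => //; congruence.
  by apply: han => //; congruence.
have E6 : lt r (chp p) = ~~ lt (chp p) r by apply: han => //; congruence.
have E7 : lt r (chp q) = lt q (chp q) by apply: (sys_blk S) => //; congruence.
have E8 : lt r (chp r) = lt q (chp r) by apply: (sys_blk S) => //; congruence.
have t1 : lt (chp p) (chp q) -> lt (chp q) (chp r) -> lt (chp p) (chp r).
  by apply: htr => //; congruence.
have t2 : lt (chp r) (chp q) -> lt (chp q) (chp p) -> lt (chp r) (chp p).
  by apply: htr => //; congruence.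
have t3 : lt (chp p) r -> lt r (chp q) -> lt (chp p) (chp q) by apply: htr => //; congruence.
have t4 : lt (chp q) r -> lt r (chp p) -> lt (chp q) (chp p) by apply: htr => //; congruence.
have t5 : lt (chp p) r -> lt r (chp r) -> lt (chp p) (chp r) by apply: htr => //; congruence.
have t6 : lt (chp r) r -> lt r (chp p) -> lt (chp r) (chp p) by apply: htr => //; congruence.
have t7 : lt (chp q) r -> lt r (chp r) -> lt (chp q) (chp r) by apply: htr => //; congruence.
have t8 : lt (chp r) r -> lt r (chp q) -> lt (chp r) (chp q) by apply: htr => //; congruence.
move: t1 t2 t3 t4 t5 t6 t7 t8; rewrite !E1 !E2 !E3 !E4 !E5 !E6 !E7 !E8.
case: (lt p q) (lt q r) (lt p r) => -[] [] //=;
  case: (lt (chp p) (chp q)) (lt (chp q) (chp r)) (lt (chp p) (chp r)) => -[] [] //=;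
  case: (lt q (chp q)) (lt (chp p) r) (lt q (chp r)) => -[] [] //=; intuition.
Qed.

Lemma tele (phi : T -> bool) i f : (i <= f)%N ->
  phi (a i) (+) phi (b f) =
  (\big[addb/false]_(i <= j < f.+1) (phi (a j) (+) phi (b j))) (+)
  (\big[addb/false]_(i <= j < f) (phi (b j) (+) phi (a j.+1))).
Proof.
move=> /subnK <-; elim: (f - i)%N => [|m IH].
  by rewrite add0n big_nat1 big_geq // addbF.
rewrite addSn [X in _ = X (+) _]big_nat_recr /=; last by lia.
rewrite [X in _ = _ (+) X]big_nat_recr /=; last by lia.
move: IH; case: (phi (a i)) (phi (b (m + i))) (phi (a (m + i).+1)) (phi (b (m + i).+1))
  (\big[_/_]_(i <= j < (m + i).+1) _) (\big[_/_]_(i <= j < (m + i)) _) => -[] [] [] [] [] //.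
Qed.

Definition is_run i f := [/\ (i <= f)%N, (f < N)%N & forall j, (i <= j < f)%N -> turn j].

Lemma run_v' i f j : is_run i f -> (i <= j <= f)%N -> v' (a j) = v' (a i).
Proof.
move=> [_ hf ht] /andP[/subnK <-]; elim: (j - i)%N => // m IH h.
rewrite -IH; last lia.
have /andP[h1 /eqP e] : turn (m + i)%N by apply: ht; lia.
rewrite addSn -(v'_d (ptb _) (pta _) e); try lia.
by rewrite -(sys_sa S) ?v's //; try apply: pta; lia.
Qed.

Lemma v'_ab j : (j < N)%N -> v' (b j) = v' (a j).
Proof. by move=> h; rewrite -(sys_sa S h) v's //; apply: pta. Qed.

Lemma run_v'b i f j : is_run i f -> (i <= j <= f)%N -> v' (b j) = v' (a i).
Proof. by move=> r h; rewrite v'_ab ?(run_v' r h) //; case: r => *; lia. Qed.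

(** The comparisons at the two mouths are complementary by [sys_pipe]; the two comparisons across
    the pipe are complementary because one mouth precedes the other. *)
Lemma strand_strand i j : (i < N)%N -> (j < N)%N -> i <> j -> v' (a i) = v' (a j) ->
  cross lt' (a i) (b i) (a j) (b j) = false.
Proof.
move=> hi hj ij vE.
have Pi := pta hi; have Pj := pta hj.
have n1 : a i <> a j by move=> e; apply: ij; apply: (sys_inja S).
have n2 : a i <> b j by apply: (sys_ab S).
have ei := sys_sa S hi; have ej := sys_sa S hj.
have di := sys_dn S Pi; have dj := sys_dn S Pj.
rewrite ei in di; rewrite ej in dj; rewrite /cross /lt'.
case: (v'P Pi Pj vE) => e.
  have e' := sys_ds S Pi Pj e; rewrite ei ej in e'.
  have := sys_pipe S Pi Pj n1 e; rewrite ei ej.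
  by rewrite e e' !eqxx (introF eqP dj) eq_sym (introF eqP dj); lia.
rewrite ej in e.
have e' := sys_ds S Pi (ptb hj) e; rewrite ei (sys_sb S hj) in e'.
have := sys_pipe S Pi (ptb hj) n2 e; rewrite ei (sys_sb S hj) e e' !eqxx.
by rewrite (introF eqP dj) eq_sym (introF eqP dj); lia.
Qed.

(** The far end of the chord at [p] lies in another dart and cannot separate the ends of the turn;
    since the chord does not cross the turn, neither can [p]. *)
Lemma terminal_turn p j : terminal p -> turn j -> p <> b j -> p <> a j.+1 ->
  lt' p (b j) = lt' p (a j.+1).
Proof.
move=> tp /andP[hj /eqP e] n1 n2; rewrite /lt' -e; case: eqP => // ed.
have [Pp Pcp cp vp np] := terminal_chp tp.
have hj' : (j < N)%N by lia.
case: tp => i hi [ni ei].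
have ij : i <> j by move=> ij; subst j; case: ei => -[? ?]; congruence.
have vi := sys_chv S hi; have vj := sys_chv S hj.
have Pb := ptb hj'; have Pa := pta hj.
have v1 : v p = v (b j) by apply: (sys_dv S).
have v2 : v (b i) = v (b j) by case: ei v1 vp => -[-> ->]; congruence.
have := sys_chd S hi hj ij v2.
have -> : cross lt (b i) (a i.+1) (b j) (a j.+1) = cross lt p (chp p) (b j) (a j.+1).
  by case: ei => -[-> ->] //; rewrite cross_swap.
rewrite /cross.
have -> : lt (chp p) (b j) = lt (chp p) (a j.+1) by apply: blkr => //; congruence.
by case: (lt p (b j)) (lt p (a j.+1)) (lt (chp p) (a j.+1)) => -[] [].
Qed.

Lemma turn_turn i j : turn i -> turn j -> i <> j -> v' (b i) = v' (b j) ->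
  cross lt' (b i) (a i.+1) (b j) (a j.+1) = false.
Proof.
move=> /andP[hi /eqP ei] /andP[hj /eqP ej] ij vE; rewrite /cross /lt' -ei -ej.
case: eqP => e; last by case: (d (b i) < _)%N.
by apply: (sys_chd S) => //; apply: (sys_dv S) => //; apply: ptb; lia.
Qed.

Lemma cross_bigl (l : rel T) q q' i f : (i <= f)%N ->
  cross l (a i) (b f) q q' =
  (\big[addb/false]_(i <= j < f.+1) cross l (a j) (b j) q q') (+)
  (\big[addb/false]_(i <= j < f) cross l (b j) (a j.+1) q q').
Proof.
move=> h; pose phi x := l x q (+) l x q'.
have E x y : cross l x y q q' = phi x (+) phi y by rewrite /cross /phi !addbA.
by rewrite E (tele phi h); congr (_ (+) _); apply: eq_bigr => j _; rewrite E.
Qed.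

Lemma cross_bigr (l : rel T) q q' i f : (i <= f)%N ->
  cross l q q' (a i) (b f) =
  (\big[addb/false]_(i <= j < f.+1) cross l q q' (a j) (b j)) (+)
  (\big[addb/false]_(i <= j < f) cross l q q' (b j) (a j.+1)).
Proof.
move=> h; pose phi x := l q x (+) l q' x.
have E x y : cross l q q' x y = phi x (+) phi y.
  by rewrite /cross /phi; case: (l q x) (l q y) (l q' x) (l q' y) => -[] [] [].
by rewrite E (tele phi h); congr (_ (+) _); apply: eq_bigr => j _; rewrite E.
Qed.

Lemma big_addb0 m n (F : nat -> bool) : (forall j, (m <= j < n)%N -> F j = false) ->
  \big[addb/false]_(m <= j < n) F j = false.
Proof. by move=> h; rewrite big_nat big1. Qed.

(* The two runs are zigzags inside one pipe.  Crossings of strands vanish, and so do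
   crossings of turns; the mixed terms of the two telescoping sums cancel because a
   turn does not separate the ends of the other run. *)
Lemma run_cross i f k g : is_run i f -> is_run k g -> (f < k)%N \/ (g < i)%N ->
  terminal (a i) -> terminal (b f) -> terminal (a k) -> terminal (b g) ->
  v' (a i) = v' (a k) -> cross lt' (a i) (b f) (a k) (b g) = false.
Proof.
move=> r1 r2 dis t1 t2 t3 t4 vE.
have [h1 hf ht1] := r1; have [h2 hg ht2] := r2.
have A j : (i <= j < f)%N -> cross lt' (b j) (a j.+1) (a k) (b g) = false.
  move=> hj; have tj := ht1 _ hj.
  have N1 p : terminal p -> (forall m, (m < f.+1)%N -> (i <= m)%N -> p <> a m /\ p <> b m) ->
      lt' (b j) p = lt' (a j.+1) p.
    move=> tp np; have [Pp _ _ _ _] := terminal_chp tp.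
    have [_ n1] := np j ltac:(lia) ltac:(lia).
    have [n2 _] := np j.+1 ltac:(lia) ltac:(lia).
    rewrite (@lt'_anti (b j)) ?(@lt'_anti (a j.+1)) ?(terminal_turn tp tj) //; try congruence.
      by apply: pta; lia.
    by apply: ptb; lia.
  rewrite /cross N1 ?(N1 (b g)) //; first by case: (lt' _ _) (lt' _ _) => -[].
    move=> m m1 m2; split=> e.
      by apply: (@sys_ab _ _ _ _ _ _ _ S m g) => //; lia.
    by have := sys_injb S _ _ e; lia.
  move=> m m1 m2; split=> e; first by have := sys_inja S _ _ e; lia.
  by apply: (@sys_ab _ _ _ _ _ _ _ S k m) => //; lia.
have B j : (k <= j < g)%N -> cross lt' (a i) (b f) (b j) (a j.+1) = false.
  move=> hj; have tj := ht2 _ hj; rewrite /cross.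
  have ? : (j.+1 < N)%N by lia.
  rewrite (terminal_turn t1 tj) ?(terminal_turn t2 tj).
  - by case: (lt' _ _) (lt' _ _) => -[].
  - by move=> e; have := sys_injb S _ _ e; lia.
  - by move/esym; apply: (sys_ab S); lia.
  - by apply: (sys_ab S); lia.
  - by move=> e; have := sys_inja S _ _ e; lia.
rewrite cross_bigl // [X in _ (+) X]big_addb0 // addbF.
have C j : (i <= j < f.+1)%N -> cross lt' (a j) (b j) (a k) (b g) =
    \big[addb/false]_(k <= m < g) cross lt' (a j) (b j) (b m) (a m.+1).
  move=> hj; rewrite cross_bigr // big_addb0 // => m hm.
  apply: strand_strand; try lia.
  by rewrite (@run_v' i f j r1) ?(@run_v' k g m r2) //; lia.
rewrite (eq_big_nat _ _ C) exchange_big_nat /= big_addb0 // => m hm.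
have := B m hm; rewrite cross_bigl // [X in _ (+) X]big_addb0 ?addbF // => j hj.
apply: turn_turn; auto; first lia.
by rewrite (@run_v'b i f j r1) ?(@run_v'b k g m r2) //; lia.
Qed.

Lemma js_run k : (k.+1 < M)%N -> is_run (js k).+1 (js k.+1).
Proof.
move=> hk; have hk' : (k < M)%N by lia.
have := js_mono hk' hk; have [h1 _] := jsP hk.
split; try lia.
by move=> j hj; apply: (js_turn hk).
Qed.

Lemma a'_terminal k : (k < M)%N -> terminal (a' k).
Proof. by move=> h; apply: ptP'; exists k; [|left]. Qed.
Lemma b'_terminal k : (k < M)%N -> terminal (b' k).
Proof. by move=> h; apply: ptP'; exists k; [|right]. Qed.

Lemma terminalP p : terminal p -> P' p.
Proof.
case=> i hi [n e]; have : i \in ends by rewrite mem_ends hi /turn hi /=; apply/eqP.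
move=> iin; exists (index i ends); first by rewrite index_mem.
by rewrite /a' /b' /js nth_index //; case: e => -[-> _]; [left|right].
Qed.

Lemma derived_system : strand_system M a' b' chp v' d' lt'.
Proof.
have PP p : P' p -> P p by move/ptP'/terminal_chp=> [].
split.
- move=> i j hi hj e; apply: js_inj => //; apply: (sys_injb S) e;
    [have [] := jsP hi|have [] := jsP hj]; lia.
- move=> i j hi hj e; apply: js_inj => //.
  have [] := jsP hi; have [] := jsP hj => h1 _ h2 _.
  by have := sys_inja S _ _ e; lia.
- move=> i j hi hj /esym; have [] := jsP hi; have [] := jsP hj => h1 _ h2 _.
  by apply: (sys_ab S); lia.
- by move=> i hi; have [] := jsP hi => h _; rewrite /a' /b' chp_b //; lia.
- by move=> i hi; have [] := jsP hi => h _; rewrite /a' /b' chp_a //; lia.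
- by move=> p q /PP Pp /PP Pq /code_inj[e _]; apply: v'_d.
- move=> p q /ptP'/terminal_chp[_ _ cp _ _] /ptP'/terminal_chp[_ _ cq _ _].
  by move/code_inj=> [e1 e2]; rewrite /d' e2 cp cq e1.
- by move=> p /ptP'/terminal_chp[_ _ cp _ n] /code_inj[].
- move=> k hk; have r := js_run hk; have [h1 h2 _] := r.
  by rewrite /a' /b' (run_v'b r) //; lia.
- by move=> p q /PP Pp /PP Pq n; apply: lt'_anti.
- by move=> p p1 q /ptP' tp /ptP' tp1 /ptP' tq; apply: terminal_blk.
- move=> p q r /ptP' tp /ptP' tq /ptP' tr _ _ n1 n2 n3.
  rewrite /lt'; case: eqP => e1; case: eqP => e2; try (rewrite ?e1 ?e2; case: eqP; lia).
  by rewrite -e2 e1 eqxx; apply: terminal_trs_same.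
- by move=> p q /ptP' tp /ptP' tq n e; apply: terminal_lt'.
- move=> i j hi hj ij vE.
  have hi' : (i < M)%N by lia.
  have hj' : (j < M)%N by lia.
  apply: run_cross (js_run hi) (js_run hj) _ (b'_terminal hi') (a'_terminal hi)
    (b'_terminal hj') (a'_terminal hj) vE.
  case: (ltngtP i j) ij => // h _; [left|right].
    have : (js i.+1 <= js j)%N by rewrite leqNgt js_mono //; lia.
    lia.
  have : (js j.+1 <= js i)%N by rewrite leqNgt js_mono //; lia.
  lia.
Qed.

(** * Lifting a planar order from the derivative *)

Section Lift.
Variable lt'' : rel T.
Hypothesis L : planar_order M a' b' chp v' d' lt' lt''.

(** Orients each pipe by the labels of its darts, so that its two mouths can be told apart. *)
Definition rising p := (d p < d (s p))%N.

Lemma rising_s p : P p -> rising (s p) = ~~ rising p.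
Proof. by move=> Pp; have := sys_dn S Pp; rewrite /rising ss //; lia. Qed.

Lemma rising_d p q : P p -> P q -> d p = d q -> rising p = rising q.
Proof. by move=> Pp Pq e; rewrite /rising e (sys_ds S Pp Pq e). Qed.

Lemma rising_eq p q : P p -> P q -> v' p = v' q -> rising p = rising q -> d p = d q.
Proof.
move=> Pp Pq vE sE; case: (v'P Pp Pq vE) => // e.
have e' : d (s p) = d q by rewrite (sys_ds S Pp (pts Pq) e) ss.
by move: sE; rewrite /rising e e'; have := sys_dn S Pq; lia.
Qed.

(** The two mouths of a pipe lie on opposite sides of a disc of the derivative, so its boundary
    order runs across the pipe in opposite senses at them. [lo] reverses one of the two and is a
    height across the pipe, read alike from both mouths. *)
Definition lo p q := (p != q) && (if rising p then lt'' p q else lt'' q p).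

Lemma term_P p : terminal p -> P p. Proof. by case/terminal_chp. Qed.

Lemma d_v' p q : terminal p -> terminal q -> d p = d q -> v' p = v' q.
Proof. by move=> tp tq; apply: v'_d; apply: term_P. Qed.

Lemma lo_anti p q : terminal p -> terminal q -> p <> q -> d p = d q -> lo p q = ~~ lo q p.
Proof.
move=> tp tq n e; rewrite /lo [q == p]eq_sym (introF eqP n) /=.
rewrite (rising_d (term_P tp) (term_P tq) e).
rewrite (po_anti L (terminalP tp) (terminalP tq) n).
by case: ifP; rewrite ?negbK.
Qed.

Lemma lo_trs p q r : terminal p -> terminal q -> terminal r -> d p = d q -> d q = d r ->
  lo p q -> lo q r -> lo p r.
Proof.
move=> tp tq tr e1 e2 h1 h2.
have n3 : p <> r.
  by move=> e; subst r; move: h1; rewrite lo_anti // ?h2 //; move: h2 => /andP[/eqP h _] ?;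
     apply: h.
move: h1 h2; rewrite /lo => /andP[/eqP n1 h1] /andP[/eqP n2 h2]; rewrite (introF eqP n3) /=.
have v1 := d_v' tp tq e1; have v2 := d_v' tq tr e2.
have sE := rising_d (term_P tp) (term_P tq) e1; rewrite sE in h1 *.
have := terminalP tp; have := terminalP tq; have := terminalP tr => Tr Tq Tp.
move: h1 h2; case: ifP => _ h1 h2.
  by apply: (po_trs L Tp Tq Tr).
by apply: (po_trs L Tr Tq Tp); congruence.
Qed.

Definition tm := [seq b j | j <- ends] ++ [seq a j.+1 | j <- ends].

Lemma tmP p : p \in tm <-> terminal p.
Proof.
split.
  rewrite mem_cat => /orP[] /mapP[j jin ->]; have [h1 h2] := endsP jin.
    by exists j => //; split=> //; left; rewrite chp_b //; lia.
  by exists j => //; split=> //; right; rewrite chp_a //; lia.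
move=> [j hj [n e]]; have jin : j \in ends by rewrite mem_ends hj /turn hj; apply/eqP.
by case: e => -[-> _]; rewrite mem_cat; apply/orP; [left|right]; apply/mapP; exists j.
Qed.

(** [st i] and [fin i] are the first and last strand of the maximal zigzag through strand [i]. The
    search in [fin] ranges beyond [N], but it stops at [N - 1] at the latest, which is not a
    turn. *)
Fixpoint st i := if i is j.+1 then if turn j then st j else i else 0.
Definition fin i := (i + find (fun j => ~~ turn j) (iota i N))%N.

Lemma st_le i : (st i <= i)%N.
Proof. by elim: i => //= i IH; case: turn => //; lia. Qed.

Lemma st_turn i j : (st i <= j < i)%N -> turn j.
Proof.
elim: i => [|i IH] /=; first lia.
case: ifP => [ti h|_]; last by lia.
by case: (ltngtP j i) => hj; [apply: IH|lia|rewrite hj]; lia.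
Qed.

Lemma st_end i : (0 < st i)%N -> ~~ turn (st i).-1.
Proof. by elim: i => //= i IH; case: ifP => // ->. Qed.

Lemma fin_prop i : (i < N)%N ->
  [/\ (i <= fin i < N)%N, ~~ turn (fin i) & forall j, (i <= j < fin i)%N -> turn j].
Proof.
move=> h; have hs : has (fun j => ~~ turn j) (iota i N).
  by apply/hasP; exists N.-1; [rewrite mem_iota|rewrite /turn]; lia.
have nt : ~~ turn (fin i).
  by have := nth_find 0 hs; rewrite nth_iota // -[X in (_ < X)%N](size_iota i) -has_find.
have ht j : (i <= j < fin i)%N -> turn j.
  move=> /andP[h1 h2]; have h3 : (j - i < find (fun j => ~~ turn j) (iota i N))%N.
    by move: h2; rewrite /fin; lia.
  have := before_find 0 h3; rewrite nth_iota; last by have := find_size (fun j => ~~ turn j) (iota i N); rewrite size_iota; lia.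
  by rewrite subnKC // => /negbFE.
split=> //; apply/andP; split; first by rewrite /fin leq_addr.
rewrite ltnNge; apply/negP => h4.
have : turn N.-1 by apply: ht; lia.
by rewrite /turn; lia.
Qed.

Lemma run_of i : (i < N)%N -> is_run (st i) (fin i).
Proof.
move=> h; have [h1 h2 h3] := fin_prop h; have := st_le i.
split; [lia|lia|] => j hj; case: (ltnP j i) => hji; first by apply: (st_turn (i:=i)); lia.
by apply: h3; lia.
Qed.

Lemma st_uniq i k : (k <= i)%N -> (forall j, (k <= j < i)%N -> turn j) -> st k = st i.
Proof.
move=> /subnKC <-; elim: (i - k)%N => [|m IH] ht; first by rewrite addn0.
rewrite addnS /= ht; last lia.
by apply: IH => j hj; apply: ht; lia.
Qed.

Lemma st_run i f j : is_run i f -> (i <= j <= f)%N -> st j = st i.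
Proof. by move=> [_ _ ht] h; symmetry; apply: st_uniq; [lia|move=> *; apply: ht; lia]. Qed.

Lemma fin_uniq i f : (i <= f < N)%N -> ~~ turn f -> (forall j, (i <= j < f)%N -> turn j) ->
  fin i = f.
Proof.
move=> h nf ht; have [h1 h2 h3] : [/\ (i <= fin i < N)%N, ~~ turn (fin i) & forall j, (i <= j < fin i)%N -> turn j].
  by apply: fin_prop; lia.
case: (ltngtP (fin i) f) => // e; first by rewrite ht in h2 => //; lia.
by rewrite h3 in nf => //; lia.
Qed.

Lemma fin_turn i : turn i -> fin i.+1 = fin i.
Proof.
move=> ti; have /andP[hi _] := ti; have hi' : (i < N)%N by lia.
have [h1 h2 h3] := fin_prop hi'.
have ne : fin i <> i by move=> e; rewrite e ti in h2.
by apply: fin_uniq => //; [lia|move=> j hj; apply: h3; lia].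
Qed.

Lemma ltn_neqC (x y : nat) : x <> y -> (x < y)%N = ~~ (y < x)%N.
Proof. by lia. Qed.

Lemma count_le (U : eqType) (A B : pred U) (l : seq U) :
  {in l, subpred A B} -> (count A l <= count B l)%N.
Proof.
move=> sub; have sub' x : x \in l -> A x -> B x by move=> xl; apply: sub.
elim: l sub' {sub} => //= x l IH sub.
have h1 : (A x <= B x)%N by case: (A x) (sub x (mem_head _ _)) => // ->.
by rewrite leq_add ?IH // => y yl; apply: sub; rewrite inE yl orbT.
Qed.

Lemma count_lt (U : eqType) (A B : pred U) (l : seq U) z :
  {in l, subpred A B} -> z \in l -> B z -> ~~ A z -> (count A l < count B l)%N.
Proof.
move=> sub; have sub' : {in l, forall x, A x -> B x} by move=> x xl; apply: sub.
elim: l sub' {sub} => //= x l IH sub; rewrite inE => /orP[/eqP <-|zl] Bz nAz.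
  rewrite Bz (negbTE nAz) add0n add1n ltnS.
  by apply: count_le => y yl; apply: sub; rewrite inE yl orbT.
have h1 : (A x <= B x)%N by case: (A x) (sub x (mem_head _ _)) => // ->.
have h2 : (count A l < count B l)%N.
  by apply: IH => // y yl; apply: sub; rewrite inE yl orbT.
lia.
Qed.

(** Maximal zigzags are of three kinds: through zigzags ([isLR]), with terminals at opposite mouths
    of the pipe; fingers ([is_finger]), with both terminals at one mouth; and those cut short by an
    endpoint of the path. *)
Definition has_start i := (0 < st i)%N.
Definition has_end i := ((fin i).+1 < N)%N.
Definition isLR i := [&& has_start i, has_end i & d (a (st i)) != d (b (fin i))].
(** The point beside which strand [i] is laid. All strands of a through zigzag follow its last end.
    A finger is attached to its entry by the first strand and to its exit by all others, so it is
    folded at its first turn. A zigzag cut short uses the terminal it has, if any. *)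
Definition att i :=
  if has_end i && ~~ [&& has_start i, d (a (st i)) == d (b (fin i)) & i == st i]
  then b (fin i) else a (st i).
Definition LRrun j x := [&& st j == j, isLR j & v' (a j) == v' x].
Definition endon j x := if d (a j) == d x then a j else b (fin j).
(** Through zigzags divide the pipe into layers, and [cnt x] is the layer of [x]. *)
Definition cnt x := count (fun j => LRrun j x && lo (endon j x) x) (iota 0 N).
Definition pos x := count (fun z => (d z == d x) && lo z x) tm.
(** Lexicographic code: the layer; then whether the strand belongs to the through zigzag bounding
    this layer from above; then the mouth to which it is attached, which stacks fingers from
    opposite mouths instead of interlocking them. In [klt] ties are broken by the position of the
    attachment and then by time. *)
Definition key i := (((cnt (att i)).*2 + isLR i).*2 + rising (att i))%N.
Definition klt i j := (key i < key j)%N ||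
  ((key i == key j) && ((pos (att i) < pos (att j))%N ||
    ((pos (att i) == pos (att j)) && (i < j)%N))).

Lemma klt_anti i j : i <> j -> klt i j = ~~ klt j i.
Proof. by rewrite /klt; lia. Qed.
Lemma klt_trs i j k : klt i j -> klt j k -> klt i k.
Proof. by rewrite /klt; lia. Qed.

Lemma nonturn_d j : (j.+1 < N)%N -> ~~ turn j -> d (b j) <> d (a j.+1).
Proof. by move=> h; rewrite /turn h => /eqP. Qed.

Lemma a_terminal j : (j.+1 < N)%N -> ~~ turn j -> terminal (a j.+1).
Proof.
move=> h nt; exists j => //; split; first exact: nonturn_d.
by right; rewrite chp_a.
Qed.
Lemma b_terminal j : (j.+1 < N)%N -> ~~ turn j -> terminal (b j).
Proof.
move=> h nt; exists j => //; split; first exact: nonturn_d.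
by left; rewrite chp_b //; lia.
Qed.

Lemma st_terminal i : (i < N)%N -> has_start i -> terminal (a (st i)).
Proof.
move=> hi hP; have := st_end hP; have := st_le i; have -> : st i = (st i).-1.+1 by rewrite prednK.
by move=> h; apply: a_terminal; lia.
Qed.
Lemma fin_terminal i : (i < N)%N -> has_end i -> terminal (b (fin i)).
Proof. by move=> hi hQ; have [_ nt _] := fin_prop hi; apply: b_terminal. Qed.

Lemma stst i : st (st i) = st i.
Proof. by apply: st_uniq; [exact: st_le|move=> j; apply: st_turn]. Qed.

Lemma finst i : (i < N)%N -> fin (st i) = fin i.
Proof.
move=> hi; have [h1 h2 h3] := run_of hi; have [_ nt _] := fin_prop hi.
by apply: fin_uniq => //; lia.
Qed.

Lemma lo_irr x : lo x x = false. Proof. by rewrite /lo eqxx. Qed.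

Lemma run_ends_v' i : (i < N)%N -> v' (b (fin i)) = v' (a (st i)).
Proof. by move=> hi; have r := run_of hi; rewrite (run_v'b r) //; case: r; lia. Qed.

(** By [run_js] both zigzags are chords of the derivative, where [po_chd] applies. *)
Lemma run_cross'' i j : (i < N)%N -> (j < N)%N -> st i = i -> st j = j -> i <> j ->
  has_start i -> has_end i -> has_start j -> has_end j -> v' (a i) = v' (a j) ->
  cross lt'' (a i) (b (fin i)) (a j) (b (fin j)) = false.
Proof.
move=> hi hj si' sj ij iP iQ jP jQ vE.
have H k : (k < N)%N -> st k = k -> has_start k -> has_end k ->
    exists m, [/\ (m.+1 < M)%N, (js m).+1 = k & js m.+1 = fin k].
  move=> hk sk kP kQ; have [h1 h2 h3] := fin_prop hk.
  have := st_end kP; rewrite /has_start sk in kP *; move=> h4.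
  by apply: run_js => //; lia.
have [k [k1 k2 k3]] := H i hi si' iP iQ.
have [l [l1 l2 l3]] := H j hj sj jP jQ.
have := @po_chd _ _ _ _ _ _ _ _ L k l k1 l1.
rewrite /a' /b' k2 k3 l2 l3; apply=> //.
by move=> kl; subst l; apply: ij; rewrite -k2 -l2.
Qed.

Lemma lt''_d p q : terminal p -> terminal q -> v' p = v' q -> d p <> d q ->
  lt'' p q = (d p < d q)%N.
Proof.
move=> tp tq vE n; rewrite (po_agree L (terminalP tp) (terminalP tq) vE).
  by rewrite /lt' (introF eqP n).
by move/code_inj => [].
Qed.

Lemma LR_ends j : (j < N)%N -> st j = j -> isLR j ->
  [/\ terminal (a j), terminal (b (fin j)), d (a j) <> d (b (fin j)) & v' (b (fin j)) = v' (a j)].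
Proof.
move=> hj sj /and3P[hP hQ /eqP n]; rewrite sj in n.
have := st_terminal hj hP; have := fin_terminal hj hQ; have := run_ends_v' hj.
by rewrite sj.
Qed.

Lemma endonP j x : (j < N)%N -> terminal x -> LRrun j x ->
  terminal (endon j x) /\ d (endon j x) = d x.
Proof.
move=> hj tx /and3P[/eqP sj LR /eqP vE]; have [ta tb n vb] := LR_ends hj sj LR.
rewrite /endon; case: eqP => // e; split=> //.
have Px := term_P tx; have Pa := term_P ta; have Pb := term_P tb.
apply: rising_eq => //; first congruence.
have s1 : rising (a j) <> rising x by move=> h; apply: e; apply: rising_eq.
have s2 : rising (a j) <> rising (b (fin j)) by move=> h; apply: n; apply: rising_eq.
by move: s1 s2; do 3 case: (rising _).
Qed.

Lemma LRrun_v' j x y : v' x = v' y -> LRrun j x = LRrun j y.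
Proof. by rewrite /LRrun => ->. Qed.

Lemma cnt_mono x y : terminal x -> terminal y -> d x = d y -> lo x y -> (cnt x <= cnt y)%N.
Proof.
move=> tx ty e l; apply: count_le => j; rewrite mem_iota => hj /andP[r h].
have hj' : (j < N)%N by lia.
have [te de] := endonP hj' tx r.
have E : endon j y = endon j x by rewrite /endon e.
rewrite -(LRrun_v' j (d_v' tx ty e)) r E /=.
by apply: lo_trs h l.
Qed.

Lemma cnt_strict x y j : terminal x -> terminal y -> d x = d y -> lo x y ->
  (j < N)%N -> LRrun j x -> endon j x = x -> (cnt x < cnt y)%N.
Proof.
move=> tx ty e l hj r ex; apply: (@count_lt _ _ _ _ j).
- move=> i; rewrite mem_iota => hi /andP[ri h].
  have hi' : (i < N)%N by lia.
  have [te de] := endonP hi' tx ri.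
  have E : endon i y = endon i x by rewrite /endon e.
  rewrite -(LRrun_v' i (d_v' tx ty e)) ri E /=.
  by apply: lo_trs h l.
- by rewrite mem_iota.
- by rewrite -(LRrun_v' j (d_v' tx ty e)) r {1}/endon -e -/(endon j x) ex l.
- by rewrite ex lo_irr andbF.
Qed.

Lemma pos_mono x y : terminal x -> terminal y -> d x = d y -> lo x y -> (pos x < pos y)%N.
Proof.
move=> tx ty e l; apply: (@count_lt _ _ _ _ x).
- move=> z /tmP tz /andP[/eqP ez h]; rewrite ez e eqxx /=.
  by apply: lo_trs h l => //; rewrite ez.
- by apply/tmP.
- by rewrite e eqxx l.
- by rewrite lo_irr andbF.
Qed.

Lemma lo_lt'' x y z : terminal x -> terminal y -> terminal z -> d x = d y -> d z = d x ->
  z <> x -> z <> y -> lt'' x z = lt'' y z -> lo z x = lo z y.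
Proof.
move=> tx ty tz e1 e2 n1 n2; rewrite /lo (introF eqP n1) (introF eqP n2) /= => h.
by rewrite (po_anti L (terminalP tz) (terminalP tx)) //
  (po_anti L (terminalP tz) (terminalP ty)) // h.
Qed.

(** Through zigzags do not cross one another in the derivative, so they come in the same order at
    both mouths. *)
Lemma cnt_LR j : (j < N)%N -> st j = j -> isLR j -> cnt (a j) = cnt (b (fin j)).
Proof.
move=> hj sj LR; have [ta tb n vb] := LR_ends hj sj LR.
apply: eq_in_count => i; rewrite mem_iota => hi; rewrite (LRrun_v' i vb).
case r : (LRrun i (a j)) => //=.
have hi' : (i < N)%N by lia.
have [te de] := endonP hi' ta r.
have r' := r; rewrite -(LRrun_v' i vb) in r'.
have [te' de'] := endonP hi' tb r'.
case: (eqVneq i j) => [ij|/eqP ij].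
  subst i; rewrite /endon eqxx (introF eqP n) lo_irr lo_irr //.
have /and3P[/eqP si' LRi /eqP vi] := r.
have [ta' tb' n' vb'] := LR_ends hi' si' LRi.
have /and3P[iP iQ _] := LRi; have /and3P[jP jQ _] := LR.
have C := run_cross'' hi' hj si' sj ij iP iQ jP jQ vi.
have Pa := term_P ta; have Pb := term_P tb.
have sab : rising (b (fin j)) = ~~ rising (a j).
  have : rising (a j) <> rising (b (fin j)) by move=> h; apply: n; apply: rising_eq.
  by do 2 case: (rising _).
have n1 : a i <> a j by move=> e; apply: ij; apply: (sys_inja S).
have hfi : (fin i < N)%N by have [] := run_of hi'.
have hfj : (fin j < N)%N by have [] := run_of hj.
have n2 : a i <> b (fin j) by apply: (sys_ab S).
have n3 : b (fin i) <> a j by move/esym; apply: (sys_ab S).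
have n4 : b (fin i) <> b (fin j).
  move=> e; have {}e := sys_injb S hfi hfj e.
  have si2 := @st_run _ _ (fin i) (run_of hi'); rewrite stst si' in si2.
  have sj2 := @st_run _ _ (fin j) (run_of hj); rewrite stst sj in sj2.
  have [ui _ _] := run_of hi'; have [uj _ _] := run_of hj.
  rewrite si' in ui; rewrite sj in uj.
  apply: ij; rewrite -si2; last by rewrite ui leqnn.
  by rewrite e sj2 // uj leqnn.
move: C; rewrite /cross; move: de de' te te'; rewrite /endon.
case: eqP => e1; case: eqP => e2 de de' te te'.
- by case: n; rewrite -e1 e2.
- rewrite [lt'' (a i) (b _)]lt''_d //; try congruence.
  rewrite [lt'' (b _) (a j)]lt''_d //; try congruence.
  rewrite /lo (introF eqP n1) (introF eqP n4) /= (rising_d (term_P ta') Pa e1).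
  rewrite (rising_d (term_P tb') Pb de') sab.
  rewrite (po_anti L (terminalP tb) (terminalP tb')); last congruence.
  rewrite (po_anti L (terminalP ta) (terminalP ta')); last congruence.
  rewrite e1 de' (ltn_neqC n).
  by case: (rising _); case: (lt'' _ _); case: (lt'' _ _); case: (d (b (fin j)) < d (a j))%N.
- rewrite [lt'' (a i) (a _)]lt''_d //; try congruence.
  rewrite [lt'' (b _) (b _)]lt''_d //; try congruence.
  rewrite /lo (introF eqP n3) (introF eqP n2) /= (rising_d (term_P tb') Pa de).
  rewrite (rising_d (term_P ta') Pb e2) sab.
  rewrite (po_anti L (terminalP tb) (terminalP ta')); last congruence.
  rewrite (po_anti L (terminalP ta) (terminalP tb')); last congruence.
  rewrite e2 de (ltn_neqC n).
  by case: (rising _); case: (lt'' _ _); case: (lt'' _ _); case: (d (b (fin j)) < d (a j))%N.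
- exfalso; apply: n; congruence.
Qed.

(** The condition under which strand [i] may be compared by [klt] as if it were at the terminal [x]:
    equal layers, and [x] is the attachment itself or, for a through strand, an end of some through
    zigzag. *)
Definition anc i x := [/\ cnt (att i) = cnt x, ~~ isLR i -> att i = x &
  isLR i -> exists2 j, (j < N)%N & LRrun j x /\ endon j x = x].

(** Going up in [lo] never lowers the layer and raises the position. If [i] is a through strand the
    layer grows strictly, because the zigzag ending at [x] is itself counted below [y]. *)
Lemma anc_lo i j x y : anc i x -> anc j y -> terminal x -> terminal y -> d x = d y ->
  lo x y -> klt i j.
Proof.
move=> [ci ni li] [cj nj lj] tx ty e l.
have c1 := cnt_mono tx ty e l; have p1 := pos_mono tx ty e l.
have sE := rising_d (term_P tx) (term_P ty) e.
rewrite /klt /key ci cj.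
case LRi : (isLR i) li ni => li ni.
  have [k hk [r ex]] := li isT.
  have c2 := cnt_strict tx ty e l hk r ex.
  have h1 := leq_b1 (rising (att i)).
  by apply/orP; left; lia.
rewrite ni //; case LRj : (isLR j) lj nj => lj nj.
  have h1 := leq_b1 (rising x).
  by apply/orP; left; lia.
rewrite nj // sE; lia.
Qed.

Lemma anc_klt i j x y : anc i x -> anc j y -> terminal x -> terminal y -> d x = d y ->
  x <> y -> i <> j -> klt i j = lo x y.
Proof.
move=> ai aj tx ty e n ij; case l : (lo x y); first exact: (anc_lo ai aj).
rewrite klt_anti // (anc_lo aj ai) // lo_anti // ?l //; congruence.
Qed.

Lemma terminal_anc x : terminal x -> anc (si x) x.
Proof.
move=> tx; have [m hm [n e]] := tx.
have hm' : (m < N)%N by lia.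
have nt : ~~ turn m by rewrite /turn hm; apply/eqP.
case: e => -[ex _]; rewrite ex ?si_a ?si_b // -ex.
  have fm : fin m = m by apply: fin_uniq => //; lia.
  have mQ : has_end m by rewrite /has_end fm.
  have run := run_of hm'.
  have hst := st_le m; have hst' : (st m < N)%N by lia.
  (* A finger has at least two strands, since the ends of one strand lie in different darts; so its
     last strand is attached to its exit. *)
  have : ~~ isLR m -> att m = x.
    rewrite /att mQ /= /isLR mQ /= fm ex; case: ifP => // /negbFE /and3P[hP /eqP e /eqP e'].
    have := sys_dn S (pta hm'); rewrite (sys_sa S hm').
    by rewrite -e' in e; rewrite e.
  move=> hn; split=> //.
    case LR : (isLR m) hn => hn; last by rewrite hn.
    rewrite /att mQ fm /=; case: ifP => _; first by rewrite ex.
    have := @cnt_LR (st m) hst' (stst m); rewrite finst // fm ex; apply.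
    by move: LR; rewrite /isLR /has_start /has_end stst finst.
  move=> LR; exists (st m) => //; split.
    rewrite /LRrun stst eqxx /isLR /has_start /has_end stst finst //.
    by rewrite -/(has_start m) -/(has_end m) -/(isLR m) LR ex (run_v'b run) //; case: run; lia.
  rewrite /endon finst // fm -ex.
  by case: eqP => // e; move: LR; rewrite /isLR fm -ex e eqxx !andbF.
have sm : st m.+1 = m.+1 by rewrite /= (negbTE nt).
have mP : has_start m.+1 by rewrite /has_start sm.
have run := run_of hm.
split.
(* A through zigzag is attached at its other end, where the count is the same by [cnt_LR]. *)
- rewrite /att mP sm eqxx andbT /=; case: ifP => [|_]; last by rewrite ex.
  move=> /andP[hQ n']; rewrite -cnt_LR //; first by rewrite ex.
  by rewrite /isLR mP hQ sm.
- rewrite /isLR /att sm mP eqxx andbT -ex.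
  by case: (has_end _) => //= /negbNE ->.
- move=> LR; exists m.+1 => //; split; last by rewrite /endon ex eqxx.
  by rewrite /LRrun sm eqxx LR ex eqxx.
Qed.

Lemma turn_run i : turn i -> [/\ st i.+1 = st i, fin i.+1 = fin i & isLR i.+1 = isLR i].
Proof.
move=> ti; have e1 : st i.+1 = st i by rewrite /= ti.
by have e2 := fin_turn ti; rewrite /isLR /has_start /has_end e1 e2.
Qed.

Definition is_finger i := [/\ has_start i, has_end i, d (a i) = d (b (fin i)) & st i = i].

Lemma att_turn i : turn i -> att i.+1 = att i \/
  [/\ is_finger i, isLR i = false, att i = a i & att i.+1 = b (fin i)].
Proof.
move=> ti; have [e1 e2 e3] := turn_run ti; rewrite /att /has_start /has_end e1 e2.
have n : (i.+1 == st i) = false by have := st_le i; lia.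
rewrite n !andbF /= andbT -/(has_start i) -/(has_end i).
case Q : (has_end i) => //=; last by left.
case: ifP; first by left.
move/negbFE/and3P=> [hP /eqP e /eqP si']; right; rewrite -si' in e *.
have LRf : isLR i = false by rewrite /isLR hP Q /= -si'; apply/negbTE/negPn/eqP.
by split=> //; split.
Qed.

Lemma klt_same i j : turn i -> att i.+1 = att i -> j <> i -> j <> i.+1 ->
  klt j i = klt j i.+1.
Proof.
move=> ti e n1 n2; have [_ _ e3] := turn_run ti.
by rewrite /klt /key e e3; lia.
Qed.

Lemma finger_terms i : (i < N)%N -> is_finger i ->
  [/\ terminal (a i), terminal (b (fin i)), v' (b (fin i)) = v' (a i) & ~~ isLR i].
Proof.
move=> hi [hP hQ e si']; have := st_terminal hi hP; have := fin_terminal hi hQ.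
have := run_ends_v' hi; rewrite si' => h1 h2 h3; split=> //.
by rewrite /isLR hP hQ si' e eqxx.
Qed.

(** A through zigzag with an end between the two terminals of a finger would cross the finger in the
    derivative. *)
Lemma cnt_finger i : (i < N)%N -> is_finger i -> cnt (a i) = cnt (b (fin i)).
Proof.
move=> hi fi; have [ta tb vb nLR] := finger_terms hi fi; have [iP iQ e si'] := fi.
apply: eq_in_count => j; rewrite mem_iota => hj; rewrite (LRrun_v' j vb).
case r : (LRrun j (a i)) => //=.
have hj' : (j < N)%N by lia.
have [te de] := endonP hj' ta r.
have /and3P[/eqP sj LRj /eqP vj] := r.
have ij : j <> i by move=> ij; subst j; rewrite LRj in nLR.
have [ta' tb' n' vb'] := LR_ends hj' sj LRj.
have /and3P[jP jQ _] := LRj.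
have C := run_cross'' hi hj' si' sj (nesym ij) iP iQ jP jQ (esym vj).
have -> : endon j (b (fin i)) = endon j (a i) by rewrite /endon e.
have nn z : terminal z -> d z = d (a i) -> z = a j \/ z = b (fin j) -> z <> a i /\ z <> b (fin i).
  have hfi : (fin i < N)%N by have [] := run_of hi.
  have hfj : (fin j < N)%N by have [] := run_of hj'.
  move=> tz dz [] ez; rewrite ez; split=> E.
  - by apply: ij; apply: (sys_inja S).
  - by apply: (sys_ab S) E.
  - by move/esym: E; apply: (sys_ab S).
  - have {}E := sys_injb S hfj hfi E; apply: ij.
    have [ui _ _] := run_of hi; have [uj _ _] := run_of hj'.
    rewrite si' in ui; rewrite sj in uj.
    have si2 := @st_run _ _ (fin i) (run_of hi); rewrite stst si' in si2.
    have sj2 := @st_run _ _ (fin j) (run_of hj'); rewrite stst sj in sj2.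
    rewrite -si2; last by rewrite ui leqnn.
    by rewrite -E sj2 // uj leqnn.
have [n1 n2] : endon j (a i) <> a i /\ endon j (a i) <> b (fin i).
  by apply: nn => //; rewrite /endon; case: ifP => _; [left|right].
apply: lo_lt'' => //.
move: C; rewrite /cross; move: de te n1 n2; rewrite /endon; case: eqP => e1 de te n1 n2.
  rewrite [lt'' (a i) (b _)]lt''_d //; try congruence.
  rewrite [lt'' (b _) (b _)]lt''_d //; try congruence.
  rewrite -e; by case: (lt'' _ _); case: (lt'' _ _); case: (_ < _)%N.
rewrite [lt'' (a i) (a j)]lt''_d //; try congruence.
rewrite [lt'' (b _) (a j)]lt''_d //; try congruence.
rewrite -e; by case: (lt'' _ _); case: (lt'' _ _); case: (_ < _)%N.
Qed.

Lemma finger_anc i : (i < N)%N -> is_finger i -> turn i -> att i = a i ->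
  att i.+1 = b (fin i) -> anc i (a i) /\ anc i.+1 (b (fin i)).
Proof.
move=> hi fi ti e1 e2; have [ta tb vb /negbTE nLR] := finger_terms hi fi.
have [_ _ e3] := turn_run ti.
by split; split; rewrite ?e1 ?e2 ?e3 ?nLR.
Qed.

Lemma key_neq (c c' : nat) (l u u' : bool) : l || (u != u') ->
  ((c.*2 + l).*2 + u)%N <> ((c'.*2 + false).*2 + u')%N.
Proof. by clear; case: l; case: u; case: u' => //= _; lia. Qed.

(** The attachment jumps only at the first turn of a finger. That turn lies at the mouth opposite to
    the attachment, and the strand at a terminal there is a through strand or has another last
    component of the key. So the key decides and the position is never consulted. *)
Lemma klt_turn i y : turn i -> terminal y -> d y = d (b i) -> si y <> i -> si y <> i.+1 ->
  klt (si y) i = klt (si y) i.+1.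
Proof.
move=> ti ty e n1 n2; have := ti => /andP[hi _]; have hi' : (i < N)%N by lia.
case: (att_turn ti) => [|[fi nLR e1 e2]]; first by move=> ?; apply: klt_same.
have [ta tb vb _] := finger_terms hi' fi; have [iP iQ ef si'] := fi.
have [_ _ e3] := turn_run ti.
have c := cnt_finger hi' fi.
have sy : rising y = ~~ rising (a i).
  by rewrite (rising_d (term_P ty) (ptb hi') e) -(sys_sa S hi') rising_s //; apply: pta.
have sP : rising (b (fin i)) = rising (a i) by apply: rising_d; [apply: term_P|apply: term_P|].
have [cy ny _] := terminal_anc ty.
have eK : key i.+1 = key i by rewrite /key e1 e2 e3 nLR -c sP.
have nK : key (si y) <> key i.
  rewrite /key e1 nLR cy; apply: key_neq.
  by case: (isLR (si y)) ny => //= -> //; rewrite sy; case: (rising _).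
by rewrite /klt eK (introF eqP nK).
Qed.

Definition nlt p q :=
  if d p == d q then (if rising p then klt (si p) (si q) else klt (si q) (si p)) else lt p q.

Lemma nlt_anti p q : P p -> P q -> p <> q -> nlt p q = ~~ nlt q p.
Proof.
move=> Pp Pq n; rewrite /nlt eq_sym; case: eqP => e; last exact: (sys_anti S).
have ns : si p <> si q by move=> h; apply: n; apply: si_inj => //.
by rewrite (rising_d Pq Pp e); case: (rising p); apply: klt_anti => //; congruence.
Qed.

Lemma nlt_terminal p q : terminal p -> terminal q -> p <> q -> d p = d q -> nlt p q = lt'' p q.
Proof.
move=> tp tq n e; rewrite /nlt e eqxx.
have Pp := term_P tp; have Pq := term_P tq.
have ns : si p <> si q by move=> h; apply: n; apply: si_inj => //.
have ap := terminal_anc tp; have aq := terminal_anc tq.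
case: ifP => sp.
  by rewrite (anc_klt ap aq) // /lo sp (introF eqP n).
rewrite (anc_klt aq ap) //; try congruence.
by rewrite /lo -(rising_d Pp Pq e) sp (introF eqP (nesym n)).
Qed.

Lemma nlt_blk p p' q : P p -> P p' -> P q -> v p = v q -> d p <> d q -> d p = d p' ->
  nlt p q = nlt p' q.
Proof.
move=> Pp Pp' Pq vE n e; rewrite /nlt -e (introF eqP n).
exact: (sys_blk S).
Qed.

Lemma nlt_turn i q : turn i -> P q -> v q = v (b i) -> q <> b i -> q <> a i.+1 ->
  terminal q \/ d q <> d (b i) \/ att i.+1 = att i ->
  nlt (b i) q = nlt (a i.+1) q.
Proof.
move=> ti Pq vE n1 n2 H; have := ti => /andP[hi /eqP ei]; have hi' : (i < N)%N by lia.
have Pb := ptb hi'; have Pa := pta hi.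
case: (eqVneq (d q) (d (b i))) => [e|/eqP n]; last first.
  by apply: nlt_blk => //; congruence.
have m1 : si q <> i by move=> h; apply: n1; apply: si_inj => //; rewrite si_b.
have m2 : si q <> i.+1.
  by move=> h; apply: n2; apply: si_inj => //; rewrite ?si_a //; congruence.
have K : klt (si q) i = klt (si q) i.+1.
  case: H => [tq|[//|h]]; first exact: klt_turn.
  exact: klt_same.
rewrite (nlt_anti Pb Pq) ?(nlt_anti Pa Pq); try congruence.
congr (~~ _); rewrite /nlt -ei e eqxx si_b // si_a // K.
rewrite (klt_anti (i:=i)) ?(klt_anti (i:=i.+1)) ?K //; congruence.
Qed.

Lemma crossC (l : rel T) p p' q q' :
  (forall x y, (x = p \/ x = p') -> (y = q \/ y = q') -> l x y = ~~ l y x) ->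
  cross l p p' q q' = cross l q q' p p'.
Proof.
move=> h; rewrite /cross !(h p, h p'); auto.
by case: (l q p) (l q p') (l q' p) (l q' p') => -[] [] [].
Qed.

(** The new order can differ from [lt] only between points of a common dart of the derivative. There
    both [lt'] and [lt''] reverse along [chp], so the comparisons at the two ends of the chords
    change together and the sum of four is kept. *)
Lemma nonturn_cross i j : (i.+1 < N)%N -> (j.+1 < N)%N -> i <> j -> v (b i) = v (b j) ->
  ~~ turn i -> ~~ turn j -> cross nlt (b i) (a i.+1) (b j) (a j.+1) = false.
Proof.
move=> hi hj ij vE ni nj.
have tb := b_terminal hi ni; have ta := a_terminal hi ni.
have tb' := b_terminal hj nj; have ta' := a_terminal hj nj.
have hi' : (i < N)%N by lia.
have hj' : (j < N)%N by lia.
have := nonturn_d hi ni; have := nonturn_d hj nj => n1 n2.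
have ci := sys_chv S hi; have cj := sys_chv S hj.
have m1 : b i <> b j by move=> e; apply: ij; apply: (sys_injb S).
have m2 : b i <> a j.+1 by move/esym; apply: (sys_ab S).
have m3 : a i.+1 <> b j by apply: (sys_ab S).
have m4 : a i.+1 <> a j.+1 by move=> e; have := sys_inja S hi hj e; lia.
have V p q : (p = b i \/ p = a i.+1) -> (q = b j \/ q = a j.+1) -> v p = v q.
  by move=> [] -> [] ->; congruence.
have E p q : (p = b i \/ p = a i.+1) -> (q = b j \/ q = a j.+1) ->
    d' p <> d' q -> nlt p q = lt p q.
  move=> hp hq n.
  have tp : terminal p by case: hp => ->.
  have tq : terminal q by case: hq => ->.
  have npq : p <> q by case: hp hq => -> [] ->.
  case: (eqVneq (d p) (d q)) => [e|/eqP e]; last by rewrite /nlt (introF eqP e).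
  rewrite nlt_terminal // (po_agree L (terminalP tp) (terminalP tq)) //; last exact: d_v'.
  by rewrite /lt' e eqxx.
have F p q : (p = b i \/ p = a i.+1) -> (q = b j \/ q = a j.+1) -> d' p = d' q ->
    nlt (chp p) (chp q) (+) nlt p q = lt (chp p) (chp q) (+) lt p q.
  move=> hp hq e.
  have tp : terminal p by case: hp => ->.
  have tq : terminal q by case: hq => ->.
  have tcp : terminal (chp p) by case: hp => ->; rewrite ?chp_a ?chp_b.
  have tcq : terminal (chp q) by case: hq => ->; rewrite ?chp_a ?chp_b.
  have npq : p <> q by case: hp hq => -> [] ->.
  have npq' : chp p <> chp q by case: hp hq => -> [] ->; rewrite ?chp_a ?chp_b.
  have [e1 e2] := code_inj e.
  have := terminal_lt' tp tq npq e; rewrite /lt' e1 e2 !eqxx => ->.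
  rewrite !nlt_terminal // (po_pipe L (terminalP tp) (terminalP tq) npq e).
  by case: (lt'' _ _); case: (lt _ _).
rewrite -(sys_chd S hi hj ij vE) /cross.
have D p q : d p <> d q -> d' p <> d' q by move=> n /code_inj[].
have c1 : chp (b i) = a i.+1 by rewrite chp_b.
have c2 : chp (b j) = a j.+1 by rewrite chp_b.
have c3 : chp (a j.+1) = b j by rewrite chp_a.
have c4 : chp (a i.+1) = b i by rewrite chp_a.
case: (eqVneq (d' (b i)) (d' (b j))) => [e|/eqP e].
  have [e1 e2] := code_inj e; rewrite c1 c2 in e2.
  rewrite (E (b i) (a j.+1)) ?(E (a i.+1) (b j)); auto; try (apply: D; congruence).
  have := F (b i) (b j) (or_introl erefl) (or_introl erefl) e; rewrite c1 c2.
  case: (nlt _ _); case: (nlt _ _); case: (lt _ _); case: (lt _ _); case: (lt _ _);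
    by case: (lt _ _).
case: (eqVneq (d' (b i)) (d' (a j.+1))) => [f|/eqP f].
  have [e1 e2] := code_inj f; rewrite c1 c3 in e2.
  rewrite (E (b i) (b j)) ?(E (a i.+1) (a j.+1)); auto; try (apply: D; congruence).
  have := F (b i) (a j.+1) (or_introl erefl) (or_intror erefl) f; rewrite c1 c3.
  case: (nlt _ _); case: (nlt _ _); case: (lt _ _); case: (lt _ _); case: (lt _ _);
    by case: (lt _ _).
rewrite !E; auto; move=> /code_inj; rewrite ?c2 ?c3 c4 => -[g1 g2].
  by apply: e; rewrite /d' c1 c2; congruence.
by apply: f; rewrite /d' c1 c3; congruence.
Qed.

Lemma turn_cross i j : turn i -> (j.+1 < N)%N -> i <> j -> v (b i) = v (b j) -> ~~ turn j ->
  cross nlt (b i) (a i.+1) (b j) (a j.+1) = false.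
Proof.
move=> ti hj ij vE nj; have /andP[hi _] := ti.
have tb' := b_terminal hj nj; have ta' := a_terminal hj nj.
have hi' : (i < N)%N by lia.
have hj' : (j < N)%N by lia.
have cj := sys_chv S hj.
have m1 : b j <> b i by move=> e; apply: ij; apply: (sys_injb S).
have m2 : b j <> a i.+1 by move/esym; apply: (sys_ab S).
have m3 : a j.+1 <> b i by apply: (sys_ab S).
have m4 : a j.+1 <> a i.+1 by move=> e; have := sys_inja S hj hi e; lia.
rewrite /cross (nlt_turn ti (term_P tb')) //; last by left.
rewrite (nlt_turn ti (term_P ta')) //; [|congruence|by left].
by case: (nlt _ _); case: (nlt _ _).
Qed.

(** If one attachment does not jump, the turn ends are not separated ([easy]). Otherwise both chords
    are first turns of fingers at one mouth; the four comparisons are then those of the four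
    terminals, and the fingers do not cross in the derivative. *)
Lemma turns_cross i j : turn i -> turn j -> i <> j -> v (b i) = v (b j) ->
  cross nlt (b i) (a i.+1) (b j) (a j.+1) = false.
Proof.
move=> ti tj ij vE; have /andP[hi /eqP ei] := ti; have /andP[hj /eqP ej] := tj.
have hi' : (i < N)%N by lia.
have hj' : (j < N)%N by lia.
have Pbi := ptb hi'; have Pai := pta hi; have Pbj := ptb hj'; have Paj := pta hj.
have ci := sys_chv S hi; have cj := sys_chv S hj.
have m1 : b j <> b i by move=> e; apply: ij; apply: (sys_injb S).
have m2 : b j <> a i.+1 by move/esym; apply: (sys_ab S).
have m3 : a j.+1 <> b i by apply: (sys_ab S).
have m4 : a j.+1 <> a i.+1 by move=> e; have := sys_inja S hj hi e; lia.
have easy k l : turn k -> turn l -> k <> l -> v (b k) = v (b l) ->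
    d (b k) <> d (b l) \/ att k.+1 = att k -> cross nlt (b k) (a k.+1) (b l) (a l.+1) = false.
  move=> tk tl kl vkl H.
  have /andP[hk /eqP ek] := tk; have /andP[hl /eqP el] := tl.
  have hk' : (k < N)%N by lia.
  have hl' : (l < N)%N by lia.
  have cl := sys_chv S hl.
  rewrite /cross (nlt_turn tk (ptb hl')) //; first last.
  - by case: H => H; right; [left; congruence|right].
  - by move/esym; apply: (sys_ab S).
  - by move=> e; apply: kl; apply: (sys_injb S).
  rewrite (nlt_turn tk (pta hl)) //; first by case: (nlt _ _); case: (nlt _ _).
  - by congruence.
  - by apply: (sys_ab S).
  - by move=> e; have := sys_inja S hl hk e; lia.
  - by case: H => H; right; [left; congruence|right].
case: (eqVneq (d (b i)) (d (b j))) => [e|/eqP ?]; last by apply: easy => //; left.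
case: (att_turn ti) => [?|[fi nLi ai ai']]; first by apply: easy => //; right.
case: (att_turn tj) => [h|[fj nLj aj aj']].
  rewrite crossC; first by apply: easy => //; [congruence|right].
  by move=> x y [] -> [] ->; apply: nlt_anti => //; congruence.
have [ta tb vb _] := finger_terms hi' fi; have [ta' tb' vb' _] := finger_terms hj' fj.
have [iP iQ ef si'] := fi; have [jP jQ ef' sj] := fj.
have [anci anci'] := finger_anc hi' fi ti ai ai'.
have [ancj ancj'] := finger_anc hj' fj tj aj aj'.
have dij : d (a i) = d (a j).
  by rewrite -(sys_sb S hi') -(sys_sb S hj'); apply: (sys_ds S).
have C := run_cross'' hi' hj' si' sj ij iP iQ jP jQ (d_v' ta ta' dij).
have hfi : (fin i < N)%N by have [] := run_of hi'.
have hfj : (fin j < N)%N by have [] := run_of hj'.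
have n1 : a i <> a j by move=> E; apply: ij; apply: (sys_inja S).
have n2 : a i <> b (fin j) by apply: (sys_ab S).
have n3 : b (fin i) <> a j by move/esym; apply: (sys_ab S).
have n4 : b (fin i) <> b (fin j).
  move=> E; have {}E := sys_injb S hfi hfj E; apply: ij.
  have si2 := @st_run _ _ (fin i) (run_of hi'); rewrite stst si' in si2.
  have sj2 := @st_run _ _ (fin j) (run_of hj'); rewrite stst sj in sj2.
  have [ui _ _] := run_of hi'; have [uj _ _] := run_of hj'.
  rewrite si' in ui; rewrite sj in uj.
  by rewrite -si2 ?ui ?leqnn // E sj2 // uj leqnn.
have i1 : i.+1 <> j by move=> E; subst j; case: (sys_dn S Pai); rewrite (sys_sa S hi); congruence.
have j1 : j.+1 <> i by move=> E; subst i; case: (sys_dn S Paj); rewrite (sys_sa S hj); congruence.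
have k1 := anc_klt anci ancj ta ta' dij n1 ij.
have k2 : klt i j.+1 = lo (a i) (b (fin j)).
  by apply: (anc_klt anci ancj') => //; congruence.
have k3 : klt i.+1 j = lo (b (fin i)) (a j).
  by apply: (anc_klt anci' ancj) => //; congruence.
have k4 : klt i.+1 j.+1 = lo (b (fin i)) (b (fin j)).
  by apply: (anc_klt anci' ancj') => //; [congruence|case].
have K : klt i j (+) klt i j.+1 (+) klt i.+1 j (+) klt i.+1 j.+1 = false.
  rewrite k1 k2 k3 k4 /lo; move: C; rewrite /cross.
  rewrite (introF eqP n1) (introF eqP n2) (introF eqP n3) (introF eqP n4) /=.
  have -> : rising (b (fin i)) = rising (a i) by apply: rising_d => //; apply: term_P.
  case: (rising (a i)) => //.
  have A p q : terminal p -> terminal q -> p <> q -> lt'' q p = ~~ lt'' p q.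
    by move=> tp tq n; apply: (po_anti L); [apply: terminalP|apply: terminalP|congruence].
  rewrite (A (a i) (a j)) // (A (a i) (b (fin j))) // (A (b (fin i)) (a j)) //.
  rewrite (A (b (fin i)) (b (fin j))) //.
  by case: (lt'' _ _); case: (lt'' _ _); case: (lt'' _ _); case: (lt'' _ _).
rewrite /cross /nlt -ei -ej e eqxx !si_b // !si_a //.
have -> : rising (a i.+1) = rising (b i) by apply: rising_d => //; congruence.
case: (rising (b i)) => //.
rewrite (klt_anti (nesym ij)) (klt_anti j1) (klt_anti (nesym i1)).
have ij1 : j.+1 <> i.+1 by case=> /nesym.
rewrite (klt_anti ij1).
move: K; by case: (klt _ _); case: (klt _ _); case: (klt _ _); case: (klt _ _).
Qed.

Lemma lift_order : planar_order N a b s v d lt nlt.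
Proof.
split.
- exact: nlt_anti.
- by move=> p q _ _ _ n; rewrite /nlt (introF eqP n).
- move=> p q r Pp Pq Pr n1 n2 n3 v1 v2.
  case: (eqVneq (d p) (d q)) => [e1|/eqP e1]; case: (eqVneq (d q) (d r)) => [e2|/eqP e2].
  + rewrite /nlt e1 e2 !eqxx -(rising_d Pp Pq e1); case: (rising p) => h1 h2.
      exact: klt_trs h1 h2.
    exact: klt_trs h2 h1.
  + by move=> _; rewrite (nlt_blk (p := p) (p' := q)) //; congruence.
  + move=> h _; rewrite (nlt_anti Pp Pr) // (nlt_blk (p := r) (p' := q)) //; try congruence.
    by rewrite -(nlt_anti Pp Pq).
  + case: (eqVneq (d p) (d r)) => [e3|/eqP e3].
      move=> h1; rewrite (nlt_anti Pq Pr) // -(nlt_blk Pp Pr Pq) // ?h1 //; congruence.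
    rewrite /nlt (introF eqP e1) (introF eqP e2) (introF eqP e3).
    exact: (sys_trs S).
- move=> p q Pp Pq n e; rewrite /nlt e (sys_ds S Pp Pq e) !eqxx !si_s // rising_s //.
  have ns : si p <> si q by move=> h; apply: n; apply: si_inj.
  by case: (rising p) => /=; apply: klt_anti; congruence.
- move=> i j hi hj ij vE.
  have hi' : (i < N)%N by lia.
  have hj' : (j < N)%N by lia.
  case ti : (turn i); case tj : (turn j).
  + exact: turns_cross.
  + by apply: turn_cross; rewrite ?ti ?tj.
  + rewrite crossC; first by apply: turn_cross; rewrite ?ti ?tj //; congruence.
    move=> x y hx hy; apply: nlt_anti.
    * by case: hx => ->; [apply: ptb|apply: pta].
    * by case: hy => ->; [apply: ptb|apply: pta].
    case: hx hy => -> [] -> E.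
    * by apply: ij; apply: (sys_injb S).
    * by move/esym: E; apply: (sys_ab S).
    * by apply: (sys_ab S) E.
    * by have := sys_inja S hi hj E; lia.
  + by apply: nonturn_cross; rewrite ?ti ?tj.
Qed.

End Lift.
End Derivative.

Theorem planar_order_exists N a b s v d lt : strand_system N a b s v d lt ->
  exists lt', planar_order N a b s v d lt lt'.
Proof.
elim/ltn_ind: N a b s v d lt => N IH a b s v d lt S.
case: (posnP N) => [N0|N_gt0].
  have P0 p : pt N a b p -> False by case=> i; rewrite N0.
  exists lt; split; try by move=> p ? /P0.
  - by move=> p q r /P0.
  - by move=> i j; rewrite N0.
(* [N] strands have only [N - 1] chords between them. *)
have lM : (size (ends N a b d) < N)%N.
  have := count_size (fun j => ~~ turn N a b d j) (iota 0 N.-1).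
  by rewrite size_iota size_filter; lia.
have [lt'' L] := IH _ lM _ _ _ _ _ _ (derived_system S).
by eexists; apply: (lift_order S L).
Qed.

End StrandSystems.

Import Order.TTheory GRing.Theory Num.Theory.
Import numFieldNormedType.Exports.
Local Open Scope classical_set_scope.
Local Open Scope ring_scope.

(** * Half-lifts of the direction map and the turning order *)

Section Slit.
Context {R : realType}.
Implicit Types (w q t l : R * R).

Lemma scale_pairE (k : R) w : k *: w = (k * w.1, k * w.2). Proof. by []. Qed.

Definition dot2 q t : R := q.1 * t.1 + q.2 * t.2.

(** The half-open half-plane of arguments in [0, pi). *)
Definition up w : bool := (0 < w.2) || ((w.2 == 0) && (0 < w.1)).

(** Whether turning from [w] to [w'] the short way crosses the negative first axis, the branch cut
    of the square root. The axis itself counts as lower half-plane, and opposite vectors give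
    [false]. *)
Definition slit w w' : bool :=
  (up w (+) up w') && (if up w then 0 < det2 w w' else 0 < det2 w' w).

Lemma slitC w w' : slit w w' = slit w' w.
Proof. by rewrite /slit addbC; case: (up w); case: (up w'). Qed.

Lemma upP w : reflect (0 < w.2 \/ w.2 = 0 /\ 0 < w.1) (up w).
Proof.
apply: (iffP orP) => -[h|h]; [by left| |by left|].
  by case/andP: h => /eqP ? ?; right.
by case: h => h1 h2; right; rewrite h1 eqxx.
Qed.

Lemma upPn w : w <> 0 -> ~~ up w -> w.2 < 0 \/ w.2 = 0 /\ w.1 < 0.
Proof.
case: w => x y n /negP h.
case: (ltgtP y 0) => [?|hy|hy]; [by left|by case: h; apply/upP; left|].
case: (ltgtP x 0) => [?|hx|hx]; [by right|by case: h; apply/upP; right|].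
by case: n; rewrite hx hy.
Qed.

Lemma upN w : w <> 0 -> up (- w) = ~~ up w.
Proof.
move=> n; apply/idP/idP; last first.
  by move/(upPn n) => h; apply/upP => /=; clear n; lra.
by move/upP => /= h; apply/negP => /upP h'; clear n; lra.
Qed.

(** The cut meets the open half-plane of [l] only if [l.1 < 0], and then [up] tells its two sides
    apart. So on a half-plane [slit] is a coboundary, which is the source of all later
    cancellations. *)
Lemma slit_half l w w' : 0 < dot2 l w -> 0 < dot2 l w' ->
  slit w w' = (l.1 < 0) && (up w (+) up w').
Proof.
have H w1 w2 : 0 < dot2 l w1 -> 0 < dot2 l w2 -> up w1 -> ~~ up w2 ->
    (0 < det2 w1 w2) = (l.1 < 0).
  move=> h1 h2 /upP u1 u2.
  have n2 : w2 <> 0 by move=> e; move: h2; rewrite e /dot2 /= !mulr0 addr0 ltxx.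
  have {}u2 := upPn n2 u2.
  move: h1 h2 u1 u2; case: l w1 w2 {n2} => a b [x y] [x' y']; rewrite /dot2 /det2 /=.
  move=> h1 h2 u1 u2; have E : y' * (a * x + b * y) - y * (a * x' + b * y') = a * (x * y' - y * x').
    by ring.
  case: (ltgtP a 0) => [an|ap|a0].
  - have : a * (x * y' - y * x') < 0 by rewrite -E; nra.
    by rewrite nmulr_rlt0.
  - have : a * (x * y' - y * x') <= 0 by rewrite -E; nra.
    by rewrite pmulr_rle0 // => h; apply/negbTE; rewrite -leNgt.
  - by rewrite a0 in h1 h2; nra.
move=> h1 h2; rewrite /slit; case u1 : (up w); case u2 : (up w'); rewrite /= ?andbF //.
  by rewrite (H w w') ?u2 // andbT.
by rewrite (H w' w) ?u1 // andbT.
Qed.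

(** The shape in which a half-lift compares two directions; by [angE] it is the comparison of their
    arguments in (-pi, pi). *)
Definition ang q t := up t (+) slit q (q - t) (+) slit (q - t) (- t).

Lemma angE q t : q.2 <> 0 -> t.2 <> 0 -> (up q = up t -> det2 q t <> 0) ->
  ang q t = if up q (+) up t then ~~ up q else 0 < det2 q t.
Proof.
move=> q0 t0 hd.
have up2 w : w.2 <> 0 -> up w = (0 < w.2).
  by move=> h; rewrite /up (introF eqP h) /= orbF.
have nq : q <> 0 by move=> e; rewrite e in q0.
have nt : t <> 0 by move=> e; rewrite e in t0.
have tN : up (- t) = ~~ up t by apply: upN.
have d1 : det2 q (q - t) = - det2 q t by rewrite /det2 /=; ring.
have d2 : det2 (q - t) q = det2 q t by rewrite /det2 /=; ring.
have d3 : det2 (q - t) (- t) = - det2 q t by rewrite /det2 /=; ring.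
have d4 : det2 (- t) (q - t) = det2 q t by rewrite /det2 /=; ring.
rewrite /ang /slit tN d1 d2 d3 d4 oppr_gt0.
case uq : (up q) hd; case ut : (up t) => hd /=.
- have : det2 q t <> 0 by apply: hd.
  by case: (up (q - t)) => /=; case: ltgtP => // -> //.
- suff -> : up (q - t) by [].
  apply/upP; left; move: uq ut; rewrite !up2 //= => h1 /negbT; rewrite -leNgt; lra.
- suff /negbTE -> : ~~ up (q - t) by [].
  apply/negP => /upP /=; move: uq ut; rewrite !up2 //= => /negbT; rewrite -leNgt => h1 h2.
  have h3 : q.2 < 0 by rewrite lt_neqAle h1 andbT; apply/eqP.
  by clear nq nt; lra.
- have : det2 q t <> 0 by apply: hd.
  by case: (up (q - t)) => /=; case: ltgtP => // -> //.
Qed.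

Lemma enorm_ge0 w : 0 <= enorm w. Proof. exact: sqrtr_ge0. Qed.

Lemma sqr_enorm w : enorm w ^+ 2 = w.1 ^+ 2 + w.2 ^+ 2.
Proof. by rewrite sqr_sqrtr // addr_ge0 // sqr_ge0. Qed.

Lemma enorm_gt0 w : w <> 0 -> 0 < enorm w.
Proof.
move=> n; rewrite lt_def enorm_ge0 andbT; apply/eqP => e; apply: n.
have := sqr_enorm w; rewrite e expr0n /= => /esym/eqP.
rewrite paddr_eq0 ?sqr_ge0 // !sqrf_eq0 => /andP[/eqP a /eqP b].
by case: w a b {e} => x y /= -> ->.
Qed.

(* tan of half the argument: the inverse of the rational parametrisation of the circle. *)
Definition stereo w : R := w.2 / (enorm w + w.1).

Lemma stereo_den w : w.2 <> 0 -> 0 < enorm w + w.1.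
Proof.
move=> n; have := sqr_enorm w; have := enorm_ge0 w.
have : 0 < w.2 ^+ 2 by rewrite lt_def sqr_ge0 sqrf_eq0 andbT; apply/eqP.
move: (enorm w) => r y2 r0 E; rewrite ltNge; apply/negP => h.
have : (r + w.1) * (r - w.1) <= 0 by rewrite mulr_le0_ge0 //; lra.
have -> : (r + w.1) * (r - w.1) = w.2 ^+ 2.
  have -> : w.2 ^+ 2 = r ^+ 2 - w.1 ^+ 2 by rewrite E; ring.
  by ring.
lra.
Qed.

Lemma stereoE w : w.2 <> 0 ->
  w.2 = enorm w * (2 * stereo w / (1 + stereo w ^+ 2)) /\
  w.1 = enorm w * ((1 - stereo w ^+ 2) / (1 + stereo w ^+ 2)).
Proof.
move=> n; have d := stereo_den n; have E := sqr_enorm w.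
have dn : enorm w + w.1 != 0 by rewrite gt_eqF.
have rn : enorm w != 0.
  by rewrite gt_eqF // enorm_gt0 // => e; apply: n; rewrite e.
have s2 : stereo w ^+ 2 = (enorm w - w.1) / (enorm w + w.1).
  rewrite /stereo expr_div_n.
  have -> : w.2 ^+ 2 = (enorm w - w.1) * (enorm w + w.1) by rewrite -subr_sqr E; ring.
  by field.
have h : enorm w + w.1 + (enorm w - w.1) != 0.
  have -> : enorm w + w.1 + (enorm w - w.1) = 2 * enorm w by ring.
  by rewrite mulf_neq0 // pnatr_eq0.
by rewrite s2 /stereo; split; field; rewrite dn h.
Qed.

Lemma stereo_up w : w.2 <> 0 -> (0 < stereo w) = up w.
Proof.
move=> n; rewrite /stereo /up (introF eqP n) /= orbF.
by rewrite pmulr_lgt0 // invr_gt0 stereo_den.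
Qed.

Lemma stereo_neq0 w : w.2 <> 0 -> stereo w <> 0.
Proof.
move=> n /eqP; rewrite /stereo mulf_eq0 invr_eq0 => /orP[/eqP //|].
by rewrite gt_eqF // stereo_den.
Qed.

Lemma stereo_lt q t : q.2 <> 0 -> t.2 <> 0 -> (up q = up t -> det2 q t <> 0) ->
  (stereo q < stereo t) = ang q t.
Proof.
move=> q0 t0 hd; rewrite angE //.
have Uq := stereo_up q0; have Ut := stereo_up t0.
have nq := stereo_neq0 q0; have nt := stereo_neq0 t0.
move: hd; rewrite -Uq -Ut.
have [Eq2 Eq1] := stereoE q0; have [Et2 Et1] := stereoE t0.
have pq : 0 < enorm q by apply: enorm_gt0 => e; apply: q0; rewrite e.
have pt : 0 < enorm t by apply: enorm_gt0 => e; apply: t0; rewrite e.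
have D : det2 q t = 2 * enorm q * enorm t * (stereo t - stereo q) * (1 + stereo q * stereo t)
   / ((1 + stereo q ^+ 2) * (1 + stereo t ^+ 2)).
  rewrite /det2 Eq1 Eq2 Et1 Et2.
  have h1 : 1 + stereo q ^+ 2 != 0 by rewrite gt_eqF // ltr_pwDl // sqr_ge0.
  have h2 : 1 + stereo t ^+ 2 != 0 by rewrite gt_eqF // ltr_pwDl // sqr_ge0.
  by field; rewrite h1 h2.
rewrite D; move: (stereo q) (stereo t) nq nt {D Uq Ut Eq1 Eq2 Et1 Et2} => a b na nb hd.
have h1 : 0 < (1 + a ^+ 2) * (1 + b ^+ 2) by rewrite mulr_gt0 // ltr_pwDl // sqr_ge0.
have P : 0 < 1 + a * b -> (a < b) =
    (0 < 2 * enorm q * enorm t * (b - a) * (1 + a * b) / ((1 + a ^+ 2) * (1 + b ^+ 2))).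
  move=> h; rewrite pmulr_lgt0 ?invr_gt0 // pmulr_lgt0 // pmulr_rgt0 ?subr_gt0 //.
  by rewrite !mulr_gt0.
case: (ltgtP 0 a) => ha; last by case: na.
  case: (ltgtP 0 b) => hb /=; last by case: nb.
  - by apply: P; rewrite addr_gt0 // mulr_gt0.
  - by apply/negbTE; rewrite -leNgt ltW // (lt_trans hb ha).
case: (ltgtP 0 b) => hb /=; last by case: nb.
- by rewrite (lt_trans ha hb).
- by apply: P; rewrite addr_gt0 // nmulr_rgt0.
Qed.

End Slit.

(** * The strand system of a walk with a half-lift *)

Section Walks.
Context {R : realType}.
Implicit Types (p q : R * R) (V : nat -> R * R) (g : nat -> nat -> bool).

(** What the argument retains of a simplicial map to a plane graph. Constant edges are allowed and
    fall under the first alternative. *)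
Definition plane_walk n V := forall i j p, (i < n)%N -> (j < n)%N ->
  seg (V i) (V i.+1) p -> seg (V j) (V j.+1) p ->
  [\/ (p = V i \/ p = V i.+1) /\ (p = V j \/ p = V j.+1),
      V i = V j /\ V i.+1 = V j.+1 | V i = V j.+1 /\ V i.+1 = V j].

(** [g i j] is the sign of the chosen square root of [V i - V j] relative to the principal branch,
    so a continuous choice changes it exactly when the cut is crossed. The conditions range over the
    red sides of the triangle above the diagonal. *)
Definition half_lift n V g :=
  (forall i j, (i < j < n)%N -> ~ seg (V j) (V j.+1) (V i) ->
     g i j (+) g i j.+1 = slit (V i - V j) (V i - V j.+1)) /\
  (forall i j, (i.+1 < j <= n)%N -> ~ seg (V i) (V i.+1) (V j) ->
     g i j (+) g i.+1 j = slit (V i - V j) (V i.+1 - V j)).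

Lemma seg_l p q : seg p q p.
Proof.
by exists 0; rewrite /unit_arc /= ?in_itv /= ?lexx ?ler01 // subr0 scale1r scale0r addr0.
Qed.
Lemma seg_r p q : seg p q q.
Proof.
by exists 1; rewrite /unit_arc /= ?in_itv /= ?lexx ?ler01 // subrr scale1r scale0r add0r.
Qed.

Lemma segC p q : seg p q = seg q p.
Proof.
have H x y : seg x y `<=` seg y x.
  move=> z [t]; rewrite /unit_arc /= in_itv /= => /andP[h1 h2] <-.
  exists (1 - t); last by rewrite subKr addrC.
  by rewrite /unit_arc /= in_itv /= subr_ge0 h2 /= gerBl.
by apply/seteqP; split; apply: H.
Qed.

Variables (n : nat) (V : nat -> R * R).
Hypothesis W : plane_walk n V.

Lemma walk_vertex i j : (i <= n)%N -> (j < n)%N -> seg (V j) (V j.+1) (V i) ->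
  V i = V j \/ V i = V j.+1.
Proof.
move=> hi hj h; have : exists2 k, (k < n)%N & V i = V k \/ V i = V k.+1.
  case: (ltnP i n) => hin; first by exists i => //; left.
  have -> : i = n by apply/eqP; rewrite eqn_leq hi.
  by exists n.-1; [lia|right; rewrite prednK //; lia].
move=> [k hk ek]; have hk2 : seg (V k) (V k.+1) (V i).
  by case: ek => ->; [exact: seg_l|exact: seg_r].
by case: (W hk hj hk2 h) => [[_ //]|[e1 e2]|[e1 e2]]; rewrite -?e1 -?e2; tauto.
Qed.

Section Points.
Variable g : nat -> nat -> bool.
Hypothesis stall_free : forall i, (i < n)%N -> V i <> V i.+1.
Hypothesis not_horizontal : forall i, (i < n)%N -> (V i.+1 - V i).2 <> 0.
Hypothesis H : half_lift n V g.

Local Notation point := (nat * nat)%type.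
Implicit Types x y z : point.

(* The point [(i, j)], where [j = i.+1] or [i = j.+1], is the place at which the edge
   between the vertices [i] and [j] leaves a small disc around [V i]. *)
Definition sta (i : nat) : point := (i, i.+1).
Definition stb (i : nat) : point := (i.+1, i).
Definition opp_pt x : point := (x.2, x.1).
Definition vcol i : nat := index (V i) [seq V k | k <- iota 0 n.+1].
Definition disc_of x : nat := vcol x.1.
Definition dart_of x : nat := choice.pickle (vcol x.1, vcol x.2).
Definition dir_of x := V x.2 - V x.1.
Definition plt x y := (x.1 < y.1)%N || ((x.1 == y.1) && (x.2 < y.2)%N).
(** For [x] before [y] at one vertex. If [V x.2] differs from [V y.2], passing through the pair
    [(x.2, y.2)] turns the two bits into the slits of [ang]. That pair no longer occurs in the
    formula, which therefore also compares two strands in the same dart, where no direction is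
    available. *)
Definition blt x y := up (dir_of y) (+) g x.2 y.1 (+) g x.1 y.2.
Definition turn_lt x y := if plt x y then blt x y else ~~ blt y x.

Let P := pt n sta stb.

Definition adj x := [/\ (x.1 <= n)%N, (x.2 <= n)%N & x.2 = x.1.+1 \/ x.1 = x.2.+1].

Lemma ptP x : P x <-> adj x.
Proof.
split; first by case=> i hi [] ->; split=> /=; try lia.
case: x => i j [/= h1 h2 [e|e]]; subst.
  by exists i; [lia|left].
by exists j; [lia|right].
Qed.

Lemma vcolP i j : (i <= n)%N -> (j <= n)%N -> vcol i = vcol j <-> V i = V j.
Proof.
move=> hi hj; split=> [|e]; last by rewrite /vcol e.
have mem k : (k <= n)%N -> V k \in [seq V k | k <- iota 0 n.+1].
  by move=> hk; apply/mapP; exists k => //; rewrite mem_iota; lia.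
by move=> e; rewrite -(nth_index 0 (mem i hi)) -(nth_index 0 (mem j hj)) -/(vcol i) e.
Qed.

Lemma discP x y : adj x -> adj y -> disc_of x = disc_of y <-> V x.1 = V y.1.
Proof. by case=> h _ _ [h' _ _]; apply: vcolP. Qed.

Lemma dartP x y : adj x -> adj y ->
  dart_of x = dart_of y <-> V x.1 = V y.1 /\ V x.2 = V y.2.
Proof.
case=> h1 h2 _ [h3 h4 _]; split.
  by move/(pcan_inj choice.pickleK) => -[/(vcolP h1 h3) ? /(vcolP h2 h4) ?].
by move=> [/(vcolP h1 h3) e1 /(vcolP h2 h4) e2]; rewrite /dart_of e1 e2.
Qed.

Lemma adj_neq x : adj x -> V x.1 <> V x.2.
Proof.
case: x => i j [/= h1 h2 [e|e]]; subst; first by apply: stall_free; lia.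
by apply: nesym; apply: stall_free; lia.
Qed.

Lemma adj_dir x : adj x -> (dir_of x).2 <> 0.
Proof.
case: x => i j [/= h1 h2 [e|e]]; subst; rewrite /dir_of.
  by apply: not_horizontal; lia.
move=> /= e; have : (j < n)%N by lia.
by move/not_horizontal; apply => /=; rewrite -[LHS]opprK opprB e oppr0.
Qed.

Lemma adj_opp x : adj x -> adj (opp_pt x).
Proof. by case: x => i j [/= h1 h2 h3]; split=> //=; case: h3; auto. Qed.

Lemma adj_vertex x k : adj x -> (k <= n)%N -> seg (V x.1) (V x.2) (V k) ->
  V k = V x.1 \/ V k = V x.2.
Proof.
case: x => i j [/= h1 h2 [e|e]] hk; subst; first by apply: walk_vertex.
by rewrite segC => /walk_vertex -[]; auto.
Qed.

Lemma lift_right x k : adj x -> (k < x.1)%N -> (k < x.2)%N ->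
  V k <> V x.1 -> V k <> V x.2 ->
  g k x.1 (+) g k x.2 = slit (V k - V x.1) (V k - V x.2).
Proof.
move=> ax h1 h2 n1 n2.
have nS : ~ seg (V x.1) (V x.2) (V k).
  have hk : (k <= n)%N by have [h _ _] := ax; lia.
  by move/(adj_vertex ax hk) => [].
case: x ax h1 h2 n1 n2 nS => i j [/= h3 h4 [e|e]] h1 h2 n1 n2 nS; subst.
  by apply: (proj1 H) nS; lia.
by rewrite addbC slitC; apply: (proj1 H); [lia|rewrite segC].
Qed.

Lemma lift_left x k : adj x -> (x.1 < k)%N -> (x.2 < k)%N -> (k <= n)%N ->
  V k <> V x.1 -> V k <> V x.2 ->
  g x.1 k (+) g x.2 k = slit (V x.1 - V k) (V x.2 - V k).
Proof.
move=> ax h1 h2 hk n1 n2.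
have nS : ~ seg (V x.1) (V x.2) (V k).
  by move/(adj_vertex ax hk) => [].
case: x ax h1 h2 n1 n2 nS => i j [/= h3 h4 [e|e]] h1 h2 n1 n2 nS; subst.
  by apply: (proj2 H) nS; lia.
by rewrite addbC slitC; apply: (proj2 H); [lia|rewrite segC].
Qed.

Lemma dir_det x y : adj x -> adj y -> V x.1 = V y.1 -> V x.2 <> V y.2 ->
  up (dir_of x) = up (dir_of y) -> det2 (dir_of x) (dir_of y) <> 0.
Proof.
have key u w (c : R) : adj u -> adj w -> V u.1 = V w.1 -> V u.2 <> V w.2 ->
    0 < c <= 1 -> dir_of u = c *: dir_of w -> False.
  move=> au aw e1 e2 hc ed.
  have : seg (V w.1) (V w.2) (V u.2).
    exists c; first by rewrite /unit_arc /= in_itv /=; lra.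
    have -> : V u.2 = V u.1 + dir_of u by rewrite /dir_of addrC subrK.
    by rewrite ed e1 /dir_of scalerBl scale1r scalerBr addrAC addrA.
  have [_ hu _] := au.
  move/(adj_vertex aw hu) => [e|//].
  by apply: (adj_neq au); rewrite e1 e.
move=> ax ay e1 e2 eu d0.
have nx := adj_dir ax; have ny := adj_dir ay.
pose c := (dir_of x).2 / (dir_of y).2.
have ed : dir_of x = c *: dir_of y.
  move: d0; rewrite /det2 => /eqP; rewrite subr_eq0 => /eqP d0.
  rewrite /c; case: (dir_of x) (dir_of y) nx ny d0 => a b [a' b'] /= nx ny d0.
  rewrite scale_pairE /=; have /eqP nb := ny.
  by congr (_, _); [apply: (mulIf nb); rewrite d0; field|field].
have cp : 0 < c.
  have ux (z : R * R) : z.2 <> 0 -> up z = (0 < z.2).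
    by move=> h; rewrite /up (introF eqP h) /= orbF.
  move: eu; rewrite !ux // /c => eu.
  case: (ltgtP 0 (dir_of y).2) eu => h eu; [by rewrite divr_gt0| |by case: ny].
  have h' : (dir_of x).2 < 0.
    by move: eu; case: (ltgtP 0 (dir_of x).2) => // e _; case: nx.
  by rewrite -mulrNN -invrN divr_gt0 // oppr_gt0.
have [hc|hc] := lerP c 1.
  have c01 : 0 < c <= 1 by rewrite cp hc.
  exact: (key x y c ax ay e1 e2 c01 ed).
have c01 : 0 < c^-1 <= 1 by rewrite invr_gt0 cp /= invf_le1 // ltW.
apply: (key y x c^-1 ay ax (esym e1) (nesym e2) c01).
by rewrite ed scalerA mulVf ?scale1r // gt_eqF.
Qed.

(** Ends of an edge have different images, so two points at one vertex are far enough apart in time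
    for the sides used by [lift_right] and [lift_left] to lie above the diagonal. *)
Lemma plt_order x y : adj x -> adj y -> V x.1 = V y.1 -> V x.2 <> V y.2 -> plt x y ->
  [/\ (x.2 < y.1)%N, (x.1 < y.2)%N & (x.2 < y.2)%N].
Proof.
move=> ax ay e1 e2 h; have nx := adj_neq ax; have ny := adj_neq ay.
have [hx1 hx2 hx3] := ax; have [hy1 hy2 hy3] := ay.
have m1 : x.2 <> y.1 by move=> e; apply: nx; rewrite e.
have m2 : x.1 <> y.2 by move=> e; apply: ny; rewrite -e.
have m3 : x.2 <> y.2 by move=> e; apply: e2; rewrite e.
by move: h; rewrite /plt; clear -m1 m2 m3 hx3 hy3; split; lia.
Qed.

Lemma plt_opp x y : adj x -> adj y -> V x.1 = V y.1 -> plt x y ->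
  plt (opp_pt x) (opp_pt y).
Proof.
move=> ax ay e1 h; have nx := adj_neq ax; have ny := adj_neq ay.
have [hx1 hx2 hx3] := ax; have [hy1 hy2 hy3] := ay.
have m1 : x.2 <> y.1 by move=> e; apply: nx; rewrite e.
have m2 : x.1 <> y.2 by move=> e; apply: ny; rewrite -e.
by move: h; rewrite /plt /=; clear -m1 m2 hx3 hy3; lia.
Qed.

Lemma blt_ang x y : adj x -> adj y -> V x.1 = V y.1 -> V x.2 <> V y.2 -> plt x y ->
  blt x y = (stereo (dir_of x) < stereo (dir_of y)).
Proof.
move=> ax ay e1 e2 h; have nx := adj_neq ax; have ny := adj_neq ay.
have [h1 h2 h3] := plt_order ax ay e1 e2 h.
have [hx1 hx2 _] := ax; have [hy1 hy2 _] := ay.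
rewrite stereo_lt; [|exact: adj_dir|exact: adj_dir|exact: dir_det].
rewrite /ang /blt.
have := @lift_right y x.2 ay h1 h3; have := @lift_left x y.2 ax h2 h3 hy2.
have -> : dir_of x - dir_of y = V x.2 - V y.2.
  by rewrite /dir_of e1 opprB addrA subrK.
have -> : - dir_of y = V x.1 - V y.2 by rewrite /dir_of opprB e1.
have -> : dir_of x = V x.2 - V y.1 by rewrite /dir_of e1.
rewrite (slitC (V x.2 - V y.2)) => <-; try congruence.
move=> <-; try congruence.
by case: (up _); case: (g x.1 y.2); case: (g x.2 y.2); case: (g x.2 y.1).
Qed.

Lemma plt_total x y : x <> y -> plt x y = ~~ plt y x.
Proof.
case: x y => i j [k l] ne; rewrite /plt /=.
have : i <> k \/ j <> l by case: (eqVneq i k) ne => [->|/eqP]; [case: (eqVneq j l) => [->|/eqP]|]; auto.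
by clear; lia.
Qed.

Lemma turn_lt_anti x y : x <> y -> turn_lt x y = ~~ turn_lt y x.
Proof. by move=> ne; rewrite /turn_lt (plt_total ne); case: (plt y x); rewrite ?negbK. Qed.

Lemma turn_lt_ang x y : adj x -> adj y -> V x.1 = V y.1 -> V x.2 <> V y.2 ->
  turn_lt x y = (stereo (dir_of x) < stereo (dir_of y)).
Proof.
move=> ax ay e1 e2; have ne : x <> y by move=> e; apply: e2; rewrite e.
rewrite /turn_lt; case: ifP => h; first exact: blt_ang.
rewrite blt_ang //; try congruence; last by rewrite plt_total ?h //; congruence.
rewrite -leNgt le_eqVlt; case: eqP => // e.
have := stereo_lt (adj_dir ax) (adj_dir ay) (@dir_det x y ax ay e1 e2).
have := stereo_lt (adj_dir ay) (adj_dir ax).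
have e21 : V y.2 <> V x.2 by congruence.
move=> /(_ (@dir_det y x ay ax (esym e1) e21)).
rewrite e !ltxx !angE; try exact: adj_dir; try exact: dir_det.
have D := @dir_det x y ax ay e1 e2.
move: D; case: (up (dir_of x)); case: (up (dir_of y)) => //= D.
- have -> : det2 (dir_of y) (dir_of x) = - det2 (dir_of x) (dir_of y) by rewrite /det2; ring.
  by have := D erefl; rewrite oppr_gt0; case: ltgtP.
- have -> : det2 (dir_of y) (dir_of x) = - det2 (dir_of x) (dir_of y) by rewrite /det2; ring.
  by have := D erefl; rewrite oppr_gt0; case: ltgtP.
Qed.

Lemma walk_system : strand_system n sta stb opp_pt disc_of dart_of turn_lt.
Proof.
split.
- by move=> i j _ _ [].
- by move=> i j _ _ [].
- by move=> i j _ _ [e1 e2]; lia.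
- by [].
- by [].
- by move=> x y /ptP ax /ptP ay /(dartP ax ay)[? _]; apply/discP.
- move=> x y /ptP ax /ptP ay /(dartP ax ay)[? ?].
  by apply/dartP; [exact: adj_opp|exact: adj_opp|].
- move=> x /ptP ax /(dartP ax (adj_opp ax))[/= e _].
  exact: (adj_neq ax).
- by [].
- by move=> x y _ _; apply: turn_lt_anti.
- move=> x x1 y /ptP ax /ptP ax1 /ptP ay /(discP ax ay) e1 nd /(dartP ax ax1)[e2 e3].
  have n1 : V x.2 <> V y.2 by move=> e; apply: nd; apply/dartP.
  rewrite (turn_lt_ang ax ay) // (turn_lt_ang ax1 ay) -?e2 -?e3 //.
  by rewrite /dir_of e2 e3.
- move=> x y z /ptP ax /ptP ay /ptP az /(discP ax ay) e1 /(discP ay az) e2 n1 n2 n3.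
  have m1 : V x.2 <> V y.2 by move=> e; apply: n1; apply/dartP.
  have m2 : V y.2 <> V z.2 by move=> e; apply: n2; apply/dartP.
  have m3 : V x.2 <> V z.2 by move=> e; apply: n3; apply/dartP; rewrite ?e1 ?e2.
  rewrite (turn_lt_ang ax ay) // (turn_lt_ang ay az) // (turn_lt_ang ax az) ?e1 ?e2 //.
  exact: lt_trans.
- move=> x y /ptP ax /ptP ay ne /(dartP ax ay)[e1 e2].
  wlog h : x y ax ay ne e1 e2 / plt x y.
    move=> hw; case h : (plt x y); first exact: hw.
    have ne' : opp_pt x <> opp_pt y.
      by move=> [? ?]; apply: ne; rewrite (surjective_pairing x) (surjective_pairing y); congr (_, _).
    rewrite turn_lt_anti // (turn_lt_anti ne) hw //; try congruence.
    by rewrite plt_total ?h //; congruence.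
  have h' := plt_opp ax ay e1 h.
  rewrite /turn_lt h h' /blt /=.
  (* Passing to the other mouth exchanges the two bits and reverses the direction, so only the term
     [up] changes. *)
  have -> : dir_of (opp_pt y) = - dir_of y by rewrite /dir_of opprB.
  rewrite upN; last by move=> e; apply: (adj_dir ay); rewrite e.
  by case: (up _); case: (g _ _); case: (g _ _).
- move=> i j hi hj ij /discP vE.
  have {}vE : V i.+1 = V j.+1.
    by apply: vE; apply/ptP; [exists i; [lia|right]|exists j; [lia|right]].
  rewrite /cross.
  wlog h : i j hi hj ij vE / (i < j)%N.
    move=> hw; case: (ltngtP i j) => // h; first exact: hw.
    have := hw j i hj hi (nesym ij) (esym vE) h.
    rewrite (@turn_lt_anti (stb i) (stb j)) ?(@turn_lt_anti (stb i) (sta j.+1)) ?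
      (@turn_lt_anti (sta i.+1) (stb j)) ?(@turn_lt_anti (sta i.+1) (sta j.+1)).
    + by case: (turn_lt _ _); case: (turn_lt _ _); case: (turn_lt _ _); case: (turn_lt _ _).
    + by move=> [e]; lia.
    + by move=> [e]; lia.
    + by move=> [e]; lia.
    + by move=> [e]; lia.
  (* With both vertices fixed, each summand of [blt] depends on one of the two points only, and so
     occurs twice in the sum of four. *)
  rewrite /turn_lt /plt /= !ltnS h /= /blt /= /dir_of /=.
  case: (g _ _); case: (g _ _); case: (g _ _); case: (g _ _); case: (up _);
    by case: (up _).
Qed.

End Points.
End Walks.

(** * Piecewise linear paths *)

Section Norm.
Context {R : realType}.
Implicit Types (p q w : R * R).

Lemma unit_arcP (t : R) : unit_arc t <-> 0 <= t <= 1.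
Proof. by rewrite /unit_arc /= in_itv. Qed.

Lemma enorm0 : enorm (0 : R * R) = 0.
Proof. by rewrite /enorm /= expr0n /= addr0 sqrtr0. Qed.

Lemma enormZ (k : R) w : enorm (k *: w) = `|k| * enorm w.
Proof.
rewrite /enorm /= !exprMn -mulrDr sqrtrM ?sqr_ge0 //.
by rewrite sqrtr_sqr.
Qed.

Lemma enormN w : enorm (- w) = enorm w.
Proof. by rewrite /enorm /= !sqrrN. Qed.

Lemma enormB p q : enorm (p - q) = enorm (q - p).
Proof. by rewrite -enormN opprB. Qed.

Lemma enorm_le w (k : R) : 0 <= k -> (enorm w <= k) = (w.1 ^+ 2 + w.2 ^+ 2 <= k ^+ 2).
Proof.
by move=> k0; rewrite -sqr_enorm ler_pXn2r // ?nnegrE ?enorm_ge0.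
Qed.

Lemma enormD p q : enorm (p + q) <= enorm p + enorm q.
Proof.
have hp := enorm_ge0 p; have hq := enorm_ge0 q.
rewrite enorm_le ?addr_ge0 //= [X in _ <= X]sqrrD !sqr_enorm.
have : p.1 * q.1 + p.2 * q.2 <= enorm p * enorm q.
  case: (lerP (p.1 * q.1 + p.2 * q.2) 0) => h; first by rewrite (le_trans h) // mulr_ge0.
  rewrite -ler_sqr ?nnegrE ?mulr_ge0 ?(ltW h) // [X in _ <= X]exprMn !sqr_enorm.
  have := sqr_ge0 (p.1 * q.2 - p.2 * q.1); nra.
move: (enorm p * enorm q) => m; rewrite -mulr_natl; nra.
Qed.

Lemma enormDB p q w : enorm (p - w) <= enorm (p - q) + enorm (q - w).
Proof. by have := enormD (p - q) (q - w); rewrite addrA subrK. Qed.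

Lemma enorm_conv (t : R) p q : 0 <= t <= 1 ->
  enorm ((1 - t) *: p + t *: q) <= (1 - t) * enorm p + t * enorm q.
Proof.
move=> /andP[h1 h2]; apply: le_trans (enormD _ _) _; rewrite !enormZ !ger0_norm //; lra.
Qed.

Lemma enorm_conv_lt (t e : R) p q : 0 <= t <= 1 -> enorm p < e -> enorm q < e ->
  enorm ((1 - t) *: p + t *: q) < e.
Proof.
move=> h hp hq; apply: le_lt_trans (enorm_conv _ _ h) _.
move: h => /andP[]; rewrite le_eqVlt => /orP[/eqP <- _|h1 h2].
  by rewrite subr0 mul1r mul0r addr0.
have a1 : (1 - t) * enorm p <= (1 - t) * e by rewrite ler_wpM2l ?subr_ge0 // ltW.
have a2 : t * enorm q < t * e by rewrite ltr_pM2l.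
lra.
Qed.

Lemma enorm_conv_le (t e : R) p q : 0 <= t <= 1 -> enorm p <= e -> enorm q <= e ->
  enorm ((1 - t) *: p + t *: q) <= e.
Proof.
move=> h hp hq; apply: le_trans (enorm_conv _ _ h) _.
move: h => /andP[h1 h2].
have a1 : (1 - t) * enorm p <= (1 - t) * e by rewrite ler_wpM2l ?subr_ge0.
have a2 : t * enorm q <= t * e by rewrite ler_wpM2l.
lra.
Qed.

Lemma continuous_fst (U V : topologicalType) : continuous (@fst U V).
Proof. by move=> [x y]; exact: cvg_fst. Qed.
Lemma continuous_snd (U V : topologicalType) : continuous (@snd U V).
Proof. by move=> [x y]; exact: cvg_snd. Qed.

Lemma continuous_pair (T U V : topologicalType) (f : T -> U) (g : T -> V) (x : T) :
  {for x, continuous f} -> {for x, continuous g} -> {for x, continuous (fun y => (f y, g y))}.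
Proof. by move=> cf cg; exact: cvg_pair. Qed.

Section Continuity.
Variables (T : topologicalType) (U : normedModType R).

Lemma contD (f g : T -> U) : continuous f -> continuous g -> continuous (fun x => f x + g x).
Proof. by move=> cf cg x; exact: (continuousD (cf x) (cg x)). Qed.
Lemma contB (f g : T -> U) : continuous f -> continuous g -> continuous (fun x => f x - g x).
Proof. by move=> cf cg x; exact: (continuousB (cf x) (cg x)). Qed.
Lemma contZ (f : T -> R) (g : T -> U) : continuous f -> continuous g ->
  continuous (fun x => f x *: g x).
Proof. by move=> cf cg x; exact: (continuousZ (cf x) (cg x)). Qed.
Lemma contM (f g : T -> R) : continuous f -> continuous g -> continuous (fun x => f x * g x).
Proof. by move=> cf cg x; exact: (continuousM (cf x) (cg x)). Qed.
Lemma cont_cst (V : topologicalType) (p : V) : continuous (fun _ : T => p).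
Proof. by move=> x; exact: cst_continuous. Qed.
Lemma cont_id : continuous (fun x : T => x).
Proof. by move=> x; exact: cvg_id. Qed.
Lemma cont_comp (V W : topologicalType) (g : V -> W) (f : T -> V) :
  continuous g -> continuous f -> continuous (fun x => g (f x)).
Proof. by move=> cg cf x; apply: (@continuous_comp _ _ _ f g); [exact: cf|exact: cg]. Qed.
Lemma cont_pair (V W : topologicalType) (g : T -> W) (f : T -> V) :
  continuous f -> continuous g -> continuous (fun x => (f x, g x)).
Proof. by move=> cf cg x; apply: continuous_pair; [exact: cf|exact: cg]. Qed.
End Continuity.

Lemma continuous_enorm : continuous (@enorm R).
Proof.
move=> w; rewrite /enorm.
apply: (@continuous_comp _ _ _ (fun w : R * R => w.1 ^+ 2 + w.2 ^+ 2) (@Num.sqrt R));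
  last exact: sqrt_continuous.
apply: (@continuousD _ _ _ (fun w : R * R => w.1 ^+ 2)).
  apply: (@continuous_comp _ _ _ (@fst R R) (fun x : R => x ^+ 2)).
    exact: continuous_fst.
  exact: exprn_continuous.
apply: (@continuous_comp _ _ _ (@snd R R) (fun x : R => x ^+ 2)).
  exact: continuous_snd.
exact: exprn_continuous.
Qed.

Lemma compact_enorm_min (T : topologicalType) (A : set T) (f : T -> R * R) :
  compact A -> continuous f -> (forall x, A x -> f x <> 0) ->
  exists2 m : R, 0 < m & forall x, A x -> m <= enorm (f x).
Proof.
move=> cA cf n0; have [->|A0] := eqVneq A set0; first by exists 1.
have ce : {within A, continuous (fun x => enorm (f x))}.
  apply: continuous_subspaceT => x; apply: continuous_comp; [exact: cf|exact: continuous_enorm].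
have [|c cin hc] := compact_EVT_min _ cA ce; first exact/set0P.
exists (enorm (f c)); first by apply: enorm_gt0; apply: n0; rewrite inE in cin.
by move=> x Ax; apply: hc; rewrite inE.
Qed.

End Norm.

(** * Conditions valid for all small positive reals *)

Section Small.
Context {R : realType}.

(** Finitely many conditions of this kind hold jointly; radii, heights, time steps and perturbations
    are all chosen in this way. *)
Definition small (P : R -> Prop) := exists2 e : R, 0 < e & forall r, 0 < r <= e -> P r.

Lemma small_and (P Q : R -> Prop) : small P -> small Q -> small (fun r => P r /\ Q r).
Proof.
move=> [e e0 h] [e' e0' h']; exists (Num.min e e'); first by rewrite lt_min e0.
by move=> r; rewrite le_min => /andP[r0 /andP[? ?]]; split; [apply: h|apply: h']; rewrite r0.
Qed.

Lemma small_sub (P Q : R -> Prop) : (forall r, 0 < r -> P r -> Q r) -> small P -> small Q.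
Proof. by move=> h [e e0 hP]; exists e => // r /[dup] /andP[r0 _] /hP; apply: h. Qed.

Lemma small_all (P : nat -> R -> Prop) n : (forall i, (i < n)%N -> small (P i)) ->
  small (fun r => forall i, (i < n)%N -> P i r).
Proof.
elim: n => [|n IH] h; first by exists 1.
apply: small_sub (small_and (IH _) (h n (ltnSn n))).
  by move=> r _ [h1 h2] i; rewrite ltnS leq_eqVlt => /orP[/eqP ->|/h1].
by move=> i hi; apply: h; exact: ltnW.
Qed.

Lemma small_lt (e : R) : 0 < e -> small (fun r => r < e).
Proof. by move=> e0; exists (e / 2); [lra|move=> r; lra]. Qed.

Lemma small_const (P : Prop) : P -> small (fun=> P).
Proof. by move=> p; exists 1. Qed.

Lemma small_imp (P : Prop) (Q : R -> Prop) : (P -> small Q) -> small (fun r => P -> Q r).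
Proof.
move=> h; have [p|np] := pselect P; last by exists 1.
by apply: small_sub (h p).
Qed.

Lemma small_affine (a b : R) : 0 < a -> small (fun r => 0 < a + r * b).
Proof.
move=> a0; exists (a / (2 * (`|b| + 1))).
  by rewrite divr_gt0 // mulr_gt0 // ltr_wpDl.
move=> r /andP[r0]; rewrite ler_pdivlMr; last by rewrite mulr_gt0 // ltr_wpDl.
have := ler_norm (- b); rewrite normrN; move: (`|b|) => c; nra.
Qed.

Lemma small_ex (P : R -> Prop) : small P -> exists2 r, 0 < r & P r.
Proof. by move=> [e e0 h]; exists e => //; apply: h; rewrite e0 lexx. Qed.

End Small.

(** * Piecewise linear interpolation *)

Section Interpolation.
Context {R : realType}.

Definition clamp01 (x : R) : R := Num.max 0 (Num.min 1 x).

Lemma clamp01_ge0 x : 0 <= clamp01 x. Proof. by rewrite /clamp01 le_max lexx. Qed.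
Lemma clamp01_le1 x : clamp01 x <= 1.
Proof. by rewrite /clamp01 ge_max ler01 ge_min lexx. Qed.
Lemma clamp01_id x : 0 <= x <= 1 -> clamp01 x = x.
Proof. by move=> /andP[h1 h2]; rewrite /clamp01 min_r // max_r. Qed.
Lemma clamp01_0 x : x <= 0 -> clamp01 x = 0.
Proof. by move=> h; rewrite /clamp01 max_l // ge_min h orbT. Qed.
Lemma clamp01_1 x : 1 <= x -> clamp01 x = 1.
Proof. by move=> h; rewrite /clamp01 min_l // max_r. Qed.

Lemma clamp01_mono x y : x <= y -> clamp01 x <= clamp01 y.
Proof.
by move=> h; rewrite /clamp01 ge_max !le_max lexx /= le_min !ge_min lexx h !orbT.
Qed.

Lemma clamp01_lip x y : `|clamp01 x - clamp01 y| <= `|x - y|.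
Proof.
wlog h : x y / x <= y.
  by move=> hw; case: (leP x y) => [|/ltW] /hw //; rewrite distrC [X in _ <= X]distrC.
rewrite ler_distl; have := clamp01_mono h.
have -> : `|x - y| = y - x by rewrite distrC ger0_norm // subr_ge0.
rewrite /clamp01; case: (leP 1 x) => h1; case: (leP 1 y) => h2.
all: try case: (leP 0 x) => h3; try case: (leP 0 y) => h4.
all: rewrite ?(max_r ler01) => ?; apply/andP; split; try lra.
Qed.

Lemma continuous_clamp01 : continuous clamp01.
Proof.
move=> x; rewrite /clamp01; apply: continuous_max; first exact: cst_continuous.
by apply: continuous_min; [exact: cst_continuous|exact: cvg_id].
Qed.

(** As a sum of clamped ramps it is continuous on the whole line by its form. On [[z k, z k.+1]] the
    earlier terms telescope to [q k] and the later ones vanish. *)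
Definition plin (U : lmodType R) (z : nat -> R) (q : nat -> U) N (s : R) : U :=
  q 0%N + \sum_(k < N) clamp01 ((s - z k) / (z k.+1 - z k)) *: (q k.+1 - q k).

Lemma plin_continuous (U : normedModType R) z (q : nat -> U) N : continuous (plin z q N).
Proof.
elim: N => [|N IH] s.
  have -> : plin z q 0 = fun=> q 0%N by apply/funext => x; rewrite /plin big_ord0 addr0.
  exact: cst_continuous.
have -> : plin z q N.+1 = (fun s => plin z q N s +
    clamp01 ((s - z N) / (z N.+1 - z N)) *: (q N.+1 - q N)).
  by apply/funext => x; rewrite /plin big_ord_recr /= addrA.
apply: continuousD; first exact: IH.
apply: (@continuous_comp _ _ _ (fun s => clamp01 ((s - z N) / (z N.+1 - z N)))
  (fun k : R => k *: (q N.+1 - q N))); last exact: scalel_continuous.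
apply: (@continuous_comp _ _ _ (fun s => (s - z N) / (z N.+1 - z N)) clamp01);
  last exact: continuous_clamp01.
apply: continuousM; last exact: cst_continuous.
by apply: continuousB; [exact: cvg_id|exact: cst_continuous].
Qed.

Variables (z : nat -> R) (N : nat).
Hypothesis zmono : forall k, (k < N)%N -> z k < z k.+1.

Lemma z_le i j : (i <= j <= N)%N -> z i <= z j.
Proof.
move=> /andP[/subnK <-]; elim: (j - i)%N => // k IH h.
by apply: le_trans (IH _) (ltW (zmono _)); lia.
Qed.

Lemma z_lt i j : (i < j <= N)%N -> z i < z j.
Proof. by move=> h; apply: (@lt_le_trans _ _ (z i.+1)); [apply: zmono; lia|apply: z_le; lia]. Qed.

Lemma plinE (U : lmodType R) (q : nat -> U) k s : (k < N)%N -> z k <= s <= z k.+1 ->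
  plin z q N s = q k + ((s - z k) / (z k.+1 - z k)) *: (q k.+1 - q k).
Proof.
move=> hk /andP[h1 h2]; rewrite /plin.
have tele m : (m <= N)%N -> (m <= k)%N ->
    q 0%N + \sum_(i < m) clamp01 ((s - z i) / (z i.+1 - z i)) *: (q i.+1 - q i) = q m.
  elim: m => [|m IH] hm hmk; first by rewrite big_ord0 addr0.
  rewrite big_ord_recr /= addrA IH; try lia.
  rewrite clamp01_1 ?scale1r ?subrKC //.
  have ? : z m < z m.+1 by apply: zmono.
  rewrite ler_pdivlMr ?subr_gt0 // mul1r lerD2r.
  by apply: le_trans h1; apply: z_le; lia.
rewrite (bigID (fun i : 'I_N => (i < k)%N)) /= addrA.
have -> : q 0%N + \sum_(i < N | (i < k)%N) clamp01 ((s - z i) / (z i.+1 - z i)) *: (q i.+1 - q i)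
   = q k.
  rewrite -[RHS](tele k) //; last lia.
  by rewrite [in RHS](big_ord_widen N (fun i => clamp01 ((s - z i) / (z i.+1 - z i)) *: (q i.+1 - q i))) //; lia.
congr (_ + _); rewrite (bigD1 (Ordinal hk)) /=; last by rewrite ltnn.
have zk := zmono hk.
rewrite clamp01_id; last first.
  rewrite divr_ge0 ?subr_ge0 ?(ltW zk) //= ler_pdivrMr ?subr_gt0 // mul1r; lra.
rewrite big1 ?addr0 // => i /andP[hi /eqP ne].
have ki : (k < i)%N.
  by rewrite ltn_neqAle leqNgt hi andbT; apply/eqP => e; apply: ne; apply/val_inj.
rewrite clamp01_0 ?scale0r // mulr_le0_ge0 //.
  rewrite subr_le0; apply: le_trans h2 _; apply: z_le; have := ltn_ord i; lia.
by rewrite invr_ge0 subr_ge0 ltW // zmono.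
Qed.

Lemma plin_vertex (U : lmodType R) (q : nat -> U) k : (0 < N)%N -> (k <= N)%N -> plin z q N (z k) = q k.
Proof.
move=> N0 hk; case: (ltnP k N) => h.
  by rewrite (plinE _ h) ?subrr ?mul0r ?scale0r ?addr0 // lexx ltW // zmono.
have -> : k = N.-1.+1 by lia.
have hN : (N.-1 < N)%N by lia.
have zz := zmono hN.
rewrite (plinE _ hN) ?divff ?scale1r ?subrKC //; first by rewrite subr_eq0 gt_eqF.
by rewrite lexx ltW.
Qed.

Lemma locate s : (0 < N)%N -> z 0%N <= s <= z N -> exists2 k, (k < N)%N & z k <= s <= z k.+1.
Proof.
move=> N0 /andP[h0 hN].
have : exists k, (k < N)%N && (s <= z k.+1) by exists N.-1; rewrite prednK // leqnn.
move=> /ex_minnP[k /andP[hk hs] hmin]; exists k => //; rewrite hs andbT.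
case: k hk hs hmin => // k hk hs hmin; rewrite leNgt; apply/negP => h.
by have := hmin k; rewrite ltW // andbT => /(_ ltac:(lia)); lia.
Qed.

Lemma plin_seg (q : nat -> R * R) k s : (k < N)%N -> z k <= s <= z k.+1 ->
  seg (q k) (q k.+1) (plin z q N s).
Proof.
move=> hk hs; have zk := zmono hk; exists ((s - z k) / (z k.+1 - z k)).
  rewrite /unit_arc /= in_itv /= divr_ge0 ?subr_ge0 ?(ltW zk) //=; last by case/andP: hs.
  by rewrite ler_pdivrMr ?subr_gt0 // mul1r; case/andP: hs => _ ?; rewrite lerD2r.
by rewrite (plinE _ hk hs) scalerBr scalerBl scale1r addrA addrAC.
Qed.

Lemma plin_inj (q : nat -> R * R) : (0 < N)%N ->
  (forall k, (k < N)%N -> q k <> q k.+1) ->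
  (forall k l p, (k < l < N)%N -> seg (q k) (q k.+1) p -> seg (q l) (q l.+1) p ->
     l = k.+1 /\ p = q l) ->
  forall s t, z 0%N <= s <= z N -> z 0%N <= t <= z N -> plin z q N s = plin z q N t -> s = t.
Proof.
move=> N0 ne dis.
have inj1 k s t : (k < N)%N -> z k <= s <= z k.+1 -> z k <= t <= z k.+1 ->
    plin z q N s = plin z q N t -> s = t.
  move=> hk hs ht; rewrite (plinE _ hk hs) (plinE _ hk ht) => /addrI /eqP.
  rewrite -subr_eq0 -scalerBl scaler_eq0 => /orP[|]; last first.
    by rewrite subr_eq0 => /eqP /esym /(ne k hk).
  rewrite -mulrBl mulf_eq0 => /orP[/eqP h|]; first lra.
  by rewrite invr_eq0 subr_eq0 gt_eqF // zmono.
move=> s t hs ht e.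
have [k hk ks] := locate N0 hs; have [l hl lt] := locate N0 ht.
wlog kl : s t k l hs ht e hk ks hl lt / (k <= l)%N.
  move=> hw; case: (leqP k l) => h; first exact: (hw s t k l).
  by symmetry; exact: (hw t s l k ht hs (esym e) hl lt hk ks (ltnW h)).
move: kl; rewrite leq_eqVlt => /orP[/eqP ekl|kl].
  by subst l; apply: (inj1 k).
have klN : (k < l < N)%N by rewrite kl.
have sl : seg (q l) (q l.+1) (plin z q N s) by rewrite e; apply: plin_seg.
have [el ep] := dis k l _ klN (plin_seg q hk ks) sl.
have zl : z k <= z l <= z k.+1 by rewrite el lexx ltW // zmono.
have zl' : z l <= z l <= z l.+1 by rewrite lexx ltW // zmono.
have pl : plin z q N (z l) = q l by rewrite plin_vertex // ltnW.
have es : s = z l by apply: (inj1 k s (z l) hk ks zl); rewrite pl.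
have et : t = z l by apply: (inj1 l t (z l) hl lt zl'); rewrite pl -e.
by rewrite es et.
Qed.

End Interpolation.

(** * The circle in its rational parametrization, and chords *)

Section Circle.
Context {R : realType}.
Implicit Types (a b c d t r : R) (u w p : R * R).

Definition circ t : R * R := ((1 - t ^+ 2) / (1 + t ^+ 2), 2 * t / (1 + t ^+ 2)).
Definition cmul u w : R * R := (u.1 * w.1 - u.2 * w.2, u.1 * w.2 + u.2 * w.1).

Lemma plane_eq u w : u.1 = w.1 -> u.2 = w.2 -> u = w.
Proof. by case: u w => [x y] [x' y'] /= -> ->. Qed.

Ltac pair_ring := apply: plane_eq; rewrite ?scale_pairE /=; ring.

Lemma sq1_gt0 t : 0 < 1 + t ^+ 2. Proof. by rewrite ltr_pwDl // sqr_ge0. Qed.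
Lemma sq1_neq0 t : 1 + t ^+ 2 != 0. Proof. by rewrite gt_eqF // sq1_gt0. Qed.

Lemma enorm_sq1 w : w.1 ^+ 2 + w.2 ^+ 2 = 1 -> enorm w = 1.
Proof. by rewrite /enorm => ->; rewrite sqrtr1. Qed.

Lemma circ_sq t : (circ t).1 ^+ 2 + (circ t).2 ^+ 2 = 1.
Proof. by rewrite /circ /=; field; exact: sq1_neq0. Qed.

Lemma enorm_circ t : enorm (circ t) = 1.
Proof. by apply: enorm_sq1; exact: circ_sq. Qed.

Lemma cmul_circ a t : 1 - a * t != 0 -> cmul (circ a) (circ t) = circ ((a + t) / (1 - a * t)).
Proof.
move=> n; have na := sq1_neq0 a; have nt := sq1_neq0 t.
have n2 : 1 + ((a + t) / (1 - a * t)) ^+ 2 = (1 + a ^+ 2) * (1 + t ^+ 2) / (1 - a * t) ^+ 2.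
  by field.
by rewrite /cmul {3}/circ /circ /= n2; congr (_, _); field; rewrite ?na ?nt ?n.
Qed.

Lemma enorm_cmul u w : enorm (cmul u w) = enorm u * enorm w.
Proof.
rewrite /enorm /cmul /= -sqrtrM ?addr_ge0 ?sqr_ge0 //; congr Num.sqrt; ring.
Qed.

(** A Vandermonde product: the orientation of three points of the circle is that of their
    parameters. *)
Lemma circ_det a b c : det2 (circ b - circ a) (circ c - circ a) =
  4 * ((b - a) * (c - a) * (c - b)) / ((1 + a ^+ 2) * (1 + b ^+ 2) * (1 + c ^+ 2)).
Proof. by rewrite /det2 /circ /=; field; rewrite !sq1_neq0. Qed.

Lemma circ_inj a b : circ a = circ b -> a = b.
Proof.
move=> [e1 e2]; have na := sq1_neq0 a; have nb := sq1_neq0 b.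
have p (x : R) : 1 + (1 - x ^+ 2) / (1 + x ^+ 2) = 2 / (1 + x ^+ 2) by field; exact: sq1_neq0.
have q (x : R) : 2 * x / (1 + x ^+ 2) = x * (1 + (1 - x ^+ 2) / (1 + x ^+ 2)) by rewrite p; ring.
move: e2; rewrite !q e1 => /mulIf; apply.
by rewrite p mulf_neq0 ?invr_neq0 // pnatr_eq0.
Qed.

Lemma circ_pt_inj p r a b : 0 < r -> p + r *: circ a = p + r *: circ b -> a = b.
Proof.
by move=> r0 /addrI /eqP; rewrite -subr_eq0 -scalerBr scaler_eq0 gt_eqF //= subr_eq0 => /eqP /circ_inj.
Qed.

Lemma det_sign a b c d : a != c -> a != d -> b != c -> b != d ->
  (a < c) (+) (a < d) (+) (b < c) (+) (b < d) = false ->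
  0 < ((c - a) * (c - b)) * ((d - a) * (d - b)).
Proof.
have H (x y z : R) : x != z -> y != z -> if (x < z) (+) (y < z) then (z - x) * (z - y) < 0
    else 0 < (z - x) * (z - y).
  case: (ltgtP x z) => // h1; case: (ltgtP y z) => // h2 _ _ /=; nra.
move=> n1 n2 n3 n4 h; have := H a b c n1 n3; have := H a b d n2 n4.
have <- : (a < c) (+) (b < c) = (a < d) (+) (b < d).
  by move: h; case: (a < c); case: (a < d); case: (b < c); case: (b < d).
by case: ifP => _ h1 h2; [rewrite nmulr_rgt0|rewrite mulr_gt0].
Qed.

Lemma conv_gt0 t a b : 0 <= t -> t <= 1 -> 0 < a -> 0 < b -> (1 - t) * a + t * b <> 0.
Proof.
move=> t0 t1 a0 b0 e; have h1 : 0 <= t * b by rewrite mulr_ge0 // ltW.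
have h2 : 0 <= (1 - t) * a by rewrite mulr_ge0 ?subr_ge0 // ltW.
have /eqP : t * b = 0 by lra.
rewrite mulf_eq0 [b == 0]gt_eqF // orbF => /eqP t00; move: e; rewrite t00; lra.
Qed.

(** The affine function that vanishes on the line of the first chord has, by [circ_det] and
    [det_sign], the same nonzero sign at both ends of the second. *)
Lemma chords_disjoint o r a b c d p : 0 < r -> a != b ->
  a != c -> a != d -> b != c -> b != d ->
  (a < c) (+) (a < d) (+) (b < c) (+) (b < d) = false ->
  seg (o + r *: circ a) (o + r *: circ b) p ->
  seg (o + r *: circ c) (o + r *: circ d) p -> False.
Proof.
move=> r0 nab n1 n2 n3 n4 h [s hs <-] [t ht e].
have P := det_sign n1 n2 n3 n4 h.
have D := circ_det a b.
have l1 : det2 (circ b - circ a) ((1 - s) *: (o + r *: circ a) + s *: (o + r *: circ b)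
    - (o + r *: circ a)) = 0.
  by clear; case: (circ a) (circ b) o => x y [x' y'] [z w]; rewrite /det2 !scale_pairE /=; ring.
have l2 : det2 (circ b - circ a) ((1 - t) *: (o + r *: circ c) + t *: (o + r *: circ d)
    - (o + r *: circ a)) = r * ((1 - t) * det2 (circ b - circ a) (circ c - circ a) +
      t * det2 (circ b - circ a) (circ d - circ a)).
  by clear; case: (circ a) (circ b) (circ c) (circ d) o => x y [x' y'] [z w] [z' w'] [? ?];
     rewrite /det2 !scale_pairE /=; ring.
rewrite -e l2 !D in l1; move: ht; rewrite /unit_arc /= in_itv /= => /andP[t0 t1].
move: l1; set A := 1 + a ^+ 2; set B := 1 + b ^+ 2.
have E : (1 - t) * (4 * ((b - a) * (c - a) * (c - b)) / (A * B * (1 + c ^+ 2))) +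
     t * (4 * ((b - a) * (d - a) * (d - b)) / (A * B * (1 + d ^+ 2)))
  = (4 * (b - a) / (A * B)) * ((1 - t) * ((c - a) * (c - b)) / (1 + c ^+ 2)
     + t * ((d - a) * (d - b)) / (1 + d ^+ 2)).
  by field; rewrite !sq1_neq0.
have nba : b - a != 0 by rewrite subr_eq0 eq_sym.
have nr : r != 0 by rewrite gt_eqF.
have n4' : (4 : R) != 0 by rewrite pnatr_eq0.
have nz : r * (4 * (b - a) / (A * B)) != 0.
  by do ?[exact: nba|exact: nr|exact: n4'|exact: sq1_neq0|apply: mulf_neq0|apply: invr_neq0].
rewrite E mulrA => /eqP; rewrite mulf_eq0 (negbTE nz) /= => /eqP.
set X := (c - a) * (c - b); set Y := (d - a) * (d - b); rewrite -/X -/Y in P.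
have c1 := sq1_gt0 c; have d1 := sq1_gt0 d.
have ic : 0 < (1 + c ^+ 2)^-1 by rewrite invr_gt0.
have id : 0 < (1 + d ^+ 2)^-1 by rewrite invr_gt0.
set m := (1 + c ^+ 2)^-1 in ic *; set k := (1 + d ^+ 2)^-1 in id *.
rewrite -(mulrA (1 - t) X m) -(mulrA t Y k).
case: (ltP 0 X) => hX.
  have hY : 0 < Y by rewrite -(pmulr_rgt0 _ hX).
  have x1 : 0 < X * m by rewrite mulr_gt0.
  have x2 : 0 < Y * k by rewrite mulr_gt0.
  exact: (conv_gt0 t0 t1 x1 x2).
have hX' : X < 0 by rewrite lt_neqAle hX andbT; apply/eqP => e0; rewrite e0 mul0r ltxx in P.
have hY : Y < 0 by rewrite -(nmulr_rgt0 _ hX').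
have x1 : X * m < 0 by rewrite pmulr_llt0.
have x2 : Y * k < 0 by rewrite pmulr_llt0.
rewrite -oppr_gt0 in x1; rewrite -oppr_gt0 in x2.
move=> e0; apply: (conv_gt0 t0 t1 x1 x2).
by rewrite !mulrN -opprD e0 oppr0.
Qed.

Lemma chord_in o r a b p : 0 < r -> seg (o + r *: circ a) (o + r *: circ b) p ->
  enorm (p - o) <= r.
Proof.
move=> r0 [s]; rewrite /unit_arc /= in_itv /= => hs <-.
have -> : (1 - s) *: (o + r *: circ a) + s *: (o + r *: circ b) - o =
    (1 - s) *: (r *: circ a) + s *: (r *: circ b).
  by pair_ring.
apply: (enorm_conv_le hs); by rewrite enormZ enorm_circ mulr1 ger0_norm // ltW.
Qed.

(** Strict convexity: the squared norm of a convex combination of two unit vectors falls short of 1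
    by [(1 - s) s] times their squared distance. *)
Lemma chord_end o r a b p : 0 < r -> a != b ->
  seg (o + r *: circ a) (o + r *: circ b) p -> r <= enorm (p - o) ->
  p = o + r *: circ a \/ p = o + r *: circ b.
Proof.
move=> r0 nab [s]; rewrite /unit_arc /= in_itv /= => /andP[s0 s1] <-.
have -> : (1 - s) *: (o + r *: circ a) + s *: (o + r *: circ b) - o =
    r *: ((1 - s) *: circ a + s *: circ b).
  by pair_ring.
rewrite enormZ gtr0_norm // -[X in X <= _]mulr1 ler_pM2l // => h.
have h2 : 1 <= enorm ((1 - s) *: circ a + s *: circ b) ^+ 2 by rewrite exprn_ege1.
have ca := circ_sq a; have cb := circ_sq b.
have D : (1 - s) * s * (((circ a).1 - (circ b).1) ^+ 2 + ((circ a).2 - (circ b).2) ^+ 2) <= 0.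
  move: h2 ca cb; rewrite sqr_enorm; clear.
  move: (circ a) (circ b) => [x y] [x' y']; rewrite !scale_pairE /= => h2 ca cb.
  have -> : (1 - s) * s * ((x - x') ^+ 2 + (y - y') ^+ 2) =
    (1 - s) * (x ^+ 2 + y ^+ 2) + s * (x' ^+ 2 + y' ^+ 2) -
    (((1 - s) * x + s * x') ^+ 2 + ((1 - s) * y + s * y') ^+ 2) by ring.
  rewrite ca cb; lra.
have Dp : 0 < ((circ a).1 - (circ b).1) ^+ 2 + ((circ a).2 - (circ b).2) ^+ 2.
  rewrite lt_neqAle addr_ge0 ?sqr_ge0 // andbT eq_sym paddr_eq0 ?sqr_ge0 // !sqrf_eq0 !subr_eq0.
  apply/negP => /andP[/eqP e1 /eqP e2]; move/eqP: nab; apply; apply: circ_inj.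
  by rewrite (surjective_pairing (circ a)) e1 e2 -surjective_pairing.
have : (1 - s) * s <= 0 by move: D; rewrite pmulr_lle0.
move=> h3; have : (1 - s) * s = 0 by apply/eqP; rewrite eq_le h3 mulr_ge0 // subr_ge0.
move=> /eqP; rewrite mulf_eq0 subr_eq0 => /orP[/eqP <-|/eqP ->].
  by right; rewrite subrr scale0r add0r scale1r.
by left; rewrite subr0 scale0r addr0 scale1r.
Qed.

End Circle.

(** * The embedding laid out along a planar order *)

Ltac pair_ring := apply: plane_eq; rewrite ?scale_pairE /=; ring.

Section Thicken.
Context {R : realType}.
Variables (n : nat) (V : nat -> R * R) (lt lt' : rel (nat * nat)).
Hypothesis W : plane_walk n V.
Hypothesis stall_free : forall i, (i < n)%N -> V i <> V i.+1.
Hypothesis not_horizontal : forall i, (i < n)%N -> (V i.+1 - V i).2 <> 0.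
Hypothesis L : planar_order n sta stb opp_pt (disc_of n V) (dart_of n V) lt lt'.
Hypothesis lt_ang : forall x y, adj n x -> adj n y -> V x.1 = V y.1 -> V x.2 <> V y.2 ->
  lt x y = (stereo (dir_of V x) < stereo (dir_of V y)).

Local Notation point := (nat * nat)%type.
Implicit Types x y z : point.
Local Notation adj := (adj n).
Local Notation dir := (dir_of V).
Local Notation dart := (dart_of n V).

Definition same_dart x y := [/\ V x.1 = V y.1 & V x.2 = V y.2].

Lemma same_dartP x y : adj x -> adj y -> reflect (same_dart x y) (dart x == dart y).
Proof.
by move=> ax ay; apply: (iffP eqP) => [/(dartP V ax ay)[]|[? ?]]; [|apply/dartP].
Qed.

Lemma opp_ptK x : opp_pt (opp_pt x) = x. Proof. by case: x. Qed.

(** [hgt x] is the number of points below [x] in its dart minus the number above. This symmetric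
    rank increases with the order and changes sign when the order is reversed, so the two ends of a
    strand get opposite heights. *)
Definition hterm y x : R :=
  if (dart y == dart x) && (y != x) then (lt' y x)%:R - (lt' x y)%:R else 0.
Definition hgt x : R := \sum_(i < n) (hterm (sta i) x + hterm (stb i) x).

Lemma hterm_opp y x : adj x -> adj y -> hterm (opp_pt y) (opp_pt x) = - hterm y x.
Proof.
move=> ax ay; have aox := adj_opp ax; have aoy := adj_opp ay; rewrite /hterm.
have -> : (dart (opp_pt y) == dart (opp_pt x)) = (dart y == dart x).
  by apply/(same_dartP aoy aox)/(same_dartP ay ax) => -[? ?]; split.
have -> : (opp_pt y != opp_pt x) = (y != x).
  by rewrite (inj_eq (can_inj opp_ptK)).
case: eqP => //= e; rewrite ?oppr0 //; case: eqP => //= ne; rewrite ?oppr0 //.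
have Py := (ptP n y).2 ay; have Px := (ptP n x).2 ax.
rewrite (po_pipe L Py Px ne e) (po_pipe L Px Py (nesym ne) (esym e)).
by rewrite (po_anti L Px Py (nesym ne)); case: (lt' y x) => /=; rewrite ?subr0 ?sub0r ?opprK.
Qed.

Lemma adj_sta i : (i < n)%N -> adj (sta i). Proof. by move=> h; split=> /=; auto; lia. Qed.
Lemma adj_stb i : (i < n)%N -> adj (stb i). Proof. by move=> h; split=> /=; auto; lia. Qed.

Lemma hgt_opp x : adj x -> hgt (opp_pt x) = - hgt x.
Proof.
move=> ax; rewrite /hgt -sumrN; apply: eq_bigr => i _; rewrite opprD addrC.
by rewrite -!hterm_opp //; [apply: adj_stb|apply: adj_sta].
Qed.

Lemma hgt_lt x y : adj x -> adj y -> x <> y -> same_dart x y -> lt' x y -> hgt x < hgt y.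
Proof.
move=> ax ay ne sd l; have /(same_dartP ax ay)/eqP de := sd.
have Px := (ptP n x).2 ax; have Py := (ptP n y).2 ay.
have le z : adj z -> hterm z x <= hterm z y.
  move=> az; have Pz := (ptP n z).2 az; rewrite /hterm de.
  case: eqP => //= dz; case: eqP => [->|zx]; case: eqP => [zy|zy] //=.
  - by rewrite l subr_ge0 ler_nat; case: (lt' y x).
  - by rewrite zy l subr_le0 ler_nat; case: (lt' y x).
  - rewrite (po_anti L Px Pz) ?(po_anti L Py Pz); try congruence.
    case zlx : (lt' z x) => /=; last by case: (lt' z y) => /=; lra.
    suff -> : lt' z y by [].
    apply: (po_trs L Pz Px Py) => //.
      by apply/(discP V az ax); have /(dartP V az ax)[] : dart z = dart x by congruence.
    by apply/(discP V ax ay); case: sd.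
have lts : hterm x x < hterm x y.
  rewrite /hterm de eqxx /= (introF eqP ne) eqxx l /= (po_anti L Py Px); last congruence.
  by rewrite l subr0 ltr01.
have [i hi ex] := Px.
rewrite /hgt (bigD1 (Ordinal hi)) //= [ltRHS](bigD1 (Ordinal hi)) //=.
apply: ltr_leD; last first.
  apply: ler_sum => j _; apply: lerD; apply: le; [exact: adj_sta|exact: adj_stb].
case: ex => ex; rewrite -ex.
  by apply: ltr_leD; [|apply: le; exact: adj_stb].
by apply: ler_ltD; [apply: le; exact: adj_sta|].
Qed.

Definition udir x : R * R := (enorm (dir x))^-1 *: dir x.
Definition tau (delta : R) x : R := delta * hgt x.
(** In complex notation, the point at distance [r] from the vertex in the direction of the edge,
    turned by an angle whose half has tangent [delta * hgt x]. [par] is the half-angle tangent of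
    the result, by the addition formula. *)
Definition loc (r delta : R) x : R * R := V x.1 + r *: cmul (udir x) (circ (tau delta x)).
Definition par (delta : R) x : R :=
  (stereo (dir x) + tau delta x) / (1 - stereo (dir x) * tau delta x).

Lemma dir_neq0 x : adj x -> dir x <> 0.
Proof. by move=> ax e; apply: (adj_dir not_horizontal ax); rewrite e. Qed.

Lemma len_gt0 x : adj x -> 0 < enorm (dir x).
Proof. by move=> ax; apply: enorm_gt0; apply: dir_neq0. Qed.

Lemma udir_circ x : adj x -> udir x = circ (stereo (dir x)).
Proof.
move=> ax; have [e2 e1] := stereoE (adj_dir not_horizontal ax).
have l0 : enorm (dir x) != 0 by rewrite gt_eqF // len_gt0.
apply: plane_eq.
  have -> : (udir x).1 = (enorm (dir x))^-1 * (dir x).1 by [].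
  by rewrite e1 mulKf.
have -> : (udir x).2 = (enorm (dir x))^-1 * (dir x).2 by [].
by rewrite e2 mulKf.
Qed.

Lemma udir_sq x : adj x -> (udir x).1 ^+ 2 + (udir x).2 ^+ 2 = 1.
Proof. by move=> ax; rewrite udir_circ // circ_sq. Qed.

Lemma dir_opp x : dir (opp_pt x) = - dir x.
Proof. by rewrite /dir_of opprB. Qed.

Lemma udir_opp x : udir (opp_pt x) = - udir x.
Proof. by rewrite /udir dir_opp enormN scalerN. Qed.

Lemma tau_opp delta x : adj x -> tau delta (opp_pt x) = - tau delta x.
Proof. by move=> ax; rewrite /tau hgt_opp // mulrN. Qed.

Lemma udir_same x y : same_dart x y -> udir x = udir y.
Proof. by case=> e1 e2; rewrite /udir /dir_of e1 e2. Qed.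

Lemma loc_dist r delta x : adj x -> 0 < r -> enorm (loc r delta x - V x.1) = r.
Proof.
move=> ax r0; rewrite /loc addrC addKr enormZ enorm_cmul enorm_circ udir_circ // enorm_circ.
by rewrite !mulr1 gtr0_norm.
Qed.

Lemma loc_par r delta x : adj x -> 1 - stereo (dir x) * tau delta x != 0 ->
  loc r delta x = V x.1 + r *: circ (par delta x).
Proof. by move=> ax h; rewrite /loc udir_circ // cmul_circ. Qed.

Definition along x (p : R * R) := dot2 (udir x) (p - V x.1).
Definition across x (p : R * R) := det2 (udir x) (p - V x.1).

Lemma dist_coord x p : adj x -> enorm (p - V x.1) ^+ 2 = along x p ^+ 2 + across x p ^+ 2.
Proof.
move=> ax; rewrite sqr_enorm /along /across /dot2 /det2.
have := udir_sq ax; move: (udir x) (p - V x.1) => [a b] [c d] /= e.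
have -> : (a * c + b * d) ^+ 2 + (a * d - b * c) ^+ 2 =
  (a ^+ 2 + b ^+ 2) * (c ^+ 2 + d ^+ 2) by ring.
by rewrite e mul1r.
Qed.

(** Opposite heights at its ends put a strand at a constant signed distance [across] from the edge:
    it is parallel to the edge. *)
Lemma strand_coord r delta x p : adj x -> seg (loc r delta x) (loc r delta (opp_pt x)) p ->
  exists2 s : R, 0 <= s <= 1 &
   [/\ p = (1 - s) *: loc r delta x + s *: loc r delta (opp_pt x),
       along x p = r * (circ (tau delta x)).1 + s * (enorm (dir x) - 2 * (r * (circ (tau delta x)).1))
     & across x p = r * (circ (tau delta x)).2].
Proof.
move=> ax [s /unit_arcP hs <-]; exists s => //.
have us := udir_sq ax.
have ed : dir x = enorm (dir x) *: udir x.
  by rewrite /udir scalerA divff ?scale1r // gt_eqF // len_gt0.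
have eV : V x.2 = V x.1 + enorm (dir x) *: udir x by rewrite -ed /dir_of addrC subrK.
have cN : circ (- tau delta x) = ((circ (tau delta x)).1, - (circ (tau delta x)).2).
  by rewrite /circ /= sqrrN mulrN mulNr.
have o1 : (opp_pt x).1 = x.2 by [].
rewrite /along /across /loc o1 udir_opp tau_opp // cN eV.
move: (enorm (dir x)) (circ (tau delta x)) (V x.1) us => l [C S] [v w] {ed eV cN}.
case: (udir x) => a b /= us; split=> //; rewrite /dot2 /det2 /cmul !scale_pairE /=.
  have -> : r * C + s * (l - 2 * (r * C)) = (a ^+ 2 + b ^+ 2) * (r * C + s * (l - 2 * (r * C))).
    by rewrite us mul1r.
  by ring.
have -> : r * S = (a ^+ 2 + b ^+ 2) * (r * S) by rewrite us mul1r.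
by ring.
Qed.

Lemma circ1_bounds (t : R) : `|t| < 1 -> 0 < (circ t).1 <= 1.
Proof.
move=> h; have t2 : t ^+ 2 < 1 by rewrite -real_normK ?num_real // expr_lt1.
have := sqr_ge0 t; rewrite /circ /= => t0.
by rewrite divr_gt0 ?subr_gt0 ?sq1_gt0 //= ler_pdivrMr ?sq1_gt0 // mul1r; lra.
Qed.

Lemma circ2_inj (s t : R) : `|s| < 1 -> `|t| < 1 -> (circ s).2 = (circ t).2 -> s = t.
Proof.
move=> hs ht; rewrite /circ /= => /eqP.
rewrite eqr_div ?sq1_neq0 // => /eqP e.
have : (s - t) * (1 - s * t) = 0 by lra.
move=> /eqP; rewrite mulf_eq0 subr_eq0 => /orP[/eqP //|/eqP h].
have : `|s * t| < 1 by rewrite normrM mulr_ilt1.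
have -> : s * t = 1 by lra.
by rewrite normr1 ltxx.
Qed.

Definition parallel_edges i j :=
  (V i = V j /\ V i.+1 = V j.+1) \/ (V i = V j.+1 /\ V i.+1 = V j).

(** The end of the strand in the limit [delta = 0], on the edge itself. *)
Definition core (r : R) x : R * R := V x.1 + r *: udir x.

(** The factor 2 makes the discs disjoint, and leaves room for strands, which stay within [r] of
    their edges. *)
Record good_radius (e r : R) : Prop := GoodRadius {
  rad_gt0 : 0 < r;
  rad_lt : r < e;
  rad_vertex : forall i, (i < n.+1)%N -> forall j, (j < n.+1)%N -> V i <> V j ->
    2 * r < enorm (V i - V j);
  rad_edge : forall c, (c < n.+1)%N -> forall i, (i < n)%N -> V c <> V i -> V c <> V i.+1 ->
    forall z : R * R, seg (V i) (V i.+1) z -> 2 * r < enorm (z - V c) }.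

Lemma continuous_conv (p q : R * R) : continuous (fun s : R => (1 - s) *: p + s *: q).
Proof.
apply: contD; apply: contZ; try exact: cont_cst; try exact: cont_id.
by apply: contB; [exact: cont_cst|exact: cont_id].
Qed.

Lemma small_2lt (m : R) : 0 < m -> small (fun r : R => 2 * r < m).
Proof. by move=> m0; apply: small_sub (small_lt (e := m / 2) _) => [r r0|]; lra. Qed.

Lemma good_radius_ex (e : R) : 0 < e -> exists r, good_radius e r.
Proof.
move=> e0.
have : small (fun r : R => r < e /\ ((forall i, (i < n.+1)%N -> forall j, (j < n.+1)%N -> V i <> V j ->
    2 * r < enorm (V i - V j)) /\
    (forall c, (c < n.+1)%N -> forall i, (i < n)%N -> V c <> V i -> V c <> V i.+1 ->
    forall z : R * R, seg (V i) (V i.+1) z -> 2 * r < enorm (z - V c)))).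
  apply: small_and; first exact: small_lt.
  apply: small_and.
    apply: small_all => i hi; apply: small_all => j hj; apply: small_imp => ne.
    by apply: small_2lt; apply: enorm_gt0 => /eqP; rewrite subr_eq0 => /eqP.
  apply: small_all => c hc; apply: small_all => i hi; apply: small_imp => n1; apply: small_imp => n2.
  have [||m m0 hm] := @compact_enorm_min R R `[0, 1]%classic
      (fun s : R => (1 - s) *: V i + s *: V i.+1 - V c) (@segment_compact _ 0 1).
  - by apply: contB; [exact: continuous_conv|exact: cont_cst].
  - move=> s hs /eqP; rewrite subr_eq0 => /eqP e1.
    have : seg (V i) (V i.+1) (V c) by exists s.
    by move/(walk_vertex W (hc : (c <= n)%N) hi) => [].
  apply: small_sub (small_2lt m0) => r r0 h z [s hs <-]; apply: lt_le_trans h _.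
  exact: hm.
by move/small_ex => [r r0 [h1 [h2 h3]]]; exists r.
Qed.

Section Radius.
Variables (e r : R).
Hypothesis G : good_radius e r.
Let r0 : 0 < r := rad_gt0 G.

Lemma len_gt2r x : adj x -> 2 * r < enorm (dir x).
Proof.
move=> ax; have [h1 h2 _] := ax; rewrite /dir_of.
by apply: (rad_vertex G) => //; apply/nesym; apply: (adj_neq stall_free).
Qed.

Lemma rad_adj x c (z : R * R) : adj x -> (c <= n)%N -> V c <> V x.1 -> V c <> V x.2 ->
  seg (V x.1) (V x.2) z -> 2 * r < enorm (z - V c).
Proof.
case: x => i j [h1 h2 h3] hc n1 n2 sz; case: h3 => /= h3.
  by subst j; apply: (rad_edge G hc h2 n1 n2 sz).
by subst i; rewrite segC in sz; apply: (rad_edge G hc h1 n2 n1 sz).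
Qed.

(** [hei_den] keeps the turned directions from passing the cut, and [hei_ord] keeps different darts
    in their angular order. *)
Record good_height (delta : R) : Prop := GoodHeight {
  hei_gt0 : 0 < delta;
  hei_tau : forall x, adj x -> `|tau delta x| < 1;
  hei_den : forall x, adj x -> 0 < 1 - stereo (dir x) * tau delta x;
  hei_ord : forall x y, adj x -> adj y -> stereo (dir x) < stereo (dir y) ->
    par delta x < par delta y;
  hei_dis : forall i j p, (i < n)%N -> (j < n)%N -> ~ parallel_edges i j ->
    seg (loc r delta (sta i)) (loc r delta (stb i)) p ->
    seg (loc r delta (sta j)) (loc r delta (stb j)) p -> False }.

Lemma small_adj (P : point -> R -> Prop) : (forall x, adj x -> small (P x)) ->
  small (fun d => forall x, adj x -> P x d).
Proof.
move=> h; have h' : small (fun d => forall i, (i < n)%N -> P (sta i) d /\ P (stb i) d).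
  by apply: small_all => i hi; apply: small_and; apply: h; [exact: adj_sta|exact: adj_stb].
apply: small_sub h' => d _ hd x /(ptP n x)[i hi [] ->]; by have [] := hd i hi.
Qed.

Lemma core_seg x (s : R) : adj x -> 0 <= s <= 1 ->
  exists2 l : R, 0 < l < 1 & (1 - s) *: core r x + s *: core r (opp_pt x) = V x.1 + l *: dir x.
Proof.
move=> ax hs; have l0 := len_gt0 ax; have lr := len_gt2r ax.
exists ((r + s * (enorm (dir x) - 2 * r)) / enorm (dir x)).
  case/andP: hs => s0 s1.
  have h1 : 0 <= s * (enorm (dir x) - 2 * r) by rewrite mulr_ge0 // subr_ge0 ltW.
  have h2 : s * (enorm (dir x) - 2 * r) <= 1 * (enorm (dir x) - 2 * r).
    by rewrite ler_wpM2r // subr_ge0 ltW.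
  have rp : 0 < r by exact: r0.
  apply/andP; split; first by apply: divr_gt0 => //; lra.
  rewrite ltr_pdivrMr // mul1r; lra.
have o1 : (opp_pt x).1 = x.2 by [].
have eV : V x.2 = V x.1 + dir x by rewrite /dir_of addrC subrK.
have -> : ((r + s * (enorm (dir x) - 2 * r)) / enorm (dir x)) *: dir x =
   (r + s * (enorm (dir x) - 2 * r)) *: udir x by rewrite -scalerA.
rewrite /core o1 eV udir_opp.
have ed : dir x = enorm (dir x) *: udir x.
  by rewrite /udir scalerA divff ?scale1r // gt_eqF.
rewrite {1}ed; move: (enorm _) (udir x) (V x.1) => l [a b] [c d]; clear; pair_ring.
Qed.

Lemma core_edge x (l : R) : adj x -> 0 < l < 1 ->
  [/\ seg (V x.1) (V x.2) (V x.1 + l *: dir x), V x.1 + l *: dir x <> V x.1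
    & V x.1 + l *: dir x <> V x.2].
Proof.
move=> ax hl; have nd := dir_neq0 ax; split.
- exists l; first by apply/unit_arcP; lra.
  by rewrite /dir_of; move: (V _) (V _) => [a b] [c d]; pair_ring.
- move=> e1; have /eqP : l *: dir x = 0 by apply: (addrI (V x.1)); rewrite addr0.
  by rewrite scaler_eq0 => /orP[/eqP l0|/eqP //]; move: hl; rewrite l0 ltxx.
- have -> : V x.2 = V x.1 + dir x by rewrite /dir_of addrC subrK.
  move=> /addrI /eqP; rewrite -subr_eq0 -{2}[dir x]scale1r -scalerBl scaler_eq0.
  move=> /orP[/eqP l1|/eqP //]; have l10 : l = 1 by lra.
  by move: hl; rewrite l10 ltxx andbF.
Qed.

(** The chord from [(1, 0)] to [circ t] has squared length [4 t^2 / (1 + t^2)], whence the factor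
    2. *)
Lemma core_dist delta x : adj x -> 0 < delta ->
  enorm (loc r delta x - core r x) <= 2 * r * (delta * `|hgt x|).
Proof.
move=> ax d0; rewrite /loc /core.
have -> : V x.1 + r *: cmul (udir x) (circ (tau delta x)) - (V x.1 + r *: udir x) =
    r *: cmul (udir x) (circ (tau delta x) - (1, 0)).
  by rewrite /cmul; move: (udir x) (circ _) (V _) => [a b] [c d] [v w]; pair_ring.
rewrite enormZ enorm_cmul udir_circ // enorm_circ mul1r gtr0_norm //.
rewrite [2 * r]mulrC -mulrA ler_pM2l //.
have -> : delta * `|hgt x| = `|tau delta x| by rewrite /tau normrM (gtr0_norm d0).
move: (tau delta x) => t; rewrite enorm_le ?mulr_ge0 // exprMn real_normK ?num_real //=.
have -> : ((1 - t ^+ 2) / (1 + t ^+ 2) - 1) ^+ 2 + (2 * t / (1 + t ^+ 2) - 0) ^+ 2 =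
   4 * t ^+ 2 / (1 + t ^+ 2) by field; exact: sq1_neq0.
have t0 := sqr_ge0 t.
rewrite ler_pdivrMr ?sq1_gt0 //; move: (t ^+ 2) t0 => u u0; nra.
Qed.

(** The cores avoid the vertices, so those of non-parallel edges are disjoint compact segments at a
    positive distance, and the strands converge to them. *)
Lemma small_dis i j : (i < n)%N -> (j < n)%N -> ~ parallel_edges i j ->
  small (fun delta => forall p,
    seg (loc r delta (sta i)) (loc r delta (stb i)) p ->
    seg (loc r delta (sta j)) (loc r delta (stb j)) p -> False).
Proof.
move=> hi hj np; have ai := adj_sta hi; have aj := adj_sta hj.
pose f (st : R * R) := ((1 - st.1) *: core r (sta i) + st.1 *: core r (stb i)) -
   ((1 - st.2) *: core r (sta j) + st.2 *: core r (stb j)).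
have cf : continuous f.
  by apply: contB; apply: (@cont_comp _ _ _ (fun s : R => (1 - s) *: _ + s *: _));
    [exact: continuous_conv|exact: continuous_fst|exact: continuous_conv|exact: continuous_snd].
have [m m0 hm] : exists2 m : R, 0 < m & forall st, (`[0, 1] `*` `[0, 1])%classic st -> m <= enorm (f st).
  apply: compact_enorm_min cf _; first by apply: compact_setX; exact: segment_compact.
  move=> [s t] [/unit_arcP hs /unit_arcP ht] /eqP; rewrite subr_eq0 => /eqP e1; apply: np.
  have [l hl e2] := core_seg ai hs; have [k hk e3] := core_seg aj ht.
  have [s1 n1 n2] := core_edge ai hl; have [s2 n3 n4] := core_edge aj hk.
  have e4 : V (sta i).1 + l *: dir (sta i) = V (sta j).1 + k *: dir (sta j).
    by rewrite -e2 -e3.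
  rewrite -e4 in s2 n3 n4.
  case: (W hi hj s1 s2) => [[[//|//] _]|h|h]; [by left|by right].
have : 0 < m by []; move/small_affine => /(_ (- (2 * r * (`|hgt (sta i)| + `|hgt (sta j)|)))).
apply: small_sub => d d0 hd p [s hs e1] [t ht e2].
have := hm (s, t) (conj hs ht); rewrite leNgt => /negP; apply.
have hs' := (unit_arcP s).1 hs; have ht' := (unit_arcP t).1 ht.
have B x (u : R) : adj x -> 0 <= u <= 1 -> enorm ((1 - u) *: loc r d x + u *: loc r d (opp_pt x)
    - ((1 - u) *: core r x + u *: core r (opp_pt x))) <= 2 * r * (d * `|hgt x|).
  move=> ax hu.
  have -> : (1 - u) *: loc r d x + u *: loc r d (opp_pt x) - ((1 - u) *: core r x + u *: core r (opp_pt x))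
     = (1 - u) *: (loc r d x - core r x) + u *: (loc r d (opp_pt x) - core r (opp_pt x)).
    by move: (loc _ _ _) (loc _ _ _) (core _ _) (core _ _) => [? ?] [? ?] [? ?] [? ?]; pair_ring.
  apply: enorm_conv_le => //; first exact: core_dist.
  have := core_dist (adj_opp ax) d0; rewrite hgt_opp // normrN //.
have := B _ _ ai hs'; have := B _ _ aj ht'; rewrite e1 e2 => b1 b2.
have -> : f (s, t) = (p - ((1 - t) *: core r (sta j) + t *: core r (opp_pt (sta j)))) -
    (p - ((1 - s) *: core r (sta i) + s *: core r (opp_pt (sta i)))).
  have gen (a b c : R * R) : b - c = (a - c) - (a - b).
    by case: a b c => [? ?] [? ?] [? ?]; pair_ring.
  exact: gen.
apply: le_lt_trans (enormD _ _) _; rewrite enormN; lra.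
Qed.

Lemma good_height_ex : exists delta, good_height delta.
Proof.
have : small (fun delta : R => (forall x, adj x -> (0 < 1 / 2 + delta * hgt x /\ 0 < 1 / 2 + delta * - hgt x) /\
     (0 < 1 + delta * (- (stereo (dir x) * hgt x)) /\
      forall y, adj y -> stereo (dir x) < stereo (dir y) -> 0 < (stereo (dir y) - stereo (dir x)) / 2 +
        delta * ((hgt y - hgt x) * (1 + stereo (dir x) * stereo (dir y))))) /\
    forall i, (i < n)%N -> forall j, (j < n)%N -> ~ parallel_edges i j -> forall p,
    seg (loc r delta (sta i)) (loc r delta (stb i)) p ->
    seg (loc r delta (sta j)) (loc r delta (stb j)) p -> False).
  apply: small_and.
    apply: small_adj => x ax; apply: small_and.
      by apply: small_and; apply: small_affine; lra.
    apply: small_and; first exact: small_affine.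
    apply: small_adj => y ay; apply: small_imp => h; apply: small_affine; lra.
  by apply: small_all => i hi; apply: small_all => j hj; apply: small_imp => h; apply: small_dis.
move=> /small_ex[d d0 [h1 h2]]; exists d.
have den x : adj x -> 0 < 1 - stereo (dir x) * tau d x.
  by move=> /h1[_ [h _]]; rewrite /tau; move: h; rewrite mulrN mulrCA.
split=> //.
- by move=> x /h1[[h3 h4] _]; rewrite /tau ltr_norml; apply/andP; split; lra.
- move=> x y ax ay hs; have [_ [_ h]] := h1 x ax; have {}h := h y ay hs.
  have dx := den x ax; have dy := den y ay.
  have [[x1 x2] _] := h1 x ax; have [[y1 y2] _] := h1 y ay.
  rewrite /par ltr_pdivrMr // mulrAC ltr_pdivlMr // /tau.
  (* With [s] for [stereo] and [t] for [tau], clearing denominators leaves [(sy - sx) (1 + tx ty) +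
     (ty - tx) (1 + sx sy) > 0]. Heights below 1/2 make the factor [1 + tx ty] larger than 1/2. *)
  have q : - (1 / 4) <= (d * hgt x) * (d * hgt y) by nra.
  have q2 := ler_wpM2r (_ : 0 <= stereo (dir y) - stereo (dir x)) q.
  have {}q2 := q2 ltac:(lra).
  lra.
- by move=> i j p hi hj np; apply: h2.
Qed.

Section Height.
Variable delta : R.
Hypothesis D : good_height delta.
Local Notation loc := (loc r delta).

Lemma par_lt x y : adj x -> adj y -> x <> y -> V x.1 = V y.1 -> lt' x y ->
  par delta x < par delta y.
Proof.
move=> ax ay ne e1 l; have Px := (ptP n x).2 ax; have Py := (ptP n y).2 ay.
have dx := hei_den D ax; have dy := hei_den D ay.
case: (pselect (V x.2 = V y.2)) => [e2|e2].
  have sd : same_dart x y by split.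
  have hl : tau delta x < tau delta y.
    by rewrite /tau ltr_pM2l ?(hei_gt0 D) // hgt_lt.
  have es : dir x = dir y by rewrite /dir_of e1 e2.
  move: dx dy; rewrite /par es; move: (stereo (dir y)) => a dx dy.
  rewrite ltr_pdivrMr // mulrAC ltr_pdivlMr //.
  (* For one direction [a], clearing denominators leaves [(ty - tx) (1 + a^2) > 0]. *)
  have := mulr_gt0 (_ : 0 < tau delta y - tau delta x) (_ : 0 < 1 + a ^+ 2).
  rewrite subr_gt0 => /(_ hl (sq1_gt0 a)); lra.
apply: (hei_ord D) => //; rewrite -(lt_ang ax ay e1 e2) -(po_agree L Px Py) //.
  by apply/(discP V ax ay).
by move=> /(dartP V ax ay)[].
Qed.

Lemma par_order x y : adj x -> adj y -> x <> y -> V x.1 = V y.1 ->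
  par delta x != par delta y /\ (par delta x < par delta y) = lt' x y.
Proof.
move=> ax ay ne e1; have Px := (ptP n x).2 ax; have Py := (ptP n y).2 ay.
have A := po_anti L Px Py ne; case l : (lt' x y) A => A.
  by have h := par_lt ax ay ne e1 l; rewrite h lt_eqF.
have l2 : lt' y x by move: A; case: (lt' y x).
have h := par_lt ay ax (nesym ne) (esym e1) l2.
by rewrite gt_eqF // lt_gtF.
Qed.

Lemma locE x : adj x -> loc x = V x.1 + r *: circ (par delta x).
Proof. by move=> ax; apply: loc_par => //; rewrite gt_eqF // (hei_den D). Qed.

Lemma loc_inj x y : adj x -> adj y -> V x.1 = V y.1 -> loc x = loc y -> x = y.
Proof.
move=> ax ay e0; rewrite !locE // e0 => /circ_pt_inj h.
apply: contrapT => ne; have [/eqP n1 _] := par_order ax ay ne e0.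
by apply: n1; apply: h.
Qed.

(** In coordinates along the edge the squared distance is [(r C + u)^2 + (r S)^2] with [C > 0] and
    [u >= 0], and it exceeds [r^2] as soon as [u > 0]. *)
Lemma strand_disc x p : adj x -> seg (loc x) (loc (opp_pt x)) p ->
  enorm (p - V x.1) <= r -> p = loc x.
Proof.
move=> ax sp hp; have [s /andP[s0 s1] [ep ea ec]] := strand_coord ax sp.
have /andP[C0 C1] := circ1_bounds (hei_tau D ax).
have lr := len_gt2r ax.
have rp : 0 < r by exact: r0.
have h : enorm (p - V x.1) ^+ 2 <= r ^+ 2 by rewrite ler_sqr ?nnegrE ?enorm_ge0 // ltW.
have cs := circ_sq (tau delta x).
rewrite dist_coord // ea ec in h.
have : s = 0.
  apply/eqP; rewrite eq_le s0 andbT leNgt; apply/negP => s00.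
  move: h cs C0 C1; move: (circ _).1 (circ _).2 => C S h cs C0 C1.
  have k1 : 0 < enorm (dir x) - 2 * (r * C).
    have : r * C <= r * 1 by rewrite ler_pM2l.
    lra.
  have k2 : 0 < s * (enorm (dir x) - 2 * (r * C)) by rewrite mulr_gt0.
  have k3 : 0 < r * C by rewrite mulr_gt0.
  have e2 : r ^+ 2 = (r * C) ^+ 2 + (r * S) ^+ 2 by rewrite !exprMn -mulrDr cs mulr1.
  move: k2 k3 h; rewrite e2; set a := s * _; set b := r * C; set c := r * S.
  by move: a b c => a b c a0 b0 h2; nra.
by move=> s00; rewrite ep s00 subr0 scale1r scale0r addr0.
Qed.

(** The strand stays within [r] of its edge, and the edge is more than [2 r] away from the vertices
    off it. *)
Lemma strand_near x c p : adj x -> (c <= n)%N -> seg (loc x) (loc (opp_pt x)) p ->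
  enorm (p - V c) <= r -> V c = V x.1 \/ V c = V x.2.
Proof.
move=> ax hc [s /unit_arcP hs <-] hp; have aox := adj_opp ax; apply: contrapT => /not_orP[n1 n2].
have rp : 0 < r by exact: r0.
pose q := (1 - s) *: V x.1 + s *: V x.2.
have sq : seg (V x.1) (V x.2) q by exists s => //; apply/unit_arcP.
have far : 2 * r < enorm (q - V c) by exact: rad_adj n1 n2 sq.
have near : enorm ((1 - s) *: loc x + s *: loc (opp_pt x) - q) <= r.
  have -> : (1 - s) *: loc x + s *: loc (opp_pt x) - q =
     (1 - s) *: (loc x - V x.1) + s *: (loc (opp_pt x) - V (opp_pt x).1).
    by rewrite /q /=; move: (loc x) (loc _) (V _) (V _) => [? ?] [? ?] [? ?] [? ?]; pair_ring.
  by apply: enorm_conv_le => //; rewrite loc_dist.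
have := enormDB q ((1 - s) *: loc x + s *: loc (opp_pt x)) (V c).
by rewrite (enormB q (_ + _)); lra.
Qed.

(** Both strands are parallel to the common edge, and distinct heights give distinct distances from
    it. *)
Lemma strands_parallel x y p : adj x -> adj y -> x <> y -> same_dart x y ->
  seg (loc x) (loc (opp_pt x)) p -> seg (loc y) (loc (opp_pt y)) p -> False.
Proof.
move=> ax ay ne sd sx sy; have [s _ [_ _ e1]] := strand_coord ax sx.
have [t _ [_ _ e2]] := strand_coord ay sy.
have rp : 0 < r by exact: r0.
have ea : across x p = across y p by rewrite /across (udir_same sd); case: sd => ->.
have et : tau delta x = tau delta y.
  apply: circ2_inj; [exact: (hei_tau D)|exact: (hei_tau D)|].
  by apply: (mulfI (x := r)); [rewrite gt_eqF|rewrite -e1 -e2].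
have {}et : hgt x = hgt y.
  by move: et; rewrite /tau => /mulfI; apply; rewrite gt_eqF // (hei_gt0 D).
have Px := (ptP n x).2 ax; have Py := (ptP n y).2 ay.
case l : (lt' x y); first by have := hgt_lt ax ay ne sd l; rewrite et ltxx.
have l2 : lt' y x by rewrite (po_anti L Py Px) ?l //; exact: nesym.
have sd' : same_dart y x by case: sd.
by have := hgt_lt ay ax (nesym ne) sd' l2; rewrite et ltxx.
Qed.

Lemma strands_disjoint i j p : (i < j < n)%N ->
  seg (loc (sta i)) (loc (stb i)) p -> seg (loc (sta j)) (loc (stb j)) p -> False.
Proof.
move=> /andP[ij hj] si sj; have hi : (i < n)%N by lia.
case: (pselect (parallel_edges i j)) => [[e1|e1]|np]; last exact: (hei_dis D hi hj np si sj).
  apply: (strands_parallel (adj_sta hi) (adj_sta hj) _ _ si sj) => //.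
  by case; lia.
rewrite segC in sj.
apply: (strands_parallel (adj_sta hi) (adj_stb hj) _ _ si sj) => //.
by case; lia.
Qed.

Lemma chord_strand_end x p y y' : adj x -> adj y -> adj y' -> y <> y' -> V y.1 = V y'.1 ->
  seg (loc x) (loc (opp_pt x)) p -> seg (loc y) (loc y') p -> V x.1 = V y.1 ->
  (p = loc x /\ (x = y \/ x = y')).
Proof.
move=> ax ay ay' ne e0 sx sy exy; have rp : 0 < r by exact: r0.
have [npar _] := par_order ay ay' ne e0.
have sy' := sy; rewrite (locE ay) (locE ay') -e0 in sy'.
have pin := chord_in rp sy'.
have ep : p = loc x by apply: strand_disc => //; rewrite exy.
split=> //; have hr : r <= enorm (p - V y.1) by rewrite ep -exy loc_dist.
case: (chord_end rp npar sy' hr) => ep2.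
  by left; apply: loc_inj => //; rewrite -ep ep2 locE.
by right; apply: loc_inj => //; [congruence|rewrite -ep ep2 (locE ay') -e0].
Qed.

Lemma chord_pt_neq j : stb j <> sta j.+1. Proof. by case; lia. Qed.

Lemma chord_strand i j p : (i < n)%N -> (j.+1 < n)%N ->
  seg (loc (sta i)) (loc (stb i)) p -> seg (loc (stb j)) (loc (sta j.+1)) p ->
  (i = j /\ p = loc (stb j)) \/ (i = j.+1 /\ p = loc (sta i)).
Proof.
move=> hi hj si sj; have hj' : (j < n)%N by lia.
have ay := adj_stb hj'; have ay' := adj_sta hj.
have ne := @chord_pt_neq j.
have rp : 0 < r by exact: r0.
have pin : enorm (p - V j.+1) <= r.
  by have sj' := sj; rewrite (locE ay) (locE ay') in sj'; exact: chord_in rp sj'.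
have [e1|e1] := strand_near (adj_sta hi) (ltnW hj) si pin.
  have [ep [[]|[e2]]] := chord_strand_end (adj_sta hi) ay ay' ne erefl si sj (esym e1); first lia.
  by right.
have si' := si; rewrite segC in si'.
have [ep [[e2]|[]]] := chord_strand_end (adj_stb hi) ay ay' ne erefl si' sj (esym e1); last lia.
by left; subst i.
Qed.

Lemma chords_meet i j p : (i < j)%N -> (j.+1 < n)%N ->
  seg (loc (stb i)) (loc (sta i.+1)) p -> seg (loc (stb j)) (loc (sta j.+1)) p -> False.
Proof.
move=> ij hj si sj; have hi : (i < n)%N by lia.
have hi1 : (i.+1 < n)%N by lia.
have hj' : (j < n)%N by lia.
have a1 := adj_stb hi; have a2 := adj_sta hi1; have a3 := adj_stb hj'; have a4 := adj_sta hj.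
have rp : 0 < r by exact: r0.
have p1 : enorm (p - V i.+1) <= r.
  by have si' := si; rewrite (locE a1) (locE a2) in si'; exact: chord_in rp si'.
have p2 : enorm (p - V j.+1) <= r.
  by have sj' := sj; rewrite (locE a3) (locE a4) in sj'; exact: chord_in rp sj'.
case: (pselect (V i.+1 = V j.+1)) => e1; last first.
  have := rad_vertex G (ltnW hi1 : (i.+1 < n.+1)%N) (ltnW hj : (j.+1 < n.+1)%N) e1.
  by have := enormDB (V i.+1) p (V j.+1); rewrite (enormB (V i.+1) p); lra.
have n1 : stb i <> stb j by case; lia.
have n2 : stb i <> sta j.+1 by case; lia.
have n3 : sta i.+1 <> stb j by case; lia.
have n4 : sta i.+1 <> sta j.+1 by case; lia.
have [d0 _] := par_order a1 a2 (@chord_pt_neq i) erefl.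
have [d1 l1] := par_order a1 a3 n1 e1.
have [d2 l2] := par_order a1 a4 n2 e1.
have [d3 l3] := par_order a2 a3 n3 e1.
have [d4 l4] := par_order a2 a4 n4 e1.
have C : cross lt' (stb i) (sta i.+1) (stb j) (sta j.+1) = false.
  have nij : i <> j by move=> h; rewrite h ltnn in ij.
  exact: (po_chd L hi1 hj nij ((discP V a1 a3).2 e1)).
have C' := C; rewrite /cross -l1 -l2 -l3 -l4 in C'.
rewrite (locE a1) (locE a2) in si; rewrite (locE a3) (locE a4) in sj.
have sj' : seg (V i.+1 + r *: circ (par delta (stb j))) (V i.+1 + r *: circ (par delta (sta j.+1))) p.
  by rewrite e1.
exact: (chords_disjoint rp d0 d1 d2 d3 d4 C' si sj').
Qed.

(** The [2 n] vertices of the polygonal embedding in order; its [2 n - 1] edges are alternately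
    strands and chords. *)
Definition qpt k : point := if odd k then stb k./2 else sta k./2.

Lemma qpt_even i : qpt i.*2 = sta i.
Proof. by rewrite /qpt odd_double doubleK. Qed.
Lemma qpt_odd i : qpt i.*2.+1 = stb i.
Proof. by rewrite /qpt /= odd_double /= uphalf_double. Qed.
Lemma qpt_even1 i : qpt i.*2.+2 = sta i.+1.
Proof. by rewrite -doubleS qpt_even. Qed.

Lemma evenodd k : exists i, k = i.*2 \/ k = i.*2.+1.
Proof. by exists k./2; have := odd_double_half k; case: (odd k) => /= h; [right|left]; lia. Qed.

Lemma qpt_step k : (k < n.*2.-1)%N -> loc (qpt k) <> loc (qpt k.+1).
Proof.
have [i [->|->]] := evenodd k => hk.
  have hi : (i < n)%N by lia.
  rewrite qpt_even qpt_odd => e1; have rp : 0 < r by exact: r0.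
  have lr := len_gt2r (adj_sta hi).
  have h1 : enorm (loc (sta i) - V i) = r := loc_dist delta (adj_sta hi) rp.
  have h2 : enorm (loc (stb i) - V i.+1) = r := loc_dist delta (adj_stb hi) rp.
  move: lr; rewrite /dir_of /= -/(loc _).
  have := enormDB (V i.+1) (loc (stb i)) (V i); rewrite (enormB (V i.+1) (loc (stb i))) h2 -e1 h1.
  lra.
have hi : (i < n)%N by lia.
have hi1 : (i.+1 < n)%N by lia.
rewrite qpt_odd qpt_even1 => e1; apply: (@chord_pt_neq i).
exact: (loc_inj (adj_stb hi) (adj_sta hi1)).
Qed.

Lemma qpt_meet k l p : (k < l < n.*2.-1)%N ->
  seg (loc (qpt k)) (loc (qpt k.+1)) p -> seg (loc (qpt l)) (loc (qpt l.+1)) p ->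
  l = k.+1 /\ p = loc (qpt l).
Proof.
have [i [->|->]] := evenodd k; have [j [->|->]] := evenodd l => h;
  rewrite ?qpt_even ?qpt_odd ?qpt_even1 => sk sl.
- by exfalso; apply: (strands_disjoint (i := i) (j := j) _ sk sl); lia.
- have [||[? ep]|[? ep]] := chord_strand _ _ sk sl; [lia|lia| |lia].
  by subst j; split.
- have [||[? ep]|[? ep]] := chord_strand _ _ sl sk; [lia|lia|lia|].
  by subst j; split; [lia|].
- by exfalso; apply: (chords_meet (i := i) (j := j) _ _ sk sl); lia.
Qed.

Section Times.
Variable eta : R.
Hypothesis n_gt0 : (0 < n)%N.
Hypothesis eta_gt0 : 0 < eta.
Hypothesis eta_lt : eta < 1 / 2.
Hypothesis eta_small : forall i, (i < n)%N -> eta * enorm (V i.+1 - V i) < e.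

(** The chord at an inner vertex [i] is traversed in the time window of radius [eta] around [i].
    There is no chord at the first and last vertex, whose times are pinned to 0 and [n]. *)
Definition zt k : R :=
  if k == 0%N then 0 else if k == n.*2.-1 then n%:R
  else if odd k then (k./2).+1%:R - eta else (k./2)%:R + eta.

Lemma zt_even i : (i < n)%N -> i%:R <= zt i.*2 <= i%:R + eta.
Proof.
move=> hi; rewrite /zt; case: eqP => [h|_].
  have -> : i = 0%N by lia.
  rewrite mulr0n; have := eta_gt0; lra.
by case: eqP => [h|_]; [lia|rewrite odd_double doubleK; have := eta_gt0; lra].
Qed.

Lemma zt_odd i : (i < n)%N -> i.+1%:R - eta <= zt i.*2.+1 <= i.+1%:R.
Proof.
move=> hi; rewrite /zt /=; case: eqP => [h|_].
  have -> : n = i.+1 by lia.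
  have := eta_gt0; lra.
by rewrite odd_double /= uphalf_double; have := eta_gt0; lra.
Qed.

Lemma zt_chord i : (i.+1 < n)%N -> zt i.*2.+1 = i.+1%:R - eta /\ zt i.*2.+2 = i.+1%:R + eta.
Proof.
move=> hi; rewrite /zt /=.
have -> : (i.*2.+1 == n.*2.-1) = false by lia.
have -> : (i.*2.+2 == n.*2.-1) = false by lia.
by rewrite odd_double /= uphalf_double doubleK.
Qed.

Lemma zt_mono k : (k < n.*2.-1)%N -> zt k < zt k.+1.
Proof.
have [i [->|->]] := evenodd k => hk.
  have hi : (i < n)%N by lia.
  by have := zt_even hi; have := zt_odd hi; rewrite -natr1; have := eta_lt; lra.
have hi : (i.+1 < n)%N by lia.
by have [-> ->] := zt_chord hi; have := eta_gt0; lra.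
Qed.

Definition Phi := plin (fun k => k%:R : R) V n.

Lemma PhiE i s : (i < n)%N -> i%:R <= s <= i.+1%:R -> Phi s = V i + (s - i%:R) *: (V i.+1 - V i).
Proof.
move=> hi hs; rewrite /Phi (plinE _ _ hi hs) => [|k _]; last by rewrite ltr_nat.
by rewrite -natr1 addrAC subrr add0r divr1.
Qed.

Lemma ztn : zt n.*2.-1 = n%:R.
Proof. by rewrite /zt eqxx; case: eqP => // h; lia. Qed.

Lemma convex_pt (a b s : R) : a < b -> a <= s <= b ->
  0 <= (s - a) / (b - a) <= 1 /\ s = (1 - (s - a) / (b - a)) * a + (s - a) / (b - a) * b.
Proof.
move=> ab /andP[h1 h2]; have d : 0 < b - a by rewrite subr_gt0.
split; last by field; rewrite gt_eqF.
by rewrite divr_ge0 ?subr_ge0 ?(ltW ab) //= ler_pdivrMr // mul1r lerD2r.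
Qed.

Definition Fmap := plin zt (fun k => loc (qpt k)) n.*2.-1.

Lemma Fmap_inj s t : 0 <= s <= n%:R -> 0 <= t <= n%:R -> Fmap s = Fmap t -> s = t.
Proof.
move=> hs ht; have z0 : zt 0 = 0 by [].
have N0 : (0 < n.*2.-1)%N by lia.
apply: (plin_inj zt_mono N0 qpt_step) => //; first exact: qpt_meet.
  by rewrite z0 ztn.
by rewrite z0 ztn.
Qed.

Lemma Fmap_close s : 0 <= s <= n%:R -> enorm (Fmap s - Phi s) < e + e.
Proof.
move=> hs; have z0 : zt 0 = 0 by [].
have elt := eta_lt; have egt := eta_gt0.
have N0 : (0 < n.*2.-1)%N by lia.
have rp : 0 < r by exact: r0.
have re : r < e := rad_lt G.
have [|k hk hks] := locate N0 (z := zt) (s := s); first by rewrite z0 ztn.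
have [t01 es] := convex_pt (zt_mono hk) hks.
set t := (s - zt k) / (zt k.+1 - zt k) in t01 es.
have eF : Fmap s = (1 - t) *: loc (qpt k) + t *: loc (qpt k.+1).
  rewrite /Fmap (plinE zt_mono _ hk hks) -/t.
  by move: (loc _) (loc _) => [? ?] [? ?]; pair_ring.
have [i [ek|ek]] := evenodd k; subst k.
  have hi : (i < n)%N by move: hk; clear; lia.
  have b1 := zt_even hi; have b2 := zt_odd hi; have b3 := natr1 i.
  have hP : i%:R <= s <= i.+1%:R by lra.
  pose dV := V i.+1 - V i.
  have eP : Phi s = (1 - t) *: (V i + (zt i.*2 - i%:R) *: dV) +
      t *: (V i.+1 - (i.+1%:R - zt i.*2.+1) *: dV).
    rewrite (PhiE hi hP) -/dV {1}es -b3.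
    have -> : V i.+1 = V i + dV by rewrite addrC subrK.
    by move: dV (V i) => [a b] [c d]; pair_ring.
  have -> : Fmap s - Phi s = (1 - t) *: (loc (qpt i.*2) - V i - (zt i.*2 - i%:R) *: dV)
     + t *: (loc (qpt i.*2.+1) - V i.+1 + (i.+1%:R - zt i.*2.+1) *: dV).
    rewrite eF eP; move: (loc _) (loc _) (_ *: dV) (_ *: dV) (V i) (V i.+1) => [? ?] [? ?] [? ?] [? ?] [? ?] [? ?].
    by pair_ring.
  have eD : eta * enorm dV < e by exact: eta_small.
  have bd (c : R) : 0 <= c <= eta -> enorm (c *: dV) < e.
    move=> /andP[c0 c1]; apply: le_lt_trans eD; rewrite enormZ ger0_norm // ler_wpM2r //.
    exact: enorm_ge0.
  rewrite qpt_even qpt_odd.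
  apply: enorm_conv_lt => //.
    apply: le_lt_trans (enormD _ _) _; rewrite enormN; apply: ltrD; last by apply: bd; lra.
    by rewrite (loc_dist delta (adj_sta hi) rp : enorm (loc (sta i) - V i) = r).
  apply: le_lt_trans (enormD _ _) _; apply: ltrD; last by apply: bd; lra.
  by rewrite (loc_dist delta (adj_stb hi) rp : enorm (loc (stb i) - V i.+1) = r).
have hi1 : (i.+1 < n)%N by move: hk; clear; lia.
have hi : (i < n)%N by exact: ltnW.
have [b1 b2] := zt_chord hi1; rewrite b1 b2 in hks.
have b3 := natr1 i; have b4 := natr1 i.+1.
have -> : Fmap s - Phi s = (Fmap s - V i.+1) - (Phi s - V i.+1).
  by move: (Fmap s) (Phi s) (V i.+1) => [? ?] [? ?] [? ?]; pair_ring.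
apply: le_lt_trans (enormD _ _) _; rewrite enormN; apply: ltrD.
  apply: le_lt_trans re; rewrite eF qpt_odd qpt_even1.
  apply: (@chord_in _ _ _ (par delta (stb i)) (par delta (sta i.+1))) => //.
  exists t; first by apply/unit_arcP.
  by rewrite (locE (adj_stb hi)) (locE (adj_sta hi1)).
case: (lerP s i.+1%:R) => h.
  rewrite (PhiE hi); last by lra.
  have -> : V i + (s - i%:R) *: (V i.+1 - V i) - V i.+1 = (s - i.+1%:R) *: (V i.+1 - V i).
    by rewrite -b3; move: (V i.+1) (V i) => [? ?] [? ?]; pair_ring.
  apply: le_lt_trans (eta_small hi); rewrite enormZ ler_wpM2r ?enorm_ge0 //.
  by rewrite ler_norml; lra.
rewrite (PhiE hi1); last by lra.
rewrite addrC addrA [- _ + _]addrC subrr add0r.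
apply: le_lt_trans (eta_small hi1); rewrite enormZ ler_wpM2r ?enorm_ge0 //.
by rewrite ler_norml; lra.
Qed.

End Times.
End Height.
End Radius.

Theorem walk_embedding (eps : R) : (0 < n)%N -> 0 < eps ->
  exists F : R -> R * R, [/\ continuous F,
    forall s t, 0 <= s <= n%:R -> 0 <= t <= n%:R -> F s = F t -> s = t
  & forall s, 0 <= s <= n%:R -> enorm (F s - plin (fun k => k%:R : R) V n s) < eps].
Proof.
(* One half pays for the displacement by at most the radius, the other for the shift in time. *)
move=> n0 eps0; have e0 : 0 < eps / 2 by lra.
have [r G] := good_radius_ex e0; have [delta D] := good_height_ex G.
have : small (fun eta : R => eta < 1 / 2 /\
    forall i, (i < n)%N -> eta * enorm (V i.+1 - V i) < eps / 2).
  apply: small_and; first by apply: small_lt; lra.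
  apply: small_all => i hi; have := @small_affine R (eps / 2) (- enorm (V i.+1 - V i)) e0.
  by apply: small_sub => d d0; rewrite mulrN subr_gt0.
move=> /small_ex[eta eta0 [eta1 eta2]].
exists (Fmap r delta eta); split.
- exact: plin_continuous.
- by move=> s t; apply: (Fmap_inj G D).
- by move=> s hs; have := Fmap_close G D n0 eta0 eta1 eta2 hs; rewrite -splitr.
Qed.

End Thicken.

(** * Rotations and a generic direction *)

Section Tilt.
Context {R : realType}.
Implicit Types (m w p q : R * R).

(** Complex multiplication by the conjugate of [m]: for a unit [m], the rotation inverse to
    [cmul m]. *)
Definition tilt m w : R * R := (dot2 m w, det2 m w).

Lemma tiltB m p q : tilt m (p - q) = tilt m p - tilt m q.
Proof. by move: m p q => [? ?] [? ?] [? ?]; rewrite /tilt /dot2 /det2; pair_ring. Qed.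

Lemma tiltD m p q : tilt m (p + q) = tilt m p + tilt m q.
Proof. by move: m p q => [? ?] [? ?] [? ?]; rewrite /tilt /dot2 /det2; pair_ring. Qed.

Lemma tiltZ m (k : R) p : tilt m (k *: p) = k *: tilt m p.
Proof. by move: m p => [? ?] [? ?]; rewrite /tilt /dot2 /det2 !scale_pairE; pair_ring. Qed.

Lemma tilt0 m : tilt m 0 = 0.
Proof. by have := tiltB m 0 0; rewrite !subrr. Qed.

Variable m : R * R.
Hypothesis m1 : m.1 ^+ 2 + m.2 ^+ 2 = 1.

Lemma tiltK w : cmul m (tilt m w) = w.
Proof.
move: m1; rewrite /cmul /tilt /dot2 /det2; case: m w => [a b] [x y] /= h.
by apply: plane_eq => /=; [rewrite -[RHS]mul1r -h|rewrite -[RHS]mul1r -h]; ring.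
Qed.

Lemma cmulK w : tilt m (cmul m w) = w.
Proof.
move: m1; rewrite /cmul /tilt /dot2 /det2; case: m w => [a b] [x y] /= h.
by apply: plane_eq => /=; [rewrite -[RHS]mul1r -h|rewrite -[RHS]mul1r -h]; ring.
Qed.

Lemma tilt_inj p q : tilt m p = tilt m q -> p = q.
Proof. by move=> h; rewrite -(tiltK p) h tiltK. Qed.

Lemma enorm_tilt w : enorm (tilt m w) = enorm w.
Proof.
have h : enorm m = 1 by exact: enorm_sq1.
by rewrite -[RHS](congr1 _ (tiltK w)) enorm_cmul h mul1r.
Qed.

Lemma seg_tilt p q w : seg (tilt m p) (tilt m q) w <-> seg p q (cmul m w).
Proof.
split=> -[t ht h]; exists t => //.
  by apply: tilt_inj; rewrite cmulK -h tiltD !tiltZ.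
by rewrite -!tiltZ -tiltD h cmulK.
Qed.

Lemma tilt_plane_walk n V : plane_walk n V -> plane_walk n (fun a => tilt m (V a)).
Proof.
move=> W i j p hi hj /seg_tilt s1 /seg_tilt s2.
have E q : cmul m p = q -> p = tilt m q by move=> <-; rewrite cmulK.
case: (W i j _ hi hj s1 s2) => [[h1 h2]|[-> ->]|[-> ->]].
- by constructor 1; split; [case: h1|case: h2] => /E; auto.
- by constructor 2.
- by constructor 3.
Qed.

Lemma tilt_sum N (F : 'I_N -> R * R) : tilt m (\sum_(i < N) F i) = \sum_(i < N) tilt m (F i).
Proof. by apply: (big_morph (tilt m)); [exact: tiltD|exact: tilt0]. Qed.

Lemma tilt_plin z V N (s : R) : plin z (fun a => tilt m (V a)) N s = tilt m (plin z V N s).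
Proof.
rewrite /plin tiltD tilt_sum; congr (_ + _); apply: eq_bigr => i _.
by rewrite tiltZ tiltB.
Qed.

Lemma continuous_cmul : continuous (cmul m).
Proof.
change (continuous (fun w : R * R => (m.1 * w.1 - m.2 * w.2, m.1 * w.2 + m.2 * w.1))).
have c1 : continuous (fun w : R * R => w.1) by exact: continuous_fst.
have c2 : continuous (fun w : R * R => w.2) by exact: continuous_snd.
have cm (k : R) (f : R * R -> R) : continuous f -> continuous (fun w => k * f w).
  by move=> cf; apply: contM => //; exact: cont_cst.
apply: cont_pair.
  by apply: (@contB R (R * R)%type R (fun w => m.1 * w.1)); exact: cm.
by apply: (@contD R (R * R)%type R (fun w => m.1 * w.2)); exact: cm.
Qed.
End Tilt.

(** Keeps every edge off the horizontal, where the cut lies. Up to a positive factor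
    [det2 (circ t) w] is a nonzero quadratic polynomial in [t], hence nonzero for small positive
    [t]. *)
Lemma generic_direction (R : realType) n (w : nat -> R * R) :
  exists2 m : R * R, m.1 ^+ 2 + m.2 ^+ 2 = 1 &
    forall i, (i < n)%N -> w i <> 0 -> det2 m (w i) <> 0.
Proof.
have pos (a b : R) : 0 < b -> small (fun t : R => 0 < (1 - t ^+ 2) * b - 2 * t * a).
  move=> b0; apply: small_sub (small_and (small_lt ltr01) (small_affine (- b - 2 * a) b0)).
  move=> t t0 [t1 h]; have : t ^+ 2 <= t by rewrite expr2 ler_piMr // ltW.
  move: (t ^+ 2) => u hu; have : u * b <= t * b by rewrite ler_wpM2r // ltW.
  lra.
have one (p : R * R) : p <> 0 -> small (fun t : R => (1 - t ^+ 2) * p.2 - 2 * t * p.1 <> 0).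
  case: p => a b np /=; case: (ltgtP 0 b) => hb.
  - by apply: small_sub (pos a b hb) => t _ h e; rewrite e ltxx in h.
  - have hb' : 0 < - b by lra.
    by apply: small_sub (pos (- a) (- b) hb') => t _ h e; clear np; lra.
  - subst b; exists 1 => // t /andP[t0 _]; rewrite mulr0 sub0r => /eqP.
    rewrite oppr_eq0 !mulf_eq0 pnatr_eq0 /= [t == 0]gt_eqF //= => /eqP a0; apply: np.
    by rewrite a0.
have : small (fun t : R => forall i, (i < n)%N -> w i <> 0 ->
    (1 - t ^+ 2) * (w i).2 - 2 * t * (w i).1 <> 0).
  by apply: small_all => i _; apply: small_imp; apply: one.
move=> /small_ex[t t0 h]; exists (circ t); first exact: circ_sq.
move=> i hi wi d0; apply: (h i hi wi).
have -> : (1 - t ^+ 2) * (w i).2 - 2 * t * (w i).1 = (1 + t ^+ 2) * det2 (circ t) (w i).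
  by rewrite /det2 /circ /=; field; exact: sq1_neq0.
by rewrite d0 mulr0.
Qed.

(** * Triangulations of the unit interval *)

Section Triangulations.
Context {R : realType}.
Variable xs : seq R.
Hypothesis T : triangulation xs.
Let n := nedges xs.

Lemma tri_size : size xs = n.+1.
Proof.
case: T => _ _; rewrite /n /nedges; case: xs => //= /eqP; by rewrite eq_sym oner_eq0.
Qed.

Lemma tri_lt i : (i < n)%N -> xs`_i < xs`_i.+1.
Proof.
move=> hi; case: T => h _ _; apply: (sorted_ltn_nth lt_trans 0 h); rewrite ?inE ?tri_size //; lia.
Qed.

Lemma tri_n : xs`_n = 1.
Proof. by case: T => _ _ <-; rewrite -nth_last /n /nedges. Qed.

Lemma tri_0 : xs`_0 = 0. Proof. by case: T. Qed.

Lemma tri_n_gt0 : (0 < n)%N.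
Proof.
rewrite lt0n; apply/eqP => n0; have := tri_n; rewrite n0 tri_0 => /eqP.
by rewrite eq_sym oner_eq0.
Qed.

Lemma tri_le i j : (i <= j <= n)%N -> xs`_i <= xs`_j.
Proof. by apply: (z_le (z := fun i => xs`_i)) => k; apply: tri_lt. Qed.

Lemma tri_01 i : (i <= n)%N -> 0 <= xs`_i <= 1.
Proof.
move=> h; have h1 := @tri_le 0 i h; have h2 := @tri_le i n.
by rewrite tri_0 in h1; rewrite tri_n h leqnn in h2; rewrite h1 h2.
Qed.

Lemma tri_locate s : 0 <= s <= 1 -> exists2 i, (i < n)%N & xs`_i <= s <= xs`_i.+1.
Proof.
move=> hs; apply: (locate (z := fun i => xs`_i) (s := s) tri_n_gt0).
by rewrite tri_0 tri_n.
Qed.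

Lemma linear_plin phi : linear_on_edges phi xs -> forall s, 0 <= s <= 1 ->
  phi s = plin (fun i => xs`_i) (fun i => phi xs`_i) n s.
Proof.
move=> Lin s hs; have [i hi his] := tri_locate hs.
rewrite (plinE tri_lt _ hi his).
have [t01 es] := convex_pt (tri_lt hi) his.
move: (_ / _) t01 es => t t01 es.
rewrite [in LHS]es (Lin i hi) //; first by move: (phi _) (phi _) => [? ?] [? ?]; pair_ring.
Qed.

End Triangulations.

(** * Removing the constant edges of a walk *)

Section Dedup.
Context {R : realType}.
Variables (n : nat) (V : nat -> R * R).

Fixpoint moves a : nat := if a is b.+1 then (moves b + (V b != V b.+1))%N else 0%N.
Definition first_at p := find (fun a => moves a == p) (iota 0 n.+1).
Definition dedup p := V (first_at p).

Lemma moves_mono a b : (a <= b)%N -> (moves a <= moves b)%N.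
Proof. by move=> /subnK <-; elim: (b - a)%N => // k; rewrite addSn /=; lia. Qed.

Lemma moves_V a b : moves a = moves b -> V a = V b.
Proof.
wlog ab : a b / (a <= b)%N.
  by move=> hw; case: (leqP a b) => [|/ltnW] h e; [apply: hw|symmetry; apply: hw].
move: ab => /subnK <-; elim: (b - a)%N => [//|k IH]; rewrite addSn /= => e.
have h := moves_mono (leq_addl k a).
have e1 : moves a = moves (k + a) by lia.
rewrite (IH e1); apply/eqP; apply: contraT => ne.
by move: e; rewrite ne; lia.
Qed.

Lemma first_atP a : (a <= n)%N -> (first_at (moves a) <= n)%N /\ moves (first_at (moves a)) = moves a.
Proof.
move=> ha; have hs : has (fun b => moves b == moves a) (iota 0 n.+1).
  by apply/hasP; exists a => //; rewrite mem_iota; lia.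
have h1 : (first_at (moves a) < n.+1)%N.
  by have := hs; rewrite has_find size_iota.
split; first by lia.
by apply/eqP; have := nth_find 0 hs; rewrite nth_iota.
Qed.

Lemma dedup_moves a : (a <= n)%N -> dedup (moves a) = V a.
Proof. by move=> /first_atP[_ h]; apply: moves_V. Qed.

Lemma edge_at p b : (p < moves b)%N -> exists a, [/\ (a < b)%N, moves a = p, moves a.+1 = p.+1 & V a <> V a.+1].
Proof.
elim: b => //= b IH hp; case: (ltnP p (moves b)) => h.
  by have [a [h1 h2 h3 h4]] := IH h; exists a; split=> //; lia.
move: hp; case: eqP => /= e; first lia.
move=> hp; exists b; split=> //; rewrite /= ?(introF eqP e) /=; lia.
Qed.

Lemma at_value p : (p <= moves n)%N -> exists2 a, (a <= n)%N & moves a = p.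
Proof.
rewrite leq_eqVlt => /orP[/eqP ->|/edge_at[a [h1 h2 _ _]]]; first by exists n.
by exists a => //; exact: ltnW.
Qed.

Let k := moves n.

Lemma dedup_edge p : (p < k)%N -> exists i, [/\ (i < n)%N, moves i = p, moves i.+1 = p.+1,
   dedup p = V i & dedup p.+1 = V i.+1].
Proof.
move=> /edge_at[a [h1 h2 h3 h4]]; exists a; split=> //.
  by rewrite -h2 dedup_moves // ltnW.
by rewrite -h3 dedup_moves.
Qed.

Lemma dedup_stall_free p : (p < k)%N -> dedup p <> dedup p.+1.
Proof.
move=> /edge_at[a [h1 h2 h3 h4]].
by rewrite -h3 -h2 !dedup_moves //; exact: ltnW.
Qed.

Lemma dedup_plane_walk : plane_walk n V -> plane_walk k dedup.
Proof.
move=> W p q z /dedup_edge[i [hi _ _ -> ->]] /dedup_edge[j [hj _ _ -> ->]].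
exact: W.
Qed.

Lemma slit_refl (w : R * R) : slit w w = false.
Proof. by rewrite /slit addbb. Qed.

Variable g : nat -> nat -> bool.
Hypothesis H : half_lift n V g.

Lemma seg_refl (p z : R * R) : seg p p z -> z = p.
Proof. by move=> [t _ <-]; rewrite -scalerDl subrK scale1r. Qed.

(** Over a constant edge the slit compares a vector with itself, so the bit does not change; the
    side is red because the two images differ. *)
Lemma lift_stall_r a b b' : (a < b <= b')%N -> (b' <= n)%N -> moves b = moves b' -> V a <> V b ->
  g a b = g a b'.
Proof.
move=> /andP[ab /subnK <-]; elim: (b' - b)%N => [//|j IH]; rewrite addSn /= => hn e ne.
have h := moves_mono (leq_addl j b).
have e1 : moves b = moves (j + b) by lia.
rewrite IH //; last by lia.
have eV : V (j + b)%N = V (j + b).+1.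
  by apply/eqP; apply: contraT => n1; move: e; rewrite n1; lia.
have := proj1 H a (j + b)%N; rewrite -eV slit_refl => h1.
have : g a (j + b)%N (+) g a (j + b).+1 = false.
  apply: h1; first lia.
  by move/seg_refl; rewrite -(moves_V e1).
by case: (g _ _) (g _ _) => -[].
Qed.

Lemma lift_stall_l a a' b : (a <= a' < b)%N -> (b <= n)%N -> moves a = moves a' -> V a <> V b ->
  g a b = g a' b.
Proof.
move=> /andP[/subnK <-]; elim: (a' - a)%N => [//|j IH]; rewrite addSn /= => hn hb e ne.
have h := moves_mono (leq_addl j a).
have e1 : moves a = moves (j + a) by lia.
rewrite IH //; last by lia.
have eV : V (j + a)%N = V (j + a).+1.
  by apply/eqP; apply: contraT => n1; move: e; rewrite n1; lia.
have := proj2 H (j + a)%N b; rewrite -eV slit_refl => h1.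
have : g (j + a)%N b (+) g (j + a).+1 b = false.
  apply: h1; first lia.
  by move/seg_refl => e2; apply: ne; rewrite e2 (moves_V e1).
by case: (g _ _) (g _ _) => -[].
Qed.

Lemma lift_stall a a' b b' : (a' <= n)%N -> (b <= n)%N -> (b' <= n)%N ->
  moves a = moves a' -> moves b = moves b' -> (moves a < moves b)%N -> V a <> V b ->
  g a b = g a' b'.
Proof.
move=> ha' hb hb' ea eb hab ne.
have lt x y : (moves x < moves y)%N -> (x < y)%N.
  by move=> h; rewrite ltnNge; apply/negP => /moves_mono; lia.
have ab : (a < b)%N by apply: lt.
have a'b : (a' < b)%N by apply: lt; lia.
have a'b' : (a' < b')%N by apply: lt; lia.
have Va := moves_V ea; have Vb := moves_V eb.
transitivity (g a' b).
  case: (leqP a a') => h; first by apply: lift_stall_l => //; rewrite h.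
  by symmetry; apply: lift_stall_l => //; [rewrite ltnW|congruence].
case: (leqP b b') => h; first by apply: lift_stall_r => //; [rewrite a'b|congruence].
by symmetry; apply: lift_stall_r => //; [rewrite a'b' ltnW|congruence].
Qed.

Lemma dedup_half_lift : half_lift k dedup (fun p q => g (first_at p) (first_at q)).
Proof.
have F p : (p <= k)%N -> (first_at p <= n)%N /\ moves (first_at p) = p.
  by move=> /at_value[a ha <-]; apply: first_atP.
have E p q a b : (p <= k)%N -> (q <= k)%N -> (p < q)%N -> (a <= n)%N -> (b <= n)%N ->
    moves a = p -> moves b = q -> V a <> V b -> g (first_at p) (first_at q) = g a b.
  move=> hp hq pq ha hb ea eb ne; have [f1 f2] := F p hp; have [f3 f4] := F q hq.
  symmetry; apply: lift_stall => //; lia.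
split.
  move=> p q hpq; have hq : (q < k)%N by lia.
  have [j [hj mj mj1 -> ->]] := dedup_edge hq.
  have hp : (p <= k)%N by lia.
  have [f1 f2] := F p hp; rewrite /dedup => red.
  rewrite (E p q (first_at p) j) ?(E p q.+1 (first_at p) j.+1) //; try lia.
  - apply: (proj1 H) => //.
    by rewrite hj andbT ltnNge; apply/negP => /moves_mono; lia.
  - by move=> e; apply: red; rewrite e; exact: seg_r.
  - by move=> e; apply: red; rewrite e; exact: seg_l.
move=> p q hpq; have hp : (p < k)%N by lia.
have [i [hi mi mi1 -> ->]] := dedup_edge hp.
have hq : (q <= k)%N by lia.
have [f1 f2] := F q hq; rewrite /dedup => red.
rewrite (E p q i (first_at q)) ?(E p.+1 q i.+1 (first_at q)) //; try lia.
- apply: (proj2 H) => //.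
  by rewrite f1 andbT ltnNge; apply/negP => /moves_mono; lia.
- by move=> e; apply: red; rewrite -e; exact: seg_r.
- by move=> e; apply: red; rewrite -e; exact: seg_l.
Qed.

End Dedup.

(** * From half-lifts to embeddings of the original path *)

Section Assembly.
Context {R : realType}.

Lemma enorm_sum N (F : 'I_N -> R * R) : enorm (\sum_(i < N) F i) <= \sum_(i < N) enorm (F i).
Proof.
elim: N F => [|N IH] F; first by rewrite !big_ord0 enorm0.
by rewrite !big_ord_recr /=; apply: le_trans (enormD _ _) _; rewrite lerD2r.
Qed.

Lemma plin_lip (W : nat -> R * R) k (s t : R) :
  enorm (plin (fun i => i%:R) W k s - plin (fun i => i%:R) W k t) <=
  `|s - t| * \sum_(i < k) enorm (W i.+1 - W i).
Proof.
rewrite /plin addrC opprD addrACA addNr add0r addrC -sumrB.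
apply: le_trans (enorm_sum _) _; rewrite mulr_sumr; apply: ler_sum => i _.
rewrite -scalerBl enormZ ler_wpM2r ?enorm_ge0 //; apply: le_trans (clamp01_lip _ _) _.
have -> : i.+1%:R - i%:R = 1 :> R by rewrite -natr1; ring.
rewrite !divr1; have -> : s - i%:R - (t - i%:R) = s - t by ring.
exact: lexx.
Qed.

Lemma plin_mono (z c : nat -> R) n (s t : R) : (forall k, (k < n)%N -> z k < z k.+1) ->
  (forall k, (k < n)%N -> c k <= c k.+1) -> s <= t ->
  plin z (c : nat -> R^o) n s <= plin z (c : nat -> R^o) n t.
Proof.
move=> hz hc st; rewrite /plin lerD2l; apply: ler_sum => i _.
have zi := hz i (ltn_ord i).
apply: ler_wpM2r; first by rewrite subr_ge0 hc.
by apply: clamp01_mono; rewrite ler_wpM2r ?invr_ge0 ?subr_ge0 ?(ltW zi) // lerD2r.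
Qed.

Variables (phi : R -> R * R) (xs : seq R).
Hypothesis T : triangulation xs.
Hypothesis Lin : linear_on_edges phi xs.
Let n := nedges xs.
Let V a := phi xs`_a.

Section Progress.
Variable V' : nat -> R * R.
Let k := moves V' n.
Hypothesis k_gt0 : (0 < k)%N.

(** Time measured in moves: composed with it the shortened walk is the original path. It is constant
    on constant edges, hence monotone but perhaps not injective. *)
Definition progress (t : R) : R :=
  plin (fun i => xs`_i) ((fun a => (moves V' a)%:R) : nat -> R^o) n t.

Lemma progress_mono s t : s <= t -> progress s <= progress t.
Proof.
apply: plin_mono => i hi; first exact: (tri_lt T).
by rewrite ler_nat moves_mono.
Qed.

Lemma progress_01 t : 0 <= t <= 1 -> 0 <= progress t <= k%:R.
Proof.
move=> /andP[t0 t1]; have n0 := tri_n_gt0 T.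
have pv j : (j <= n)%N -> progress xs`_j = (moves V' j)%:R.
  exact: (plin_vertex (tri_lt T) ((fun a => (moves V' a)%:R) : nat -> R^o) n0).
have p0 : progress 0 = 0 by have := pv 0%N isT; rewrite (tri_0 T).
have p1 : progress 1 = k%:R by have := pv n (leqnn n); rewrite (tri_n T).
by rewrite -{1}p0 -p1 !progress_mono.
Qed.

Lemma dedup_progress t : 0 <= t <= 1 ->
  plin (fun i => i%:R : R) (dedup n V') k (progress t) = plin (fun i => xs`_i) V' n t.
Proof.
move=> ht; have [i hi his] := tri_locate T ht.
have nat_mono j : (j < k)%N -> (j%:R : R) < j.+1%:R by rewrite ltr_nat.
have [m01 _] := convex_pt (tri_lt T hi) his.
rewrite /progress !(plinE (tri_lt T) _ hi his); move: (_ / _) m01 => mu m01.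
have hi' : (i <= n)%N by exact: ltnW.
case: (eqVneq (V' i) (V' i.+1)) => e.
  have -> : (moves V' i.+1)%:R = (moves V' i)%:R :> R^o by rewrite /= e eqxx addn0.
  rewrite e !subrr !scaler0 !addr0 plin_vertex // ?dedup_moves //.
  exact: moves_mono.
have em : moves V' i.+1 = (moves V' i).+1 by rewrite /= e addn1.
have hk : (moves V' i < k)%N by rewrite -em moves_mono.
have -> : (moves V' i)%:R + mu *: ((moves V' i.+1)%:R - (moves V' i)%:R : R^o) =
   (moves V' i)%:R + mu :> R.
  by rewrite em -natr1 [_ + 1]addrC addrK /GRing.scale /= mulr1.
rewrite (plinE nat_mono _ hk); last by rewrite -natr1; lra.
rewrite -em !dedup_moves //; congr (_ + _ *: _).
by rewrite em -natr1 [_ + mu]addrC addrK [_ + 1]addrC addrK divr1.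
Qed.

End Progress.

(** The rotation that is used must be generic for the edges of the walk and is chosen inside the
    proof; hence the quantification over [m]. *)
Theorem approximable_of_half_lifts : plane_walk n V ->
  (forall m : R * R, m.1 ^+ 2 + m.2 ^+ 2 = 1 -> exists g, half_lift n (fun a => tilt m (V a)) g) ->
  approximable_by_embeddings phi.
Proof.
move=> W H eps eps0.
have [m m1 gen] := generic_direction n (fun i => V i.+1 - V i).
pose V' a := tilt m (V a); pose k := moves V' n.
have phiE t : 0 <= t <= 1 -> tilt m (phi t) = plin (fun i => xs`_i) V' n t.
  by move=> ht; rewrite (linear_plin T Lin ht) tilt_plin.
case: (posnP k) => [k0|k0].
  (* Nothing moves: [phi] is constant and is approximated by a short segment. *)
  have c t : 0 <= t <= 1 -> phi t = V 0%N.
    move=> ht; apply: (tilt_inj m1); rewrite phiE //; have [i hi his] := tri_locate T ht.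
    have e a : (a <= n)%N -> V' a = V' 0%N.
      by move=> ha; apply: moves_V; have := moves_mono V' ha; rewrite -/k k0 /=; lia.
    by rewrite (plinE (tri_lt T) _ hi his) !e // ?subrr ?scaler0 ?addr0 // ltnW.
  exists (fun t => V 0%N + t *: (eps / 2, 0)); split.
  - apply: continuous_subspaceT; apply: contD; first exact: cont_cst.
    by apply: contZ; [exact: cont_id|exact: cont_cst].
  - move=> s t _ _ /addrI /eqP; rewrite -subr_eq0 -scalerBl scaler_eq0 subr_eq0.
    by move=> /orP[/eqP //|/eqP[/eqP]]; rewrite mulf_eq0 gt_eqF //= invr_eq0 pnatr_eq0.
  - move=> t /unit_arcP ht; rewrite c // addrC addKr enormZ.
    have -> : enorm ((eps / 2, 0) : R * R) = eps / 2.
      by rewrite /enorm /= expr0n /= addr0 sqrtr_sqr gtr0_norm //; lra.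
    by case/andP: ht => t0 t1; rewrite ger0_norm //; nra.
have W' : plane_walk k (dedup n V') by apply: dedup_plane_walk; apply: tilt_plane_walk.
have SF p : (p < k)%N -> dedup n V' p <> dedup n V' p.+1 by exact: dedup_stall_free.
have NH p : (p < k)%N -> (dedup n V' p.+1 - dedup n V' p).2 <> 0.
  move=> hp; have := SF p hp; have [i [hi _ _ -> ->]] := dedup_edge hp => ne.
  rewrite /V' -tiltB; apply: (gen i hi) => /eqP; rewrite subr_eq0 => /eqP e.
  by apply: ne; rewrite /V' e.
have [g0 H0] := H m m1; have Hg := dedup_half_lift H0.
have S := walk_system W' SF NH Hg.
have [lt' L] := planar_order_exists S.
have e2 : 0 < eps / 2 by lra.
have [F [cF injF clF]] := walk_embedding W' SF NH L (turn_lt_ang W' SF NH Hg) k0 e2.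
pose M := \sum_(i < k) enorm (dedup n V' i.+1 - dedup n V' i).
have M0 : 0 <= M by apply: sumr_ge0 => i _; exact: enorm_ge0.
(* [M] is a Lipschitz constant of the shortened walk, so an error of [kappa] in time costs less than
   [eps / 2]. *)
pose kappa := eps / (2 * (M + 1)).
have kap0 : 0 < kappa by rewrite divr_gt0 // mulr_gt0 //; lra.
have kapM : kappa * M < eps / 2.
  have -> : eps / 2 = kappa * (M + 1) by rewrite /kappa; field; rewrite gt_eqF //; lra.
  by rewrite ltr_pM2l //; lra.
have kR : 0 < k%:R :> R by rewrite ltr0n.
pose P := progress V'.
(* Adding [kappa * t] makes the reparametrization strictly increasing; the factor brings its range
   back into [[0, k]]. *)
pose rho t := (P t + kappa * t) * (k%:R / (k%:R + kappa)).
have kk : 0 < k%:R / (k%:R + kappa) by rewrite divr_gt0 // addr_gt0.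
have rho_lt s t : s < t -> rho s < rho t.
  by move=> st; rewrite /rho ltr_pM2r // ler_ltD ?ltr_pM2l // progress_mono // ltW.
have rho01 t : 0 <= t <= 1 -> 0 <= rho t <= k%:R.
  move=> ht; have /andP[p0 p1] := progress_01 V' ht; have /andP[t0 t1] := ht.
  have kt0 : 0 <= kappa * t by rewrite mulr_ge0 // ltW.
  apply/andP; split; first by rewrite /rho mulr_ge0 ?(ltW kk) // addr_ge0.
  rewrite /rho.
  have kt : kappa * t <= kappa by rewrite -{2}[kappa]mulr1 ler_pM2l.
  by rewrite mulrA ler_pdivrMr ?addr_gt0 // mulrC ler_pM2l // lerD.
have rho_close t : 0 <= t <= 1 -> `|rho t - P t| <= kappa.
  move=> ht; have /andP[p0 p1] := progress_01 V' ht; have /andP[t0 t1] := ht.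
  have -> : rho t - P t = kappa * ((k%:R * t - P t) / (k%:R + kappa)).
    by rewrite /rho; field; rewrite gt_eqF // addr_gt0.
  rewrite normrM (gtr0_norm kap0) -[leRHS]mulr1 ler_pM2l // normrM normfV.
  have q0 : 0 < k%:R + kappa by rewrite addr_gt0.
  rewrite (gtr0_norm q0) ler_pdivrMr // mul1r.
  have kt : k%:R * t <= k%:R by rewrite -[leRHS]mulr1 ler_pM2l.
  have kt0 : 0 <= k%:R * t by rewrite mulr_ge0 // ltW.
  rewrite -/P in p0 p1; rewrite -/k in p1.
  by rewrite ler_norml; lra.
exists (fun t => cmul m (F (rho t))); split.
- apply: continuous_subspaceT; apply: (cont_comp (g := cmul m)); first exact: continuous_cmul.
  apply: (cont_comp (g := F)) => //; apply: contM; last exact: cont_cst.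
  apply: (@contD R R R); first exact: plin_continuous.
  by apply: contM; [exact: cont_cst|exact: cont_id].
- move=> s t; rewrite !inE => /unit_arcP hs /unit_arcP ht e.
  have {}e : rho s = rho t.
    by apply: injF; [exact: rho01|exact: rho01|rewrite -(cmulK m1 (F (rho s))) e cmulK].
  by case: (ltgtP s t) => // /rho_lt; rewrite e ltxx.
- move=> t /unit_arcP ht; rewrite -(enorm_tilt m1) tiltB cmulK // phiE // -(dedup_progress k0) //.
  set Phi := plin _ _ _; apply: le_lt_trans (enormDB _ (Phi (rho t)) _) _.
  have c1 := clF (rho t) (rho01 t ht).
  have c2 := plin_lip (dedup n V') k (rho t) (P t); rewrite -/Phi -/M in c2.
  have c3 : `|rho t - P t| * M <= kappa * M by rewrite ler_wpM2r // rho_close.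
  rewrite -/Phi in c1; rewrite [ltRHS]splitr; apply: ltr_leD; first exact: c1.
  by apply: le_trans c2 _; apply: le_trans c3 (ltW kapM).
Qed.

End Assembly.

(** * Crossing parity of two segments *)

Section Crossing.
Context {R : realType}.
Implicit Types (a b c d p w : R * R).

Definition orient a b c : R := det2 (b - a) (c - a).

Definition crossing a b c d : bool :=
  (orient a b c * orient a b d < 0) && (orient c d a * orient c d b < 0).

Lemma up_trans p q w : up p -> up q -> up w -> 0 < det2 p q -> 0 < det2 q w -> 0 < det2 p w.
Proof.
move: p q w => [a b] [a' b'] [a2 b2] /upP u /upP u' /upP u2; rewrite /det2 /= in u u' u2 *.
move=> h1 h2; have E : b' * (a * b2 - b * a2) = b2 * (a * b' - b * a') + b * (a' * b2 - b' * a2) by ring.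
have b0 : 0 <= b by lra.
have b20 : 0 <= b2 by lra.
have bb : 0 < b2 \/ b2 = 0 /\ 0 < a2 by [].
have k1 : 0 <= b * (a' * b2 - b' * a2) by rewrite mulr_ge0 // ltW.
case: u' => [h|[e h]]; last by rewrite e in h2; nra.
rewrite -(pmulr_rgt0 _ h) E; case: bb => [k|[k1' k2]].
  by rewrite ltr_wpDr // mulr_gt0.
by rewrite k1' in h2 *; nra.
Qed.

(** The four vectors are the corners of a parallelogram that runs once counterclockwise around the
    origin, so its boundary crosses the cut an odd number of times. *)
Lemma slit_cycle w00 w10 w11 w01 : w00 + w11 = w10 + w01 ->
  w00 <> 0 -> w10 <> 0 -> w11 <> 0 -> w01 <> 0 ->
  0 < det2 w00 w10 -> 0 < det2 w10 w11 -> 0 < det2 w11 w01 -> 0 < det2 w01 w00 ->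
  slit w00 w10 (+) slit w10 w11 (+) slit w11 w01 (+) slit w01 w00.
Proof.
move=> E n1 n2 n3 n4 d1 d2 d3 d4.
have anti p q : det2 q p = - det2 p q by rewrite /det2; ring.
have cyc p q w z : up p -> up q -> up w -> up z ->
    0 < det2 p q -> 0 < det2 q w -> 0 < det2 w z -> 0 < det2 z p -> False.
  move=> u1 u2 u3 u4 h1 h2 h3 h4.
  have := up_trans u1 u2 u3 h1 h2; have := up_trans u3 u4 u1 h3 h4.
  by rewrite (anti p w); lra.
have dN p q : det2 (- p) (- q) = det2 p q by rewrite /det2 /=; ring.
have upD p q : up p -> up q -> up (p + q).
  by move=> /upP h1 /upP h2; apply/upP => /=; lra.
rewrite /slit !(anti w00 w10) !(anti w10 w11) !(anti w11 w01) !(anti w01 w00) !oppr_gt0.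
rewrite d1 d2 d3 d4 (lt_gtF d1) (lt_gtF d2) (lt_gtF d3) (lt_gtF d4).
case u1 : (up w00); case u2 : (up w10); case u3 : (up w11); case u4 : (up w01) => //=.
- by case: (cyc w00 w10 w11 w01).
- have h := upD _ _ u1 u3; have : up (- w10 - w01).
    by apply: upD; rewrite upN // ?u2 ?u4.
  rewrite -opprD -E upN ?h // => e0; by rewrite e0 in h; move/upP: h => /=; lra.
- have h := upD _ _ u2 u4; have : up (- w00 - w11).
    by apply: upD; rewrite upN // ?u1 ?u3.
  rewrite -opprD E upN ?h // => e0; by rewrite e0 in h; move/upP: h => /=; lra.
- case: (cyc (- w00) (- w10) (- w11) (- w01)); rewrite ?dN ?upN // ?u1 ?u2 ?u3 ?u4 //.
Qed.

(** The differences of points of two segments fill the parallelogram with these corners, and the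
    segments meet iff it contains the origin. If it does not, its corners lie in an open half-plane,
    where the sum of slits around it is zero. *)
Lemma slit_crossing a b c d : orient a b c <> 0 -> orient a b d <> 0 ->
  orient c d a <> 0 -> orient c d b <> 0 ->
  crossing a b c d =
  slit (a - c) (b - c) (+) slit (b - c) (b - d) (+) slit (b - d) (a - d) (+) slit (a - d) (a - c).
Proof.
move=> o1 o2 o3 o4.
have D1 : det2 (a - c) (b - c) = orient a b c by rewrite /orient /det2 /=; ring.
have D2 : det2 (b - c) (b - d) = orient c d b by rewrite /orient /det2 /=; ring.
have D3 : det2 (b - d) (a - d) = - orient a b d by rewrite /orient /det2 /=; ring.
have D4 : det2 (a - d) (a - c) = - orient c d a by rewrite /orient /det2 /=; ring.
have E : orient a b c - orient a b d = orient c d b - orient c d a by rewrite /orient /det2 /=; ring.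
have anti p q : det2 q p = - det2 p q by rewrite /det2; ring.
have nz (x y : R * R) : det2 x y <> 0 -> x <> 0 /\ y <> 0.
  by move=> h; split=> e; apply: h; rewrite e /det2 /= ?mulr0 ?mul0r subrr.
have [n1 n2] : a - c <> 0 /\ b - c <> 0 by apply: nz; rewrite D1.
have [n4 _] : a - d <> 0 /\ a - c <> 0.
  by apply: nz; rewrite D4 => /eqP; rewrite oppr_eq0 => /eqP.
have [_ n3] : b - c <> 0 /\ b - d <> 0 by apply: nz; rewrite D2.
have sum : (a - c) + (b - d) = (b - c) + (a - d).
  by move: a b c d {o1 o2 o3 o4 D1 D2 D3 D4 E n1 n2 n3 n4} => [? ?] [? ?] [? ?] [? ?]; pair_ring.
rewrite /crossing.
case: (ltP (orient a b c * orient a b d) 0) => h1 /=; last first.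
  (* [c] and [d] lie on one side of the line [a b]; up to sign its normal has a positive product
     with all four differences. *)
  pose l : R * R := if 0 < orient a b c then (- (b - a).2, (b - a).1) else ((b - a).2, - (b - a).1).
  have s x : x = a \/ x = b -> forall y, y = c \/ y = d -> 0 < dot2 (- l) (x - y).
    have p1 : 0 < orient a b c * orient a b d.
      by rewrite lt_neqAle h1 andbT eq_sym mulf_eq0; apply/negP => /orP[/eqP|/eqP].
    move=> hx y hy; have k : 0 < (if 0 < orient a b c then 1 else -1) * orient a b y.
      case: (ltP 0 (orient a b c)) p1 => s1 p1.
        by rewrite mul1r; case: hy => -> //; rewrite -(pmulr_rgt0 _ s1).
      have s1' : orient a b c < 0 by rewrite lt_neqAle s1 andbT; apply/eqP.
      by rewrite mulN1r oppr_gt0; case: hy => -> //; rewrite -(nmulr_rgt0 _ s1').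
    move: k; rewrite /l; case: ifP => _ k; case: hx => ->; move: k;
      rewrite /orient /det2 /dot2 /=; lra.
  rewrite !(@slit_half _ (- l)); try (by apply: s; auto).
  by case: (_ < _); case: (up _); case: (up _); case: (up _); case: (up _).
case: (ltP (orient c d a * orient c d b) 0) => h2 /=; last first.
  pose l : R * R := if 0 < orient c d a then (- (d - c).2, (d - c).1) else ((d - c).2, - (d - c).1).
  have s x : x = a \/ x = b -> forall y, y = c \/ y = d -> 0 < dot2 l (x - y).
    have p1 : 0 < orient c d a * orient c d b.
      by rewrite lt_neqAle h2 andbT eq_sym mulf_eq0; apply/negP => /orP[/eqP|/eqP].
    move=> hy y hx; have k : 0 < (if 0 < orient c d a then 1 else -1) * orient c d x.
      case: (ltP 0 (orient c d a)) p1 => s1 p1.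
        by rewrite mul1r; case: hy => -> //; rewrite -(pmulr_rgt0 _ s1).
      have s1' : orient c d a < 0 by rewrite lt_neqAle s1 andbT; apply/eqP.
      by rewrite mulN1r oppr_gt0; case: hy => -> //; rewrite -(nmulr_rgt0 _ s1').
    move: k; rewrite /l; case: ifP => _ k; case: hx => ->; move: k;
      rewrite /orient /det2 /dot2 /=; lra.
  rewrite !(@slit_half _ l); try (by apply: s; auto).
  by case: (_ < _); case: (up _); case: (up _); case: (up _); case: (up _).
symmetry; case: (ltgtP (orient a b c) 0) => // s1; last first.
  have s2 : orient a b d < 0 by rewrite -(pmulr_rlt0 _ s1).
  have s3 : orient c d a < 0 /\ 0 < orient c d b.
    move: h2; case: (ltgtP (orient c d a) 0) => // t1; first by rewrite nmulr_rlt0.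
    by rewrite pmulr_rlt0 // => t2; lra.
  by apply: slit_cycle => //; rewrite ?D1 ?D2 ?D3 ?D4; lra.
have s2 : 0 < orient a b d by rewrite -(nmulr_rlt0 _ s1).
have s3 : 0 < orient c d a /\ orient c d b < 0.
  move: h2; case: (ltgtP (orient c d a) 0) => // t1; last by rewrite pmulr_rlt0.
  by rewrite nmulr_rlt0 // => t2; lra.
(* Here the parallelogram runs clockwise, so it is traversed backwards. *)
rewrite (slitC (a - c) (b - c)) (slitC (b - c) (b - d)) (slitC (b - d) (a - d)) (slitC (a - d) (a - c)).
have := @slit_cycle (a - c) (a - d) (b - d) (b - c).
have -> : det2 (a - c) (a - d) = orient c d a by rewrite anti D4 opprK.
have -> : det2 (a - d) (b - d) = orient a b d by rewrite anti D3 opprK.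
have -> : det2 (b - d) (b - c) = - orient c d b by rewrite anti D2.
have -> : det2 (b - c) (a - c) = - orient a b c by rewrite anti D1.
rewrite sum addrC => /(_ erefl n1 n4 n3 n2).
have -> : slit (b - c) (a - c) (+) slit (b - d) (b - c) (+) slit (a - d) (b - d) (+) slit (a - c) (a - d)
 = slit (a - c) (a - d) (+) slit (a - d) (b - d) (+) slit (b - d) (b - c) (+) slit (b - c) (a - c).
  by case: (slit _ _); case: (slit _ _); case: (slit _ _); case: (slit _ _).
by apply; lra.
Qed.

Lemma conv_orient a b p (t : R) c d : p = (1 - t) *: c + t *: d ->
  orient a b p = (1 - t) * orient a b c + t * orient a b d.
Proof. by move=> ->; move: a b c d => [? ?] [? ?] [? ?] [? ?]; rewrite /orient /det2 !scale_pairE /=; ring. Qed.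

Lemma seg_orient a b p : seg a b p -> orient a b p = 0.
Proof.
move=> [t _ /esym/conv_orient ->]; rewrite /orient /det2 /= !subrr.
by ring.
Qed.

Lemma crossing_seg a b c d : orient a b c <> 0 -> orient a b d <> 0 ->
  orient c d a <> 0 -> orient c d b <> 0 ->
  (exists p, seg a b p /\ seg c d p) <-> crossing a b c d.
Proof.
move=> o1 o2 o3 o4.
have key (x y t : R) : x <> 0 -> y <> 0 -> 0 <= t <= 1 -> (1 - t) * x + t * y = 0 -> x * y < 0.
  move=> nx ny /andP[t0 t1] e.
  have e2 : (1 - t) * x ^+ 2 + t * (x * y) = 0 by rewrite -[RHS](mulr0 x) -e; ring.
  have x2 : 0 < x ^+ 2 by rewrite lt_def sqr_ge0 sqrf_eq0 andbT; apply/eqP.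
  have t0' : 0 < t.
    rewrite lt_neqAle t0 andbT; apply/eqP => te; move: e; rewrite -te subr0 mul1r mul0r addr0.
    exact: nx.
  have t1' : t < 1.
    rewrite lt_neqAle t1 andbT; apply/eqP => te; move: e; rewrite te subrr mul1r mul0r add0r.
    exact: ny.
  have : t * (x * y) < 0.
    have : 0 < (1 - t) * x ^+ 2 by rewrite mulr_gt0 // subr_gt0.
    lra.
  by rewrite pmulr_rlt0.
split.
  move=> [p [s1 s2]]; apply/andP; split.
    have := seg_orient s1; case: s2 => t /unit_arcP ht /esym/conv_orient ->.
    exact: key.
  have := seg_orient s2; case: s1 => t /unit_arcP ht /esym/conv_orient ->.
  exact: key.
move=> /andP[h1 h2].
have E : orient a b c - orient a b d = orient c d b - orient c d a by rewrite /orient /det2 /=; ring.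
have nE : orient a b c - orient a b d != 0.
  apply/eqP => e; have e' : orient a b c = orient a b d by lra.
  by move: h1; rewrite e' -expr2; have := sqr_ge0 (orient a b d); lra.
have frac (x y : R) : x * y < 0 -> 0 <= x / (x - y) <= 1.
  move=> h; case: (ltgtP x 0) => hx; last by rewrite hx mul0r ltxx in h.
    have hy : 0 < y by rewrite -(nmulr_rlt0 _ hx).
    have -> : x / (x - y) = - x / (y - x) by rewrite -[y - x]opprB invrN mulrNN.
    have hd : 0 < y - x by lra.
    by rewrite divr_ge0 ?ler_pdivrMr ?mul1r ?oppr_ge0 ?(ltW hd) ?(ltW hx) //=; lra.
  have hy : y < 0 by rewrite -(pmulr_rlt0 _ hx).
  have hd : 0 < x - y by lra.
  by rewrite divr_ge0 ?ler_pdivrMr ?mul1r ?(ltW hd) ?(ltW hx) //=; lra.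
pose t := orient a b c / (orient a b c - orient a b d).
pose s := orient c d a / (orient c d a - orient c d b).
have nE2 : orient c d a - orient c d b != 0 by rewrite -opprB -E oppr_eq0.
exists ((1 - t) *: c + t *: d); split; last by exists t => //; apply/unit_arcP; exact: frac.
exists s; first by apply/unit_arcP; exact: frac.
rewrite /s /t; move: nE nE2 {s t E frac key o1 o2 o3 o4 h1 h2}.
move: a b c d => [a1 a2] [b1 b2] [c1 c2] [d1 d2]; rewrite /orient /det2 /= => nE nE2.
by apply: plane_eq; rewrite !scale_pairE /=; field; rewrite nE nE2.
Qed.

Lemma crossing_uniq a b c d p q : orient a b c <> 0 ->
  seg a b p -> seg c d p -> seg a b q -> seg c d q -> p = q.
Proof.
move=> o1 s1 [t _ e1] s2 [u _ e2].
have h1 := seg_orient s1; have h2 := seg_orient s2.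
rewrite (conv_orient _ _ (esym e1)) in h1; rewrite (conv_orient _ _ (esym e2)) in h2.
suff -> : p = q by [].
rewrite -e1 -e2; congr ((1 - _) *: _ + _ *: _).
all: have : (t - u) * (orient a b c - orient a b d) = 0 by lra.
all: move=> /eqP; rewrite mulf_eq0 subr_eq0 => /orP[/eqP //|/eqP e].
all: have e' : orient a b c = orient a b d by lra.
all: by exfalso; apply: o1; rewrite -e' in h1; lra.
Qed.

End Crossing.

(** * Crossings of a general position map *)

Lemma big_addb_tele (F : nat -> bool) a b : (a <= b)%N ->
  \big[addb/false]_(a <= l < b) (F l (+) F l.+1) = F a (+) F b.
Proof.
move=> /subnK <-; elim: (b - a)%N => [|k IH]; first by rewrite add0n big_geq // addbb.
rewrite addSn big_nat_recr ?leq_addl //= IH.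
by case: (F a); case: (F (k + a)%N); case: (F _).
Qed.

Lemma not_uniq3 (T : eqType) (s t u : T) : ~~ uniq [:: s; t; u] -> [\/ s = t, s = u | t = u].
Proof.
rewrite /= !inE andbT negb_and !negbK -orbA => /or3P[] /eqP; by [constructor 1|constructor 2|constructor 3].
Qed.

Section Fine.
Context {R : realType}.
Variables (f : R -> R * R) (xs ys : seq R).
Hypothesis Tx : triangulation xs.
Hypothesis Ty : triangulation ys.
Hypothesis xs_ys : {subset xs <= ys}.
Hypothesis Lin : linear_on_edges f ys.
Hypothesis no_collinear : forall a b c, a \in ys -> b \in ys -> c \in ys ->
  uniq [:: a; b; c] -> ~ collinear (f a) (f b) (f c).
Hypothesis no_triple : forall s t u, unit_arc s -> unit_arc t -> unit_arc u ->
  f s = f t -> f t = f u -> ~~ uniq [:: s; t; u].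
Let n := nedges xs.
Let N := nedges ys.

Definition pos_in i := index xs`_i ys.
Let K := pos_in.
Let P l := f ys`_l.

Lemma pos_inP i : (i <= n)%N -> (K i <= N)%N /\ ys`_(K i) = xs`_i.
Proof.
move=> hi; have h : xs`_i \in ys by apply: xs_ys; rewrite mem_nth // tri_size.
split; last by rewrite nth_index.
by have := h; rewrite -index_mem tri_size.
Qed.

Lemma ys_inj i j : (i <= N)%N -> (j <= N)%N -> ys`_i = ys`_j -> i = j.
Proof.
move=> hi hj; wlog ij : i j hi hj / (i <= j)%N.
  by move=> hw; case: (leqP i j) => [|/ltnW] h e; [apply: hw|symmetry; apply: hw].
move: ij; rewrite leq_eqVlt => /orP[/eqP //|ij] e.
have := z_lt (z := fun i => ys`_i) (tri_lt Ty) (i := i) (j := j).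
by rewrite ij hj e ltxx => /(_ isT).
Qed.

Lemma pos_in_mono i j : (i < j <= n)%N -> (K i < K j)%N.
Proof.
move=> /andP[ij hj]; have hi : (i <= n)%N by lia.
have [h1 e1] := pos_inP hi; have [h2 e2] := pos_inP hj.
have lt := z_lt (z := fun i => xs`_i) (tri_lt Tx) (i := i) (j := j).
rewrite ltnNge; apply/negP => h.
have := z_le (z := fun i => ys`_i) (tri_lt Ty) (i := K j) (j := K i).
rewrite h h1 e1 e2 => /(_ isT); rewrite leNgt => /negP; apply; apply: lt.
by rewrite ij.
Qed.

Lemma orient_neq0 i j k : (i <= N)%N -> (j <= N)%N -> (k <= N)%N ->
  i <> j -> i <> k -> j <> k -> orient (P i) (P j) (P k) <> 0.
Proof.
move=> hi hj hk n1 n2 n3.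
have mem l : (l <= N)%N -> ys`_l \in ys by move=> hl; rewrite mem_nth // tri_size.
apply: (no_collinear (mem _ hi) (mem _ hj) (mem _ hk)).
rewrite /= !inE negb_or andbT; apply/andP; split.
  by apply/andP; split; apply/eqP => /ys_inj; auto.
by apply/eqP => /ys_inj; auto.
Qed.

Lemma fine_seg l s : (l < N)%N -> ys`_l <= s <= ys`_l.+1 -> seg (P l) (P l.+1) (f s).
Proof.
move=> hl hs; have [t01 es] := convex_pt (tri_lt Ty hl) hs.
move: (_ / _) t01 es => t t01 es; exists t; first by apply/unit_arcP.
by rewrite {1}es (Lin hl) //; apply/unit_arcP.
Qed.

Lemma fine_seg_ex l p : (l < N)%N -> seg (P l) (P l.+1) p ->
  exists2 s, ys`_l <= s <= ys`_l.+1 & p = f s.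
Proof.
move=> hl [t ht e]; exists ((1 - t) * ys`_l + t * ys`_l.+1); last by rewrite (Lin hl).
have /andP[t0 t1] := (unit_arcP t).1 ht; have := tri_lt Ty hl; nra.
Qed.

Lemma fine_locate i s : (i < n)%N -> xs`_i <= s <= xs`_i.+1 ->
  exists2 l, (K i <= l < K i.+1)%N & ys`_l <= s <= ys`_l.+1.
Proof.
move=> hi hs; have hi' : (i <= n)%N by lia.
have [h1 e1] := pos_inP hi'; have [h2 e2] := pos_inP hi.
have km : (K i < K i.+1)%N by apply: pos_in_mono; lia.
have [||l hl hls] := @locate R (fun l => ys`_(K i + l)) (K i.+1 - K i) s.
- lia.
- by rewrite addn0 subnKC ?(ltnW km) // e1 e2.
by exists (K i + l)%N; [lia|rewrite addnS in hls].
Qed.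

Lemma fine_sub i l s : (i < n)%N -> (K i <= l < K i.+1)%N -> ys`_l <= s <= ys`_l.+1 ->
  xs`_i <= s <= xs`_i.+1.
Proof.
move=> hi hl /andP[h1 h2]; have hi' : (i <= n)%N by lia.
have [k1 e1] := pos_inP hi'; have [k2 e2] := pos_inP hi.
rewrite -e1 -e2; apply/andP; split.
  by apply: le_trans h1; apply: (z_le (z := fun i => ys`_i) (tri_lt Ty)); lia.
by apply: le_trans h2 _; apply: (z_le (z := fun i => ys`_i) (tri_lt Ty)); lia.
Qed.

Definition fine_cross l k := crossing (P l) (P l.+1) (P k) (P k.+1).
Definition fine_pt l k : R * R := xget 0 (seg (P l) (P l.+1) `&` seg (P k) (P k.+1)).
Definition fine_cells i j := [seq c <- allpairs pair (index_iota (K i) (K i.+1))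
  (index_iota (K j) (K j.+1)) | fine_cross c.1 c.2].

Section Cell.
Variables (i j : nat).
Hypothesis ij : (i.+1 < j)%N.
Hypothesis jn : (j < n)%N.

Lemma cell_lt l k : (K i <= l < K i.+1)%N -> (K j <= k < K j.+1)%N ->
  [/\ (l.+1 < k)%N, (l < N)%N & (k < N)%N].
Proof.
move=> hl hk; have h1 : (K i.+1 < K j)%N by apply: pos_in_mono; lia.
have [h2 _] := pos_inP jn; split; lia.
Qed.

Lemma cell_orient l k : (K i <= l < K i.+1)%N -> (K j <= k < K j.+1)%N ->
  [/\ orient (P l) (P l.+1) (P k) <> 0, orient (P l) (P l.+1) (P k.+1) <> 0,
      orient (P k) (P k.+1) (P l) <> 0 & orient (P k) (P k.+1) (P l.+1) <> 0].
Proof.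
by move=> hl hk; have [h1 h2 h3] := cell_lt hl hk; split; apply: orient_neq0; lia.
Qed.

Lemma fine_cellsP c : c \in fine_cells i j <->
  [/\ (K i <= c.1 < K i.+1)%N, (K j <= c.2 < K j.+1)%N & fine_cross c.1 c.2].
Proof.
rewrite mem_filter; split.
  move=> /andP[h /allpairsP[[l k] /= [h1 h2 e]]]; subst c.
  by rewrite !mem_index_iota in h1 h2.
case: c => l k /= [h1 h2 ->]; apply/allpairsP; exists (l, k).
by rewrite !mem_index_iota.
Qed.

Lemma fine_ptP c : c \in fine_cells i j ->
  seg (P c.1) (P c.1.+1) (fine_pt c.1 c.2) /\ seg (P c.2) (P c.2.+1) (fine_pt c.1 c.2).
Proof.
move=> /fine_cellsP[h1 h2 h3]; have [ o1 o2 o3 o4] := cell_orient h1 h2.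
have [p [s1 s2]] := (crossing_seg o1 o2 o3 o4).2 h3.
rewrite /fine_pt; case: xgetP => [q _ []|/(_ p) []] //.
Qed.

Lemma fine_params c : c \in fine_cells i j -> exists s t,
  [/\ ys`_c.1 <= s <= ys`_c.1.+1, ys`_c.2 <= t <= ys`_c.2.+1, fine_pt c.1 c.2 = f s
    & fine_pt c.1 c.2 = f t].
Proof.
move=> hc; have [s1 s2] := fine_ptP hc; have /fine_cellsP[h1 h2 h3] := hc.
have [_ h4 h5] := cell_lt h1 h2.
have [s hs es] := fine_seg_ex h4 s1; have [t ht et] := fine_seg_ex h5 s2.
by exists s, t.
Qed.

(** A parameter on two fine edges is a vertex, and its image on edge [m] would make three vertices
    collinear. *)
Lemma same_param (m l l' : nat) (s : R) (p : R * R) : (l < N)%N -> (l' < N)%N -> (m < N)%N ->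
  (l.+1 < m)%N \/ (m.+1 < l)%N -> (l'.+1 < m)%N \/ (m.+1 < l')%N ->
  ys`_l <= s <= ys`_l.+1 -> ys`_l' <= s <= ys`_l'.+1 -> f s = p ->
  seg (P m) (P m.+1) p -> l = l'.
Proof.
wlog ll : l l' / (l <= l')%N.
  by move=> hw; case: (leqP l l') => [|/ltnW] h *; [apply: hw|symmetry; apply: hw].
move=> hl hl' hm d1 d2 /andP[a1 a2] /andP[a3 a4] es sp.
move: ll; rewrite leq_eqVlt => /orP[/eqP //|ll].
have h1 := z_le (z := fun i => ys`_i) (tri_lt Ty) (i := l.+1) (j := l').
have {}h1 : ys`_l.+1 <= ys`_l' by apply: h1; rewrite ll ltnW.
have e1 : s = ys`_l' by apply/eqP; rewrite eq_le a3 andbT; apply: le_trans a2 h1.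
exfalso; apply: (@orient_neq0 m m.+1 l'); try lia.
by rewrite /P -e1 es; exact: seg_orient.
Qed.

Lemma param_arc l s : (l < N)%N -> ys`_l <= s <= ys`_l.+1 -> unit_arc s.
Proof.
move=> hl /andP[h1 h2]; apply/unit_arcP.
have /andP[a _] := tri_01 Ty (ltnW hl); have /andP[_ b] := tri_01 Ty hl.
by rewrite (le_trans a h1) (le_trans h2 b).
Qed.

(** A common point of two crossing pairs has preimages [s], [s'] on edge [i] and [t], [t'] on edge
    [j], and these edges are disjoint. Without triple points this forces [s = s'] and [t = t']. *)
Lemma fine_pt_inj : {in fine_cells i j &, injective (fun c => fine_pt c.1 c.2)}.
Proof.
move=> c c' hc hc' /= e.
have [s [t [hs ht es et]]] := fine_params hc; have [s' [t' [hs' ht' es' et']]] := fine_params hc'.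
have /fine_cellsP[c1 c2 _] := hc; have /fine_cellsP[c1' c2' _] := hc'.
have [d1 d2 d3] := cell_lt c1 c2; have [d1' d2' d3'] := cell_lt c1' c2'.
have [d4 _ _] := cell_lt c1 c2'; have [d5 _ _] := cell_lt c1' c2.
have lt u w : xs`_i <= u <= xs`_i.+1 -> xs`_j <= w <= xs`_j.+1 -> u <> w.
  move=> /andP[_ h1] /andP[h2 _] euw.
  have h3 := z_lt (z := fun i => xs`_i) (tri_lt Tx) (i := i.+1) (j := j).
  have {}h3 : xs`_i.+1 < xs`_j by apply: h3; rewrite ij ltnW.
  by move: (le_lt_trans h1 (lt_le_trans h3 h2)); rewrite euw ltxx.
have hi : (i < n)%N by exact: ltn_trans (ltnW ij) jn.
have si := fine_sub hi c1 hs; have si' := fine_sub hi c1' hs'.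
have jt := fine_sub jn c2 ht; have jt' := fine_sub jn c2' ht'.
have ss : s = s'.
  case: (not_uniq3 (no_triple (param_arc d2 hs) (param_arc d2' hs') (param_arc d3 ht)
    (etrans (esym es) (etrans e es')) (etrans (esym es') (etrans (esym e) et)))) => // h.
    by case: (lt _ _ si jt h).
  by case: (lt _ _ si' jt h).
have tt : t = t'.
  case: (not_uniq3 (no_triple (param_arc d3 ht) (param_arc d3' ht') (param_arc d2 hs)
    (etrans (esym et) (etrans e et')) (etrans (esym et') (etrans (esym e) es)))) => // h.
    by case: (lt _ _ si jt (esym h)).
  by case: (lt _ _ si jt' (esym h)).
have [s1 s2] := fine_ptP hc.
have e1 : c.1 = c'.1.
  by apply: (same_param d2 d2' d3 (or_introl d1) (or_introl d5) hs _ (esym es) s2); rewrite ss.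
have e2 : c.2 = c'.2.
  by apply: (same_param d3 d3' d2 (or_intror d1) (or_intror d4) ht _ (esym et) s1); rewrite tt.
by rewrite (surjective_pairing c) (surjective_pairing c') e1 e2.
Qed.

Lemma cell_image : (f @` edge xs i) `&` (f @` edge xs j) =
  [set p | p \in [seq fine_pt c.1 c.2 | c <- fine_cells i j]].
Proof.
have hi : (i < n)%N by lia.
apply/seteqP; split=> p /=.
  rewrite /edge /= => -[[s hs es] [t ht et]]; rewrite !in_itv /= in hs ht.
  have [l hl hls] := fine_locate hi hs; have [k hk hkt] := fine_locate jn ht.
  have [d1 d2 d3] := cell_lt hl hk; have [ o1 o2 o3 o4] := cell_orient hl hk.
  have s1 := fine_seg d2 hls; have s2 := fine_seg d3 hkt; rewrite es in s1; rewrite et in s2.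
  have X : fine_cross l k by apply/(crossing_seg o1 o2 o3 o4); exists p.
  have hc : (l, k) \in fine_cells i j by apply/fine_cellsP.
  have [s3 s4] := fine_ptP hc.
  by apply/mapP; exists (l, k) => //=; apply: (crossing_uniq o1 s1 s2).
move=> /mapP[c hc ->]; have [s [t [hs ht es et]]] := fine_params hc.
have /fine_cellsP[c1 c2 _] := hc.
split; [exists s|exists t] => //; rewrite /edge /= in_itv /=.
  exact: fine_sub hs.
exact: fine_sub ht.
Qed.

Lemma card_cell : #|` fset_set ((f @` edge xs i) `&` (f @` edge xs j))| = size (fine_cells i j).
Proof.
rewrite cell_image.
set L := [seq _ | _ <- _]; have -> : [set p | p \in L] = [set` [fset p in L]%fset].
  by apply/seteqP; split=> p /=; rewrite inE.
rewrite set_fsetK card_fseq undup_id ?size_map //.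
rewrite map_inj_in_uniq; last exact: fine_pt_inj.
by rewrite filter_uniq // allpairs_uniq ?iota_uniq // => -[a b] [c d].
Qed.

End Cell.
End Fine.

Lemma odd_count (T : Type) (a : pred T) s : odd (count a s) = \big[addb/false]_(x <- s) a x.
Proof. by elim: s => [|x s IH] /=; rewrite ?big_nil // big_cons oddD IH; case: (a x). Qed.

(** * Crossing parity as a sum over the sides of a cell *)

Section HalfPlane.
Context {R : realType}.

Lemma slit_tele (l : R * R) (w : nat -> R * R) a b : (a <= b)%N ->
  (forall k, (a <= k <= b)%N -> 0 < dot2 l (w k)) ->
  \big[addb/false]_(a <= k < b) slit (w k) (w k.+1) = slit (w a) (w b).
Proof.
move=> ab h; rewrite (@slit_half _ l) ?h ?leqnn ?ab //.
rewrite (eq_big_nat _ _ (F2 := fun k => ((l.1 < 0) && up (w k)) (+) ((l.1 < 0) && up (w k.+1)))); last first.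
  move=> k /andP[k1 k2]; rewrite (@slit_half _ l) ?h //; first by case: (l.1 < 0).
    by rewrite k1 ltnW.
  by rewrite k2 andbT ltnW.
by rewrite (big_addb_tele (fun k => (l.1 < 0) && up (w k))) //; case: (l.1 < 0).
Qed.

Lemma slit_square (l w0 w1 u0 u1 : R * R) : 0 < dot2 l w0 -> 0 < dot2 l w1 -> 0 < dot2 l u0 ->
  0 < dot2 l u1 -> slit w0 w1 = slit w0 u0 (+) slit u0 u1 (+) slit w1 u1.
Proof.
move=> h1 h2 h3 h4; rewrite !(@slit_half _ l) //.
by case: (l.1 < 0); case: (up w0); case: (up w1); case: (up u0); case: (up u1).
Qed.

(** [l] is the bisector of the two directions. It vanishes only if they are opposite, and then the
    segment contains the origin. *)
Lemma half_plane (w0 w1 : R * R) : ~ seg w0 w1 0 -> exists2 l, 0 < dot2 l w0 & 0 < dot2 l w1.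
Proof.
move=> h; have n0 : w0 <> 0 by move=> e; apply: h; rewrite e; exact: seg_l.
have n1 : w1 <> 0 by move=> e; apply: h; rewrite e; exact: seg_r.
have a0 := enorm_gt0 n0; have a1 := enorm_gt0 n1.
set a := enorm w0 in a0 *; set b := enorm w1 in a1 *; pose l := b *: w0 + a *: w1.
have ab : 0 < a + b by lra.
have l0 : l <> 0.
  move=> e; apply: h; exists (a / (a + b)).
    apply/unit_arcP/andP; split; first by rewrite divr_ge0 // ltW.
    by rewrite ler_pdivrMr // mul1r lerDl ltW.
  have -> : 1 - a / (a + b) = b / (a + b) by field; rewrite gt_eqF.
  have -> : (b / (a + b)) *: w0 + (a / (a + b)) *: w1 = (a + b)^-1 *: l.
    by rewrite /l scalerDr !scalerA; congr (_ *: _ + _ *: _); rewrite mulrC.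
  by rewrite e scaler0.
have l2 := enorm_gt0 l0; have : 0 < enorm l ^+ 2 by rewrite exprn_gt0.
have E0 : a ^+ 2 = w0.1 ^+ 2 + w0.2 ^+ 2 by rewrite sqr_enorm.
have E1 : b ^+ 2 = w1.1 ^+ 2 + w1.2 ^+ 2 by rewrite sqr_enorm.
have -> : enorm l ^+ 2 = 2 * (a * b) * (a * b + dot2 w0 w1).
  rewrite sqr_enorm /l /dot2 /=.
  transitivity (b ^+ 2 * (w0.1 ^+ 2 + w0.2 ^+ 2) + a ^+ 2 * (w1.1 ^+ 2 + w1.2 ^+ 2) +
    2 * (a * b) * (w0.1 * w1.1 + w0.2 * w1.2)); first by rewrite /GRing.scale /=; ring.
  by rewrite -E0 -E1; ring.
rewrite pmulr_rgt0; last by rewrite !mulr_gt0.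
move=> k; exists l.
  have -> : dot2 l w0 = a * (a * b + dot2 w0 w1); last by rewrite mulr_gt0.
  transitivity (b * (w0.1 ^+ 2 + w0.2 ^+ 2) + a * dot2 w0 w1).
    by rewrite /l /dot2 /= /GRing.scale /=; ring.
  by rewrite -E0; ring.
have -> : dot2 l w1 = b * (a * b + dot2 w0 w1); last by rewrite mulr_gt0.
transitivity (a * (w1.1 ^+ 2 + w1.2 ^+ 2) + b * dot2 w0 w1).
  by rewrite /l /dot2 /= /GRing.scale /=; ring.
by rewrite -E1; ring.
Qed.

Lemma dot2_tilt (m p q : R * R) : m.1 ^+ 2 + m.2 ^+ 2 = 1 -> dot2 (tilt m p) (tilt m q) = dot2 p q.
Proof.
move=> h; transitivity ((m.1 ^+ 2 + m.2 ^+ 2) * dot2 p q); last by rewrite h mul1r.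
by rewrite /dot2 /tilt /dot2 /det2 /=; ring.
Qed.

Lemma det2_tilt (m p q : R * R) : m.1 ^+ 2 + m.2 ^+ 2 = 1 -> det2 (tilt m p) (tilt m q) = det2 p q.
Proof.
move=> h; transitivity ((m.1 ^+ 2 + m.2 ^+ 2) * det2 p q); last by rewrite h mul1r.
by rewrite /det2 /tilt /dot2 /det2 /=; ring.
Qed.

Lemma orient_tilt (m a b c : R * R) : m.1 ^+ 2 + m.2 ^+ 2 = 1 ->
  orient (tilt m a) (tilt m b) (tilt m c) = orient a b c.
Proof. by move=> h; rewrite /orient -!tiltB det2_tilt. Qed.

(** [t1] and [t2] count modulo 2 how often the difference vector crosses the cut along a side of
    [I^*]. The last two clauses say that only the ends of a side matter when the difference stays in
    an open half-plane, as it does on red sides. *)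
Theorem general_position_parity (m : R * R) (xs : seq R) (f : R -> R * R) :
  m.1 ^+ 2 + m.2 ^+ 2 = 1 -> triangulation xs -> general_position xs f ->
  let n := nedges xs in
  exists t1 t2 : nat -> nat -> bool,
  [/\ forall i j, (i.+1 < j)%N -> (j < n)%N ->
        odd #|` fset_set ((f @` edge xs i) `&` (f @` edge xs j))| =
        t1 i j (+) t1 i.+1 j (+) t2 i j (+) t2 i j.+1,
      forall a j l, (a <= n)%N -> (j < n)%N ->
        (forall s, xs`_j <= s <= xs`_j.+1 -> 0 < dot2 l (f xs`_a - f s)) ->
        t1 a j = slit (tilt m (f xs`_a - f xs`_j)) (tilt m (f xs`_a - f xs`_j.+1)) &
      forall i b l, (i < n)%N -> (b <= n)%N ->
        (forall s, xs`_i <= s <= xs`_i.+1 -> 0 < dot2 l (f s - f xs`_b)) ->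
        t2 i b = slit (tilt m (f xs`_i - f xs`_b)) (tilt m (f xs`_i.+1 - f xs`_b))].
Proof.
move=> um Tx [ys [Ty xs_ys Lin ncol ntri]] n.
pose K := pos_in xs ys; pose P l := f ys`_l.
pose A l k := slit (tilt m (P l - P k)) (tilt m (P l.+1 - P k)).
pose B l k := slit (tilt m (P l - P k)) (tilt m (P l - P k.+1)).
exists (fun a j => \big[addb/false]_(K j <= k < K j.+1) B (K a) k),
  (fun i b => \big[addb/false]_(K i <= l < K i.+1) A l (K b)).
have KP i : (i <= n)%N -> P (K i) = f xs`_i by move=> hi; rewrite /P (pos_inP Tx Ty xs_ys hi).2.
have Kle i : (i < n)%N -> (K i <= K i.+1)%N.
  by move=> hi; apply: ltnW; apply: (pos_in_mono Tx Ty xs_ys); rewrite ltnSn.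
have Ksub i k : (i < n)%N -> (K i <= k <= K i.+1)%N -> xs`_i <= ys`_k <= xs`_i.+1.
  move=> hi /andP[h1 h2].
  have [k1 e1] := pos_inP Tx Ty xs_ys (ltnW hi); have [k2 e2] := pos_inP Tx Ty xs_ys hi.
  rewrite -e1 -e2 !(tri_le Ty) //; rewrite ?h1 ?h2 ?k2 //=.
  exact: leq_trans k2.
split.
- move=> i j ij jn; rewrite (card_cell Tx Ty xs_ys Lin ncol ntri ij jn) size_filter odd_count big_allpairs_dep.
  have hi : (i < n)%N by exact: ltn_trans (ltnW ij) jn.
  (* Each pair of fine edges contributes the four sides of its parallelogram, and the sides shared
     by neighbouring pairs cancel in the double sum. *)
  transitivity (\big[addb/false]_(K i <= l < K i.+1) \big[addb/false]_(K j <= k < K j.+1)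
     ((A l k (+) A l k.+1) (+) (B l k (+) B l.+1 k))).
    apply: eq_big_nat => l hl; apply: eq_big_nat => k hk /=.
    have [ o1 o2 o3 o4] := cell_orient Tx Ty xs_ys ncol ij jn hl hk.
    rewrite /fine_cross.
    have -> : crossing (f ys`_l) (f ys`_l.+1) (f ys`_k) (f ys`_k.+1) =
      crossing (tilt m (P l)) (tilt m (P l.+1)) (tilt m (P k)) (tilt m (P k.+1)).
      by rewrite /crossing !orient_tilt.
    rewrite slit_crossing ?orient_tilt // -!tiltB -/(A l k) -/(B l.+1 k).
    rewrite [slit (tilt m (P l.+1 - P k.+1)) _]slitC -/(A l k.+1).
    rewrite [slit (tilt m (P l - P k.+1)) _]slitC -/(B l k).
    by case: (A l k); case: (A l k.+1); case: (B l k); case: (B l.+1 k).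
  under eq_big_nat => l hl do rewrite big_split /=.
  rewrite big_split /=.
  have -> : \big[addb/false]_(K i <= l < K i.+1) \big[addb/false]_(K j <= k < K j.+1) (A l k (+) A l k.+1) =
     \big[addb/false]_(K i <= l < K i.+1) (A l (K j) (+) A l (K j.+1)).
    by apply: eq_big_nat => l hl; rewrite big_addb_tele ?Kle.
  rewrite exchange_big_nat /=.
  have -> : \big[addb/false]_(K j <= k < K j.+1) \big[addb/false]_(K i <= l < K i.+1) (B l k (+) B l.+1 k) =
     \big[addb/false]_(K j <= k < K j.+1) (B (K i) k (+) B (K i.+1) k).
    by apply: eq_big_nat => k hk; rewrite (big_addb_tele (fun l => B l k)) ?Kle.
  rewrite !big_split /=; set x1 := bigop _ _ _; set x2 := bigop _ _ _; set x3 := bigop _ _ _.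
  by set x4 := bigop _ _ _; case: x1; case: x2; case: x3; case: x4.
- move=> a j l ha hj h.
  rewrite -(KP a) // -(KP j) ?(ltnW hj) // -(KP j.+1) //.
  rewrite (@slit_tele (tilt m l) (fun k => tilt m (P (K a) - P k))) ?Kle // => k hk.
  by rewrite dot2_tilt // KP // h // Ksub.
move=> i b l hi hb h.
rewrite -(KP b) // -(KP i) ?(ltnW hi) // -(KP i.+1) //.
rewrite (@slit_tele (tilt m l) (fun k => tilt m (P k - P (K b)))) ?Kle // => k hk.
by rewrite dot2_tilt // KP // h // Ksub.
Qed.

End HalfPlane.

(** * The complex cut along the red sides *)

Lemma big_addb_const (T : finType) (A : {pred T}) (b : bool) :
  \big[addb/false]_(x in A) b = b && odd #|A|.
Proof. by rewrite big_const; elim: #|A| => [|k /= ->]; [rewrite andbF|case: b; rewrite ?andbT //= ; case: (odd k)]. Qed.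

Lemma big_addb_delta (T : finType) (P : pred T) (x0 : T) (F : T -> bool) :
  \big[addb/false]_(x | P x) ((x == x0) && F x) = P x0 && F x0.
Proof.
case: (boolP (P x0)) => h /=.
  by rewrite (bigD1 x0) //= eqxx big1 ?addbF // => x /andP[_ /negPf ->].
by rewrite big1 // => x hx; case: eqP hx h => [-> ->|].
Qed.

Lemma natr_Z2_eq0 (k : nat) : (k%:R == 0 :> 'Z_2) = ~~ odd k.
Proof. by rewrite -val_eqE /= Zp_nat /= modn2 eqb0. Qed.

Section Cut.
Variable n : nat.
Implicit Types (c d : cell n) (e : side n) (C : {set cell n}).

Definition face1 c : side n := inl (widen_ord (leqnSn n) (val c).1, (val c).2).
Definition face2 c : side n := inl (lift ord0 (val c).1, (val c).2).
Definition face3 c : side n := inr ((val c).1, widen_ord (leqnSn n) (val c).2).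
Definition face4 c : side n := inr ((val c).1, lift ord0 (val c).2).

Lemma is_faceP e c : reflect [\/ e = face1 c, e = face2 c, e = face3 c | e = face4 c] (is_face e c).
Proof.
apply: (iffP idP).
  case: e => -[x y] /=; rewrite /endpoint.
    move=> /andP[/orP[] /eqP h /eqP h'].
      by constructor 1; rewrite /face1 -h'; congr (inl (_, _)); apply: val_inj.
    by constructor 2; rewrite /face2 -h'; congr (inl (_, _)); apply: val_inj; rewrite /= h.
  move=> /andP[/eqP h' /orP[] /eqP h].
    by constructor 3; rewrite /face3 -h'; congr (inr (_, _)); apply: val_inj.
  by constructor 4; rewrite /face4 -h'; congr (inr (_, _)); apply: val_inj; rewrite /= h.
by case=> ->; rewrite /= /endpoint ?lift0 !eqxx ?orbT.
Qed.

Lemma faces_sum (s : side n -> bool) c :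
  \big[addb/false]_(e | is_face e c) s e = s (face1 c) (+) s (face2 c) (+) s (face3 c) (+) s (face4 c).
Proof.
have N12 : face2 c != face1 c by apply/eqP => -[h]; move: h (h) => _ /=; rewrite /bump /=; lia.
have N34 : face4 c != face3 c by apply/eqP => -[h]; move: h (h) => _ /=; rewrite /bump /=; lia.
have f1 : is_face (face1 c) c by apply/is_faceP; constructor.
have f2 : is_face (face2 c) c by apply/is_faceP; constructor.
have f3 : is_face (face3 c) c by apply/is_faceP; constructor.
have f4 : is_face (face4 c) c by apply/is_faceP; constructor.
rewrite (bigD1 (face1 c)) // (bigD1 (face2 c)) ?f2 // (bigD1 (face3 c)) ?f3 // (bigD1 (face4 c)) ?f4 //.
rewrite big1 /= ?addbF ?addbA // => e /andP[/andP[/andP[/andP[/is_faceP h n1] n2] n3] n4].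
by case: h n1 n2 n3 n4 => ->; rewrite eqxx.
Qed.

Definition cells_of e : {set cell n} := [set c | is_face e c]%SET.

(** A cell with the side [e] is determined by whether the vertex in [e] is the first end of its
    edge, which [k] records. *)
Lemma card_cells_of e : (#|cells_of e| <= 2)%N.
Proof.
rewrite -card_bool; pose k c := match e with inl (a, j) => (a == (val c).1 :> nat) | inr (i, b) => (b == (val c).2 :> nat) end.
rewrite -(card_in_imset (f := k) (D := cells_of e)); first by apply: max_card.
move=> c d; rewrite !inE /k => hc hd E; apply: val_inj.
case: e hc hd @k E => -[x y] /=; rewrite /endpoint.
  move=> /andP[h1 /eqP h2] /andP[h3 /eqP h4] E.
  rewrite (surjective_pairing (val c)) (surjective_pairing (val d)) -h2 -h4; congr pair.
  apply: val_inj => /=; case: eqP E h1 => [h1|n1] /esym; case: eqP h3 => //=.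
    by rewrite -h1 => ->.
  by move=> _ /eqP h3 _ /eqP; rewrite h3 => -[].
move=> /andP[/eqP h2 h1] /andP[/eqP h4 h3] E.
rewrite (surjective_pairing (val c)) (surjective_pairing (val d)) -h2 -h4; congr pair.
apply: val_inj => /=; case: eqP E h1 => [h1|n1] /esym; case: eqP h3 => //=.
  by rewrite -h1 => ->.
by move=> _ /eqP h3 _ /eqP; rewrite h3 => -[].
Qed.

Variable red : pred (side n).

Definition glue : rel (cell n) := [rel c d | [exists e, [&& is_face e c, is_face e d & ~~ red e]]].

Definition closed_component C :=
  (C \in equivalence_partition (connect glue) [set: cell n]%SET) &&
  [forall c in C, forall e, is_face e c && boundary_side e ==> red e].

Lemma glue_sym : symmetric glue.
Proof.
move=> c d; apply/existsP/existsP => -[e /and3P[h1 h2 h3]]; exists e; by rewrite h1 h2 h3.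
Qed.

Lemma glue_equiv : {in [set: cell n]%SET & &, equivalence_rel (connect glue)}.
Proof. move=> c d x _ _ _; split; [exact: connect0|by move=> h; rewrite (same_connect (sym_connect_sym glue_sym) h)]. Qed.

Lemma component_glued C c d : C \in equivalence_partition (connect glue) [set: cell n]%SET ->
  c \in C -> (d \in C) = connect glue c d.
Proof.
move=> hC hc; rewrite -(pblock_equivalence_partition glue_equiv) ?inE //.
have /and3P[_ tr _] := equivalence_partitionP glue_equiv.
by rewrite (def_pblock tr hC hc).
Qed.

(** [p] is the coboundary of a $\mathbb{Z}_2$-cochain relative to the red sides. *)
Definition face_sum (p : cell n -> bool) := exists s : side n -> bool,
  (forall e, red e -> s e = false) /\ (forall c, \big[addb/false]_(e | is_face e c) s e = p c).

Lemma face_sum_eq p q : p =1 q -> face_sum p -> face_sum q.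
Proof. by move=> e [s [h1 h2]]; exists s; split=> // c; rewrite h2 e. Qed.

Lemma face_sum0 : face_sum (fun=> false).
Proof. by exists (fun=> false); split=> // c; rewrite big1. Qed.

Lemma face_sumD p q : face_sum p -> face_sum q -> face_sum (fun c => p c (+) q c).
Proof.
move=> [s [h1 h2]] [t [h3 h4]]; exists (fun e => s e (+) t e); split.
  by move=> e re; rewrite h1 ?h3.
by move=> c; rewrite big_split /= h2 h4.
Qed.

Lemma face_sum_side e : ~~ red e -> face_sum (fun c => is_face e c).
Proof.
move=> ne; exists (fun x => x == e); split.
  by move=> x rx; apply: contraNF ne => /eqP <-.
move=> c; rewrite -[RHS]andbT -(big_addb_delta (fun x => is_face x c) e (fun=> true)).
by apply: eq_bigr => x _; rewrite andbT.
Qed.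

(** Two distinct cells glued along a side are all the cells at that side, so their sum is its
    coboundary. *)
Lemma face_sum_connect c d : connect glue c d -> face_sum (fun x => (x == c) (+) (x == d)).
Proof.
move=> /connectP[w]; elim: w c => [|x w IH] c /= h e.
  by apply: face_sum_eq face_sum0 => y; rewrite e addbb.
move/andP: h => [/existsP[si /and3P[h1 h2 h3]] h].
have step : face_sum (fun y => (y == c) (+) (y == x)).
  case: (eqVneq c x) => [->|cx]; first by apply: face_sum_eq face_sum0 => y; rewrite addbb.
  apply: face_sum_eq (face_sum_side h3) => y.
  have /eqP E : [set c; x]%SET == cells_of si.
    by rewrite eqEcard cards2 cx card_cells_of andbT; apply/fintype.subsetP => z; rewrite !inE => /orP[] /eqP ->.
  have : (y \in cells_of si) = is_face si y by rewrite inE.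
  rewrite -E !inE => <-; case: (eqVneq y c) => [->|_] //=; rewrite (negPf cx) //.
apply: face_sum_eq (face_sumD step (IH _ h e)) => y.
by case: (y == c); case: (y == x); case: (y == d).
Qed.

Lemma face_sum_big (I : Type) (r : seq I) (P : pred I) (F : I -> cell n -> bool) :
  (forall i, P i -> face_sum (F i)) -> face_sum (fun c => \big[addb/false]_(i <- r | P i) F i c).
Proof.
move=> h; elim: r => [|i r IH]; first by apply: face_sum_eq face_sum0 => c; rewrite big_nil.
case: (boolP (P i)) => hi.
  by apply: face_sum_eq (face_sumD (h _ hi) IH) => c; rewrite big_cons hi.
by apply: face_sum_eq IH => c; rewrite big_cons (negPf hi).
Qed.

(** The second relative cohomology has one generator for each closed component. A non-red side of a
    closed component has two cells, both in the component, so coboundaries sum to zero there.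
    Conversely every cell can be moved within its component to a base cell, where an even number of
    copies cancels; in a component that is not closed the base cell alone is a coboundary. *)
Theorem cut_exact p :
  face_sum p <-> forall C, closed_component C -> \big[addb/false]_(c in C) p c = false.
Proof.
split.
  move=> [s [s_red s_sum]] C /andP[hC /forallP bd].
  rewrite -(eq_bigr _ (fun c _ => s_sum c)) (exchange_big_dep xpredT) //= big1 // => e _.
  case: (boolP (red e)) => re; first by rewrite big1 // => c _; rewrite s_red.
  rewrite (eq_bigl (fun c => c \in C :&: cells_of e)); last by move=> c; rewrite !inE.
  rewrite big_addb_const; apply/negbTE; rewrite negb_and orbC; apply/orP; left.
  case: (set_0Vmem (C :&: cells_of e)) => [->|[c]]; first by rewrite cards0.
  rewrite !inE => /andP[cC ce].
  have -> : (C :&: cells_of e)%SET = cells_of e.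
    apply/finset.setIidPr/fintype.subsetP => d; rewrite inE => de; rewrite (component_glued d hC cC).
    by apply: connect1; apply/existsP; exists e; rewrite ce de re.
  have := bd c; rewrite cC => /forallP /(_ e); rewrite ce (negPf re) implybF /boundary_side.
  have := card_cells_of e; have : (0 < #|cells_of e|)%N by apply/card_gt0P; exists c; rewrite inE.
  by rewrite /cells_of; case: #|_| => [|[|[|k]]].
move=> h.
apply: (face_sum_eq (p := fun c => \big[addb/false]_(C in equivalence_partition (connect glue) [set: cell n]%SET)
    \big[addb/false]_(d in C) (p d && (c == d)))).
  move=> c; rewrite -(set_partition_big _ (equivalence_partitionP glue_equiv)).
  transitivity (\big[addb/false]_(d in [set: cell n]%SET) ((d == c) && p d)).
    by apply: eq_bigr => d _; rewrite andbC eq_sym.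
  by rewrite big_addb_delta inE.
apply: face_sum_big => C hC.
case: (boolP (closed_component C)) => cC.
  case: (set_0Vmem C) => [->|[c0 hc0]].
    by apply: face_sum_eq face_sum0 => c; rewrite big_set0.
  apply: (face_sum_eq (p := fun c => \big[addb/false]_(d in C) (p d && ((c == c0) (+) (c == d))))).
    move=> c; transitivity ((\big[addb/false]_(d in C) (p d && (c == c0))) (+)
        \big[addb/false]_(d in C) (p d && (c == d))).
      by rewrite -big_split /=; apply: eq_bigr => d _; rewrite andb_addr.
    have -> : \big[addb/false]_(d in C) (p d && (c == c0)) = false; last by rewrite addFb.
    case: (c == c0); last by rewrite big1 // => d _; rewrite andbF.
    by apply: etrans (h C cC); apply: eq_bigr => d _; rewrite andbT.
  apply: face_sum_big => d hd; case: (p d); last exact: face_sum0.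
  by apply: face_sum_connect; rewrite -(component_glued d hC hc0).
(* The coboundary of a non-red side on the boundary of [I^*] is a single cell. *)
have [c0 [hc0 hs]] : exists c0, c0 \in C /\ face_sum (fun c => c == c0).
  move: cC; rewrite /closed_component hC /= negb_forall => /existsP[c0]; rewrite negb_imply => /andP[hc0].
  rewrite negb_forall => /existsP[e]; rewrite negb_imply => /andP[/andP[he bd] re].
  exists c0; split=> //; apply: face_sum_eq (face_sum_side re) => c.
  move: bd => /cards1P[c1 E].
  have : c0 \in cells_of e by rewrite inE.
  have : (c \in cells_of e) = is_face e c by rewrite inE.
  by rewrite /cells_of E !inE => <- /eqP ->.
apply: face_sum_big => d hd; case: (p d); last exact: face_sum0.
have := face_sumD hs (face_sum_connect (c := c0) (d := d) _); rewrite -(component_glued d hC hc0) => /(_ hd).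
by apply: face_sum_eq => c; rewrite addbA addbb.
Qed.

End Cut.

(** * The van Kampen obstruction and half-lifts *)

Lemma conv_ge (R : realType) (c x y t : R) : c <= x -> c <= y -> 0 <= t -> t <= 1 ->
  c <= (1 - t) * x + t * y.
Proof. by nra. Qed.

Lemma perturb_gt0 (R : realType) (c k w x y z : R) : 0 < c + k * - (2 * w) -> c <= x ->
  `|y| <= w * k -> `|z| <= w * k -> 0 < x + y - z.
Proof. by rewrite !ler_norml => h1 h2 /andP[h3 h4] /andP[h5 h6]; lra. Qed.

Section Red.
Context {R : realType}.
Variables (phi : R -> R * R) (xs : seq R).
Hypothesis T : triangulation xs.
Hypothesis Lin : linear_on_edges phi xs.
Let n := nedges xs.
Let V a := phi xs`_a.

Lemma edge_seg j s : (j < n)%N -> xs`_j <= s <= xs`_j.+1 -> seg (V j) (V j.+1) (phi s).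
Proof.
move=> hj hs; have [t01 es] := convex_pt (tri_lt T hj) hs.
move: (_ / _) t01 es => t t01 es; exists t; first by apply/unit_arcP.
by rewrite {1}es (Lin hj) //; apply/unit_arcP.
Qed.

Lemma edge_image j p : (j < n)%N -> (phi @` edge xs j) p <-> seg (V j) (V j.+1) p.
Proof.
move=> hj; split=> [[s hs <-]|[t ht <-]].
  by apply: edge_seg => //; move: hs; rewrite /edge /= in_itv.
exists ((1 - t) * xs`_j + t * xs`_j.+1); last by rewrite (Lin hj).
rewrite /edge /= in_itv /=.
have /andP[t0 t1] := (unit_arcP t).1 ht; have := tri_lt T hj; nra.
Qed.

Lemma dot2_bound (l e : R * R) (k : R) : enorm e < k -> `|dot2 l e| <= (`|l.1| + `|l.2|) * k.
Proof.
move=> h; have e1 : `|e.1| <= enorm e.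
  by rewrite -sqrtr_sqr; apply: ler_wsqrtr; rewrite lerDl sqr_ge0.
have e2 : `|e.2| <= enorm e.
  by rewrite -sqrtr_sqr; apply: ler_wsqrtr; rewrite lerDr sqr_ge0.
rewrite (le_trans (ler_normD _ _)) // !normrM mulrDl lerD //.
  by rewrite ler_wpM2l // (le_trans e1) // ltW.
by rewrite ler_wpM2l // (le_trans e2) // ltW.
Qed.

Lemma dot2_conv (l p q w : R * R) (t : R) : dot2 l (p - ((1 - t) *: q + t *: w)) =
  (1 - t) * dot2 l (p - q) + t * dot2 l (p - w).
Proof. by rewrite /dot2 /= /GRing.scale /=; ring. Qed.

(** On a red side the differences of [phi] fill a segment that misses the origin, so they lie in an
    open half-plane at a positive distance from its border, and small perturbations stay inside. *)
Lemma red_half_plane a j : (a <= n)%N -> (j < n)%N -> ~ seg (V j) (V j.+1) (V a) ->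
  small (fun eps : R => forall f, close_to eps f phi -> exists l,
    forall s, xs`_j <= s <= xs`_j.+1 -> 0 < dot2 l (f xs`_a - f s) /\ 0 < dot2 l (V a - phi s)).
Proof.
move=> ha hj red.
have [|l l0 l1] := @half_plane R (V a - V j) (V a - V j.+1).
  move=> [t ht e]; apply: red; exists t => //.
  apply/eqP; rewrite -subr_eq0 -oppr_eq0; apply/eqP; rewrite -{}e opprB.
  by rewrite !scalerBr addrACA -opprD -scalerDl subrK scale1r.
pose c := Num.min (dot2 l (V a - V j)) (dot2 l (V a - V j.+1)).
have c0 : 0 < c by rewrite lt_min l0.
have cs s : xs`_j <= s <= xs`_j.+1 -> c <= dot2 l (V a - phi s).
  move=> hs; have [t /unit_arcP /andP[t0 t1] <-] := edge_seg hj hs.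
  have -> : dot2 l (V a - ((1 - t) *: V j + t *: V j.+1)) =
     (1 - t) * dot2 l (V a - V j) + t * dot2 l (V a - V j.+1).
    exact: dot2_conv.
  have h1 : c <= dot2 l (V a - V j) by rewrite ge_min lexx.
  have h2 : c <= dot2 l (V a - V j.+1) by rewrite ge_min lexx orbT.
  exact: conv_ge.
apply: small_sub (small_affine (- (2 * (`|l.1| + `|l.2|))) c0) => eps e0 he f close; exists l => s hs.
have h := cs s hs; split; last exact: lt_le_trans h.
have us : unit_arc s.
  apply/unit_arcP; case/andP: hs => h1 h2; have /andP[a0 _] := tri_01 T (ltnW hj).
  by have /andP[_ a1] := tri_01 T hj; rewrite (le_trans a0 h1) (le_trans h2 a1).
have ua : unit_arc xs`_a by apply/unit_arcP; exact: tri_01.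
have b1 := dot2_bound l (close _ ua); have b2 := dot2_bound l (close _ us).
have -> : dot2 l (f xs`_a - f s) = dot2 l (V a - phi s) + dot2 l (f xs`_a - V a) - dot2 l (f s - phi s).
  by rewrite /dot2 /=; ring.
exact: perturb_gt0 he h b1 b2.
Qed.

Variable m : R * R.
Hypothesis um : m.1 ^+ 2 + m.2 ^+ 2 = 1.

Definition side_forms (f : R -> R * R) (t1 t2 : nat -> nat -> bool) :=
  (forall a j l, (a <= n)%N -> (j < n)%N ->
        (forall s, xs`_j <= s <= xs`_j.+1 -> 0 < dot2 l (f xs`_a - f s)) ->
        t1 a j = slit (tilt m (f xs`_a - f xs`_j)) (tilt m (f xs`_a - f xs`_j.+1))) /\
  (forall i b l, (i < n)%N -> (b <= n)%N ->
        (forall s, xs`_i <= s <= xs`_i.+1 -> 0 < dot2 l (f s - f xs`_b)) ->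
        t2 i b = slit (tilt m (f xs`_i - f xs`_b)) (tilt m (f xs`_i.+1 - f xs`_b))).

(** Whether the cut is crossed when the difference of [f] at two vertices is turned into that of
    [phi]; it compares the side counts of [f] with the slits of [phi]. *)
Definition swing (f : R -> R * R) a b := slit (tilt m (f xs`_a - f xs`_b)) (tilt m (V a - V b)).

Lemma red_sides : small (fun eps : R => forall f t1 t2, close_to eps f phi -> side_forms f t1 t2 ->
  forall a j, (a <= n)%N -> (j < n)%N -> ~ seg (V j) (V j.+1) (V a) ->
   t1 a j = swing f a j (+) slit (tilt m (V a - V j)) (tilt m (V a - V j.+1)) (+) swing f a j.+1 /\
   t2 j a = swing f j a (+) slit (tilt m (V j - V a)) (tilt m (V j.+1 - V a)) (+) swing f j.+1 a).
Proof.
have main : small (fun eps : R => forall a, (a < n.+1)%N -> forall j, (j < n)%N ->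
    ~ seg (V j) (V j.+1) (V a) -> forall f, close_to eps f phi -> exists l,
    forall s, xs`_j <= s <= xs`_j.+1 -> 0 < dot2 l (f xs`_a - f s) /\ 0 < dot2 l (V a - phi s)).
  apply: small_all => a ha; apply: small_all => j hj; apply: small_imp => red.
  exact: red_half_plane.
apply: small_sub main => eps e0 main f t1 t2 close [F1 F2] a j ha hj red.
have [l hl] := main a ha j hj red f close.
have lj := tri_lt T hj.
have [p1 p2] : 0 < dot2 l (f xs`_a - f xs`_j) /\ 0 < dot2 l (V a - V j) by apply: hl; rewrite lexx ltW.
have [q1 q2] : 0 < dot2 l (f xs`_a - f xs`_j.+1) /\ 0 < dot2 l (V a - V j.+1) by apply: hl; rewrite lexx ltW.
have dN (x y : R * R) : dot2 (- l) (y - x) = dot2 l (x - y) by rewrite /dot2 /=; ring.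
split.
  rewrite (F1 a j l) //; last by move=> s hs; case: (hl s hs).
  by apply: (@slit_square _ (tilt m l)); rewrite dot2_tilt.
rewrite (F2 j a (- l)) //; last by move=> s hs; rewrite dN; case: (hl s hs).
by apply: (@slit_square _ (tilt m (- l))); rewrite dot2_tilt // dN.
Qed.

Lemma red_sideP (e : side n) : red_side phi e <-> match e with
  | inl (a, j) => ~ seg (V j) (V j.+1) (V a)
  | inr (i, b) => ~ seg (V i) (V i.+1) (V b) end.
Proof.
case: e => -[a j] /=; split=> [/asboolP h s|h]; try (by apply: h; apply/edge_image);
  by apply/asboolP => /edge_image k; apply: h; apply: k.
Qed.

(** The vertex of a side belongs to one edge of the cell; if the images of the two edges are
    disjoint, the image of that vertex is off the other edge. *)
Lemma in_red_setE (e : side n) : in_red_set phi e = red_side phi e.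
Proof.
apply/orP/idP => [[//|/existsP[c /andP[ec /asboolP rc]]]|]; last by left.
have edge0 (i : 'I_n) : (phi @` edge xs i) (V i).
  by apply/edge_image => //; exact: seg_l.
have edge1 (i : 'I_n) : (phi @` edge xs i) (V i.+1).
  by apply/edge_image => //; exact: seg_r.
have no p : (phi @` edge xs (val c).1) p -> (phi @` edge xs (val c).2) p -> False.
  by move=> h1 h2; have : set0 p by rewrite -rc.
case: e ec => -[a j] /= /andP[].
  by move=> /orP[] /eqP h1 /eqP h2; apply/asboolP; rewrite h1 h2; apply: no.
by move=> /eqP h2 /orP[] /eqP h1; apply/asboolP; rewrite h1 h2 => h; apply: (no _ h).
Qed.

Lemma obstruction_componentE (C : {set cell n}) :
  obstruction_component phi C = closed_component (red_side phi (xs := xs)) C.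
Proof.
rewrite /obstruction_component /closed_component; congr (_ && _).
by under eq_forallb => c do under eq_forallb => e do rewrite in_red_setE.
Qed.

Definition cell_parity (f : R -> R * R) (c : cell n) : bool :=
  odd #|` fset_set ((f @` edge xs (val c).1) `&` (f @` edge xs (val c).2))|.

Lemma obstruction_of_map_eq0 f : obstruction_of_map phi xs f = 0 <->
  face_sum (red_side phi (xs := xs)) (cell_parity f).
Proof.
rewrite cut_exact; split=> [/ffunP h C hC|h].
  have oC : obstruction_component phi C by rewrite obstruction_componentE.
  have := h (Sub C oC); rewrite !ffunE SubK /intersection_parity -natr_sum => /eqP.
  rewrite natr_Z2_eq0 (big_morph odd oddD (erefl : odd 0 = false)) => /negPf E.
  exact: E.
apply/ffunP => C; rewrite !ffunE /intersection_parity -natr_sum; apply/eqP.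
rewrite natr_Z2_eq0 (big_morph odd oddD (erefl : odd 0 = false)).
have := h (val C); rewrite /cell_parity => -> //.
by rewrite -obstruction_componentE; exact: (valP C).
Qed.

Definition side_of (t1 t2 : nat -> nat -> bool) (e : side n) : bool :=
  match e with inl (a, j) => t1 a j | inr (i, b) => t2 i b end.

Lemma side_of_faces t1 t2 c : \big[addb/false]_(e | is_face e c) side_of t1 t2 e =
  t1 (val c).1 (val c).2 (+) t1 (val c).1.+1 (val c).2 (+)
  t2 (val c).1 (val c).2 (+) t2 (val c).1 (val c).2.+1.
Proof. by rewrite faces_sum. Qed.

(** Adding the coboundary of [G], the half-lift corrected by the swings, keeps the sum around each
    cell and annihilates the side counts on red sides. *)
Theorem half_lift_obstruction g : half_lift n (fun a => tilt m (V a)) g ->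
  is_van_kampen_obstruction phi xs 0.
Proof.
move=> [g1 g2]; have [eps e0 main] := small_ex red_sides; exists eps => // f gp close.
apply/obstruction_of_map_eq0.
have [t1 [t2 [par s1 s2]]] := general_position_parity um T gp.
have {main} red := main f t1 t2 close (conj s1 s2).
pose G a b := g a b (+) swing f a b.
pose d1 a j := t1 a j (+) G a j (+) G a j.+1.
pose d2 i b := t2 i b (+) G i b (+) G i.+1 b.
(* The relations of a half-lift are available above the diagonal only, where the sides of cells lie;
   elsewhere the cochain is set to zero. *)
exists (fun e => [exists c : cell n, is_face e c] && side_of d1 d2 e).
split=> [e re|c]; last first.
  rewrite (eq_bigr (side_of d1 d2)); last first.
    by move=> e he; have -> : [exists c : cell n, is_face e c] by apply/existsP; exists c.
  rewrite side_of_faces /cell_parity (par (val c).1 (val c).2) ?(valP c) // /d1 /d2.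
  set i : nat := (val c).1; set j : nat := (val c).2.
  case: (G i j); case: (G i.+1 j); case: (G i j.+1); case: (G i.+1 j.+1);
  by case: (t1 i j); case: (t1 i.+1 j); case: (t2 i j); case: (t2 i j.+1).
have seg_tilt' a b w : seg (tilt m (V a)) (tilt m (V b)) (tilt m (V w)) -> seg (V a) (V b) (V w).
  by move/(seg_tilt um); rewrite tiltK.
case: existsP => //= -[c ec]; move/red_sideP: re.
have cP : ((val c).1.+1 < (val c).2)%N := valP c.
case: e ec => -[x y] /= /andP[].
  move=> hx /eqP hy re.
  have xy : (x < y < n)%N by rewrite ltn_ord andbT hy; case/orP: hx => /eqP ->; rewrite // ltnW.
  rewrite /d1 /G; have [-> _] := red x y (ltn_ord x) (ltn_ord y) re.
  rewrite !tiltB -g1 //; last by move/seg_tilt'.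
  by case: (swing f x y); case: (swing f x y.+1); case: (g x y); case: (g x y.+1).
move=> /eqP hx hy re.
have xy : (x.+1 < y <= n)%N.
  apply/andP; split; last exact: (ltn_ord y).
  by rewrite hx; case/orP: hy => /eqP ->; rewrite // (ltn_trans cP).
rewrite /d2 /G; have [_ ->] := red y x (ltn_ord y) (ltn_ord x) re.
rewrite !tiltB -g2 //; last by move/seg_tilt'.
by case: (swing f x y); case: (swing f x.+1 y); case: (g x y); case: (g x.+1 y).
Qed.

(** The region above the diagonal is simply connected. [G a b] sums along the path from [(0, 1)]
    through [(0, b)] to [(a, b)], and the cells move the first relation from one [a] to the next. *)
Lemma cocycle_primitive (d1 d2 : nat -> nat -> bool) :
  (forall i j, (i.+1 < j)%N -> (j < n)%N ->
     d1 i j (+) d1 i.+1 j (+) d2 i j (+) d2 i j.+1 = false) ->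
  exists G : nat -> nat -> bool,
    (forall a j, (a < j < n)%N -> d1 a j = G a j (+) G a j.+1) /\
    (forall i b, (i.+1 < b <= n)%N -> d2 i b = G i b (+) G i.+1 b).
Proof.
move=> coc; pose G a b := \big[addb/false]_(1 <= j < b) d1 0%N j (+) \big[addb/false]_(0 <= i < a) d2 i b.
have G2 i b : G i b (+) G i.+1 b = d2 i b.
  rewrite /G big_nat_recr //=; case: (\big[_/_]_(_ <= _ < _) _); case: (\big[_/_]_(_ <= _ < _) _);
  by case: (d2 i b).
have G1 a j : (a < j < n)%N -> G a j (+) G a j.+1 = d1 a j.
  elim: a => [|a IH] /andP[aj jn].
    have E b : G 0%N b = \big[addb/false]_(1 <= j < b) d1 0%N j by rewrite /G [X in _ (+) X]big_geq // addbF.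
    rewrite !E big_nat_recr //=.
    by case: (\big[_/_]_(_ <= _ < _) _); case: (d1 _ _).
  have := coc a j aj jn; rewrite -IH ?(ltnW aj) // -(G2 a j) -(G2 a j.+1).
  by case: (G a j); case: (G a.+1 j); case: (G a j.+1); case: (G a.+1 j.+1); case: (d1 _ _).
by exists G; split=> [a j h|i b h]; rewrite ?G1 ?G2.
Qed.

Theorem obstruction_half_lift :
  (forall eps : R, 0 < eps -> exists2 f, general_position xs f & close_to eps f phi) ->
  is_van_kampen_obstruction phi xs 0 -> exists g, half_lift n (fun a => tilt m (V a)) g.
Proof.
move=> gpx [e1 e10 van]; have [e2 e20 main] := small_ex red_sides.
have [|f gp close] := gpx (Num.min e1 e2); first by rewrite lt_min e10.
have {}van : obstruction_of_map phi xs f = 0.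
  by apply: van => // t ht; apply: lt_le_trans (close t ht) _; rewrite ge_min lexx.
have [t1 [t2 [par s1 s2]]] := general_position_parity um T gp.
have {main} red : forall a j, (a <= n)%N -> (j < n)%N -> ~ seg (V j) (V j.+1) (V a) ->
   t1 a j = swing f a j (+) slit (tilt m (V a - V j)) (tilt m (V a - V j.+1)) (+) swing f a j.+1 /\
   t2 j a = swing f j a (+) slit (tilt m (V j - V a)) (tilt m (V j.+1 - V a)) (+) swing f j.+1 a.
  apply: main (conj s1 s2) => t ht; apply: lt_le_trans (close t ht) _; by rewrite ge_min lexx orbT.
move/obstruction_of_map_eq0: van => [s [s_red s_sum]].
pose u1 (a j : nat) := match insub a : option 'I_n.+1, insub j : option 'I_n with
  | Some x, Some y => s (inl (x, y)) | _, _ => false end.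
pose u2 (i b : nat) := match insub i : option 'I_n, insub b : option 'I_n.+1 with
  | Some x, Some y => s (inr (x, y)) | _, _ => false end.
have u1E (x : 'I_n.+1) (y : 'I_n) : u1 x y = s (inl (x, y)) by rewrite /u1 !valK.
have u2E (x : 'I_n) (y : 'I_n.+1) : u2 x y = s (inr (x, y)) by rewrite /u2 !valK.
(* The correction [s] vanishes on red sides, so this cocycle still equals the side counts there. *)
have [|G [G1 G2]] := @cocycle_primitive (fun a j => t1 a j (+) u1 a j) (fun i b => t2 i b (+) u2 i b).
  move=> i j ij jn; have hi : (i < n)%N by exact: ltn_trans (ltnW ij) jn.
  pose c : cell n := exist _ (Ordinal hi, Ordinal jn) ij.
  have := s_sum c; rewrite faces_sum /face1 /face2 /face3 /face4 -!u1E -!u2E /cell_parity (par i j) //=.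
  rewrite -!/(bump 0 _) /bump !add1n.
  case: (t1 i j); case: (t1 i.+1 j); case: (t2 i j); case: (t2 i j.+1);
  by case: (u1 i j); case: (u1 i.+1 j); case: (u2 i j); case: (u2 i j.+1).
have seg_tilt' a b w : seg (V a) (V b) (V w) -> seg (tilt m (V a)) (tilt m (V b)) (tilt m (V w)).
  by move=> h; apply/(seg_tilt um); rewrite tiltK.
exists (fun a b => G a b (+) swing f a b); split=> [a j /andP[aj jn]|i b /andP[ib bn]] h.
  have ha : (a < n.+1)%N by rewrite ltnS ltnW // (ltn_trans aj).
  have hs : ~ seg (V j) (V j.+1) (V a) by move/seg_tilt'.
  have := G1 a j; rewrite aj jn => /(_ isT).
  have [-> _] := red a j ha jn hs.
  have -> : u1 a j = false.
    have -> : u1 a j = s (inl (Ordinal ha, Ordinal jn)) by rewrite -u1E.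
    by apply: s_red; apply/red_sideP.
  rewrite -!tiltB; set X := slit _ _; clear.
  by case: (G a j); case: (G a j.+1); case: (swing f a j); case: (swing f a j.+1); case: X.
have hi : (i < n)%N by exact: leq_trans (ltnW ib) bn.
have hs : ~ seg (V i) (V i.+1) (V b) by move/seg_tilt'.
have := G2 i b; rewrite ib bn => /(_ isT).
have [_ ->] := red b i bn hi hs.
have -> : u2 i b = false.
  have hb : (b < n.+1)%N by [].
  have -> : u2 i b = s (inr (Ordinal hi, Ordinal hb)) by rewrite -u2E.
  by apply: s_red; apply/red_sideP.
rewrite -!tiltB; set X := slit _ _; clear.
by case: (G i b); case: (G i.+1 b); case: (swing f i b); case: (swing f i.+1 b); case: X.
Qed.

End Red.

(** * Existence of general position maps *)

Section Avoid.
Context {R : realType}.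

Lemma small_quadratic (a b k : R) : (a, b, k) <> (0, 0, 0) -> small (fun r => a + r * (b + r * k) <> 0).
Proof.
move=> h.
have pos (a' b' k' : R) : 0 < a' -> small (fun r => a' + r * (b' + r * k') <> 0).
  move=> a0; apply: small_sub (small_and (small_affine (- (`|b'| + `|k'|)) a0) (small_lt ltr01)).
  move=> r r0 [h1 h2]; apply/eqP; rewrite gt_eqF //; apply: lt_le_trans h1 _.
  have := ler_norm (- b'); have := ler_norm (- k'); have := normr_ge0 k'; rewrite !normrN.
  move: `|b'| `|k'| => x y; clear h => y0 ky bx.
  have rk : - y <= r * k' by nra.
  by rewrite lerD2l ler_pM2l //; lra.
have nz (a' b' k' : R) : a' != 0 -> small (fun r => a' + r * (b' + r * k') <> 0).
  rewrite neq_lt => /orP[a0|]; last exact: pos.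
  apply: small_sub (pos (- a') (- b') (- k') _); last by rewrite oppr_gt0.
  by move=> r _ h1 h2; apply: h1; rewrite -[RHS]oppr0 -{}h2; ring.
case: (eqVneq a 0) => [a0|]; last exact: nz.
case: (eqVneq b 0) => [b0|].
  case: (eqVneq k 0) => [k0|kn]; first by case: h; rewrite a0 b0 k0.
  apply: small_sub (small_const kn) => r r0 kn'.
  by rewrite a0 b0 !add0r => /eqP; rewrite !mulf_eq0 (negPf kn') (gt_eqF r0).
move=> bn; apply: small_sub (nz b k 0 bn) => r r0; rewrite a0 mulr0 addr0 add0r => h1 /eqP.
by rewrite mulf_eq0 (gt_eqF r0) /= => /eqP.
Qed.

(** Points of a parabola through [v]: a given line contains at most two of them, hence none with
    small positive [r]. *)
Definition arc_pt (v : R * R) (r : R) : R * R := v + (r, r ^+ 2).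

Lemma small_line c d v : c <> d -> small (fun r => orient c d (arc_pt v r) <> 0).
Proof.
move=> cd; pose a := orient c d v.
have [|e e0 h] := @small_quadratic a (- (d - c).2) (d - c).1.
  move=> [_ h2 h1]; apply: cd; apply/eqP; rewrite eq_sym -subr_eq0; apply/eqP; apply: plane_eq => //=.
  by rewrite -[LHS]opprK h2 oppr0.
exists e => // r hr E; apply: (h r hr); rewrite -E /a /orient /det2 /arc_pt /=; ring.
Qed.

Lemma small_arc_pt v (eps : R) : 0 < eps -> small (fun r => enorm (arc_pt v r - v) < eps).
Proof.
move=> e0; have e2 : 0 < eps / 2 by lra.
apply: small_sub (small_and (small_lt e2) (small_lt ltr01)) => r r0 [h1 h2].
apply: (@le_lt_trans _ _ (2 * r)); last by lra.
rewrite enorm_le /arc_pt; last by lra.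
rewrite addrAC subrr add0r /=.
have q1 : r ^+ 2 <= 1 by nra.
have -> : (2 * r) ^+ 2 = r ^+ 2 + 3 * r ^+ 2 by ring.
by have := sqr_ge0 r; move: (r ^+ 2) q1 => q q1 q0; rewrite lerD2l expr2; nra.
Qed.

Lemma avoid_lines N (F G H : nat -> nat -> (R * R) * (R * R)) v (eps : R) : 0 < eps ->
  exists2 p, enorm (p - v) < eps & forall i j, (i < N)%N -> (j < N)%N ->
    [/\ (F i j).1 <> (F i j).2 -> orient (F i j).1 (F i j).2 p <> 0,
        (G i j).1 <> (G i j).2 -> orient (G i j).1 (G i j).2 p <> 0
      & (H i j).1 <> (H i j).2 -> orient (H i j).1 (H i j).2 p <> 0].
Proof.
move=> e0.
have one (L : nat -> nat -> (R * R) * (R * R)) : small (fun r => forall i, (i < N)%N -> forall j, (j < N)%N ->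
    (L i j).1 <> (L i j).2 -> orient (L i j).1 (L i j).2 (arc_pt v r) <> 0).
  by apply: small_all => i _; apply: small_all => j _; apply: small_imp; exact: small_line.
have [r r0 [h [h1 [h2 h3]]]] := small_ex (small_and (small_arc_pt v e0)
  (small_and (one F) (small_and (one G) (one H)))).
by exists (arc_pt v r) => // i j hi hj; split; [exact: h1|exact: h2|exact: h3].
Qed.

End Avoid.

Section General.
Context {R : realType}.
Variables (V : nat -> R * R) (eps : R).
Hypothesis eps0 : 0 < eps.

Definition generic k (p : nat -> R * R) :=
  [/\ forall a, (a <= k)%N -> enorm (p a - V a) < eps,
      forall a b, (a < b <= k)%N -> p a <> p b,
      forall a b c, (a < b < c)%N -> (c <= k)%N -> orient (p a) (p b) (p c) <> 0
    & forall i j l x, (i.+1 < j)%N -> (j.+1 < l)%N -> (l < k)%N ->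
        seg (p i) (p i.+1) x -> seg (p j) (p j.+1) x -> seg (p l) (p l.+1) x -> False].

Lemma generic_ex k : exists p, generic k p.
Proof.
elim: k => [|k [p [p1 p2 p3 p4]]].
  exists V; split=> [a _|a b|a b c|i j l x].
  - by rewrite subrr enorm0.
  - by case/andP; case: b.
  - by case: c => // /andP[_]; case: b.
  - by case: l.
pose X i j : R * R := xget 0 (seg (p i) (p i.+1) `&` seg (p j) (p j.+1)).
(* The new vertex avoids the lines through two old vertices, the horizontals through old vertices,
   which keeps it distinct from them even when there is only one, and the lines joining [p k] to old
   crossings, which prevents triple points on the new edge. *)
have [q q1 q2] := @avoid_lines R k.+1 (fun a b => (p a, p b)) (fun a _ => (p a, p a + (1, 0)))
  (fun i j => (p k, X i j)) (V k.+1) _ eps0.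
pose p' a := if (a <= k)%N then p a else q.
have E a : (a <= k)%N -> p' a = p a by rewrite /p' => ->.
have Eq : p' k.+1 = q by rewrite /p' ltnn.
have lt1 a b : (a <= k)%N -> orient (p a) q q = 0 by move=> _; rewrite /orient /det2; ring.
exists p'; split.
- move=> a; rewrite leq_eqVlt => /orP[/eqP ->|]; first by rewrite Eq.
  by rewrite ltnS => ha; rewrite E //; apply: p1.
- move=> a b /andP[ab]; rewrite leq_eqVlt => /orP[/eqP e|]; last first.
    by rewrite ltnS => hb; rewrite !E ?(leq_trans (ltnW ab)) //; apply: p2; rewrite ab.
  subst b; rewrite Eq E // => e.
  have [_ g _] := q2 a 0%N ab isT; apply: g => /=; last by rewrite -e /orient /det2; ring.
  by move=> /(congr1 fst) /=; rewrite -[LHS]addr0 => /addrI /eqP; rewrite eq_sym oner_eq0.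
- move=> a b c /andP[ab bc]; rewrite leq_eqVlt => /orP[/eqP e|]; last first.
    rewrite ltnS => hc; have hb := leq_trans (ltnW bc) hc; have ha := leq_trans (ltnW ab) hb.
    by rewrite !E //; apply: p3; rewrite ?ab.
  subst c; rewrite Eq (E a (leq_trans (ltnW ab) bc)) (E b bc).
  have [f _ _] := q2 a b (ltn_trans ab bc) bc; apply: f => /=; apply: p2.
  by rewrite ab.
move=> i j l x ij jl; rewrite ltnS leq_eqVlt => /orP[/eqP e|lk]; last first.
  have jk := ltn_trans (ltnW jl) lk; have ik := ltn_trans (ltnW ij) jk.
  by rewrite !E ?(ltnW jk) ?(ltnW ik) ?(ltnW lk) //; apply: p4.
subst l; have ik : (i.+1 < k)%N := ltn_trans ij (ltnW jl).
rewrite Eq !E ?leqnn ?(ltnW jl) ?(ltnW ik) ?(ltnW (ltnW jl)) ?(ltnW (ltnW ik)) // => s1 s2 s3.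
have o1 : orient (p i) (p i.+1) (p j) <> 0 by apply: p3; rewrite ?ltnSn ?(ltnW jl) ?(ltnW (ltnW jl)).
have ex : x = X i j.
  rewrite /X; case: xgetP => [y _ [y1 y2]|/(_ x) []] //.
  exact: crossing_uniq o1 s1 s2 y1 y2.
have xk : x <> p k.
  move=> e; apply: (@p3 j j.+1 k); rewrite ?ltnSn ?jl //.
  by rewrite -e; exact: seg_orient.
have [_ _ h] := q2 i j (leqW (ltnW ik)) (leqW (ltnW jl)).
apply: h => /=; first by rewrite -ex => /esym.
rewrite -ex; have := seg_orient s3; rewrite /orient => h.
by rewrite /det2 in h *; rewrite -[RHS]oppr0 -h; ring.
Qed.

End General.

Section Position.
Context {R : realType}.
Variables (phi : R -> R * R) (xs : seq R).
Hypothesis T : triangulation xs.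
Hypothesis Lin : linear_on_edges phi xs.
Let n := nedges xs.

Theorem general_position_ex (eps : R) : 0 < eps ->
  exists2 f, general_position xs f & close_to eps f phi.
Proof.
move=> e0; have [p [p1 p2 p3 p4]] := generic_ex (fun a => phi xs`_a) e0 n.
pose z i := xs`_i; pose f := plin z p n.
have zm := tri_lt T; have n0 := tri_n_gt0 T.
have fv k : (k <= n)%N -> f (z k) = p k by exact: plin_vertex.
have inj1 i s t : (i < n)%N -> z i <= s <= z i.+1 -> z i <= t <= z i.+1 -> f s = f t -> s = t.
  move=> hi hs ht; rewrite /f (plinE zm _ hi hs) (plinE zm _ hi ht) => /addrI /eqP.
  rewrite -subr_eq0 -scalerBl scaler_eq0 => /orP[|]; last first.
    by rewrite subr_eq0 => /eqP /esym; case/(p2 i i.+1); rewrite ltnSn.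
  have d : z i.+1 - z i != 0 by rewrite subr_eq0 gt_eqF // zm.
  by rewrite -mulrBl mulf_eq0 invr_eq0 (negPf d) orbF => /eqP h; lra.
(* Each edge is embedded and consecutive edges meet only at their common vertex, so a coincidence
   involves edges further apart. *)
have key s t i j : s < t -> (i < n)%N -> (j < n)%N -> z i <= s <= z i.+1 -> z j <= t <= z j.+1 ->
    f s = f t -> (i.+1 < j)%N.
  move=> st hi hj hs ht e; case: (ltngtP i.+1 j) => // h.
    case/andP: hs => a1 a2; case/andP: ht => b1 b2.
    move: h; rewrite ltnS leq_eqVlt => /orP[/eqP ij|ji].
      by subst j; move: st; rewrite (inj1 i s t hi) ?ltxx // ?a1 ?b1.
    have := z_le (z := z) zm (i := j.+1) (j := i); rewrite ji (ltnW hi) => /(_ isT) h.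
    by move: st; rewrite ltNge (le_trans b2 (le_trans h a1)).
  subst j; have s1 := plin_seg zm p hi hs; have s2 := plin_seg zm p hj ht.
  rewrite -/(f s) in s1; rewrite -/(f t) -e segC in s2.
  have o1 : orient (p i) (p i.+1) (p i.+2) <> 0 by apply: p3; rewrite ?ltnSn.
  have v := crossing_uniq o1 s1 s2 (seg_r _ _) (seg_r _ _).
  have l1 := zm i hi; have l2 := zm i.+1 hj.
  have z1 : z i <= z i.+1 <= z i.+1 by rewrite lexx (ltW l1).
  have z2 : z i.+1 <= z i.+1 <= z i.+2 by rewrite lexx (ltW l2).
  have es := inj1 i s (z i.+1) hi hs z1 (etrans v (esym (fv i.+1 hi))).
  have et := inj1 i.+1 t (z i.+1) hj ht z2 (etrans (esym e) (etrans v (esym (fv i.+1 hi)))).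
  by move: st; rewrite es et ltxx.
have core s t u : unit_arc s -> unit_arc t -> unit_arc u -> s < t -> t < u -> f s = f t -> f t = f u -> False.
  move=> /unit_arcP hs /unit_arcP ht /unit_arcP hu st tu e1 e2.
  have [i hi si] := tri_locate T hs; have [j hj tj] := tri_locate T ht.
  have [k hk uk] := tri_locate T hu.
  have ij := key s t i j st hi hj si tj e1; have jk := key t u j k tu hj hk tj uk e2.
  apply: (p4 i j k (f t) ij jk hk); first by rewrite -e1; exact: plin_seg.
    exact: plin_seg.
  by rewrite e2; exact: plin_seg.
exists f.
  exists xs; split=> //.
  - move=> i hi t ht; have /andP[t0 t1] := (unit_arcP t).1 ht; have l := zm i hi.
    have hs : z i <= (1 - t) * xs`_i + t * xs`_i.+1 <= z i.+1 by rewrite /z; nra.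
    rewrite -/(z i) -/(z i.+1) !fv ?(ltnW hi) // /f (plinE zm _ hi hs) /z.
    have -> : ((1 - t) * xs`_i + t * xs`_i.+1 - xs`_i) / (xs`_i.+1 - xs`_i) = t.
      by field; rewrite subr_eq0 gt_eqF.
    by rewrite scalerBr scalerBl scale1r addrA addrAC.
  - have neq a b c : (a <= n)%N -> (b <= n)%N -> (c <= n)%N -> a <> b -> a <> c -> b <> c ->
        det2 (p b - p a) (p c - p a) <> 0.
      have sw x y w : det2 (p y - p x) (p w - p x) = - det2 (p w - p x) (p y - p x) by rewrite /det2; ring.
      have cy x y w : det2 (p y - p x) (p w - p x) = det2 (p w - p y) (p x - p y) by rewrite /det2 /=; ring.
      have nz x : - x <> 0 -> x <> 0 :> R by move=> h e; apply: h; rewrite e oppr0.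
      have base x y w : (x < y < w)%N -> (w <= n)%N -> det2 (p y - p x) (p w - p x) <> 0 by exact: p3.
      move=> ha hb hc /eqP ab /eqP ac /eqP bc; move: ab ac bc; rewrite !neq_ltn.
      move=> /orP[] h1 /orP[] h2 /orP[] h3.
      - by apply: base; rewrite ?h1.
      - by apply: nz; rewrite -sw; apply: base; rewrite ?h2.
      - by move: (ltn_trans h1 h3); rewrite ltnNge (ltnW h2).
      - by rewrite cy cy; apply: base; rewrite ?h2.
      - by apply: nz; rewrite -sw cy cy; apply: base; rewrite ?h1.
      - by move: (ltn_trans h3 h1); rewrite ltnNge (ltnW h2).
      - by rewrite cy; apply: base; rewrite ?h3.
      - by apply: nz; rewrite -sw cy; apply: base; rewrite ?h3.
    have vert a : a \in xs -> exists2 i, (i <= n)%N & a = z i.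
      move=> /(nthP 0)[i hi <-]; exists i => //; move: hi; rewrite (tri_size T); exact.
    move=> a b c /vert[i hi ->] /vert[j hj ->] /vert[k hk ->].
    rewrite /collinear !fv //= !inE negb_or andbT => /andP[/andP[/eqP n1 /eqP n2] /eqP n3].
    by apply: neq => // e; [apply: n1|apply: n2|apply: n3]; rewrite e.
  - move=> s t u hs ht hu e1 e2; apply/negP; rewrite /= !inE negb_or andbT => /andP[/andP[n1 n2] n3].
    move: n1 n2 n3; rewrite !neq_lt => /orP[a1|a1] /orP[a2|a2] /orP[a3|a3].
    + exact: (core s t u hs ht hu a1 a3 e1 e2).
    + exact: (core s u t hs hu ht a2 a3 (etrans e1 e2) (esym e2)).
    + by move: (lt_trans a1 a3); rewrite ltNge (ltW a2).
    + exact: (core u s t hu hs ht a2 a1 (esym (etrans e1 e2)) e1).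
    + exact: (core t s u ht hs hu a1 a2 (esym e1) (etrans e1 e2)).
    + by move: (lt_trans a3 a1); rewrite ltNge (ltW a2).
    + exact: (core t u s ht hu hs a3 a2 e2 (esym (etrans e1 e2))).
    + exact: (core u t s hu ht hs a3 a1 (esym e2) (esym e1)).
move=> t ht; have t01 := (unit_arcP t).1 ht; rewrite (linear_plin T Lin t01).
have [i hi hs] := tri_locate T t01.
rewrite /f (plinE zm _ hi hs) (plinE zm _ hi hs).
have [u01 _] := convex_pt (zm i hi) hs; move: (_ / _) u01 => u u01.
have -> : p i + u *: (p i.+1 - p i) - (phi xs`_i + u *: (phi xs`_i.+1 - phi xs`_i)) =
  (1 - u) *: (p i - phi xs`_i) + u *: (p i.+1 - phi xs`_i.+1).
  by rewrite /z; move: (p i) (p i.+1) (phi _) (phi _) => [? ?] [? ?] [? ?] [? ?]; pair_ring.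
apply: enorm_conv_lt => //; apply: p1 => //; exact: ltnW.
Qed.

End Position.

(** * Half-lifts from the deleted product property *)

Section Squares.
Context {R : realType}.
Implicit Types h u v w m : R * R.

Definition sq h : R * R := cmul h h.
Definition conj2 h : R * R := (h.1, - h.2).

(* The cut is the one of [slit]: [lexneg h] fails iff the argument of [h] lies in [[-pi/2, pi/2)]. *)
Definition lexneg h : bool := (h.1 < 0) || ((h.1 == 0) && (0 < h.2)).

Lemma lexnegP h : h <> 0 -> if lexneg h then h.1 < 0 \/ h.1 = 0 /\ 0 < h.2 else 0 < h.1 \/ h.1 = 0 /\ h.2 < 0.
Proof.
move=> n0; rewrite /lexneg; case: (ltrgt0P h.1) => /= [h1|h1|h1]; [by left|by left|].
case: (ltrgt0P h.2) => h2; [by right|by right|].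
by case: n0; apply: plane_eq; rewrite /= ?h1 ?h2.
Qed.

Lemma up_sq h : h <> 0 -> up (sq h) = if lexneg h then (h.1 < 0) && (h.2 <= 0) else (0 < h.1) && (0 <= h.2).
Proof.
move=> n0; have := lexnegP n0; move: n0; case: h => a b _ /=.
have E : up (sq (a, b)) <-> 0 < a * b \/ a * b = 0 /\ b ^+ 2 < a ^+ 2.
  have e1 : (sq (a, b)).1 = a ^+ 2 - b ^+ 2 by rewrite /sq /cmul /=; ring.
  have e2 : (sq (a, b)).2 = 2 * (a * b) by rewrite /sq /cmul /=; ring.
  split=> [/upP|H]; last apply/upP; rewrite e1 e2.
    by case=> [h|[h h']]; [left|right; split]; lra.
  by case: H => [h|[h h']]; [left|right; split]; lra.
case: (lexneg _) => H; apply/idP/idP => [/E|/andP[h1 h2]].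
- case: H => [h|[a0 h]] [k|[/eqP k k']].
  + have b0 : b < 0 by nra.
    by rewrite h ltW.
  + by rewrite h; move: k; rewrite mulf_eq0 (lt_eqF h) => /eqP ->; rewrite lexx.
  + by move: k; rewrite a0 mul0r ltxx.
  + by move: k'; rewrite a0 expr0n /= ltNge sqr_ge0.
- apply/E; have [e|b0] := eqVneq b 0; first by right; rewrite e mulr0 expr0n /= exprn_even_gt0 //= lt_eqF.
  have b1 : b < 0 by rewrite lt_neqAle b0.
  by left; nra.
- case: H => [h|[a0 h]] [k|[/eqP k k']].
  + have b0 : 0 < b by nra.
    by rewrite h ltW.
  + by rewrite h; move: k; rewrite mulf_eq0 (gt_eqF h) => /eqP ->; rewrite lexx.
  + by move: k; rewrite a0 mul0r ltxx.
  + by move: k'; rewrite a0 expr0n /= ltNge sqr_ge0.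
apply/E; have [e|b0] := eqVneq b 0; first by right; rewrite e mulr0 expr0n /= exprn_gt0.
have b1 : 0 < b by rewrite lt_neqAle eq_sym b0.
by left; nra.
Qed.

(** Squaring maps the vertical axis, across which [lexneg] changes, onto the cut. Vectors at an
    acute angle are separated by the former iff their squares cross the latter the short way. *)
Lemma slit_sq h h' : 0 < dot2 h h' -> slit (sq h) (sq h') = lexneg h (+) lexneg h'.
Proof.
move=> D; have n0 : h <> 0 by move=> e; move: D; rewrite e /dot2 /= !mul0r addr0 ltxx.
have n1 : h' <> 0 by move=> e; move: D; rewrite e /dot2 /= !mulr0 addr0 ltxx.
have dE u v : det2 (sq u) (sq v) = 2 * dot2 u v * det2 u v.
  by rewrite /sq /dot2 /det2 /cmul /=; ring.
have D' : 0 < dot2 h' h by have -> : dot2 h' h = dot2 h h' by rewrite /dot2; ring.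
have D2 : 0 < 2 * dot2 h h' by rewrite mulr_gt0.
have D2' : 0 < 2 * dot2 h' h by rewrite mulr_gt0.
rewrite /slit !dE !pmulr_rgt0 // !up_sq //; have := lexnegP n0; have := lexnegP n1.
clear dE D' D2 D2' n0 n1; case: h h' D => a b [a' b'] /=; rewrite /dot2 /det2 /= => D.
case: (lexneg (a, b)); case: (lexneg (a', b')) => /= H' H.
all: case: H => [H|[H H2]]; case: H' => [H'|[H' H2']]; case: (ltrgt0P b) => hb; case: (ltrgt0P b') => hb'.
all: rewrite ?H ?H' ?(ltW H) ?(ltW H') ?hb ?hb' ?ltxx ?lexx //=.
all: try (by exfalso; lra).
all: try (by exfalso; nra).
all: try (by apply/negbTE; rewrite -leNgt; nra).
all: try nra.
Qed.

Lemma slit_scale (k k' : R) w w' : 0 < k -> 0 < k' -> slit (k *: w) (k' *: w') = slit w w'.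
Proof.
move=> h h'; have upZ (l : R) u : 0 < l -> up (l *: u) = up u.
  move=> l0; rewrite /up /= /GRing.scale /= !pmulr_rgt0 //.
  by rewrite mulf_eq0 (gt_eqF l0).
have dZ (l l' : R) u u' : det2 (l *: u) (l' *: u') = l * l' * det2 u u'.
  by rewrite /det2 /= /GRing.scale /=; ring.
by rewrite /slit !upZ // !dZ !pmulr_rgt0 ?mulr_gt0.
Qed.

Lemma cmulC u w : cmul u w = cmul w u. Proof. by case: u w => [a b] [c d]; rewrite /cmul /=; congr pair; ring. Qed.
Lemma cmulA u v w : cmul u (cmul v w) = cmul (cmul u v) w.
Proof. by case: u v w => [a b] [c d] [e f]; rewrite /cmul /=; congr pair; ring. Qed.
Lemma cmulZ (k : R) u w : cmul u (k *: w) = k *: cmul u w.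
Proof. by case: u w => [a b] [c d]; rewrite /cmul /= /GRing.scale /=; congr pair; rewrite /GRing.scale /=; ring. Qed.
Lemma sqM u w : sq (cmul u w) = cmul (sq u) (sq w).
Proof. by case: u w => [a b] [c d]; rewrite /sq /cmul /=; congr pair; ring. Qed.
Lemma conj_unit u : u.1 ^+ 2 + u.2 ^+ 2 = 1 -> cmul u (conj2 u) = (1, 0).
Proof. by move=> <-; rewrite /cmul /conj2 /=; congr pair; ring. Qed.
Lemma cmul1 u : cmul (1, 0) u = u.
Proof. by case: u => a b; rewrite /cmul /=; congr pair; ring. Qed.
Lemma tiltE m w : tilt m w = cmul (conj2 m) w.
Proof. by rewrite /tilt /cmul /conj2 /dot2 /det2 /=; congr pair; ring. Qed.

Lemma circleP u : circle u <-> u.1 ^+ 2 + u.2 ^+ 2 = 1.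
Proof.
rewrite /circle /=; split=> [h|]; last exact: enorm_sq1.
by rewrite -sqr_enorm h expr1n.
Qed.

(** On the unit circle the square of [1 + u] is a positive multiple of [u], except at [u = -1]. *)
Lemma square_root u : u.1 ^+ 2 + u.2 ^+ 2 = 1 -> exists h, exists2 k : R, 0 < k & sq h = k *: u.
Proof.
case: u => a b /= e; have [a1|a1] := eqVneq a (-1).
  exists (0, 1); exists 1 => //; rewrite /sq /cmul /= /GRing.scale /= a1.
  have -> : b = 0 by apply/eqP; rewrite -sqrf_eq0; apply/eqP; move: e; rewrite a1 sqrrN expr1n; lra.
  by congr pair; rewrite /GRing.scale /=; ring.
exists (1 + a, b); exists (2 + 2 * a).
  have : -1 < a by rewrite lt_neqAle eq_sym a1; have := sqr_ge0 b; nra.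
  by lra.
by rewrite /sq /cmul /= /GRing.scale /=; congr pair; rewrite /GRing.scale /=; nra.
Qed.

(** A discrete lift to the double cover: each factor is, up to a positive scalar, the square root
    with positive real part of the ratio of two consecutive values. It depends continuously on [c],
    and no branch is chosen. *)
Fixpoint turns (c : nat -> R * R) N : R * R :=
  if N is k.+1 then cmul (turns c k) ((1, 0) + cmul (conj2 (c k)) (c k.+1)) else (1, 0).

(* [(1 + z) ^ 2 = |1 + z| ^ 2 z] on the unit circle, and the ratios of consecutive values telescope. *)
Lemma sq_turns c N : (forall k, (k <= N)%N -> circle (c k)) ->
  (forall k, (k < N)%N -> enorm (c k - c k.+1) < 2) ->
  exists2 l : R, 0 < l & sq (turns c N) = l *: cmul (conj2 (c 0%N)) (c N).
Proof.
elim: N => [|N IH] unit near.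
  exists 1 => //; rewrite scale1r cmulC conj_unit; last exact/circleP/unit.
  by rewrite /sq /= cmul1.
have [l l0 e] : exists2 l : R, 0 < l & sq (turns c N) = l *: cmul (conj2 (c 0%N)) (c N).
  by apply: IH => k hk; [apply: unit; exact: ltnW|apply: near; exact: ltnW].
have /circleP u0 := unit N (leqnSn N); have /circleP u1 := unit N.+1 (leqnn _).
pose d := 2 + 2 * dot2 (c N) (c N.+1).
have d0 : 0 < d.
  have : enorm (c N - c N.+1) ^+ 2 < 2 ^+ 2 by rewrite ltr_pXn2r ?nnegrE ?enorm_ge0 ?near.
  rewrite sqr_enorm /d /dot2 /=; move: (c N) (c N.+1) u0 u1 => [a b] [a' b'] /= u0 u1 h; nra.
exists (l * d); first by rewrite mulr_gt0.
rewrite /= sqM e.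
have -> : sq ((1, 0) + cmul (conj2 (c N)) (c N.+1)) = d *: cmul (conj2 (c N)) (c N.+1).
  rewrite /d; move: (c N) (c N.+1) u0 u1 => [a b] [a' b'] /= u0 u1.
  have E : (a * a' + b * b') ^+ 2 + (a * b' - b * a') ^+ 2 = 1.
    by transitivity ((a ^+ 2 + b ^+ 2) * (a' ^+ 2 + b' ^+ 2)); [ring|rewrite u0 u1 mulr1].
  by rewrite /sq /cmul /conj2 /dot2 /= /GRing.scale /=; congr pair; rewrite /GRing.scale /=; nra.
rewrite cmulZ [cmul (l *: _) _]cmulC cmulZ scalerA [d * l]mulrC; congr (_ *: _).
rewrite [LHS]cmulC -!cmulA; congr cmul.
by rewrite cmulA conj_unit // cmul1.
Qed.

Lemma continuous_cmul2 (T : topologicalType) (f g : T -> R * R) : continuous f -> continuous g ->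
  continuous (fun x => cmul (f x) (g x)).
Proof.
move=> cf cg.
have c1 : continuous (fun x => (f x).1) by apply: (cont_comp (@continuous_fst R R)).
have c2 : continuous (fun x => (f x).2) by apply: (cont_comp (@continuous_snd R R)).
have d1 : continuous (fun x => (g x).1) by apply: (cont_comp (@continuous_fst R R)).
have d2 : continuous (fun x => (g x).2) by apply: (cont_comp (@continuous_snd R R)).
rewrite /cmul; apply: cont_pair.
  by apply: (@contB R T R (fun x => (f x).1 * (g x).1)); apply: contM.
by apply: (@contD R T R (fun x => (f x).1 * (g x).2)); apply: contM.
Qed.

Lemma continuous_turns (T : topologicalType) (c : T -> nat -> R * R) N :
  (forall k, continuous (fun x => c x k)) -> continuous (fun x => turns (c x) N).
Proof.
move=> cc; elim: N => [|N IH] /=; first exact: cont_cst.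
apply: continuous_cmul2 => //; apply: (@contD R T (R * R)%type); first exact: cont_cst.
apply: continuous_cmul2 => //; apply: cont_pair.
  exact: (cont_comp (@continuous_fst R R)).
have := cont_comp (@continuous_snd R R) (cc N) => h.
by move=> x; apply: (@continuousN R R T (fun y => (c y N).2)); exact: h.
Qed.

End Squares.

Section Uniform.
Context {R : realType}.

Lemma continuous_within (T U V : topologicalType) (A : set U) (G : U -> V) (p : T -> U) :
  {within A, continuous G} -> continuous p -> (forall x, A (p x)) -> continuous (fun x => G (p x)).
Proof.
move=> /subspace_continuousP cG cp Ap x W /= hW.
have := cG _ (Ap x) _ hW; rewrite /nbhs /= /within /= => h.
have := cp x _ h; rewrite /nbhs /=; apply: filterS => y /=; apply; exact: Ap.
Qed.

End Uniform.

Section Uniform.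
Context {R : realType}.

(** Uniform continuity in the second variable, so that one number of steps serves a whole family of
    paths. *)
Lemma uniform_steps (F : R * R -> R * R) (c d e : R) : continuous F -> 0 < e ->
  small (fun r => forall s t t', c <= s <= d -> 0 <= t <= 1 -> `|t - t'| <= r ->
    enorm (F (s, t) - F (s, t')) < e).
Proof.
move=> cF e0.
have cA : compact (`[c, d]%classic `*` `[0, 1]%classic : set (R * R)).
  by apply: compact_setX; exact: segment_compact.
pose P (r : R) (z : R * R) := forall t', `|z.2 - t'| <= r -> enorm (F z - F (z.1, t')) < e.
have := (compact_near_coveringP _).1 cA R (nbhs (0 : R)) P _.
case=> [z _|e1 /= e10 h].
  have cE : continuous (fun z' => enorm (F z' - F z)).
    by apply: (cont_comp (@continuous_enorm R)); apply: (@contB R); [exact: cF|exact: cont_cst].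
  have /cE : nbhs (enorm (F z - F z)) [set x : R | x < e / 2].
    by rewrite subrr enorm0; apply: lt_nbhsl; rewrite divr_gt0.
  rewrite /= => /nbhs_ballP[del /= del0 hb].
  exists (ball z (del / 2), ball (0 : R) (del / 2)) => /=.
    by split; apply: nbhsx_ballx; rewrite divr_gt0.
  move=> [z' r] /= [[b1 b2] b3] t' ht'.
  have h1 : ball z del z' by apply: le_ball (_ : del / 2 <= del) _ _; [lra|split].
  have h2 : ball z del (z'.1, t').
    split=> /=; first by apply: le_ball b1; lra.
    rewrite /ball /= in b2 b3 *; rewrite sub0r normrN in b3.
    have := ler_normD (z.2 - z'.2) (z'.2 - t'); rewrite subrKA.
    by have := ler_norm r; lra.
  have := hb _ h1; have := hb _ h2; rewrite /= => k1 k2.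
  by have := enormDB (F z') (F z) (F (z'.1, t')); rewrite (enormB (F z)); lra.
exists (e1 / 2); first by rewrite divr_gt0.
move=> r /andP[r0 re] s t t' hs ht htt'.
apply: (h r _ (s, t)) => //=.
by rewrite /ball /= sub0r normrN gtr0_norm //; lra.
Qed.

End Uniform.

(** * Square roots carried along the homotopy *)

Section Half.
Context {R : realType}.
Variables (phi : R -> R * R) (G : R * R -> R * R) (H : (R * R) * R -> R * R).
Hypothesis Gmap : map_to_circle deleted_product G.
Hypothesis Hcont : {within separated_pairs phi `*` unit_arc, continuous H}.
Hypothesis Hcirc : forall z t, separated_pairs phi z -> unit_arc t -> circle (H (z, t)).
Hypothesis H_0 : forall z, separated_pairs phi z -> H (z, 0) = G z.
Hypothesis H_1 : forall z, separated_pairs phi z -> H (z, 1) = gauss_map phi z.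
Variable m : R * R.
Hypothesis um : m.1 ^+ 2 + m.2 ^+ 2 = 1.
Variables (h0 : R * R) (k0 : R).
Hypothesis k0_gt0 : 0 < k0.
Hypothesis sq_h0 : sq h0 = k0 *: tilt m (G (0, 1)).

Definition ray (z : R * R) (t : R) : R * R := (t * z.1, (1 - t) + t * z.2).

(* A square root of the homotopy class of [G], followed along the segment from
   [(0, 1)] to [z] and then along the homotopy; [N] is the number of steps. *)
Definition half N (z : R * R) : R * R :=
  cmul (cmul h0 (turns (fun k => G (ray z (clamp01 (k%:R / N%:R)))) N))
    (turns (fun k => H (z, clamp01 (k%:R / N%:R))) N).

Definition above z := [/\ 0 <= z.1, z.1 < z.2, z.2 <= 1 & phi z.1 <> phi z.2].

Lemma above_sep z : above z -> separated_pairs phi z.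
Proof. by move=> [z1 z12 z2 n]; split=> //; apply/unit_arcP; lra. Qed.

Lemma clamp01_arc (t : R) : unit_arc (clamp01 t).
Proof. by apply/unit_arcP; rewrite clamp01_ge0 clamp01_le1. Qed.

Lemma ray_deleted z t : above z -> unit_arc t -> deleted_product (ray z t).
Proof.
move=> [z1 z12 z2 _] /unit_arcP/andP[t0 t1]; rewrite /ray.
have a1 : 0 <= t * z.1 by rewrite mulr_ge0.
have a2 : t * z.1 <= t * z.2 by rewrite ler_wpM2l // ltW.
have a3 : t * z.2 <= t by rewrite -[leRHS]mulr1 ler_wpM2l.
split=> /=; try (apply/unit_arcP; lra).
have [->|tn] := eqVneq t 0; first by rewrite !mul0r subr0 addr0 => /eqP; rewrite eq_sym oner_eq0.
have : 0 < t * (z.2 - z.1) by rewrite mulr_gt0 ?subr_gt0 // lt_neqAle eq_sym tn.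
by rewrite mulrBr => ? ?; lra.
Qed.

Lemma half_sq N z : (0 < N)%N -> above z ->
  (forall t t', 0 <= t <= 1 -> `|t - t'| <= N%:R^-1 ->
     enorm (G (ray z (clamp01 t)) - G (ray z (clamp01 t'))) < 2) ->
  (forall t t', 0 <= t <= 1 -> `|t - t'| <= N%:R^-1 ->
     enorm (H (z, clamp01 t) - H (z, clamp01 t')) < 2) ->
  exists2 l : R, 0 < l & sq (half N z) = l *: tilt m (phi z.1 - phi z.2).
Proof.
move=> N0 az near1 near2; have Nn : N%:R != 0 :> R by rewrite pnatr_eq0 -lt0n.
have sz := above_sep az.
have k01 k : (k < N)%N -> 0 <= (k%:R / N%:R : R) <= 1.
  by move=> kN; rewrite divr_ge0 ?ler0n //= ler_pdivrMr ?ltr0n // mul1r ler_nat ltnW.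
have step k : `|k%:R / N%:R - k.+1%:R / N%:R| <= (N%:R^-1 : R).
  by rewrite -mulrBl -natr1 opprD addrA subrr add0r mulN1r normrN ger0_norm ?invr_ge0 ?ler0n.
have [|k kN|l1 l10 E1] := @sq_turns R (fun k => G (ray z (clamp01 (k%:R / N%:R)))) N.
- by move=> k _; apply: (Gmap.2); apply: ray_deleted => //; exact: clamp01_arc.
- by apply: near1; [exact: k01|exact: step].
have [|k kN|l2 l20 E2] := @sq_turns R (fun k => H (z, clamp01 (k%:R / N%:R))) N.
- by move=> k _; apply: Hcirc => //; exact: clamp01_arc.
- by apply: near2; [exact: k01|exact: step].
have c0 : clamp01 (0%:R / N%:R : R) = 0 by rewrite mul0r clamp01_0.
have c1 : clamp01 (N%:R / N%:R : R) = 1 by rewrite divff // clamp01_1.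
rewrite c0 c1 in E1 E2; rewrite H_0 // H_1 // in E2.
have r0 : ray z 0 = (0, 1) by rewrite /ray !mul0r subr0 addr0.
have r1 : ray z 1 = z by rewrite /ray !mul1r subrr add0r; case: (z).
rewrite r0 r1 in E1.
have uG p : deleted_product p -> cmul (G p) (conj2 (G p)) = (1, 0).
  by move=> dp; apply: conj_unit; apply/circleP; apply: (Gmap.2).
have u0 := uG (0, 1); have uz := uG z.
have d := enorm_gt0 (_ : phi z.1 - phi z.2 <> 0).
have {d} dpos : 0 < enorm (phi z.1 - phi z.2).
  by apply: d => /eqP; rewrite subr_eq0 => /eqP; case: az.
exists (k0 * l1 * l2 * (enorm (phi z.1 - phi z.2))^-1).
  by rewrite !mulr_gt0 // invr_gt0.
rewrite /half !sqM E1 E2 sq_h0 /gauss_map !tiltE.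
have scl (k : R) u w : cmul (k *: u) w = k *: cmul u w by rewrite cmulC cmulZ cmulC.
rewrite !(cmulZ, scl) !scalerA.
have -> : forall a b c e f : R * R, cmul a b = (1, 0) -> cmul c e = (1, 0) ->
  cmul (cmul (cmul (conj2 m) a) (cmul b c)) (cmul e f) = cmul (conj2 m) f.
  move=> a b c e f ab ce.
  rewrite -[cmul (cmul (conj2 m) a) _]cmulA [cmul a _]cmulA ab cmul1 -!cmulA [cmul c _]cmulA ce.
  by rewrite cmul1.
- by congr (_ *: _); ring.
- apply: u0; split=> /=; try (apply/unit_arcP; lra).
  by move/eqP; rewrite eq_sym oner_eq0.
apply: uz; have [z1 z12 z2 _] := az; split; try (apply/unit_arcP; lra).
by move=> e; move: z12; rewrite e ltxx.
Qed.

Lemma perp_opp h h' w w' (l l' : R) : 0 < l -> 0 < l' -> sq h = l *: w -> sq h' = l' *: w' ->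
  h <> 0 -> h' <> 0 -> dot2 h h' = 0 -> exists2 k : R, 0 < k & w' + k *: w = 0.
Proof.
move=> l0 l0' e e' n n' d; have a := enorm_gt0 n; have a' := enorm_gt0 n'.
exists (l * enorm h' ^+ 2 / (l' * enorm h ^+ 2)); first by rewrite divr_gt0 // mulr_gt0 // exprn_gt0.
have k0' : l' * enorm h ^+ 2 != 0 by rewrite gt_eqF // mulr_gt0 // exprn_gt0.
apply: (scalerI k0'); rewrite scaler0 scalerDr scalerA [_ * (_ / _)]mulrC divfK //.
have -> : (l' * enorm h ^+ 2) *: w' = enorm h ^+ 2 *: sq h' by rewrite e' scalerA mulrC.
have -> : (l * enorm h' ^+ 2) *: w = enorm h' ^+ 2 *: sq h by rewrite e scalerA mulrC.
rewrite !sqr_enorm.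
move: d; rewrite /dot2 /sq /cmul; case: h h' {n n' e e' a a' k0'} => [x y] [x' y'] /= d.
rewrite /GRing.scale /=; apply: plane_eq; rewrite /= /GRing.scale /=.
  by transitivity (2 * (x * x' - y * y') * (x * x' + y * y')); [ring|rewrite d mulr0].
by transitivity (2 * (x * y' + x' * y) * (x * x' + y * y')); [ring|rewrite d mulr0].
Qed.

(** The difference of [phi] never becomes opposite to its initial value, so by [perp_opp] its square
    root never becomes perpendicular to the initial one. Their product stays positive, and [slit_sq]
    applies to the two ends. *)
Lemma edge_bits (p : R -> R * R) (c d : R) : c < d -> continuous p ->
  (forall s, c <= s <= d -> above (p s)) ->
  (forall s (k : R), c <= s <= d -> 0 < k ->
     (phi (p s).1 - phi (p s).2) + k *: (phi (p c).1 - phi (p c).2) <> 0) ->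
  small (fun r : R => forall N, (0 < N)%N -> N%:R^-1 <= r ->
    lexneg (half N (p c)) (+) lexneg (half N (p d)) =
    slit (tilt m (phi (p c).1 - phi (p c).2)) (tilt m (phi (p d).1 - phi (p d).2))).
Proof.
move=> cd cp ab noopp; have dc : 0 < d - c by rewrite subr_gt0.
(* Retracts the line to [[c, d]], so that all functions below are defined and continuous
   everywhere. *)
pose cl (s : R) := c + (d - c) * clamp01 ((s - c) / (d - c)).
have cl_in s : c <= cl s <= d.
  have := clamp01_ge0 ((s - c) / (d - c)); have := clamp01_le1 ((s - c) / (d - c)).
  by rewrite /cl; move: (clamp01 _) => v v0 v1; nra.
have cl_id s : c <= s <= d -> cl s = s.
  move=> hs; rewrite /cl clamp01_id; last by case: (convex_pt cd hs).
  by field; rewrite gt_eqF.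
have ccl : continuous cl.
  apply: (@contD R R R); first exact: cont_cst.
  apply: (@contM R R); first exact: cont_cst.
  apply: (cont_comp (@continuous_clamp01 R)).
  apply: (@contM R R); last exact: cont_cst.
  by apply: (@contB R R R); [exact: cont_id|exact: cont_cst].
have cfst : continuous (@fst R R) by exact: continuous_fst.
have csnd : continuous (@snd R R) by exact: continuous_snd.
pose F1 (z : R * R) := G (ray (p (cl z.1)) (clamp01 z.2)).
pose F2 (z : R * R) := H (p (cl z.1), clamp01 z.2).
have c1 : continuous (fun z : R * R => p (cl z.1)).
  by apply: (cont_comp cp); apply: (cont_comp ccl).
have c2 : continuous (fun z : R * R => clamp01 z.2).
  by apply: (cont_comp (@continuous_clamp01 R)).
have cF1 : continuous F1.
  apply: (continuous_within (Gmap.1)).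
    have c3 : continuous (fun z : R * R => (p (cl z.1)).1) by apply: (cont_comp cfst).
    have c4 : continuous (fun z : R * R => (p (cl z.1)).2) by apply: (cont_comp csnd).
    apply: cont_pair; first exact: contM.
    apply: (@contD R (R * R)%type R); last exact: contM.
    by apply: (@contB R (R * R)%type R); [exact: cont_cst|exact: c2].
  by move=> z; apply: ray_deleted; [exact: ab|exact: clamp01_arc].
have cF2 : continuous F2.
  apply: (continuous_within Hcont); first exact: cont_pair.
  by move=> z; split=> /=; [apply: above_sep; exact: ab|exact: clamp01_arc].
have two : 0 < 2 :> R by [].
apply: small_sub (small_and (uniform_steps c d cF1 two) (uniform_steps c d cF2 two)) => r r0 [u1 u2] N N0 Nr.
have hsq s : c <= s <= d -> exists2 l : R, 0 < l & sq (half N (p s)) = l *: tilt m (phi (p s).1 - phi (p s).2).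
  move=> hs; apply: half_sq => //; first exact: ab.
    by move=> t t' ht tt; have := u1 s t t' hs ht (le_trans tt Nr); rewrite /F1 /= cl_id.
  by move=> t t' ht tt; have := u2 s t t' hs ht (le_trans tt Nr); rewrite /F2 /= cl_id.
have cc : c <= c <= d by rewrite lexx ltW.
have dd : c <= d <= d by rewrite lexx ltW.
have hn0 s : c <= s <= d -> half N (p s) <> 0.
  move=> hs e; have [l l0] := hsq s hs; rewrite e.
  have -> : sq (0 : R * R) = 0 by rewrite /sq /cmul /= !mul0r subrr addr0.
  move=> /esym/eqP; rewrite scaler_eq0 gt_eqF //= => /eqP e'.
  have [_ _ _ n] := ab s hs; apply: n; apply/eqP; rewrite -subr_eq0; apply/eqP.
  by apply: (tilt_inj um); rewrite e' tilt0.
pose q (s : R) := dot2 (half N (p c)) (half N (p (cl s))).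
have cq : continuous q.
  have cp2 (v : R) : continuous (fun s : R => (s, v)).
    by apply: cont_pair; [exact: cont_id|exact: cont_cst].
  have ch : continuous (fun s => half N (p (cl s))).
    apply: continuous_cmul2.
      apply: continuous_cmul2; first exact: cont_cst.
      by apply: continuous_turns => k; exact: (cont_comp cF1 (cp2 (k%:R / N%:R))).
    by apply: continuous_turns => k; exact: (cont_comp cF2 (cp2 (k%:R / N%:R))).
  apply: (@contD R R R).
    by apply: (@contM R R); [exact: cont_cst|apply: (cont_comp cfst)].
  by apply: (@contM R R); [exact: cont_cst|apply: (cont_comp csnd)].
have qc : 0 < q c.
  rewrite /q cl_id // /dot2 -!expr2 -sqr_enorm exprn_gt0 // enorm_gt0 //; exact: hn0.
have qd : 0 < q d.
  rewrite ltNge; apply/negP => qd.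
  have [|s] := @IVT R q c d 0 (ltW cd) (continuous_subspaceT cq).
    by rewrite ge_min le_max qd (ltW qc) orbT.
  rewrite in_itv /= => hs; rewrite /q cl_id // => e.
  have [l l0 E] := hsq c cc; have [l' l0' E'] := hsq s hs.
  have [k kp] := perp_opp l0 l0' E E' (hn0 c cc) (hn0 s hs) e.
  rewrite -tiltZ -tiltD => z; apply: (noopp s k hs kp).
  by apply: (tilt_inj um); rewrite z tilt0.
rewrite /q cl_id // in qd.
have [l l0 E] := hsq c cc; have [l' l0' E'] := hsq d dd.
by rewrite -(slit_sq qd) E E' slit_scale.
Qed.

End Half.

Theorem deleted_product_half_lift {R : realType} (phi : R -> R * R) (xs : seq R) (m : R * R) :
  triangulation xs -> linear_on_edges phi xs -> m.1 ^+ 2 + m.2 ^+ 2 = 1 ->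
  deleted_product_property phi ->
  exists g, half_lift (nedges xs) (fun a => tilt m (phi xs`_a)) g.
Proof.
move=> T Lin um [G Gmap [H [Hc Hu H0 H1]]].
set n := nedges xs; pose V a := phi xs`_a.
have uG : (tilt m (G (0, 1))).1 ^+ 2 + (tilt m (G (0, 1))).2 ^+ 2 = 1.
  apply/circleP; rewrite /circle /= enorm_tilt //; apply: (Gmap.2); split=> /=; try (apply/unit_arcP; lra).
  by move/eqP; rewrite eq_sym oner_eq0.
have [h0 [k0 k00 sq0]] := square_root uG.
pose h := half G H h0.
have seg_phi j s : (j < n)%N -> xs`_j <= s <= xs`_j.+1 ->
    exists2 u : R, 0 <= u <= 1 & phi s = (1 - u) *: V j + u *: V j.+1.
  move=> hj hs; have [u01 es] := convex_pt (tri_lt T hj) hs.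
  by move: (_ / _) u01 es => u u01 es; exists u; rewrite // {1}es (Lin j hj) //; apply/unit_arcP.
(* If the difference at parameter [u] were opposite to the one at the start of the edge, [V a] would
   be the point of the edge at parameter [u / (1 + k)]. *)
have inseg j a (u k : R) : 0 <= u <= 1 -> 0 <= k ->
    V a - ((1 - u) *: V j + u *: V j.+1) + k *: (V a - V j) = 0 -> seg (V j) (V j.+1) (V a).
  move=> /andP[u0 u1] k0' e; exists (u / (1 + k)).
    apply/unit_arcP/andP; split; first by rewrite divr_ge0 // addr_ge0.
    by rewrite ler_pdivrMr; lra.
  have n0 : 1 + k != 0 by rewrite gt_eqF //; lra.
  apply: (scalerI n0); apply/eqP; rewrite -subr_eq0 -oppr_eq0; apply/eqP; rewrite -[RHS]e.
  move: (V a) (V j) (V j.+1) => [a1 a2] [b1 b2] [c1 c2].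
  by apply: plane_eq; rewrite /= /GRing.scale /=; field.
have sgn (p q w : R * R) (k : R) : (q - p) + k *: (w - p) = 0 -> (p - q) + k *: (p - w) = 0.
  by move=> e; rewrite -[RHS]oppr0 -e opprD -scalerN !opprB.
have tle i j : (i <= j <= n)%N -> xs`_i <= xs`_j by exact: tri_le.
have main : small (fun r : R => forall a, (a < n.+1)%N -> forall j, (j < n)%N ->
    ~ seg (V j) (V j.+1) (V a) -> forall N, (0 < N)%N -> N%:R^-1 <= r ->
    ((a < j)%N -> lexneg (h N (xs`_a, xs`_j)) (+) lexneg (h N (xs`_a, xs`_j.+1)) =
       slit (tilt m (V a - V j)) (tilt m (V a - V j.+1))) /\
    ((j.+1 < a)%N -> lexneg (h N (xs`_j, xs`_a)) (+) lexneg (h N (xs`_j.+1, xs`_a)) =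
       slit (tilt m (V j - V a)) (tilt m (V j.+1 - V a)))).
  apply: small_all => a ha; apply: small_all => j hj; apply: small_imp => red.
  have phi_neq s : xs`_j <= s <= xs`_j.+1 -> V a <> phi s.
    by move=> hs e; apply: red; have [u /unit_arcP u01 es] := seg_phi j s hj hs; rewrite e es; exists u.
  have := tri_01 T ha => /andP[a0 a1]; have := tri_01 T (ltnW hj) => /andP[j0 _]; have := tri_01 T hj => /andP[_ j1].
  have ca : continuous (fun _ : R => xs`_a) by exact: cont_cst.
  have ci : continuous (fun s : R => s) by exact: cont_id.
  have P1 : small (fun r : R => (a < j)%N -> forall N, (0 < N)%N -> N%:R^-1 <= r ->
     lexneg (h N (xs`_a, xs`_j)) (+) lexneg (h N (xs`_a, xs`_j.+1)) =
       slit (tilt m (V a - V j)) (tilt m (V a - V j.+1))).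
    apply: small_imp => aj.
    have lt : xs`_a < xs`_j by apply: (z_lt (z := fun i => xs`_i) (tri_lt T)); rewrite aj ltnW.
    apply: (edge_bits Gmap Hc Hu H0 H1 um k00 sq0 (tri_lt T hj) (p := fun s => (xs`_a, s))).
    - exact: cont_pair.
    - by move=> s hs; split=> //=; [case/andP: hs => h1 _; lra|case/andP: hs => _ h1; lra|exact: phi_neq].
    - move=> s k hs k0' /= e; apply: red; have [u u01 es] := seg_phi j s hj hs.
      by apply: (inseg j a u k u01 (ltW k0')); rewrite -es.
  have P2 : small (fun r : R => (j.+1 < a)%N -> forall N, (0 < N)%N -> N%:R^-1 <= r ->
     lexneg (h N (xs`_j, xs`_a)) (+) lexneg (h N (xs`_j.+1, xs`_a)) =
       slit (tilt m (V j - V a)) (tilt m (V j.+1 - V a))).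
    apply: small_imp => ja.
    have lt : xs`_j.+1 < xs`_a by apply: (z_lt (z := fun i => xs`_i) (tri_lt T)); rewrite ja.
    apply: (edge_bits Gmap Hc Hu H0 H1 um k00 sq0 (tri_lt T hj) (p := fun s => (s, xs`_a))).
    - exact: cont_pair.
    - move=> s hs; split=> //=; [case/andP: hs => h1 _; lra|case/andP: hs => _ h1; lra|].
      by move=> e; apply: (phi_neq s hs).
    - move=> s k hs k0' /= e; apply: red; have [u u01 es] := seg_phi j s hj hs.
      by apply: (inseg j a u k u01 (ltW k0')); rewrite -es; apply: sgn.
  by apply: small_sub (small_and P1 P2) => r r0 [p1 p2] N N0 Nr; split=> h'; [exact: p1|exact: p2].
have [r r0 {}main] := small_ex main.
(* One number of steps fine enough for all red sides, of which there are finitely many. *)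
pose N := Num.bound r^-1.
have rN : r^-1 < N%:R by apply: archi_boundP; rewrite invr_ge0 ltW.
have N0 : (0 < N)%N by rewrite -(ltr0n R); apply: lt_trans rN; rewrite invr_gt0.
have Nr : N%:R^-1 <= r by rewrite invf_ple ?posrE ?ltr0n // ltW.
have seg_tilt' a b w : seg (V a) (V b) (V w) -> seg (tilt m (V a)) (tilt m (V b)) (tilt m (V w)).
  by move=> h'; apply/(seg_tilt um); rewrite tiltK.
exists (fun a b => lexneg (h N (xs`_a, xs`_b))); split=> [a j /andP[aj jn]|i b /andP[ib bn]] red.
  have ha : (a < n.+1)%N by rewrite ltnS ltnW // (ltn_trans aj).
  have [-> //] := main a ha j jn (fun s => red (seg_tilt' _ _ _ s)) N N0 Nr.
  by rewrite !tiltB.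
have hi : (i < n)%N by exact: leq_trans (ltnW ib) bn.
have [_ -> //] := main b bn i hi (fun s => red (seg_tilt' _ _ _ s)) N N0 Nr.
by rewrite !tiltB.
Qed.

(** * Pushing pairs away from the self-intersections *)

Section Quad.
Context {R : realType}.
Implicit Types p q w : R * R.

Lemma dot2_le p q : dot2 p q <= enorm p * enorm q.
Proof.
have a := enorm_ge0 p; have b := enorm_ge0 q; have ab : 0 <= enorm p * enorm q by rewrite mulr_ge0.
rewrite leNgt; apply/negP => h; have : (enorm p * enorm q) ^+ 2 < dot2 p q ^+ 2.
  by rewrite ltr_pXn2r // nnegrE // ltW // (le_lt_trans ab).
rewrite exprMn !sqr_enorm; apply/negP; rewrite -leNgt -subr_ge0.
have -> : (p.1 ^+ 2 + p.2 ^+ 2) * (q.1 ^+ 2 + q.2 ^+ 2) - dot2 p q ^+ 2 = det2 p q ^+ 2.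
  by rewrite /dot2 /det2; ring.
exact: sqr_ge0.
Qed.

Lemma det2_le p q : `|det2 p q| <= enorm p * enorm q.
Proof.
have e : det2 p q = dot2 (- p.2, p.1) q by rewrite /dot2 /det2 /=; ring.
have n : enorm (- p.2, p.1) = enorm p by rewrite /enorm /= sqrrN addrC.
rewrite ler_norml; apply/andP; split; last by rewrite e -n dot2_le.
have -> : det2 p q = - dot2 (p.2, - p.1) q by rewrite /dot2 /det2 /=; ring.
have <- : enorm (p.2, - p.1) = enorm p by rewrite /enorm /= sqrrN addrC.
by rewrite lerN2 dot2_le.
Qed.

Lemma cauchy4 (a b c d x y z t : R) : 0 <= a -> 0 <= b -> 0 <= c -> 0 <= d ->
  (a * x + b * y + c * z + d * t) ^+ 2 <=
  (a + b + c + d) * (a * x ^+ 2 + b * y ^+ 2 + c * z ^+ 2 + d * t ^+ 2).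
Proof.
move=> a0 b0 c0 d0; rewrite -subr_ge0.
have -> : (a + b + c + d) * (a * x ^+ 2 + b * y ^+ 2 + c * z ^+ 2 + d * t ^+ 2) -
    (a * x + b * y + c * z + d * t) ^+ 2 =
  a * b * (x - y) ^+ 2 + a * c * (x - z) ^+ 2 + a * d * (x - t) ^+ 2 +
  b * c * (y - z) ^+ 2 + b * d * (y - t) ^+ 2 + c * d * (z - t) ^+ 2 by ring.
have nn (u v w : R) : 0 <= u -> 0 <= v -> 0 <= u * v * w ^+ 2.
  by move=> u0 v0; rewrite mulr_ge0 ?sqr_ge0 // mulr_ge0.
by do !apply: addr_ge0; exact: nn.
Qed.

Variables (l : nat -> R) (W : nat -> R * R).
Hypothesis l_ge0 : forall k, 0 <= l k.
Hypothesis l_sum : l 0%N + l 1%N + l 2%N + l 3%N = 1.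

Definition sum4 (U : lmodType R) (F : nat -> U) : U :=
  l 0%N *: F 0%N + l 1%N *: F 1%N + l 2%N *: F 2%N + l 3%N *: F 3%N.

Let D := sum4 W.
(** The corners of a cell are reweighted by the positive part of their component along [D]; corners
    with zero difference drop out. With [S = wsum] one has [|D|^2 <= S], [S^2 <= Q], and the product
    of [D] with [pushed] is [Q / S]: the average moves away from zero and keeps an acute angle with
    [D]. *)
Definition weight k := Num.max 0 (dot2 D (W k)).
Definition wsum := sum4 (fun k => weight k : R^o) : R.
Definition pushed := (wsum)^-1 *: sum4 (fun k => weight k *: W k).
Hypothesis D0 : D <> 0.

Let Q := l 0%N * weight 0 ^+ 2 + l 1%N * weight 1 ^+ 2 + l 2%N * weight 2 ^+ 2 + l 3%N * weight 3 ^+ 2.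

Lemma weight_ge0 k : 0 <= weight k. Proof. by rewrite /weight le_max lexx. Qed.

Lemma weight_sq k : weight k * dot2 D (W k) = weight k ^+ 2.
Proof. by rewrite /weight; case: (lerP 0 (dot2 D (W k))) => h; rewrite ?expr2 // !mul0r. Qed.

Lemma wsumE : wsum = l 0%N * weight 0 + l 1%N * weight 1 + l 2%N * weight 2 + l 3%N * weight 3.
Proof. by []. Qed.

Lemma dot2_sum4 p (F : nat -> R * R) : dot2 p (sum4 F) =
  l 0%N * dot2 p (F 0%N) + l 1%N * dot2 p (F 1%N) + l 2%N * dot2 p (F 2%N) + l 3%N * dot2 p (F 3%N).
Proof. by rewrite /dot2 /sum4 /= /GRing.scale /=; ring. Qed.

Lemma dot2_self p : dot2 p p = enorm p ^+ 2.
Proof. by rewrite sqr_enorm /dot2 !expr2. Qed.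

Lemma wsum_ge : enorm D ^+ 2 <= wsum.
Proof.
have h k : l k * dot2 D (W k) <= l k * weight k.
  by rewrite ler_wpM2l // /weight le_max lexx orbT.
rewrite -dot2_self {2}/D dot2_sum4 wsumE.
by rewrite !lerD.
Qed.

Lemma wsum_gt0 : 0 < wsum.
Proof. by apply: lt_le_trans wsum_ge; rewrite exprn_gt0 // enorm_gt0. Qed.

Lemma dot2_pushed : dot2 D pushed = Q / wsum.
Proof.
have dZ (k : R) p q : dot2 p (k *: q) = k * dot2 p q by rewrite /dot2 /= /GRing.scale /=; ring.
rewrite /pushed dZ mulrC dot2_sum4 !dZ !weight_sq.
by [].
Qed.

Lemma wsum_sq : wsum ^+ 2 <= Q.
Proof. by have := cauchy4 (weight 0) (weight 1) (weight 2) (weight 3) (l_ge0 0) (l_ge0 1) (l_ge0 2) (l_ge0 3); rewrite l_sum mul1r. Qed.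

Lemma dot2_pushed_gt0 : 0 < dot2 D pushed.
Proof.
rewrite dot2_pushed divr_gt0 ?wsum_gt0 //; apply: lt_le_trans wsum_sq.
by rewrite exprn_gt0 // wsum_gt0.
Qed.

Lemma pushed_ge (c : R) : c * enorm D * wsum <= Q -> c <= enorm pushed.
Proof.
move=> h; have d := enorm_gt0 D0; have := dot2_le D pushed; rewrite dot2_pushed => k.
rewrite -(ler_pM2l d) mulrC; apply: le_trans k.
by rewrite ler_pdivlMr ?wsum_gt0.
Qed.

Lemma pushed_far (c : R) : c <= enorm D -> c <= enorm pushed.
Proof.
move=> h; apply: pushed_ge; apply: le_trans wsum_sq; rewrite expr2 ler_pM2r ?wsum_gt0 //.
apply: le_trans wsum_ge; rewrite expr2 ler_pM2r //; exact: enorm_gt0.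
Qed.

(** A positive weight is then [|D| |W k|], so every corner that still counts is at least [c] long
    and points along [D]. *)
Lemma pushed_collinear (c : R) : (forall k, (k < 4)%N -> W k <> 0 -> c <= enorm (W k)) ->
  (forall k, (k < 4)%N -> det2 D (W k) = 0) -> c <= enorm pushed.
Proof.
move=> cW dW; apply: pushed_ge; rewrite wsumE !mulrDr.
have h k : (k < 4)%N -> c * enorm D * (l k * weight k) <= l k * weight k ^+ 2.
  move=> k4; rewrite mulrCA ler_wpM2l //.
  have [w0|wp] := eqVneq (weight k) 0; first by rewrite w0 mulr0 expr0n.
  have wp' : 0 < weight k by rewrite lt_neqAle eq_sym wp weight_ge0.
  rewrite expr2 ler_pM2r //.
  have wE : weight k = dot2 D (W k).
    by move: wp'; rewrite /weight; case: (lerP 0 (dot2 D (W k))) => //; rewrite ltxx.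
  have n0 : W k <> 0 by move=> e; move: wp'; rewrite wE e /dot2 !mulr0 addr0 ltxx.
  have -> : weight k = enorm D * enorm (W k).
    apply/eqP; rewrite -(eqrXn2 (n := 2)) ?weight_ge0 ?mulr_ge0 ?enorm_ge0 //; apply/eqP.
    rewrite wE exprMn !sqr_enorm; have := dW k k4; move: (D) (W k) => [a b] [a' b'].
    rewrite /det2 /dot2 /= => e; apply/eqP; rewrite -subr_eq0 -oppr_eq0; apply/eqP.
    by transitivity ((a * b' - b * a') ^+ 2); [ring|rewrite e expr0n].
  by rewrite mulrC ler_wpM2l ?enorm_ge0 // cW.
by rewrite !lerD ?h.
Qed.

(* Near the only zero of the cell, the vertex [j], the remaining weights are comparable to the
   distance to that vertex. *)
Lemma pushed_vertex (c : R) j : (j < 4)%N -> W j = 0 -> c * (1 - l j) <= enorm D -> c <= enorm pushed.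
Proof.
move=> j4 Wj h; apply: pushed_ge.
have wj : weight j = 0.
  by rewrite /weight Wj /dot2 !mulr0 addr0 maxxx.
have S0 := wsum_gt0; have d := enorm_gt0 D0.
have mu : wsum ^+ 2 <= (1 - l j) * Q.
  pose l' k := if k == j then 0 else l k.
  have l'0 k : 0 <= l' k by rewrite /l'; case: eqP.
  have := cauchy4 (weight 0) (weight 1) (weight 2) (weight 3) (l'0 0%N) (l'0 1%N) (l'0 2%N) (l'0 3%N).
  have e k : l' k * weight k = l k * weight k.
    by rewrite /l'; case: eqP => [->|//]; rewrite wj !mulr0.
  have e2 k : l' k * weight k ^+ 2 = l k * weight k ^+ 2 by rewrite !expr2 !mulrA e.
  rewrite !e !e2 -wsumE -/Q; have -> // : l' 0%N + l' 1%N + l' 2%N + l' 3%N = 1 - l j.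
  by rewrite -l_sum /l'; case: j j4 {Wj h wj l' l'0 e e2} => [|[|[|[|j]]]] //= _; ring.
have m0 : 0 < 1 - l j.
  have Q0 : 0 < Q by apply: lt_le_trans wsum_sq; rewrite exprn_gt0.
  by rewrite -(pmulr_lgt0 _ Q0); apply: lt_le_trans mu; rewrite exprn_gt0.
rewrite -(ler_pM2l m0); apply: le_trans mu; rewrite expr2 mulrA ler_pM2r //.
apply: le_trans wsum_ge; rewrite expr2 mulrA ler_pM2r // mulrC; exact: h.
Qed.

End Quad.

Lemma le_sum4_23 (R : realType) (a b c d : R) : 0 <= a -> 0 <= b -> c + d <= a + b + c + d.
Proof. by lra. Qed.
Lemma le_sum4_13 (R : realType) (a b c d : R) : 0 <= a -> 0 <= c -> b + d <= a + b + c + d.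
Proof. by lra. Qed.
Lemma det2_span (R : realType) (e e' : R * R) (a b a' b' : R) : det2 e e' = 0 ->
  det2 (a *: e - b *: e') (a' *: e - b' *: e') = 0.
Proof.
move=> h; transitivity ((b * a' - a * b') * det2 e e'); last by rewrite h mulr0.
by rewrite /det2 /= /GRing.scale /=; ring.
Qed.
Lemma det2_span_l (R : realType) (e e' : R * R) (a b : R) : det2 (a *: e - b *: e') e' = a * det2 e e'.
Proof. by rewrite /det2 /= /GRing.scale /=; ring. Qed.
Lemma det2_span_r (R : realType) (e e' : R * R) (a b : R) : det2 (a *: e - b *: e') e = b * det2 e e'.
Proof. by rewrite /det2 /= /GRing.scale /=; ring. Qed.
Lemma one_sub_mul (R : realType) (x y : R) : 1 - (1 - `|x|) * (1 - `|y|) <= `|x| + `|y|.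
Proof. by have := mulr_ge0 (normr_ge0 x) (normr_ge0 y); lra. Qed.
Lemma vertex_weight (R : realType) (s u : R) : 0 <= s <= 1 -> u = 0 \/ u = 1 ->
  (if u == 0 then 1 - s else s) = 1 - `|s - u|.
Proof.
move=> /andP[s0 s1] [] ->; rewrite ?eqxx ?oner_eq0; first by rewrite subr0 ger0_norm.
by rewrite ler0_norm ?subr_le0 //; ring.
Qed.
Lemma between_conv (R : realType) (a b s : R) : a < b -> 0 <= s <= 1 -> a <= a + s * (b - a) <= b.
Proof. by move=> ab /andP[s0 s1]; apply/andP; split; nra. Qed.

(** * The push on the product triangulation of the square *)

Section Retraction.
Context {R : realType}.
Variables (xs : seq R) (V : nat -> R * R).
Hypothesis T : triangulation xs.
Let n := nedges xs.
Let z i := xs`_i.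
Let Phi := plin z V n.
Hypothesis PW : plane_walk n V.

Definition bil (U : lmodType R) (F : nat -> nat -> U) (p : R * R) : U :=
  plin z (fun a => plin z (F a) n p.2) n p.1.

Definition gap (p : R * R) := Phi p.1 - Phi p.2.
(** The weights belong to pairs of vertices and are interpolated bilinearly by one formula on the
    whole square, so there is nothing to match along the sides of cells. *)
Definition push a b (p : R * R) : R := Num.max 0 (dot2 (gap p) (V a - V b)).
Definition push_sum p : R := bil (fun a b => push a b p : R^o) p.
Definition retr p : R * R := (push_sum p)^-1 *: bil (fun a b => push a b p *: ((z a, z b) : R * R)) p.

Definition in_cell i j (p : R * R) := (z i <= p.1 <= z i.+1) /\ (z j <= p.2 <= z j.+1).
Definition slope i (s : R) := (s - z i) / (z i.+1 - z i).
(** [k] is read in binary: the high bit selects the end of the first edge, the low bit that of the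
    second. *)
Definition corner (U : Type) (F : nat -> nat -> U) i j k := F (if (1 < k)%N then i.+1 else i) (if odd k then j.+1 else j).
Definition bary i j (p : R * R) k : R :=
  (if (1 < k)%N then slope i p.1 else 1 - slope i p.1) *
  (if odd k then slope j p.2 else 1 - slope j p.2).

Section Cell.
Variables (i j : nat).
Hypothesis hi : (i < n)%N.
Hypothesis hj : (j < n)%N.

Lemma slope01 k s : (k < n)%N -> z k <= s <= z k.+1 -> 0 <= slope k s <= 1.
Proof. by move=> hk hs; case: (convex_pt (tri_lt T hk) hs). Qed.

Lemma bary_ge0 p k : in_cell i j p -> 0 <= bary i j p k.
Proof.
move=> [h1 h2]; have /andP[a b] := slope01 hi h1; have /andP[a' b'] := slope01 hj h2.
by rewrite /bary mulr_ge0 //; case: ifP; rewrite ?subr_ge0.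
Qed.

Lemma bary_sum p : bary i j p 0 + bary i j p 1 + bary i j p 2 + bary i j p 3 = 1.
Proof. by rewrite /bary /=; ring. Qed.

Lemma bilE (U : lmodType R) (F : nat -> nat -> U) p : in_cell i j p ->
  bil F p = sum4 (bary i j p) (corner F i j).
Proof.
move=> [h1 h2]; rewrite /bil (plinE (tri_lt T) _ hi h1) !(plinE (tri_lt T) _ hj h2).
rewrite -/(slope i p.1) -/(slope j p.2) /sum4 /bary /corner /=.
move: (slope _ _) (slope _ _) => u v.
have conv (w : R) (x y : U) : x + w *: (y - x) = (1 - w) *: x + w *: y.
  by rewrite scalerBr scalerBl scale1r addrA addrAC.
by rewrite !conv !scalerDr !scalerA !addrA.
Qed.

Let W := corner (fun a b => V a - V b) i j.
Let e := V i.+1 - V i.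
Let e' := V j.+1 - V j.

Lemma PhiE_cell k s : (k < n)%N -> z k <= s <= z k.+1 -> Phi s = V k + slope k s *: (V k.+1 - V k).
Proof. by move=> hk hs; rewrite /Phi (plinE (tri_lt T) _ hk hs). Qed.

Lemma gapE p : in_cell i j p -> gap p = (V i - V j) + slope i p.1 *: e - slope j p.2 *: e'.
Proof.
move=> [h1 h2]; rewrite /gap (PhiE_cell hi h1) (PhiE_cell hj h2) -/e -/e'.
by rewrite opprD addrACA addrA.
Qed.

Lemma gap_sum4 p : in_cell i j p -> gap p = sum4 (bary i j p) W.
Proof.
move=> h; rewrite gapE // /sum4 /W /corner /bary /= /e /e'.
move: (slope _ _) (slope _ _) (V _) (V _) (V _) (V _) => u v [a a'] [b b'] [c c'] [d d'].
by apply: plane_eq; rewrite /= /GRing.scale /=; ring.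
Qed.

Lemma push_sumE p : in_cell i j p -> push_sum p = wsum (bary i j p) W.
Proof.
by move=> h; rewrite /push_sum bilE // /wsum /weight -gap_sum4.
Qed.

Section Point.
Variable p : R * R.
Hypothesis hp : in_cell i j p.
Hypothesis gp : gap p <> 0.

Let l := bary i j p.
Let w k := weight l W k.
Let S := wsum l W.

Lemma gap0' : sum4 l W <> 0. Proof. by rewrite -gap_sum4. Qed.
Let l0 k : 0 <= l k := bary_ge0 k hp.

Lemma push_sum_gt0 : 0 < push_sum p.
Proof. by rewrite push_sumE //; apply: (wsum_gt0 l0); exact: gap0'. Qed.

Lemma retrE : exists s t : R, [/\ 0 <= s <= 1, 0 <= t <= 1,
  retr p = (z i + s * (z i.+1 - z i), z j + t * (z j.+1 - z j)) &
  pushed l W = (V i - V j) + s *: e - t *: e'].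
Proof.
have S0 : 0 < S by apply: (wsum_gt0 l0); exact: gap0'.
have SE : S = l 0%N * w 0 + l 1%N * w 1 + l 2%N * w 2 + l 3%N * w 3 by [].
have lw k : 0 <= l k * w k by rewrite mulr_ge0 // weight_ge0.
exists ((l 2%N * w 2 + l 3%N * w 3) / S), ((l 1%N * w 1 + l 3%N * w 3) / S).
have [m0 m1 m2 m3] := And4 (lw 0%N) (lw 1%N) (lw 2%N) (lw 3%N).
split.
- rewrite divr_ge0 ?addr_ge0 ?(ltW S0) //= ler_pdivrMr // mul1r SE.
  exact: le_sum4_23.
- rewrite divr_ge0 ?addr_ge0 ?(ltW S0) //= ler_pdivrMr // mul1r SE.
  exact: le_sum4_13.
- rewrite /retr push_sumE // bilE // -/S -/l /sum4 /corner /=.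
  have wE k : push (if (1 < k)%N then i.+1 else i) (if odd k then j.+1 else j) p = w k.
    by rewrite /push gap_sum4.
  have := wE 0%N; have := wE 1%N; have := wE 2%N; have := wE 3%N => /= -> -> -> ->.
  have Sn : S != 0 by rewrite gt_eqF.
  apply: (scalerI Sn); rewrite scalerA divff // scale1r; apply: plane_eq; rewrite /= /GRing.scale /=.
    rewrite mulrDr [S * (_ / S * _)]mulrA [S * (_ / S)]mulrC divfK // SE; ring.
  by rewrite mulrDr [S * (_ / S * _)]mulrA [S * (_ / S)]mulrC divfK // SE; ring.
have Sn : S != 0 by rewrite gt_eqF.
apply: (scalerI Sn); rewrite /pushed scalerA divff // scale1r /sum4 /W /corner /e /e' /=.
rewrite -!/(w _) !(scalerBr, scalerDr, scalerN, scalerA) ![S * (_ / S)]mulrC !divfK // SE.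
move: (w _) (w _) (w _) (w _) (l _) (l _) (l _) (l _) (V _) (V _) (V _) (V _); clear.
move=> w0 w1 w2 w3 x0 x1 x2 x3 [a a'] [b b'] [c c'] [d d'].
by apply: plane_eq; rewrite /= /GRing.scale /=; ring.
Qed.

(** [gap] is affine on a cell, so it maps the weighted mean of the corners to the weighted mean of
    their differences, which is [pushed]. *)
Lemma retr_cell : in_cell i j (retr p) /\ gap (retr p) = pushed l W.
Proof.
have [s [t [hs ht E E']]] := retrE.
have li := tri_lt T hi; have lj := tri_lt T hj.
have h1 : z i <= z i + s * (z i.+1 - z i) <= z i.+1 by exact: between_conv.
have h2 : z j <= z j + t * (z j.+1 - z j) <= z j.+1 by exact: between_conv.
have hc : in_cell i j (retr p) by rewrite E.
split=> //; rewrite gapE // E' E /slope /=.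
have ni : z i.+1 - z i != 0 by rewrite subr_eq0 gt_eqF.
have nj : z j.+1 - z j != 0 by rewrite subr_eq0 gt_eqF.
by rewrite [z i + _]addrC [z j + _]addrC !addrK !mulfK.
Qed.

Lemma gap_conv (k : R) : 0 <= k <= 1 ->
  let q := (1 - k) *: p + k *: retr p in
  in_cell i j q /\ gap q = (1 - k) *: gap p + k *: gap (retr p).
Proof.
move=> /andP[k0 k1] q; have [[r1 r2] _] := retr_cell; case: hp => p1 p2.
have cv (a b x y : R) : a <= x <= b -> a <= y <= b -> a <= (1 - k) * x + k * y <= b.
  by move=> /andP[? ?] /andP[? ?]; apply/andP; split; nra.
have hq : in_cell i j q by split; [exact: cv|exact: cv].
have [rc _] := retr_cell; split=> //; rewrite (gapE hq) (gapE hp) (gapE rc).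
have sl a : (a < n)%N -> forall x y : R, slope a ((1 - k) * x + k * y) = (1 - k) * slope a x + k * slope a y.
  move=> ha x y; have na : z a.+1 - z a != 0 by rewrite subr_eq0 gt_eqF // (tri_lt T).
  by rewrite /slope; field.
rewrite /q /= /GRing.scale /= !sl //.
move: (slope _ _) (slope _ _) (slope _ _) (slope _ _) (V i - V j) e e' => a b c d [x x'] [y y'] [t t'].
by apply: plane_eq; rewrite /= /GRing.scale /=; ring.
Qed.

(** At both ends of the slide the difference has a positive component along [gap p]. *)
Lemma gap_conv_neq0 (k : R) : 0 <= k <= 1 -> gap ((1 - k) *: p + k *: retr p) <> 0.
Proof.
move=> hk; have [_ ->] := gap_conv hk; have [_ ->] := retr_cell.
have := dot2_pushed_gt0 l0 (bary_sum p) gap0'; rewrite -/l -/W -gap_sum4 // => h e0.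
have d : 0 < dot2 (gap p) (gap p) by rewrite dot2_self exprn_gt0 // enorm_gt0.
have : dot2 (gap p) ((1 - k) *: gap p + k *: pushed l W) = 0 by rewrite e0 /dot2 !mulr0 addr0.
have -> : dot2 (gap p) ((1 - k) *: gap p + k *: pushed l W) =
   (1 - k) * dot2 (gap p) (gap p) + k * dot2 (gap p) (pushed l W).
  by rewrite /dot2 /= /GRing.scale /=; ring.
by move: hk => /andP[k0 k1]; exact: conv_gt0.
Qed.

End Point.

(** If [gap] has no zero in the cell, compactness bounds it below and the push does not shorten it.
    If it has one and the edges are parallel, possibly constant, all corner differences lie on a
    line. If the edges are transversal, the zero is a corner, because edges of a plane walk cross
    only at vertices. *)
Lemma retr_far_cell : small (fun c => forall p, in_cell i j p -> gap p <> 0 -> c <= enorm (gap (retr p))).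
Proof.
have [[p0 hp0 z0]|nz] := pselect (exists2 p, in_cell i j p & gap p = 0); last first.
  have cC : compact (`[z i, z i.+1]%classic `*` `[z j, z j.+1]%classic : set (R * R)).
    by apply: compact_setX; exact: segment_compact.
  have cg : continuous gap.
    by apply: (@contB R (R * R)%type (R * R)%type); apply: (cont_comp (@plin_continuous R _ z V n));
       [exact: continuous_fst|exact: continuous_snd].
  have [|c c0 hc] := compact_enorm_min cC cg.
    by move=> p [/= h1 h2] g0; apply: nz; exists p => //; split; rewrite in_itv in h1 h2.
  apply: small_sub (small_lt c0) => r r0 rc p hp gp; have [_ ->] := retr_cell hp gp.
  apply: (pushed_far (fun k => bary_ge0 k hp) (bary_sum p) (gap0' hp gp)).
  rewrite -(gap_sum4 hp); apply: le_trans (ltW rc) _; apply: hc.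
  by case: hp => h1 h2; split; rewrite /= in_itv.
have gap_diff p : in_cell i j p -> gap p = (slope i p.1 - slope i p0.1) *: e - (slope j p.2 - slope j p0.2) *: e'.
  move=> hp; rewrite -[LHS]subr0 -z0 !gapE //.
  move: (slope _ _) (slope _ _) (slope _ _) (slope _ _) (V i - V j) e e' => a b c d [x x'] [y y'] [t t'].
  by apply: plane_eq; rewrite /= /GRing.scale /=; ring.
have [d0|dn] := eqVneq (det2 e e') 0.
  have wsm : small (fun c : R => forall k, (k < 4)%N -> W k <> 0 -> c < enorm (W k)).
    by apply: small_all => k k4; apply: small_imp => wk; apply: small_lt; exact: enorm_gt0.
  apply: small_sub wsm => c c0 hc p hp gp; have [_ ->] := retr_cell hp gp.
  apply: (pushed_collinear (fun k => bary_ge0 k hp) (gap0' hp gp)) => [k k4 wk|k k4].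
    by apply: ltW; apply: hc.
  rewrite -(gap_sum4 hp) (gap_diff p hp).
  have WE : exists a b : R, W k = a *: e - b *: e'.
    have E0 : V i - V j = - (slope i p0.1 *: e - slope j p0.2 *: e').
      by apply/eqP; rewrite -addr_eq0 addrA; apply/eqP; rewrite -z0 (gapE hp0).
    exists ((if (1 < k)%N then 1 else 0) - slope i p0.1), ((if odd k then 1 else 0) - slope j p0.2).
    have -> : W k = (V i - V j) + (if (1 < k)%N then 1 else 0) *: e - (if odd k then 1 else 0) *: e'.
      rewrite /W /corner /e /e'; case: ifP => _; case: ifP => _;
      move: (V i) (V i.+1) (V j) (V j.+1) => [x x'] [y y'] [t t'] [r r'];
      by apply: plane_eq; rewrite /= /GRing.scale /=; ring.
    rewrite E0; move: (slope _ _) (slope _ _) (if _ then _ else _) (if _ then _ else _) e e' => a b c' d [x x'] [y y'].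
    by apply: plane_eq; rewrite /= /GRing.scale /=; ring.
  by have [a [b ->]] := WE; exact: det2_span.
have e0 : e <> 0 by move=> h; move: dn; rewrite h /det2 /= !mul0r subrr eqxx.
have e0' : e' <> 0 by move=> h; move: dn; rewrite h /det2 /= !mulr0 subrr eqxx.
have a0 := enorm_gt0 e0; have a0' := enorm_gt0 e0'.
have [k k4 [Wk [uk [vk [huk hvk gk lk]]]]] : exists2 k, (k < 4)%N & W k = 0 /\ exists u v : R,
    [/\ u = 0 \/ u = 1, v = 0 \/ v = 1,
     forall p, in_cell i j p -> gap p = (slope i p.1 - u) *: e - (slope j p.2 - v) *: e' &
     forall p, bary i j p k = (if u == 0 then 1 - slope i p.1 else slope i p.1) *
       (if v == 0 then 1 - slope j p.2 else slope j p.2)].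
  case: hp0 => h1 h2; have s1 := plin_seg (tri_lt T) V hi h1; have s2 := plin_seg (tri_lt T) V hj h2.
  have E : plin z V n p0.1 = plin z V n p0.2.
    by apply/eqP; rewrite -subr_eq0; apply/eqP; exact: z0.
  rewrite -/n -/z E in s1.
  have one : (1 : R) == 0 = false by rewrite oner_eq0.
  case: (PW hi hj s1 s2) => [[q1 q2]|[q1 q2]|[q1 q2]].
  - move: (plin z V n p0.2) q1 q2 => q q1 q2.
    case: q1 => q1; case: q2 => q2; [exists 0%N|exists 1%N|exists 2%N|exists 3%N] => //;
      (split; first by rewrite /W /corner /= -q1 -q2 subrr).
    + exists 0, 0; split; auto; last by move=> p; rewrite !eqxx.
      by move=> p hp; rewrite gapE // -q1 -q2 subrr add0r !subr0.
    + exists 0, 1; split; auto; last by move=> p; rewrite !eqxx one.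
      move=> p hp; rewrite gapE // /e' -q1 -q2 subr0.
      move: (slope _ _) (slope _ _) e (V _) q {q1 q2} => a b [x x'] [y y'] [t t'].
      by apply: plane_eq; rewrite /= /GRing.scale /=; ring.
    + exists 1, 0; split; auto; last by move=> p; rewrite !eqxx one.
      move=> p hp; rewrite gapE // /e -q1 -q2 subr0.
      move: (slope _ _) (slope _ _) e' (V _) q {q1 q2} => a b [x x'] [y y'] [t t'].
      by apply: plane_eq; rewrite /= /GRing.scale /=; ring.
    + exists 1, 1; split; auto; last by move=> p; rewrite one.
      move=> p hp; rewrite gapE // /e /e' -q1 -q2.
      move: (slope _ _) (slope _ _) (V _) (V _) q {q1 q2} => a b [x x'] [y y'] [t t'].
      by apply: plane_eq; rewrite /= /GRing.scale /=; ring.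
  - by move: dn; rewrite /e /e' q1 q2 /det2 mulrC subrr eqxx.
  move: dn; rewrite /e /e' q1 q2; have -> : det2 (V j - V j.+1) (V j.+1 - V j) = 0; last by rewrite eqxx.
  by rewrite /det2 /=; ring.
(* Cramer's rule recovers [a] and [b] from [gap p = a e - b e'], which bounds the distance to the
   corner by [enorm (gap p) / c]. *)
pose c := `|det2 e e'| / (enorm e + enorm e').
have ee : 0 < enorm e + enorm e' by rewrite addr_gt0.
have c0 : 0 < c by rewrite divr_gt0 // normr_gt0.
apply: small_sub (small_lt c0) => r r0 rc p hp gp; have [_ ->] := retr_cell hp gp.
apply: le_trans (ltW rc) _.
apply: (pushed_vertex (fun k => bary_ge0 k hp) (bary_sum p) (gap0' hp gp) k4 Wk).
rewrite -(gap_sum4 hp).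
have g := gk p hp; set a := slope i p.1 - uk in g; set b := slope j p.2 - vk in g.
have d1 : `|a| * `|det2 e e'| <= enorm (gap p) * enorm e'.
  by rewrite -normrM -(det2_span_l e e' a b) -g; exact: det2_le.
have d2 : `|b| * `|det2 e e'| <= enorm (gap p) * enorm e.
  by rewrite -normrM -(det2_span_r e e' a b) -g; exact: det2_le.
have m : 1 - bary i j p k <= `|a| + `|b|.
  rewrite lk (vertex_weight (slope01 hi hp.1) huk) (vertex_weight (slope01 hj hp.2) hvk).
  exact: (one_sub_mul a b).
apply: le_trans (ler_wpM2l (ltW c0) m) _.
rewrite /c mulrAC (ler_pdivrMr _ _ ee) mulrC mulrDl mulrDr [leRHS]addrC; exact: (lerD d1 d2).
Qed.

End Cell.
End Retraction.

Section Continuity.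
Context {R : realType}.

Lemma continuous_plin (T : topologicalType) (U : normedModType R) (z : nat -> R) N
    (q : T -> nat -> U) (s : T -> R) : (forall k, continuous (fun x => q x k)) -> continuous s ->
  continuous (fun x => plin z (q x) N (s x)).
Proof.
move=> cq cs; elim: N => [|N IH].
  have -> : (fun x => plin z (q x) 0 (s x)) = (fun x => q x 0%N).
    by apply/funext => x; rewrite /plin big_ord0 addr0.
  exact: cq.
have -> : (fun x => plin z (q x) N.+1 (s x)) = (fun x => plin z (q x) N (s x) +
    clamp01 ((s x - z N) / (z N.+1 - z N)) *: (q x N.+1 - q x N)).
  by apply/funext => x; rewrite /plin big_ord_recr /= addrA.
apply: contD => //; apply: contZ; last exact: contB.
apply: (cont_comp (@continuous_clamp01 R)).
apply: (@contM R T); last exact: cont_cst.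
by apply: (@contB R T R); [exact: cs|exact: cont_cst].
Qed.

Lemma continuous_normalize (T : topologicalType) (f : T -> R * R) (x : T) :
  {for x, continuous f} -> f x <> 0 -> {for x, continuous (fun y => (enorm (f y))^-1 *: f y)}.
Proof.
move=> cf n0; have ce : {for x, continuous (fun y => enorm (f y))}.
  by apply: continuous_comp; [exact: cf|exact: continuous_enorm].
apply: continuousZ; last exact: cf.
by apply: continuousV; [rewrite gt_eqF // enorm_gt0|exact: ce].
Qed.

Lemma enorm_normalize (w : R * R) : w <> 0 -> enorm ((enorm w)^-1 *: w) = 1.
Proof.
move=> n0; have e := enorm_gt0 n0; rewrite enormZ gtr0_norm ?invr_gt0 // mulVf // gt_eqF //.
Qed.

Lemma sub_sub (V : zmodType) (a b p q : V) : a - b - (p - q) = (a - p) - (b - q).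
Proof. by rewrite !opprB addrACA [RHS]addrACA; congr (_ + _); rewrite addrC. Qed.

Lemma conv_eq0 (m : R) (d g : R * R) : (1 - m) *: d + m *: g = 0 -> g = - ((1 - m) *: (d - g)).
Proof.
move=> e; apply/eqP; rewrite -subr_eq0 opprK -e; apply/eqP.
case: d g {e} => [a b] [a' b']; apply: plane_eq; rewrite /= /GRing.scale /=; ring.
Qed.

End Continuity.

(** * Approximability implies the deleted product property *)

Section Homotopy.
Context {R : realType}.
Variables (phi : R -> R * R) (xs : seq R).
Hypothesis T : triangulation xs.
Hypothesis Lin : linear_on_edges phi xs.
Let n := nedges xs.
Let V a := phi xs`_a.
Hypothesis PW : plane_walk n V.
Let gap := gap xs V.
Let retr := retr xs V.

Lemma gap_phi z : unit_arc z.1 -> unit_arc z.2 -> gap z = phi z.1 - phi z.2.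
Proof. by move=> /unit_arcP h1 /unit_arcP h2; rewrite !(linear_plin T Lin). Qed.

Lemma gap_sep z : separated_pairs phi z -> gap z <> 0.
Proof. by move=> [h1 h2 ne]; rewrite gap_phi // => /eqP; rewrite subr_eq0 => /eqP. Qed.

Lemma sep_cell z : unit_arc z.1 -> unit_arc z.2 ->
  exists i j, [/\ (i < n)%N, (j < n)%N & in_cell xs i j z].
Proof.
move=> /unit_arcP h1 /unit_arcP h2.
have [i hi his] := tri_locate T h1; have [j hj hjs] := tri_locate T h2.
by exists i, j.
Qed.

Lemma cell_arc i j z : (i < n)%N -> (j < n)%N -> in_cell xs i j z -> unit_arc z.1 /\ unit_arc z.2.
Proof.
have arc k s : (k < n)%N -> xs`_k <= s <= xs`_k.+1 -> unit_arc s.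
  move=> hk /andP[a b]; apply/unit_arcP.
  have /andP[a0 _] := tri_01 T (ltnW hk); have /andP[_ b1] := tri_01 T hk.
  by rewrite (le_trans a0 a) (le_trans b b1).
by move=> hi hj [h1 h2]; split; [exact: arc h1|exact: arc h2].
Qed.

Lemma retr_far : exists2 c : R, 0 < c & forall z, separated_pairs phi z -> c <= enorm (gap (retr z)).
Proof.
have h : small (fun c : R => forall i, (i < n)%N -> forall j, (j < n)%N ->
    forall p, in_cell xs i j p -> gap p <> 0 -> c <= enorm (gap (retr p))).
  by apply: small_all => i hi; apply: small_all => j hj; exact: (retr_far_cell T PW hi hj).
have [c c0 hc] := small_ex h; exists c => // z sz.
have [z1 z2 _] := sz; have [i [j [hi hj cz]]] := sep_cell z1 z2.
exact: (hc i hi j hj z cz (gap_sep sz)).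
Qed.

Definition slide (z : R * R) (k : R) := (1 - k) *: z + k *: retr z.

Lemma slide_sep z k : separated_pairs phi z -> 0 <= k <= 1 -> separated_pairs phi (slide z k).
Proof.
move=> sz hk; have [z1 z2 _] := sz; have [i [j [hi hj cz]]] := sep_cell z1 z2.
have [cq _] := gap_conv T hi hj cz (gap_sep sz) hk.
have ne := gap_conv_neq0 T hi hj cz (gap_sep sz) hk.
have [q1 q2] := cell_arc hi hj cq.
by split=> // e; apply: ne; have := gap_phi q1 q2; rewrite e subrr.
Qed.

Lemma continuous_gap : continuous gap.
Proof.
apply: (@contB R (R * R)%type (R * R)%type).
  by apply: (cont_comp (@plin_continuous R (R * R)%type (fun i => xs`_i) V n)); exact: continuous_fst.
by apply: (cont_comp (@plin_continuous R (R * R)%type (fun i => xs`_i) V n)); exact: continuous_snd.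
Qed.

Lemma continuous_push a b : continuous (push xs V a b).
Proof.
have cd : continuous (fun p => dot2 (gap p) (V a - V b)).
  apply: (@contD R (R * R)%type R); apply: (@contM R (R * R)%type); try exact: cont_cst.
    by apply: (cont_comp (@continuous_fst R R)); exact: continuous_gap.
  by apply: (cont_comp (@continuous_snd R R)); exact: continuous_gap.
move=> p; apply: (@continuous_max _ _ (fun=> 0) _ p); last exact: cd.
exact: cst_continuous.
Qed.

Lemma continuous_bil (U : normedModType R) (F : nat -> nat -> R * R -> U) :
  (forall a b, continuous (F a b)) -> continuous (fun p => bil xs (fun a b => F a b p) p).
Proof.
move=> cF; apply: continuous_plin; last exact: continuous_fst.
by move=> a; apply: continuous_plin; [move=> b; exact: cF|exact: continuous_snd].
Qed.

Lemma continuous_retr z : separated_pairs phi z -> {for z, continuous retr}.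
Proof.
move=> sz; have [z1 z2 _] := sz; have [i [j [hi hj cz]]] := sep_cell z1 z2.
have S0 := push_sum_gt0 T hi hj cz (gap_sep sz).
apply: continuousZ.
  apply: continuousV; first by rewrite gt_eqF.
  by apply: (@continuous_bil R^o (fun a b => push xs V a b)) => a b; exact: continuous_push.
apply: (@continuous_bil _ (fun a b p => push xs V a b p *: ((xs`_a, xs`_b) : R * R))) => a b.
by apply: (@contZ R); [exact: continuous_push|exact: cont_cst].
Qed.

Theorem approximable_deleted_product :
  approximable_by_embeddings phi -> deleted_product_property phi.
Proof.
move=> app; have [c c0 far] := retr_far.
(* Errors of [c / 2] at the two points keep the difference of [f] within [c] of that of [phi], which
   is at least [c] long after the push. *)
have [|f0 [cf0 inj0 close0]] := app (c / 2); first by rewrite divr_gt0.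
pose f t := f0 (clamp01 t).
have fE t : unit_arc t -> f t = f0 t by move=> /unit_arcP h; rewrite /f clamp01_id.
have cf : continuous f.
  by apply: (continuous_within cf0); [exact: continuous_clamp01|exact: clamp01_arc].
pose df (z : R * R) := f z.1 - f z.2.
have cdf : continuous df.
  apply: (@contB R (R * R)%type (R * R)%type).
    by apply: (cont_comp cf); exact: continuous_fst.
  by apply: (cont_comp cf); exact: continuous_snd.
have df0 z : deleted_product z -> df z <> 0.
  move=> [z1 z2 ne] /eqP; rewrite subr_eq0 !fE // => /eqP e; apply: ne.
  by apply: inj0 e; exact: mem_set.
have sep_del z : separated_pairs phi z -> deleted_product z.
  by move=> [z1 z2 ne]; split=> // e; apply: ne; rewrite e.
(* Slide out in the first third, go straight from the difference of [f] to that of [phi] in the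
   second, slide back in the last. *)
pose lam (t : R) := clamp01 (Num.min (3 * t) (3 * (1 - t))).
pose mu (t : R) := clamp01 (3 * t - 1).
pose num (w : (R * R) * R) := (1 - mu w.2) *: df (slide w.1 (lam w.2)) + mu w.2 *: gap (slide w.1 (lam w.2)).
have num0 z t : separated_pairs phi z -> unit_arc t -> num (z, t) <> 0.
  move=> sz /unit_arcP /andP[t0 t1]; rewrite /num /=.
  have l01 : 0 <= lam t <= 1 by rewrite clamp01_ge0 clamp01_le1.
  have ss := slide_sep sz l01.
  have [t3|t3] := lerP (3 * t) 1.
    have -> : mu t = 0 by apply: clamp01_0; lra.
    by rewrite subr0 scale1r scale0r addr0; apply: df0; exact: sep_del.
  have [t4|t4] := lerP 2 (3 * t).
    have -> : mu t = 1 by apply: clamp01_1; lra.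
    by rewrite subrr scale1r scale0r add0r; exact: gap_sep.
  have l1 : lam t = 1 by apply: clamp01_1; rewrite le_min; apply/andP; split; lra.
  have sE : slide z (lam t) = retr z by rewrite /slide l1 subrr scale0r add0r scale1r.
  rewrite sE in ss *; have [r1 r2 _] := ss.
  have fz := far z sz.
  have m01 : 0 <= 1 - mu t <= 1.
    have := clamp01_ge0 (3 * t - 1); have := clamp01_le1 (3 * t - 1).
    by rewrite /mu; move: (clamp01 _) => v *; apply/andP; split; lra.
  have d : enorm (df (retr z) - gap (retr z)) < c.
    rewrite gap_phi // /df !fE //.
    have -> : f0 (retr z).1 - f0 (retr z).2 - (phi (retr z).1 - phi (retr z).2) =
      (f0 (retr z).1 - phi (retr z).1) - (f0 (retr z).2 - phi (retr z).2).
      exact: sub_sub.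
    have := enormD (f0 (retr z).1 - phi (retr z).1) (- (f0 (retr z).2 - phi (retr z).2)).
    rewrite enormN => h; apply: le_lt_trans h _.
    by have := close0 _ r1; have := close0 _ r2 => /= h2 h1; rewrite [ltRHS](splitr c) ltrD.
  move=> e; have : enorm (gap (retr z)) < c.
    rewrite (conv_eq0 e).
    rewrite enormN enormZ ger0_norm; last by case/andP: m01.
    apply: le_lt_trans d; rewrite -[leRHS]mul1r ler_wpM2r ?enorm_ge0 //.
    by case/andP: m01.
  by rewrite ltNge fz.
exists (gauss_map f).
  split.
    apply: continuous_in_subspaceT => z /set_mem dz.
    by apply: (@continuous_normalize R _ df); [exact: cdf|exact: df0].
  by move=> z dz; apply: enorm_normalize; exact: df0.
have lam0 : lam 0 = 0 by apply: clamp01_0; rewrite mulr0 ge_min lexx.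
have lam1 : lam 1 = 0 by apply: clamp01_0; rewrite subrr mulr0 ge_min lexx orbT.
have mu0 : mu 0 = 0 by apply: clamp01_0; lra.
have mu1 : mu 1 = 1 by apply: clamp01_1; lra.
have slide0 z : slide z 0 = z by rewrite /slide subr0 scale1r scale0r addr0.
exists (fun w => (enorm (num w))^-1 *: num w); split.
- apply: continuous_in_subspaceT => -[z t] /set_mem [/= sz ut].
  apply: continuous_normalize; last exact: num0.
  have clam : continuous lam.
    apply: (cont_comp (@continuous_clamp01 R)).
    have c1 : continuous (fun t : R => 3 * t) by apply: (@contM R R); [exact: cont_cst|exact: cont_id].
    have c2 : continuous (fun t : R => 3 * (1 - t)).
      apply: (@contM R R); first exact: cont_cst.
      by apply: (@contB R R R); [exact: cont_cst|exact: cont_id].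
    by move=> s; apply: (@continuous_min _ _ _ _ s); [exact: c1|exact: c2].
  have cmu : continuous mu.
    apply: (cont_comp (@continuous_clamp01 R)); apply: (@contB R R R); last exact: cont_cst.
    by apply: (@contM R R); [exact: cont_cst|exact: cont_id].
  have cfst : continuous (@fst (R * R)%type R) by exact: continuous_fst.
  have csnd : continuous (@snd (R * R)%type R) by exact: continuous_snd.
  have clam2 : continuous (fun w : (R * R) * R => lam w.2) by apply: (cont_comp clam).
  have cmu2 : continuous (fun w : (R * R) * R => mu w.2) by apply: (cont_comp cmu).
  have c1m : continuous (fun w : (R * R) * R => 1 - mu w.2).
    by apply: (@contB R _ R); [exact: cont_cst|exact: cmu2].
  have c1l : continuous (fun w : (R * R) * R => 1 - lam w.2).
    by apply: (@contB R _ R); [exact: cont_cst|exact: clam2].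
  have cr : {for (z, t), continuous (fun w : (R * R) * R => retr w.1)}.
    by apply: (@continuous_comp _ _ _ (@fst (R * R)%type R) retr); [exact: cfst|exact: continuous_retr].
  have cs : {for (z, t), continuous (fun w : (R * R) * R => slide w.1 (lam w.2))}.
    apply: continuousD; first by apply: continuousZ; [exact: c1l|exact: cfst].
    by apply: continuousZ; [exact: clam2|exact: cr].
  apply: continuousD; apply: continuousZ; [exact: c1m| |exact: cmu2|].
    by apply: (@continuous_comp _ _ _ (fun w : (R * R) * R => slide w.1 (lam w.2)) df); [exact: cs|exact: cdf].
  by apply: (@continuous_comp _ _ _ (fun w : (R * R) * R => slide w.1 (lam w.2)) gap); [exact: cs|exact: continuous_gap].
- by move=> z t sz ut; apply: enorm_normalize; exact: num0.
- by move=> z sz; rewrite /num /= lam0 mu0 slide0 subr0 scale1r scale0r addr0.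
move=> z sz; have [z1 z2 _] := sz.
by rewrite /num /= lam1 mu1 slide0 subrr scale1r scale0r add0r gap_phi.
Qed.

End Homotopy.

(** * Simplicial triangulations *)

Section Walk.
Context {R : realType}.

Theorem simplicial_plane_walk (phi : R -> R * R) (xs : seq R) : simplicial_triangulation phi xs ->
  [/\ triangulation xs, linear_on_edges phi xs & plane_walk (nedges xs) (fun a => phi xs`_a)].
Proof.
move=> [T [G [G1 G2 G3] [S1 S2 S3]]]; split=> //.
set n := nedges xs; pose V a := phi xs`_a.
have vert a : (a <= n)%N -> V a \in gvertices G.
  by move=> ha; apply: S1; rewrite mem_nth // (tri_size T).
have A i v : (i < n)%N -> v \in gvertices G -> seg (V i) (V i.+1) v -> v = V i \/ v = V i.+1.
  move=> hi hv; rewrite /V; case: (S3 i hi) => [->|e|e] s.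
  - by left; exact: seg_refl s.
  - exact: G2 e hv s.
  - by rewrite segC in s; case: (G2 _ _ e hv s); [right|left].
have B i j : (i < n)%N -> (j < n)%N -> V i <> V i.+1 -> V j <> V j.+1 ->
    seg (V i) (V i.+1) = seg (V j) (V j.+1) \/
    seg (V i) (V i.+1) `&` seg (V j) (V j.+1) `<=` [set v | v \in gvertices G].
  move=> hi hj ni nj; rewrite /V.
  case: (S3 i hi) => [//|ei|ei]; case: (S3 j hj) => [//|ej|ej]; have := G3 _ _ ei ej => /=.
  - by [].
  - by rewrite [seg (phi xs`_j.+1) _]segC.
  - by rewrite [seg (phi xs`_i.+1) _]segC.
  by rewrite [seg (phi xs`_j.+1) _]segC [seg (phi xs`_i.+1) _]segC.
move=> i j p hi hj s1 s2; rewrite -/(V i) -/(V i.+1) -/(V j) -/(V j.+1) in s1 s2 *.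
have hv : p \in gvertices G -> (p = V i \/ p = V i.+1) /\ (p = V j \/ p = V j.+1).
  by move=> pv; split; apply: A.
have [ei|ni] := pselect (V i = V i.+1).
  constructor 1; apply: hv; rewrite -ei in s1; rewrite (seg_refl s1); apply: vert; exact: ltnW.
have [ej|nj] := pselect (V j = V j.+1).
  constructor 1; apply: hv; rewrite -ej in s2; rewrite (seg_refl s2); apply: vert; exact: ltnW.
case: (B i j hi hj ni nj) => [E|sub]; last by constructor 1; apply: hv; exact: sub.
have c1 : V i = V j \/ V i = V j.+1.
  by apply: A; [exact: hj|exact: vert (ltnW hi)|rewrite -E; exact: seg_l].
have c2 : V i.+1 = V j \/ V i.+1 = V j.+1.
  by apply: A; [exact: hj|exact: vert|rewrite -E; exact: seg_r].
case: c1 => e1; case: c2 => e2.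
- by case: ni; rewrite e1 e2.
- by constructor 2.
- by constructor 3.
by case: ni; rewrite e1 e2.
Qed.

End Walk.

(** * Parallel and transversal segments *)

Section Segments.
Context {R : realType}.
Implicit Types a b c d p q : R * R.

Lemma seg_sub a b p q : seg a b p -> seg a b q -> exists k : R, p - q = k *: (b - a).
Proof.
move=> [s _ <-] [t _ <-]; exists (s - t); case: a b => [x y] [x' y'].
by apply: plane_eq; rewrite /= /GRing.scale /=; ring.
Qed.

Lemma transverse_uniq a b c d p q : det2 (b - a) (d - c) <> 0 ->
  seg a b p -> seg c d p -> seg a b q -> seg c d q -> p = q.
Proof.
move=> n0 p1 p2 q1 q2; have [k1 e1] := seg_sub p1 q1; have [k2 e2] := seg_sub p2 q2.
have : k2 * det2 (b - a) (d - c) = 0.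
  have -> : k2 * det2 (b - a) (d - c) = det2 (b - a) (k2 *: (d - c)).
    by rewrite /det2 /= /GRing.scale /=; ring.
  by rewrite -e2 e1 /det2 /= /GRing.scale /=; ring.
move=> /eqP; rewrite mulf_eq0 => /orP[/eqP k0|/eqP //].
by apply/eqP; rewrite -subr_eq0 e2 k0 scale0r.
Qed.

Lemma parallel_coord (e w : R * R) : e <> 0 -> det2 e w = 0 -> exists k : R, w = k *: e.
Proof.
move=> ne h; have d0 : enorm e ^+ 2 != 0 by rewrite gt_eqF // exprn_gt0 // enorm_gt0.
exists (dot2 e w / enorm e ^+ 2); apply: (scalerI d0); rewrite scalerA [_ * (_ / _)]mulrC divfK //.
rewrite sqr_enorm; move: h; rewrite /dot2 /det2; case: e w {ne d0} => [x y] [x' y'] /= h.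
apply: plane_eq; rewrite /= /GRing.scale /=; apply/eqP; rewrite -subr_eq0; apply/eqP.
  by transitivity (- y * (x * y' - y * x')); [ring|rewrite h mulr0].
by transitivity (x * (x * y' - y * x')); [ring|rewrite h mulr0].
Qed.

(** In the coordinate [q] on the common line the first segment is [[0, 1]]. Neither segment has an
    end strictly inside the other and they share an inner point, so their ends agree. *)
Lemma overlap a b c d p : a <> b -> c <> d -> det2 (b - a) (d - c) = 0 ->
  seg a b p -> seg c d p -> p <> a -> p <> b -> p <> c -> p <> d ->
  (seg a b c -> c = a \/ c = b) -> (seg a b d -> d = a \/ d = b) ->
  (seg c d a -> a = c \/ a = d) -> (seg c d b -> b = c \/ b = d) ->
  seg a b = seg c d.
Proof.
move=> ab cd par p1 p2 na nb nc nd.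
have ne : b - a <> 0 by move=> /eqP; rewrite subr_eq0 => /eqP /esym.
have ne0 : b - a != 0 by apply/eqP.
pose q (x : R) := a + x *: (b - a).
have q_inj x y : q x = q y -> x = y.
  move=> /addrI /eqP; rewrite -subr_eq0 -scalerBl scaler_eq0 (negPf ne0) orbF subr_eq0.
  by move/eqP.
have q0 : q 0 = a by rewrite /q scale0r addr0.
have q1 : q 1 = b by rewrite /q scale1r addrC subrK.
have qc (x y t : R) : (1 - t) *: q x + t *: q y = q ((1 - t) * x + t * y).
  by rewrite /q; case: a b {ab par p1 na nb ne ne0 q q_inj q0 q1} => [a1 a2] [b1 b2];
    apply: plane_eq; rewrite /= /GRing.scale /=; ring.
have seg_q (x y u : R) : x < y -> x <= u <= y -> seg (q x) (q y) (q u).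
  move=> xy hu; have [t01 eu] := convex_pt xy hu; move: (_ / _) t01 eu => t t01 eu.
  by exists t; [apply/unit_arcP|rewrite qc -eu].
have [pi ep] : exists pi, p = q pi.
  by case: p1 => t _ <-; exists ((1 - t) * 0 + t * 1); rewrite -qc q0 q1.
have p01 : 0 < pi < 1.
  have [t /unit_arcP /andP[t0 t1] et] := p1.
  have -> : pi = t by apply: q_inj; rewrite -ep -et -{1}q0 -{1}q1 qc; congr q; ring.
  rewrite !lt_neqAle t0 t1 !andbT; apply/andP; split; apply/eqP => e.
    by apply: na; rewrite -et -e subr0 scale1r scale0r addr0.
  by apply: nb; rewrite -et e subrr scale1r scale0r add0r.
have [al [be [ec ed]]] : exists al be, c = q al /\ d = q be.
  have [k ek] := parallel_coord ne par; have [t _ et] := p2.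
  have ec : c = q (pi - t * k).
    have -> : c = p - t *: (d - c).
      rewrite -et; case: c d {cd par p2 nc nd ek et} => [c1 c2] [d1 d2].
      by apply: plane_eq; rewrite /= /GRing.scale /=; ring.
    by rewrite ek ep /q scalerA scalerBl addrA.
  exists (pi - t * k), (pi - t * k + k); split=> //.
  by rewrite /q scalerDl addrA -/(q _) -ec -ek addrC subrK.
have neab : al <> be by move=> e; apply: cd; rewrite ec ed e.
wlog lt : c d al be cd par p2 nc nd ec ed neab / al < be.
  move=> hw ac ad sa sb; case: (ltgtP al be) => // h; first exact: (hw c d al be).
  rewrite [seg c d]segC; apply: (hw d c be al) => //.
  - exact: nesym.
  - by have := congr1 (fun x => - x) par; rewrite oppr0 => <-; rewrite /det2 /=; ring.
  - by rewrite segC.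
  - exact: nesym.
  - by rewrite segC => /sa [] ?; [right|left].
  - by rewrite segC => /sb [] ?; [right|left].
move=> ac ad sa sb.
have pcd : al < pi < be.
  have [t /unit_arcP /andP[t0 t1] et] := p2.
  have E : pi = (1 - t) * al + t * be by apply: q_inj; rewrite -ep -et ec ed qc.
  have n1 : t != 0 by apply/eqP => t0'; apply: nc; rewrite -et t0' subr0 scale1r scale0r addr0.
  have n2 : t != 1 by apply/eqP => t1'; apply: nd; rewrite -et t1' subrr scale1r scale0r add0r.
  have t0' : 0 < t by rewrite lt_neqAle eq_sym n1.
  have t1' : t < 1 by rewrite lt_neqAle n2.
  by rewrite E; move: lt t0' t1'; clear; move=> *; apply/andP; split; nra.
move: p01 pcd => /andP[h1 h2] /andP[h3 h4].
have al0 : al = 0.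
  case: (ltgtP al 0) => // h.
    have : seg c d a by rewrite ec ed -q0; apply: seg_q => //; apply/andP; split; lra.
    by move/sa; rewrite ec ed -q0 => -[] /q_inj e; lra.
  have : seg a b c by rewrite ec -q0 -q1; apply: seg_q => //; apply/andP; split; lra.
  by move/ac; rewrite ec -q0 -q1 => -[] /q_inj e; lra.
have be1 : be = 1.
  case: (ltgtP be 1) => // h.
    have : seg a b d by rewrite ed -q0 -q1; apply: seg_q => //; apply/andP; split; lra.
    by move/ad; rewrite ed -q0 -q1 => -[] /q_inj e; lra.
  have : seg c d b by rewrite ec ed -q1; apply: seg_q => //; apply/andP; split; lra.
  by move/sb; rewrite ec ed -q1 => -[] /q_inj e; lra.
by rewrite ec ed al0 be1 q0 q1.
Qed.

End Segments.

(** * Refining a linear triangulation to a simplicial one *)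

Section Refinement.
Context {R : realType}.
Variables (phi : R -> R * R) (ys : seq R).
Hypothesis T : triangulation ys.
Hypothesis Lin : linear_on_edges phi ys.
Let N := nedges ys.
Let V a := phi ys`_a.

Let crossings : seq (R * R) := [seq V a | a <- iota 0 N.+1] ++
  [seq xget 0 (seg (V k) (V k.+1) `&` seg (V l) (V l.+1)) | k <- iota 0 N, l <- iota 0 N].
Let param k p : R := xget 0 [set s | ys`_k <= s <= ys`_k.+1 /\ phi s = p].
Let marked := ys ++ [seq param kp.1 kp.2 | kp <- [seq (k, p) | k <- iota 0 N, p <- crossings] &
  `[< V kp.1 <> V kp.1.+1 /\ seg (V kp.1) (V kp.1.+1) kp.2 >]].

Definition refinement := sort <=%R (undup marked).
Let xs := refinement.
Let n := nedges xs.

Lemma edge_point k s : (k < N)%N -> ys`_k <= s <= ys`_k.+1 ->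
  exists2 u : R, 0 <= u <= 1 & s = (1 - u) * ys`_k + u * ys`_k.+1 /\ phi s = V k + u *: (V k.+1 - V k).
Proof.
move=> hk hs; have [u01 es] := convex_pt (tri_lt T hk) hs; move: (_ / _) u01 es => u u01 es.
exists u => //; split=> //; rewrite es (Lin hk); last exact/unit_arcP.
by rewrite scalerBr scalerBl scale1r addrA addrAC.
Qed.

Lemma edge_phi_inj k s t : (k < N)%N -> V k <> V k.+1 -> ys`_k <= s <= ys`_k.+1 -> ys`_k <= t <= ys`_k.+1 ->
  phi s = phi t -> s = t.
Proof.
move=> hk ne hs ht; have [u u01 [-> ->]] := edge_point hk hs; have [v v01 [-> ->]] := edge_point hk ht.
move=> /addrI /eqP; rewrite -subr_eq0 -scalerBl scaler_eq0 => /orP[|]; rewrite subr_eq0 => /eqP e.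
  by rewrite e.
by case: ne; rewrite e.
Qed.

Lemma edge_phi_seg k s : (k < N)%N -> ys`_k <= s <= ys`_k.+1 -> seg (V k) (V k.+1) (phi s).
Proof.
move=> hk hs; have [u u01 [_ ->]] := edge_point hk hs; exists u; first exact/unit_arcP.
by rewrite scalerBr scalerBl scale1r addrA addrAC.
Qed.

Lemma paramP k p : (k < N)%N -> seg (V k) (V k.+1) p ->
  ys`_k <= param k p <= ys`_k.+1 /\ phi (param k p) = p.
Proof.
move=> hk [t ht e]; rewrite /param; case: xgetP => [y _ []|/(_ ((1 - t) * ys`_k + t * ys`_k.+1)) []] //.
split; last by rewrite (Lin hk).
by have /andP[t0 t1] := (unit_arcP t).1 ht; have := tri_lt T hk; nra.
Qed.

Lemma mem_refinement s : (s \in xs) = (s \in marked).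
Proof. by rewrite mem_sort mem_undup. Qed.

Lemma marked_param k p : (k < N)%N -> p \in crossings -> V k <> V k.+1 -> seg (V k) (V k.+1) p ->
  param k p \in xs.
Proof.
move=> hk hp ne sp; rewrite mem_refinement mem_cat; apply/orP; right.
apply/mapP; exists (k, p) => //; rewrite mem_filter; apply/andP; split; first exact/asboolP.
by apply: allpairs_f => //; rewrite mem_iota.
Qed.

Lemma vertex_crossing a : (a <= N)%N -> V a \in crossings.
Proof. by move=> ha; rewrite mem_cat map_f // mem_iota. Qed.

Lemma markedP s : s \in xs -> phi s \in crossings /\ 0 <= s <= 1.
Proof.
rewrite mem_refinement mem_cat => /orP[/(nthP 0)[a ha <-]|/mapP[[k p]]].
  have ha' : (a <= N)%N by rewrite -ltnS -(tri_size T).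
  by split; [exact: vertex_crossing|exact: tri_01].
rewrite mem_filter => /andP[/asboolP[ne sp] h];
  move: h => /allpairsPdep[k' [p' [hk hp [ek ep]]]] ->; subst k' p'.
rewrite mem_iota in hk; have [h ->] := paramP hk sp; split=> //.
have /andP[a0 _] := tri_01 T (ltnW hk); have /andP[_ b1] := tri_01 T hk.
by case/andP: h => h1 h2; rewrite (le_trans a0 h1) (le_trans h2 b1).
Qed.

Lemma sub_refinement s : s \in ys -> s \in xs.
Proof. by move=> h; rewrite mem_refinement mem_cat h. Qed.

Lemma mem_ys a : (a <= N)%N -> ys`_a \in xs.
Proof. by move=> ha; apply: sub_refinement; rewrite mem_nth // (tri_size T). Qed.

Lemma refinement_triangulation : triangulation xs.
Proof.
have srt : sorted <%R xs by rewrite sort_lt_sorted undup_uniq.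
have srt' : sorted <=%R xs by exact: sort_le_sorted.
have m0 : 0 \in xs by rewrite -(tri_0 T); exact: mem_ys.
have m1 : 1 \in xs by rewrite -(tri_n T); exact: mem_ys.
have sz : (0 < size xs)%N by case: (xs) m0.
split=> //.
  apply/eqP; rewrite eq_le; apply/andP; split.
    have := m0 => /(nthP 0)[i hi e]; rewrite -[leRHS]e.
    by apply: (sorted_leq_nth le_trans le_refl 0 srt').
  by have [_ /andP[]] := markedP (mem_nth 0 sz).
rewrite -nth_last; have sl : ((size xs).-1 < size xs)%N by rewrite prednK.
apply/eqP; rewrite eq_le; apply/andP; split.
  by have [_ /andP[]] := markedP (mem_nth 0 sl).
have := m1 => /(nthP 0)[i hi e]; rewrite -[leLHS]e.
by apply: (sorted_leq_nth le_trans le_refl 0 srt') => //; rewrite -ltnS prednK.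
Qed.

Let Tx := refinement_triangulation.

Lemma consecutive i s : (i < n)%N -> s \in xs -> xs`_i <= s <= xs`_i.+1 -> s = xs`_i \/ s = xs`_i.+1.
Proof.
move=> hi /(nthP 0)[m hm <-] /andP[h1 h2]; rewrite (tri_size Tx) ltnS in hm.
have le a b : (a <= b <= n)%N -> xs`_a <= xs`_b by exact: tri_le.
have [mi|im] := leqP m i.
  left; apply/eqP; rewrite eq_le h1 andbT; apply: le; rewrite mi ltnW //.
right; apply/eqP; rewrite eq_le h2 /=; apply: le; rewrite im //.
Qed.

Lemma coarse_edge i : (i < n)%N -> exists2 k, (k < N)%N & ys`_k <= xs`_i /\ xs`_i.+1 <= ys`_k.+1.
Proof.
(* The midpoint lies in some coarse edge, and no end of that edge falls strictly inside the fine
   one. *)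
move=> hi; have lt := tri_lt Tx hi; pose c := (xs`_i + xs`_i.+1) / 2.
have /andP[a0 a1] := tri_01 Tx (ltnW hi); have /andP[b0 b1] := tri_01 Tx hi.
have c01 : 0 <= c <= 1 by rewrite /c; apply/andP; split; lra.
have [k hk /andP[k1 k2]] := tri_locate T c01; exists k => //.
have c1 : xs`_i < c by rewrite /c; lra.
have c2 : c < xs`_i.+1 by rewrite /c; lra.
split; rewrite leNgt; apply/negP => h.
  have [|e|e] := consecutive hi (mem_ys (ltnW hk)); first by rewrite (ltW h) (le_trans k1 (ltW c2)).
    by move: h; rewrite e ltxx.
  by move: (le_lt_trans k1 c2); rewrite e ltxx.
have [|e|e] := consecutive hi (mem_ys hk); first by rewrite (ltW h) andbT (le_trans (ltW c1) k2).
  by move: (lt_le_trans c1 k2); rewrite e ltxx.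
by move: h; rewrite e ltxx.
Qed.

Lemma refinement_linear : linear_on_edges phi xs.
Proof.
move=> i hi; have [k hk [k1 k2]] := coarse_edge hi; have lt := tri_lt Tx hi.
move=> t /unit_arcP /andP[t0 t1]; have ly := tri_lt T hk.
have h1 : ys`_k <= xs`_i <= ys`_k.+1 by rewrite k1 (le_trans (ltW lt)).
have h2 : ys`_k <= xs`_i.+1 <= ys`_k.+1 by rewrite k2 andbT (le_trans k1 (ltW lt)).
have [u _ [eu pu]] := edge_point hk h1; have [v _ [ev pv]] := edge_point hk h2.
have hs : ys`_k <= (1 - t) * xs`_i + t * xs`_i.+1 <= ys`_k.+1.
  have /andP[? ?] := h1; have /andP[? ?] := h2; apply/andP; split; nra.
have [w _ [ew pw]] := edge_point hk hs.
have E : w = (1 - t) * u + t * v.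
  have d : ys`_k.+1 - ys`_k != 0 by rewrite subr_eq0 gt_eqF.
  apply: (mulIf d); apply: (addrI ys`_k).
  transitivity ((1 - w) * ys`_k + w * ys`_k.+1); first by ring.
  by rewrite -ew eu ev; ring.
rewrite pu pv pw E; move: (V k) (V k.+1) => [a a'] [b b'].
by apply: plane_eq; rewrite /= /GRing.scale /=; ring.
Qed.

(** On a coarse edge the value [p] is taken at one parameter only, and that parameter was marked. *)
Lemma crossing_end i p : (i < n)%N -> p \in crossings -> phi xs`_i <> phi xs`_i.+1 ->
  seg (phi xs`_i) (phi xs`_i.+1) p -> p = phi xs`_i \/ p = phi xs`_i.+1.
Proof.
move=> hi hp ne [t ht et]; have [k hk [k1 k2]] := coarse_edge hi; have lt := tri_lt Tx hi.
have /andP[t0 t1] := (unit_arcP t).1 ht.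
have h1 : ys`_k <= xs`_i <= ys`_k.+1 by rewrite k1 (le_trans (ltW lt)).
have h2 : ys`_k <= xs`_i.+1 <= ys`_k.+1 by rewrite k2 andbT (le_trans k1 (ltW lt)).
have nk : V k <> V k.+1.
  move=> e; apply: ne; have [u _ [_ ->]] := edge_point hk h1; have [v _ [_ ->]] := edge_point hk h2.
  by rewrite e subrr !scaler0.
pose s := (1 - t) * xs`_i + t * xs`_i.+1.
have ps : phi s = p by rewrite /s (refinement_linear hi) // et.
have s1 : xs`_i <= s <= xs`_i.+1 by rewrite /s; apply/andP; split; nra.
have s2 : ys`_k <= s <= ys`_k.+1 by case/andP: s1 => a b; rewrite (le_trans k1 a) (le_trans b k2).
have sp : seg (V k) (V k.+1) p by rewrite -ps; exact: edge_phi_seg.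
have [q1 q2] := paramP hk sp.
have es : param k p = s by apply: (edge_phi_inj hk nk q1 s2); rewrite q2 ps.
have := marked_param hk hp nk sp; rewrite es => ms.
by case: (consecutive hi ms s1) => <-; rewrite ps; [left|right].
Qed.

Lemma crossing_vertex i p : (i < n)%N -> p \in crossings -> phi xs`_i <> phi xs`_i.+1 ->
  seg (phi xs`_i) (phi xs`_i.+1) p -> p \in [seq phi x | x <- xs].
Proof.
move=> hi hp ne sp; have [->|->] := crossing_end hi hp ne sp; rewrite map_f //.
  by rewrite mem_nth // (tri_size Tx) ltnS ltnW.
by rewrite mem_nth // (tri_size Tx).
Qed.

Lemma coarse_direction i k : (k < N)%N -> (i < n)%N -> ys`_k <= xs`_i -> xs`_i.+1 <= ys`_k.+1 ->
  (forall p, seg (phi xs`_i) (phi xs`_i.+1) p -> seg (V k) (V k.+1) p) /\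
  exists c : R, phi xs`_i.+1 - phi xs`_i = c *: (V k.+1 - V k).
Proof.
move=> hk hi k1 k2; have lt := tri_lt Tx hi.
have h1 : ys`_k <= xs`_i <= ys`_k.+1 by rewrite k1 (le_trans (ltW lt)).
have h2 : ys`_k <= xs`_i.+1 <= ys`_k.+1 by rewrite k2 andbT (le_trans k1 (ltW lt)).
split.
  move=> p [t ht <-]; rewrite -(refinement_linear hi) //; apply: edge_phi_seg => //.
  have /andP[t0 t1] := (unit_arcP t).1 ht.
  by have /andP[? ?] := h1; have /andP[? ?] := h2; apply/andP; split; nra.
have [u _ [_ ->]] := edge_point hk h1; have [v _ [_ ->]] := edge_point hk h2.
by exists (v - u); rewrite opprD addrACA subrr add0r scalerBl.
Qed.

Theorem refinement_simplicial : simplicial_triangulation phi xs.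
Proof.
split; first exact: Tx.
pose E := [seq (phi xs`_i, phi xs`_i.+1) | i <- iota 0 n & phi xs`_i != phi xs`_i.+1].
have EP e : e \in E -> exists2 i, (i < n)%N & phi xs`_i <> phi xs`_i.+1 /\ e = (phi xs`_i, phi xs`_i.+1).
  by move=> /mapP[i]; rewrite mem_filter mem_iota => /andP[/eqP ne hi] ->; exists i.
have vx i : (i <= n)%N -> phi xs`_i \in [seq phi x | x <- xs].
  by move=> hi; rewrite map_f // mem_nth // (tri_size Tx).
exists (GraphData [seq phi x | x <- xs] E); last first.
  split=> /= [x hx||i hi].
  - exact: map_f.
  - exact: refinement_linear.
  have [e|ne] := eqVneq (phi xs`_i) (phi xs`_i.+1); first by constructor 1.
  constructor 2; apply/mapP; exists i => //; by rewrite mem_filter ne mem_iota.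
split=> /=.
- move=> e /EP[i hi [ne ->]] /=; split; [exact: vx (ltnW hi)|exact: vx|exact/eqP].
- move=> e v /EP[i hi [ne ->]] /= /mapP[x hx ->]; apply: crossing_end => //.
  by have [] := markedP hx.
move=> e e' /EP[i hi [ne ->]] /EP[j hj [ne' ->]] /=.
(* A common point that is not a vertex excludes transversal coarse edges, whose common point is
   marked; the edges are then parallel and [overlap] applies. *)
have [|notsub] := pselect (seg (phi xs`_i) (phi xs`_i.+1) `&` seg (phi xs`_j) (phi xs`_j.+1) `<=`
  [set v | v \in [seq phi x | x <- xs]]); [by right|left].
have [p [[s1 s2] np]] : exists p, (seg (phi xs`_i) (phi xs`_i.+1) `&` seg (phi xs`_j) (phi xs`_j.+1)) p /\
    p \notin [seq phi x | x <- xs].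
  by have [p /not_implyP[sp np]] := (existsNP _).2 notsub; exists p; split=> //; apply/negP.
have npc : p \notin crossings.
  by apply/negP => hp; move/negP: np; apply; exact: (crossing_vertex hi hp ne s1).
have [k hk [k1 k2]] := coarse_edge hi; have [l hl [l1 l2]] := coarse_edge hj.
have [sk [c ec]] := coarse_direction hk hi k1 k2; have [sl [c' ec']] := coarse_direction hl hj l1 l2.
have par : det2 (V k.+1 - V k) (V l.+1 - V l) = 0.
  have [//|dn] := pselect (det2 (V k.+1 - V k) (V l.+1 - V l) = 0).
  move/negP: npc; case; rewrite mem_cat; apply/orP; right.
  apply/allpairsPdep; exists k, l; rewrite !mem_iota; split=> //=.
  case: xgetP => [y _ [y1 y2]|/(_ p) []]; last by split; [exact: sk|exact: sl].
  exact: (transverse_uniq dn (sk p s1) (sl p s2) y1 y2).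
have nv a : (a <= n)%N -> p <> phi xs`_a by move=> ha pa; move/negP: np; apply; rewrite pa; exact: vx.
have cr a : (a <= n)%N -> phi xs`_a \in crossings.
  by move=> ha; have [] := markedP (mem_nth 0 (_ : (a < size xs)%N)); rewrite ?(tri_size Tx).
apply: (overlap ne ne' _ s1 s2); try (by apply: nv; rewrite // ltnW).
- rewrite ec ec'; transitivity (c * c' * det2 (V k.+1 - V k) (V l.+1 - V l)); last by rewrite par mulr0.
  by rewrite /det2 /= /GRing.scale /=; ring.
- by apply: crossing_end => //; apply: cr; exact: ltnW.
- by apply: crossing_end => //; apply: cr.
- by apply: crossing_end => //; apply: cr; exact: ltnW.
by apply: crossing_end => //; apply: cr.
Qed.

End Refinement.

(** * The equivalences for a simplicial triangulation *)

Section Equivalence.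
Context {R : realType}.
Variables (phi : R -> R * R) (xs : seq R).
Hypothesis S : simplicial_triangulation phi xs.

Lemma approximable_iff_deleted_product :
  approximable_by_embeddings phi <-> deleted_product_property phi.
Proof.
have [T Lin PW] := simplicial_plane_walk S.
split; first exact: approximable_deleted_product T Lin PW.
move=> D; apply: (approximable_of_half_lifts T Lin PW) => m um.
exact: deleted_product_half_lift.
Qed.

Lemma approximable_iff_obstruction :
  approximable_by_embeddings phi <-> is_van_kampen_obstruction phi xs 0.
Proof.
have [T Lin PW] := simplicial_plane_walk S; split.
  move=> /(approximable_deleted_product T Lin PW) D.
  (* The identity rotation. *)
  have u1 : ((1, 0) : R * R).1 ^+ 2 + ((1, 0) : R * R).2 ^+ 2 = 1 by rewrite /= expr1n expr0n addr0.
  have [g hg] := deleted_product_half_lift T Lin u1 D.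
  exact (half_lift_obstruction T Lin u1 hg).
move=> v; apply: (approximable_of_half_lifts T Lin PW) => m um.
apply: (obstruction_half_lift T Lin um) v => eps eps0.
exact: general_position_ex.
Qed.

End Equivalence.

Unset Implicit Arguments.

Theorem corollary1p4 (R : realType) (phi : R -> R * R)
    (phiPL : piecewise_linear phi) :
  (approximable_by_embeddings phi <-> deleted_product_property phi) /\
  (forall xs : seq R, simplicial_triangulation phi xs ->
     (approximable_by_embeddings phi <->
      is_van_kampen_obstruction phi xs 0)).
Proof.
have [ys T Lin] := phiPL; split.
  (* Neither side mentions a triangulation, so a simplicial one is supplied by refinement. *)
  exact: approximable_iff_deleted_product (refinement_simplicial T Lin).
by move=> xs; exact: approximable_iff_obstruction.
Qed.
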